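(* Let $0<p<\infty$, $\omega\in\widehat{\mathcal{D}}$ and let $\mu$ be a positive Borel measure on $\mathbb{D}$. Then the following assertions are equivalent: (a) the Toeplitz operator $\mathcal{T}_\mu$ belongs to the Schatten class $\mathcal{S}_p(A^2_\omega)$; (b) $\displaystyle\sum_{j}\left(\frac{\mu(R_j)}{\omega^\star(z_j)}\right)^p<\infty$, where the sum runs over all dyadic polar rectangles $R_j=R(I_j)$, $I_j\in\Upsilon$; (c) for some $0<r<1$, the function $z\mapsto\frac{\mu(\Delta(z,r))}{\omega^\star(z)}$ belongs to $L^p\left(\frac{1}{(1-|z|)^2}\right)$, that is, $\displaystyle\int_{\mathbb{D}}\left(\frac{\mu(\Delta(z,r))}{\omega^\star(z)}\right)^p\frac{dA(z)}{(1-|z|)^2}<\infty$.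
   Context: $\mathbb{D}$ is the open unit disc, $\mathbb{T}$ its boundary, and $dA=\frac{dx\,dy}{\pi}$. A weight is a nonnegative integrable function on $\mathbb{D}$; it is radial if $\omega(z)=\omega(|z|)$. For a radial weight, $\widehat{\omega}(r)=\int_r^1\omega(s)\,ds$. The class $\widehat{\mathcal{D}}$ consists of the (not a.e. zero) radial weights $\omega$ for which there is $C>0$ with $\widehat{\omega}(r)\le C\,\widehat{\omega}\left(\frac{1+r}{2}\right)$ for all $0\le r<1$. Further, $\omega^\star(z)=\int_{|z|}^1\omega(s)\log\frac{s}{|z|}\,s\,ds$ for $z\in\mathbb{D}\setminus\{0\}$. $A^2_\omega$ is the Hilbert space of analytic functions $f$ on $\mathbb{D}$ with $\|f\|_{A^2_\omega}^2=\int_{\mathbb{D}}|f|^2\omega\,dA<\infty$, with inner product $\langle f,g\rangle_{A^2_\omega}=\int_{\mathbb{D}}f\overline{g}\,\omega\,dA$; for $\omega\in\widehat{\mathcal{D}}$ it has reproducing kernels $B^\omega_z$, so that $f(z)=\langle f,B^\omega_z\rangle_{A^2_\omega}$. The Toeplitz operator is $\mathcal{T}_\mu(f)(z)=\int_{\mathbb{D}}f(\zeta)\overline{B^\omega_z(\zeta)}\,d\mu(\zeta)$. $\mathcal{S}_p(H)$ is the Schatten class of compact operators on $H$ whose singular values form an $\ell^p$ sequence. $\Delta(a,r)=\{z\in\mathbb{D}:|\varphi_a(z)|<r\}$ with $\varphi_a(z)=\frac{a-z}{1-\overline{a}z}$ is the pseudohyperbolic disc. $\Upsilon$ is the family of dyadic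 arcs $I_{n,k}=\{e^{i\theta}:\frac{2\pi k}{2^n}\le\theta<\frac{2\pi(k+1)}{2^n}\}$, $k=0,\dots,2^n-1$, $n\in\mathbb{N}\cup\{0\}$. For an arc $I\subset\mathbb{T}$ of length $|I|$, $R(I)=\{z\in\mathbb{D}:\frac{z}{|z|}\in I,\ 1-\frac{|I|}{2\pi}\le|z|<1-\frac{|I|}{4\pi}\}$ and $z_I=(1-|I|/2\pi)\xi$, where $\xi$ is the midpoint of $I$; the rectangles $R(I)$, $I\in\Upsilon$, are pairwise disjoint and cover $\mathbb{D}$. Enumerating $\Upsilon=\{I_j\}$, put $R_j=R(I_j)$ and $z_j=z_{I_j}$ for $I_j\ne I_{0,0}$, while the arc $I_{0,0}$ is associated with the point $1/2$. *)

(* Defs.v *)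
From HB Require Import structures.
From mathcomp Require Import all_boot all_order all_algebra.
From mathcomp Require Import complex.
From mathcomp Require Import all_classical all_reals all_analysis.

Set Implicit Arguments.
Unset Strict Implicit.
Unset Printing Implicit Defensive.

Import Order.TTheory GRing.Theory Num.Theory.
Import numFieldNormedType.Exports.
Import ComplexField.Normc.

Local Open Scope classical_set_scope.
Local Open Scope ring_scope.
Local Open Scope complex_scope.

Section ComplexBorel.
Variable R : realType.

Definition complex_of_pair (x : R * R) : R[i] := x.1 +i* x.2.

HB.instance Definition _ := isPointed.Build R[i] 0.

(* The Borel sigma-algebra of R[i], transported from the product
   sigma-algebra of R * R along the homeomorphism (x, y) |-> x + iy. *)
Definition complex_measurable : set (set R[i]) :=
  [set A | measurable (complex_of_pair @^-1` A)].

Let complex_measurable0 : complex_measurable set0.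
Proof. by rewrite /complex_measurable /= preimage_set0. Qed.

Let complex_measurableC A : complex_measurable A -> complex_measurable (~` A).
Proof. by rewrite /complex_measurable /= preimage_setC; exact: measurableC. Qed.

Let complex_measurable_bigcup (F : (set R[i])^nat) :
  (forall i, complex_measurable (F i)) -> complex_measurable (\bigcup_i F i).
Proof.
move=> mF; rewrite /complex_measurable /= preimage_bigcup.
by apply: bigcup_measurable => i _; exact: mF.
Qed.

HB.instance Definition _ := isMeasurable.Build default_measure_display R[i]
  complex_measurable0 complex_measurableC complex_measurable_bigcup.

Lemma measurable_complex_of_pair :
  measurable_fun [set: R * R] complex_of_pair.
Proof. by move=> _ A mA; rewrite setTI. Qed.

(* dA = dx dy / pi *)
Definition area (A : set R[i]) : \bar R :=
  ((pi^-1)%:E *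
   (lebesgue_measure \x lebesgue_measure)%E (complex_of_pair @^-1` A))%E.

Let area0 : area set0 = 0%E.
Proof. by rewrite /area preimage_set0 measure0 mule0. Qed.

Let area_ge0 A : (0 <= area A)%E.
Proof. by rewrite /area mule_ge0 // lee_fin invr_ge0 pi_ge0. Qed.

Let area_sigma_additive : semi_sigma_additive area.
Proof.
move=> F mF tF mUF; rewrite /area preimage_bigcup.
under eq_fun do rewrite -ge0_sume_distrr //.
apply: cvgeZl => //; apply: measure_semi_sigma_additive => //.
- apply/trivIsetP => i j _ _ ij; rewrite -preimage_setI.
  by move/trivIsetP : tF => /(_ i j Logic.I Logic.I ij) ->; rewrite preimage_set0.
Qed.

HB.instance Definition _ :=
  isMeasure.Build _ _ _ area area0 area_ge0 area_sigma_additive.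

End ComplexBorel.
Arguments area {R}.

Section SchattenClass.
Variables (R : realType) (E : lmodType R[i]).
(* A Hilbert space, given as a subspace H of E with its Hilbert norm nrm;
   operators are considered only on H. *)
Variables (H : set E) (nrm : E -> R).

Definition is_bounded_linear (T : E -> E) : Prop :=
  [/\ forall f, H f -> H (T f),
      forall (a : R[i]) f g, H f -> H g -> T (a *: f + g) = a *: T f + T g &
      exists M : R, forall f, H f -> nrm (T f) <= M * nrm f].

Definition op_norm (T : E -> E) : R :=
  inf [set M : R | 0 <= M /\ forall f, H f -> nrm (T f) <= M * nrm f].

Definition rank_le (n : nat) (F : E -> E) : Prop :=
  exists g : 'I_n -> E, (forall i, H (g i)) /\
    forall f, H f -> exists c : 'I_n -> R[i], F f = \sum_(i < n) c i *: g i.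

(* The n-th singular value (n >= 0, in decreasing order): the distance in
   operator norm to the operators of rank at most n. *)
Definition singular_value (T : E -> E) (n : nat) : R :=
  inf [set op_norm (fun f => T f - F f) |
       F in [set F : E -> E | is_bounded_linear F /\ rank_le n F]].

Definition is_compact_operator (T : E -> E) : Prop :=
  forall u : nat -> E, (forall n, H (u n)) ->
    (exists M : R, forall n, nrm (u n) <= M) ->
    exists (k : nat -> nat) (g : E),
      [/\ {homo k : m n / (m < n)%N}, H g &
          (fun n => nrm (T (u (k n)) - g)) @ \oo --> (0 : R)].

Definition schatten_class (p : R) (T : E -> E) : Prop :=
  [/\ is_bounded_linear T, is_compact_operator T &
      (\sum_(0 <= n <oo) ((singular_value T n) `^ p)%:E < +oo)%E].

End SchattenClass.

Section ComplexIntegral.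
Variables (R : realType) (mu : {measure set R[i] -> \bar R}).

Definition cintegrable (D : set R[i]) (f : R[i] -> R[i]) : Prop :=
  mu.-integrable D (fun z => (complex.Re (f z))%:E) /\
  mu.-integrable D (fun z => (complex.Im (f z))%:E).

Definition cintegral (D : set R[i]) (f : R[i] -> R[i]) : R[i] :=
  (\int[mu]_(z in D) complex.Re (f z)) +i* (\int[mu]_(z in D) complex.Im (f z)).

End ComplexIntegral.

Section Bergman.
Variable R : realType.
Local Notation C := R[i].

Definition unit_disc : set C := [set z | normc z < 1].

Definition is_weight (w : C -> R) : Prop :=
  (forall z, unit_disc z -> 0 <= w z) /\
  area.-integrable unit_disc (fun z => (w z)%:E).

Definition is_radial (w : C -> R) : Prop :=
  forall z, unit_disc z -> w z = w (normc z)%:C.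

Definition weight_hat (w : C -> R) (r : R) : \bar R :=
  (\int[lebesgue_measure]_(s in `[r, 1%R[) (w s%:C)%:E)%E.

(* weight_hat is extended-real: the doubling condition at r = 0 forces it to
   be finite there, which integrability on the disc alone does not. *)
Definition class_Dhat (w : C -> R) : Prop :=
  [/\ is_weight w, is_radial w,
      ~ {ae area, forall z, unit_disc z -> w z = 0} &
      exists2 K : R, 0 < K & forall r : R, 0 <= r < 1 ->
        (weight_hat w r <= K%:E * weight_hat w ((1 + r) / 2))%E].

(* Meaningful for z != 0; the value at 0 is irrelevant below. *)
Definition weight_star (w : C -> R) (z : C) : R :=
  \int[lebesgue_measure]_(s in `[normc z, 1[)
    (w s%:C * ln (s / normc z) * s).

(* Complex differentiability at every point of the disc. *)
Definition analytic_on_disc (f : C -> C) : Prop :=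
  forall z, unit_disc z -> derivable (f : C^o -> C^o) (z : C^o) 1.

(* Functions on the disc are represented by their extension by 0. *)
Definition bergman_space (w : C -> R) : set (C -> C^o) :=
  [set f | [/\ analytic_on_disc f,
      forall z, ~ unit_disc z -> f z = 0 &
      (\int[area]_(z in unit_disc) (normc (f z) ^+ 2 * w z)%:E < +oo)%E]].

Definition bergman_norm (w : C -> R) (f : C -> C^o) : R :=
  Num.sqrt (\int[area]_(z in unit_disc) (normc (f z) ^+ 2 * w z)).

Definition bergman_inner (w : C -> R) (f g : C -> C^o) : C :=
  cintegral area unit_disc (fun z => f z * conjc (g z) * (w z)%:C).

(* B^w_z, chosen by its defining property (0 if there is no such function). *)
Definition bergman_kernel (w : C -> R) (z : C) : C -> C^o :=
  xget (fun=> 0) [set K | bergman_space w K /\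
    forall f, bergman_space w f -> f z = bergman_inner w f K].

Definition toeplitz_integrand (w : C -> R) (f : C -> C^o) (z : C) : C -> C :=
  fun zeta => f zeta * conjc (bergman_kernel w z zeta).

Definition toeplitz_operator (w : C -> R) (mu : {measure set C -> \bar R})
    (f : C -> C^o) : C -> C^o :=
  fun z => if z \in unit_disc
           then cintegral mu unit_disc (toeplitz_integrand w f z) else 0.

(* cintegral is total, so the existence of the integrals defining T_mu on
   the whole space has to be required separately. *)
Definition toeplitz_defined (w : C -> R) (mu : {measure set C -> \bar R}) :=
  forall f z, bergman_space w f -> unit_disc z ->
    cintegrable mu unit_disc (toeplitz_integrand w f z).

Definition toeplitz_in_schatten (p : R) (w : C -> R)
    (mu : {measure set C -> \bar R}) : Prop :=
  toeplitz_defined w mu /\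
  schatten_class (bergman_space w) (bergman_norm w) p (toeplitz_operator w mu).

Definition phdisc (a : C) (r : R) : set C :=
  [set z | unit_disc z /\ normc ((a - z) / (1 - conjc a * z)) < r].

Definition expi (t : R) : C := cos t +i* sin t.

Definition dyadic_arc (n k : nat) : set C :=
  [set expi t | t in `[2 * pi * k%:R / 2 ^+ n, 2 * pi * k.+1%:R / 2 ^+ n[].

Definition dyadic_length (n : nat) : R := 2 * pi / 2 ^+ n.

Definition dyadic_midpoint (n k : nat) : C :=
  expi (2 * pi * (k%:R + 2^-1) / 2 ^+ n).

(* R(I) for an arc I of length l. The condition z/|z| \in I is written
   z = |z| xi with xi \in I, so that 0 belongs to the rectangle of the full
   circle and the dyadic rectangles cover the disc. *)
Definition polar_rectangle (I : set C) (l : R) : set C :=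
  [set z | [/\ unit_disc z, exists2 xi, I xi & z = (normc z)%:C * xi &
      1 - l / (2 * pi) <= normc z < 1 - l / (4 * pi)]].

Definition dyadic_rectangle (n k : nat) : set C :=
  polar_rectangle (dyadic_arc n k) (dyadic_length n).

Definition dyadic_point (n k : nat) : C :=
  if n == 0%N then (2^-1 : R)%:C
  else (1 - dyadic_length n / (2 * pi))%:C * dyadic_midpoint n k.

Definition dyadic_indices : set (nat * nat) := [set j | (j.2 < 2 ^ j.1)%N].

End Bergman.

Arguments unit_disc {R}.
Arguments dyadic_rectangle {R}.
Arguments dyadic_point {R}.

(* Main.v *)
(** A function f = sum_m a_m z^m lies in A^2_w iff sum_m |a_m|^2 W_m is finite, where the
    moments W_m of w are comparable to hat(1 - 2^-n) for 2^n <= m < 2^(n+1), and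
    star z is comparable to (1 - |z|) hat(|z|).  Put m_j = mu(R_j) / star(z_j).

    From (a) to (b): atoms g_j made of squared Dirichlet kernels satisfy
    |g_j|^2 star >= c on R_j, sum_j |g_j| <= C star^(-1/2) and
    |sum_j c_j g_j|^2 <= C sum_j |c_j|^2.  If m_j > t for N indices j, a colouring
    argument extracts a fixed proportion of them on which the matrix of T_mu is diagonally
    dominant, so that the singular values satisfy s_n >= c t for n < N / d.

    From (b) to (a): sampling f on roots of unity gives f = P + sum_i c_i(f) g_i, with P a
    Taylor polynomial of fixed degree, sum_i |c_i(f)|^2 <= C |f|^2, and |g_i| star^(1/2) <= C M_ij
    on R_j, where M decays in the level and in the angle.  By Cauchy-Schwarz the indices i
    with Y_i = sum_j m_j M_ij^b <= t contribute at most C t |f|^2 to the integral of |f|^2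
    against mu, so T_mu is within C t of an operator of rank at most
    2 (C + #{i : Y_i > t}); a Schur test bounds sum_i Y_i^p by C sum_j m_j^p.

    Between (b) and (c): for small r the disc Delta(z, r) meets only cells close to z;
    conversely each cell splits into a bounded number of pieces, each contained in Delta(x, r)
    for every x in a box of comparable area, and the boxes overlap boundedly. *)
From HB Require Import structures.
Require Import Defs.
From mathcomp Require Import all_boot all_order all_algebra.
From mathcomp Require Import complex.
From mathcomp Require Import all_classical all_reals all_analysis.
From mathcomp Require Import measurable_realfun.
From mathcomp Require Import ring lra zify.
Set Implicit Arguments.
Unset Strict Implicit.
Unset Printing Implicit Defensive.
Import Order.TTheory GRing.Theory Num.Theory.
Import numFieldNormedType.Exports.
Import ComplexField.Normc.
Local Open Scope classical_set_scope.
Local Open Scope ring_scope.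
Local Open Scope complex_scope.

Local Notation cRe := complex.Re.
Local Notation cIm := complex.Im.

(** The doubling hypothesis lets hat(1 - 2^-n) lose an unknown factor K per dyadic level, so no
    decay of fixed order is enough: the exponents of the decaying factors are chosen only after K or
    p is known. Since p may be arbitrarily small, both directions between (a) and (b) proceed by
    counting: at each threshold t the number of large cells is compared with the number of large
    singular values, which serves every p at once. The measure mu is not assumed finite. Its
    finiteness on the disc is extracted first, from the constant function in (a) and from the cell
    sums in (b), because the kernel expansion of T_mu integrates bounded functions against mu. In
    (c) the function z -> mu(Delta(z, r)) is handled by domination alone. Atoms of level n are
    matched with cells of level n + 5: on such a cell a Dirichlet kernel of length 2^n is off its
    peak by a relative error of at most 9/32, so it stays above half of its maximum. *)

Lemma le_of_eq d (T : porderType d) (x y : T) : x = y -> (x <= y)%O.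
Proof. by move=> ->; exact: lexx. Qed.

(** * Complex modulus and finite Fourier sums *)

Section ComplexNorm.
Variable R : realType.
Local Notation C := R[i].
Implicit Types (x y z : C).

Lemma ReD x y : cRe (x + y) = cRe x + cRe y.
Proof. by case: x; case: y. Qed.
Lemma ImD x y : cIm (x + y) = cIm x + cIm y.
Proof. by case: x; case: y. Qed.
Lemma ReN x : cRe (- x) = - cRe x. Proof. by case: x. Qed.
Lemma ImN x : cIm (- x) = - cIm x. Proof. by case: x. Qed.
Lemma ReM x y : cRe (x * y) =
 cRe x * cRe y - cIm x * cIm y.
Proof. by case: x; case: y. Qed.
Lemma ImM x y : cIm (x * y) =
 cRe x * cIm y + cIm x * cRe y.
Proof. by case: x => a b; case: y => c d /=. Qed.
Lemma Re_sum (I : Type) (r : seq I) (P : pred I) (F : I -> C) :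
 cRe (\sum_(i <- r | P i) F i) = \sum_(i <- r | P i) cRe (F i).
Proof. by elim/big_rec2: _ => // i a b _ <-; rewrite ReD. Qed.
Lemma Im_sum (I : Type) (r : seq I) (P : pred I) (F : I -> C) :
 cIm (\sum_(i <- r | P i) F i) = \sum_(i <- r | P i) cIm (F i).
Proof. by elim/big_rec2: _ => // i a b _ <-; rewrite ImD. Qed.
Lemma ReZ (a : R) z : cRe (a%:C * z) = a * cRe z.
Proof. by rewrite ReM /= mul0r subr0. Qed.
Lemma ImZ (a : R) z : cIm (a%:C * z) = a * cIm z.
Proof. by rewrite ImM /= mul0r addr0. Qed.

Lemma eqc x y : cRe x = cRe y -> cIm x = cIm y ->
 x = y.
Proof. by case: x; case: y => a b c d /= -> ->. Qed.

Lemma nc_ge0 z : 0 <= normc z.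
Proof. by case: z => a b /=; exact: sqrtr_ge0. Qed.
Hint Resolve nc_ge0 : core.

Lemma nc_sqr z : normc z ^+ 2 = cRe z ^+ 2 + cIm z ^+ 2.
Proof. by case: z => a b /=; rewrite sqr_sqrtr // addr_ge0 ?sqr_ge0. Qed.

Lemma nc_def z : `|z| = (normc z)%:C. Proof. by []. Qed.

Lemma ncX z n : normc (z ^+ n) = normc z ^+ n.
Proof. by elim: n => [|n IH]; rewrite ?expr0 ?normc1 // !exprS normcM IH. Qed.

Lemma ncD x y : normc (x + y) <= normc x + normc y.
Proof. exact: le_normcD. Qed.

Lemma ncN x : normc (- x) = normc x. Proof. exact: normcN. Qed.

Lemma ncBC x y : normc (x - y) = normc (y - x).
Proof. by rewrite -ncN opprB. Qed.

Lemma ncB x y : normc (x - y) <= normc x + normc y.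
Proof. by rewrite -(ncN y) ncD. Qed.

Lemma nc_triangle y x z : normc (x - z) <= normc (x - y) + normc (y - z).
Proof. by rewrite (_ : x - z = (x - y) + (y - z)) ?ncD //; ring. Qed.

Lemma ncB_ge x y : normc x - normc y <= normc (x - y).
Proof. by rewrite lerBlDr (le_trans _ (ncD _ _)) // subrK. Qed.

Lemma nc_real (a : R) : normc a%:C = `|a|.
Proof. by rewrite /= expr0n addr0 sqrtr_sqr. Qed.

Lemma nc_conj z : normc (conjc z) = normc z.
Proof. by case: z => a b /=; rewrite sqrrN. Qed.

Lemma nc_Re z : `|cRe z| <= normc z.
Proof.
by rewrite -(ler_sqr (normr_ge0 _)) ?nnegrE// real_normK ?num_real// nc_sqr lerDl sqr_ge0.
Qed.

Lemma nc_Im z : `|cIm z| <= normc z.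
Proof.
by rewrite -(ler_sqr (normr_ge0 _)) ?nnegrE// real_normK ?num_real// nc_sqr lerDr sqr_ge0.
Qed.

Lemma nc_ReIm z : normc z <= `|cRe z| + `|cIm z|.
Proof.
rewrite -(@ler_sqr _ (normc z)) ?nnegrE ?addr_ge0// nc_sqr sqrrD !real_normK ?num_real//.
by rewrite addrAC lerDl mulrn_wge0// mulr_ge0.
Qed.

Lemma nc_eq0 z : (normc z == 0) = (z == 0).
Proof. by apply/eqP/eqP => [/eq0_normc//|->]; rewrite normc0. Qed.

Lemma nc_gt0 z : (0 < normc z) = (z != 0).
Proof. by rewrite lt_def nc_ge0 andbT nc_eq0. Qed.

Lemma nc_sum (I : Type) (r : seq I) (P : pred I) (F : I -> C) :
 normc (\sum_(i <- r | P i) F i) <= \sum_(i <- r | P i) normc (F i).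
Proof.
elim/big_rec2: _ => [|i a b _ H]; first by rewrite normc0.
by apply: (le_trans (ncD _ _)); rewrite lerD2l.
Qed.

Lemma mul_conj z : z * conjc z = (normc z ^+ 2)%:C.
Proof.
rewrite nc_sqr; case: z => a b; apply: eqc; rewrite ?ReM ?ImM /=; ring.
Qed.

Lemma conjM x y : conjc (x * y) = conjc x * conjc y. Proof. by rewrite rmorphM. Qed.
Lemma conjD x y : conjc (x + y) = conjc x + conjc y. Proof. by rewrite rmorphD. Qed.
Lemma conjX x n : conjc (x ^+ n) = conjc x ^+ n. Proof. by rewrite rmorphXn. Qed.
Lemma conjK x : conjc (conjc x) = x. Proof. exact: conjcK. Qed.

Lemma conj_sum (I : Type) (r : seq I) (P : pred I) (F : I -> C) :
 conjc (\sum_(i <- r | P i) F i) = \sum_(i <- r | P i) conjc (F i).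
Proof. by elim/big_rec2: _ => [|i a b _ <-]; rewrite ?conjc0 // conjD. Qed.

Lemma RCM (a b : R) : (a * b)%:C = a%:C * b%:C. Proof. by rewrite rmorphM. Qed.
Lemma RCB (a b : R) : (a - b)%:C = a%:C - b%:C. Proof. by rewrite rmorphB. Qed.
Lemma RC_sum (I : Type) (r : seq I) (P : pred I) (F : I -> R) :
 (\sum_(i <- r | P i) F i)%:C = \sum_(i <- r | P i) (F i)%:C.
Proof. by rewrite rmorph_sum. Qed.
Lemma RC_inj (a b : R) : a%:C = b%:C -> a = b. Proof. by case. Qed.

Lemma nc_sqrD_le x y : normc (x + y) ^+ 2 <= 2 * (normc x ^+ 2 + normc y ^+ 2).
Proof.
have := ncD x y; have := nc_ge0 (x + y); have := nc_ge0 x; have := nc_ge0 y.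
have := sqr_ge0 (normc x - normc y); nra.
Qed.

Lemma expiD (s t : R) : expi (s + t) = expi s * expi t.
Proof. by apply: eqc; rewrite ?ReM ?ImM /= ?cosD ?sinD; ring. Qed.

Lemma expi0 : expi 0 = 1 :> C.
Proof. by rewrite /expi cos0 sin0. Qed.

Lemma nc_expi (t : R) : normc (expi t) = 1.
Proof. by rewrite /= cos2Dsin2 sqrtr1. Qed.

Lemma conj_expi (t : R) : conjc (expi t) = expi (- t).
Proof. by rewrite /expi cosN sinN. Qed.

Lemma expiX (t : R) n : expi t ^+ n = expi (t * n%:R).
Proof.
elim: n => [|n IH]; first by rewrite mulr0 expi0 expr0.
by rewrite exprS IH -natr1 mulrDr mulr1 addrC expiD.
Qed.

Lemma expi2pi : expi (2 * pi) = 1 :> C.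
Proof. by rewrite /expi mulrDl mul1r -[pi + pi]mulr2n cos2pi sin2pi. Qed.

Lemma expiB (s t : R) : expi (s - t) = expi s * conjc (expi t).
Proof. by rewrite expiD conj_expi. Qed.

End ComplexNorm.
#[global] Hint Resolve nc_ge0 : core.

Section FiniteFourier.
Variable R : realType.
Local Notation C := R[i].

Definition zeta N : C := expi (2 * pi / N%:R).

Lemma nc_zeta N : normc (zeta N) = 1. Proof. exact: nc_expi. Qed.

Lemma zetaX N k : zeta N ^+ k = expi (2 * pi * k%:R / N%:R) :> C.
Proof. by rewrite /zeta expiX; congr expi; rewrite mulrAC. Qed.

Lemma zetaXN N : (0 < N)%N -> zeta N ^+ N = 1.
Proof. by move=> N0; rewrite zetaX mulfK ?expi2pi// pnatr_eq0 -lt0n. Qed.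

(** The angle lies strictly between 0 and 2 pi, so the sine of its half is positive, whereas cos x =
    1 would make that sine vanish. *)
Lemma zeta_neq1 N m : (0 < m < N)%N -> zeta N ^+ m != 1.
Proof.
move=> /andP[m0 mN]; rewrite zetaX; apply/negP => /eqP [c1 s0].
have N0 : (0 < N)%N by exact: leq_trans mN.
have N0r : 0 < N%:R :> R by rewrite ltr0n.
set x := 2 * pi * m%:R / N%:R in c1 s0.
have x2 : x = x / 2 + x / 2 by lra.
have : sin (x / 2) = 0.
 have := cosD (x / 2) (x / 2); rewrite -x2 c1 -!expr2 cos2sin2.
 move=> h; apply/eqP; rewrite -sqrf_eq0; apply/eqP; lra.
have hx : x / 2 = pi * (m%:R / N%:R) by rewrite /x; field; rewrite gt_eqF.
have : 0 < sin (x / 2).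
 apply: sin_gt0_pi; rewrite hx mulr_gt0 ?pi_gt0 ?divr_gt0 ?ltr0n//=.
 by rewrite -ltr_pdivlMl ?pi_gt0// mulVf ?gt_eqF ?pi_gt0// ltr_pdivrMr// mul1r ltr_nat.
by move=> h0 h; rewrite h ltxx in h0.
Qed.

(** Conjugation exchanges [m] and [m'], so [m' <= m] may be assumed; the sum is then geometric with
    ratio [zeta N ^+ (m - m')], an N-th root of unity different from 1 unless m = m'. *)
Lemma sum_zeta N (m m' : nat) : (m < N)%N -> (m' < N)%N ->
 \sum_(k < N) (zeta N ^+ k) ^+ m * conjc ((zeta N ^+ k) ^+ m') =
 if m == m' then N%:R else 0 :> C.
Proof.
have zz n : zeta N ^+ n * conjc (zeta N ^+ n) = 1.
 by rewrite mul_conj ncX nc_zeta expr1n expr1n.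
wlog le : m m' / (m' <= m)%N => [hw mN m'N|mN m'N].
 case: (leqP m' m) => [h|/ltnW h]; first exact: hw.
 have := hw _ _ h m'N mN; rewrite eq_sym => /(congr1 (@conjc R)).
 rewrite conj_sum => hh; transitivity (conjc (if m == m' then N%:R else 0 : C)).
  rewrite -hh; apply: eq_bigr => k _; by rewrite conjM conjK mulrC.
 by case: ifP => _; rewrite ?conjc0 ?conjc_nat.
have E k : (zeta N ^+ k) ^+ m * conjc ((zeta N ^+ k) ^+ m') = (zeta N ^+ (m - m')) ^+ k :> C.
 rewrite -{1}(subnKC le) exprD mulrAC -!exprM zz mul1r; congr (_ ^+ _); lia.
under eq_bigr => i _ do rewrite E.
case: eqP => [->|/eqP ne].
 rewrite subnn expr0 (eq_bigr (fun=> 1)) => [|i _]; last by rewrite expr1n.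
 by rewrite sumr_const card_ord.
have d1 : zeta N ^+ (m - m') != 1 by apply: zeta_neq1; lia.
have := subrX1 (zeta N ^+ (m - m')) N.
rewrite -exprM mulnC exprM zetaXN ?expr1n ?subrr; last by lia.
by move/eqP; rewrite eq_sym mulf_eq0 subr_eq0 (negbTE d1) => /eqP.
Qed.

Lemma parseval N (a : 'I_N -> C) :
 \sum_(k < N) normc (\sum_(m < N) a m * (zeta N ^+ k) ^+ m) ^+ 2
 = N%:R * \sum_(m < N) normc (a m) ^+ 2.
Proof.
apply: (@RC_inj R); rewrite RCM !RC_sum.
under eq_bigr => k _.
 rewrite -mul_conj conj_sum big_distrlr /=.
 under eq_bigr => i _ do under eq_bigr => j _ do
  rewrite conjM mulrACA.
 over.
rewrite exchange_big /= mulr_sumr; apply: eq_bigr => i _.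
rewrite exchange_big /= (bigD1 i) //= [X in _ + X]big1 => [|j ji].
 by rewrite addr0 -mulr_sumr sum_zeta // eqxx mul_conj rmorph_nat mulrC.
by rewrite -mulr_sumr sum_zeta// val_eqE eq_sym (negbTE ji) mulr0.
Qed.

Lemma parseval_le N M (a : nat -> C) : (M <= N)%N ->
 \sum_(k < N) normc (\sum_(m < M) a m * (zeta N ^+ k) ^+ m) ^+ 2
 = N%:R * \sum_(m < M) normc (a m) ^+ 2.
Proof.
move=> MN; have := parseval (fun m : 'I_N => if (m < M)%N then a m else 0).
have -> : \sum_(m < N) normc (if (m < M)%N then a m else 0) ^+ 2 =
     \sum_(m < M) normc (a m) ^+ 2.
 rewrite (big_ord_widen N (fun m => normc (a m) ^+ 2)) // [RHS]big_mkcond /=.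
 by apply: eq_bigr => m _; case: ifP => //; rewrite normc0 expr0n.
move=> <-; apply: eq_bigr => k _; congr (normc _ ^+ 2).
rewrite (big_ord_widen N (fun m => a m * (zeta N ^+ k) ^+ m)) // big_mkcond /=.
by apply: eq_bigr => m _; case: ifP => //; rewrite mul0r.
Qed.

(** Since (zeta^k)^m = (zeta^m)^k, exchanging nodes and frequencies turns this sum into the one in
    [parseval]; passing to [S] discards nonnegative terms. *)
Lemma parseval_dual N (c : 'I_N -> C) (S : pred 'I_N) :
 \sum_(m < N | S m) normc (\sum_(k < N) c k * (conjc (zeta N ^+ k)) ^+ m) ^+ 2
 <= N%:R * \sum_(k < N) normc (c k) ^+ 2.
Proof.
apply: (@le_trans _ _ (\sum_(m < N) normc (\sum_(k < N) c k * (conjc (zeta N ^+ k)) ^+ m) ^+ 2)).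
 by rewrite [leRHS](bigID S) /= lerDl sumr_ge0 // => i _; rewrite sqr_ge0.
have -> : \sum_(k < N) normc (c k) ^+ 2 = \sum_(k < N) normc (conjc (c k)) ^+ 2.
 by apply: eq_bigr => k _; rewrite nc_conj.
rewrite -parseval le_eqVlt; apply/orP; left; apply/eqP/eq_bigr => m _.
rewrite -nc_conj conj_sum.
congr (normc _ ^+ 2); apply: eq_bigr => k _.
by rewrite conjM (conjX (conjc _)) conjK -!exprM mulnC.
Qed.

End FiniteFourier.

(** * Goursat and Taylor *)

Section RealIntegral.
Variable R : realType.
Implicit Types (f g : R -> R) (a b c : R).

Definition itg f a b : R := \int[lebesgue_measure]_(x in `[a, b]) f x.

Definition cts_at f x := forall e : R, 0 < e -> exists2 d : R, 0 < d &
 forall y, `|y - x| < d -> `|f y - f x| <= e.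

Lemma cts_atP f x : cts_at f x -> {for x, continuous f}.
Proof.
move=> fx; apply/cvgrPdist_le => e e0; have [d d0 fd] := fx _ e0.
near=> y; rewrite distrC; apply: fd; near: y.
by exists d => //= y /=; rewrite distrC.
Unshelve. all: by end_near. Qed.

Definition cts_on f a b := forall x, a <= x <= b -> cts_at f x.

Lemma cts_on_integrable f a b : cts_on f a b ->
 lebesgue_measure.-integrable `[a, b] (EFin \o f).
Proof.
move=> fab; apply: continuous_compact_integrable; first exact: segment_compact.
apply: continuous_in_subspaceT => x; rewrite inE /= in_itv /= => /fab.
exact: cts_atP.
Qed.

Lemma cts_atB f g x : cts_at f x -> cts_at g x -> cts_at (fun y => f y - g y) x.
Proof.
move=> fx gx e e0; have e20 : 0 < e / 2 by rewrite divr_gt0.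
have [d d0 fd] := fx _ e20; have [d' d'0 gd] := gx _ e20.
exists (Num.min d d'); first by rewrite lt_min d0.
move=> y; rewrite lt_min => /andP[/fd h1 /gd h2].
rewrite (_ : _ - _ = (f y - f x) - (g y - g x)); last by ring.
rewrite (le_trans (ler_normB _ _)) // (splitr e) lerD //.
Qed.

Lemma cts_at_cst c x : cts_at (fun=> c) x.
Proof. by move=> e e0; exists 1 => // y _; rewrite subrr normr0 ltW. Qed.

Lemma cts_on_sub f a b a' b' : a <= a' -> b' <= b -> cts_on f a b -> cts_on f a' b'.
Proof.
by move=> h1 h2 fab x /andP[h3 h4]; apply: fab; rewrite (le_trans h1 h3) (le_trans h4 h2).
Qed.

Lemma itg_cst c a b : a <= b -> itg (fun=> c) a b = c * (b - a).
Proof.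
move=> ab; rewrite /itg Rintegral_cst //.
transitivity (c * fine (if (a < b)%R then (b - a)%:E else 0%E)).
 have := lebesgue_measure_itv `[a, b]; rewrite /= lte_fin => E.
 exact: (congr1 (fun u => c * fine u) E).
case: ltP => //= ba; rewrite (_ : b = a) ?subrr //; apply/le_anti; by rewrite ba.
Qed.

Lemma itgB f g a b : cts_on f a b -> cts_on g a b ->
 itg (fun x => f x - g x) a b = itg f a b - itg g a b.
Proof. by move=> hf hg; apply: RintegralB => //; exact: cts_on_integrable. Qed.

Lemma itg_close f a b c e : a <= b -> cts_on f a b ->
 (forall x, a <= x <= b -> `|f x - c| <= e) ->
 `|itg f a b - c * (b - a)| <= e * (b - a).
Proof.
move=> ab fab fc.
rewrite -itg_cst // -itgB //; last by move=> x _; exact: cts_at_cst.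
have H x : `[a, b]%classic x -> - e <= f x - c <= e.
 by rewrite /= in_itv /= => /fc; rewrite ler_norml.
have If : cts_on (fun x => f x - c) a b.
 by move=> x hx; apply: cts_atB; [exact: fab|exact: cts_at_cst].
have Ie u : lebesgue_measure.-integrable `[a, b] (EFin \o (fun=> u : R)).
 by apply: cts_on_integrable => x _; exact: cts_at_cst.
rewrite ler_norml -mulNr -!itg_cst //; apply/andP; split.
 by apply: le_Rintegral => //; [exact: cts_on_integrable|move=> x /H /andP[]].
by apply: le_Rintegral => //; [exact: cts_on_integrable|move=> x /H /andP[]].
Qed.

Lemma itg_split f a b c : a <= b -> b <= c -> cts_on f a c ->
 itg f a c = itg f a b + itg f b c.
Proof.
move=> ab bc fac; apply/eqP; rewrite addrC -subr_eq; apply/eqP.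
rewrite /itg Rintegral_itvB ?bnd_simp //; last exact: cts_on_integrable.
rewrite Rintegral_itv_obnd_cbnd //.
apply: (integrableS _ _ _ (cts_on_integrable fac)) => //.
by apply: subset_itv; rewrite bnd_simp.
Qed.

End RealIntegral.

(** * Goursat's theorem on rectangles, in real variables *)

Section Goursat.
Variable R : realType.
Implicit Types (U V : R -> R -> R).

(** Total differentiability with partial derivatives [al] in s and [ga] in t. It is assumed
    pointwise, without continuity of the derivative, as Goursat's argument allows. *)
Definition diff_at U (s t al ga : R) := forall e : R, 0 < e -> exists2 d : R, 0 < d &
 forall s' t', `|s' - s| < d -> `|t' - t| < d ->
 `|U s' t' - U s t - al * (s' - s) - ga * (t' - t)| <= e * (`|s' - s| + `|t' - t|).

Lemma diff_at_bound U s t al ga : diff_at U s t al ga -> exists2 d : R, 0 < d &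
 forall s' t', `|s' - s| < d -> `|t' - t| < d ->
 `|U s' t' - U s t| <= (1 + `|al| + `|ga|) * (`|s' - s| + `|t' - t|).
Proof.
move=> /(_ _ ltr01)[d d0 H]; exists d => // s' t' hs ht.
have := H _ _ hs ht; rewrite mul1r => h.
rewrite (_ : U s' t' - U s t = (U s' t' - U s t - al * (s' - s) - ga * (t' - t))
  + al * (s' - s) + ga * (t' - t)); last by ring.
rewrite (le_trans (ler_normD _ _)) // (le_trans (lerD (ler_normD _ _) (lexx _))) // !normrM.
have := normr_ge0 (s' - s); have := normr_ge0 (t' - t).
have := normr_ge0 al; have := normr_ge0 ga; nra.
Qed.

Lemma diff_cts1 U s t al ga : diff_at U s t al ga -> cts_at (U s) t.
Proof.
move=> /diff_at_bound[d d0 H] e e0.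
have K0 : 0 < 1 + `|al| + `|ga| by rewrite ltr_wpDr// ltr_wpDr.
exists (Num.min d (e / (1 + `|al| + `|ga|))).
 by rewrite lt_min d0 divr_gt0.
move=> y; rewrite lt_min => /andP[yd ye].
have := H s y; rewrite subrr normr0 add0r => /(_ d0 yd) h.
by rewrite (le_trans h)// mulrC -ler_pdivlMr// ltW.
Qed.

Lemma diff_cts2 U s t al ga : diff_at U s t al ga -> cts_at (U^~ t) s.
Proof.
move=> /diff_at_bound[d d0 H] e e0.
have K0 : 0 < 1 + `|al| + `|ga| by rewrite ltr_wpDr// ltr_wpDr.
exists (Num.min d (e / (1 + `|al| + `|ga|))).
 by rewrite lt_min d0 divr_gt0.
move=> y; rewrite lt_min => /andP[yd ye].
have := H y t; rewrite subrr normr0 addr0 => /(_ yd d0) h.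
by rewrite (le_trans h)// mulrC -ler_pdivlMr// ltW.
Qed.

Section Bisection.
Variables (F : R -> R -> R -> R -> R) (a b c d : R).
Hypotheses (ab : a <= b) (cd : c <= d).
Hypothesis splitF : forall s0 s1 s2 t0 t1 t2, a <= s0 -> s0 <= s1 -> s1 <= s2 -> s2 <= b ->
 c <= t0 -> t0 <= t1 -> t1 <= t2 -> t2 <= d ->
 F s0 s2 t0 t2 <= F s0 s1 t0 t1 + F s0 s1 t1 t2 + F s1 s2 t0 t1 + F s1 s2 t1 t2.

Let W n := (b - a) / 2 ^+ n.
Let H n := (d - c) / 2 ^+ n.

Let good n (p : R * R) := [/\ a <= p.1, p.1 + W n <= b, c <= p.2, p.2 + H n <= d &
  F a b c d / 4 ^+ n <= F p.1 (p.1 + W n) p.2 (p.2 + H n)].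

Let half (x : R) n : 0 <= x -> 0 <= x / 2 ^+ n.+1 /\ x / 2 ^+ n = 2 * (x / 2 ^+ n.+1).
Proof.
move=> x0; split; first by rewrite divr_ge0 ?exprn_ge0.
by rewrite exprS; field; rewrite expf_neq0.
Qed.

Let goodS n p : good n p -> exists2 q, good n.+1 q &
 [/\ p.1 <= q.1, q.1 + W n.+1 <= p.1 + W n, p.2 <= q.2 & q.2 + H n.+1 <= p.2 + H n].
Proof.
rewrite /good /W /H.
have ba0 : 0 <= b - a by rewrite subr_ge0.
have dc0 : 0 <= d - c by rewrite subr_ge0.
have [w0 ->] := half n ba0; have [v0 ->] := half n dc0.
have -> : F a b c d / 4 ^+ n.+1 = F a b c d / 4 ^+ n / 4.
 by rewrite exprSr invfM mulrA.
move: w0 v0; case: p => x y /=.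
move: ((b - a) / 2 ^+ n.+1) => w; move: ((d - c) / 2 ^+ n.+1) => v.
move: (F a b c d / 4 ^+ n) => X w0 v0 [h1 h2 h3 h4 h5].
have E := @splitF x (x + w) (x + 2 * w) y (y + v) (y + 2 * v) h1.
have {}E : F x (x + 2 * w) y (y + 2 * v) <= F x (x + w) y (y + v) +
 F x (x + w) (y + v) (y + 2 * v) + F (x + w) (x + 2 * w) y (y + v) +
 F (x + w) (x + 2 * w) (y + v) (y + 2 * v) by apply: E => //; lra.
have ew : x + w + w = x + 2 * w by ring.
have ev : y + v + v = y + 2 * v by ring.
case: (leP (X / 4) (F x (x + w) y (y + v))) => q1.
 by exists (x, y) => /=; split => //; lra.
case: (leP (X / 4) (F x (x + w) (y + v) (y + 2 * v))) => q2.
 by exists (x, y + v); rewrite /= ?ev; split => //; lra.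
case: (leP (X / 4) (F (x + w) (x + 2 * w) y (y + v))) => q3.
 by exists (x + w, y); rewrite /= ?ew; split => //; lra.
by exists (x + w, y + v); rewrite /= ?ew ?ev; split => //; lra.
Qed.

Let nested (x : nat -> R) (r : nat -> R) :
 (forall n, 0 <= r n) -> (forall n, x n <= x n.+1) ->
 (forall n, x n.+1 + r n.+1 <= x n + r n) ->
 exists y, forall n, x n <= y <= x n + r n.
Proof.
move=> r0 xS xrS.
have mono n k : x n <= x (n + k)%N.
 by elim: k => [|k IH]; rewrite ?addn0// addnS (le_trans IH).
have anti n k : x (n + k)%N + r (n + k)%N <= x n + r n.
 by elim: k => [|k IH]; rewrite ?addn0// addnS (le_trans _ IH).
have bnd n m : x m <= x n + r n.
 have h1 := mono m n; have h2 := anti n m; have := r0 (n + m)%N.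
 rewrite addnC in h1; lra.
have ubx : has_ubound (range x).
 by exists (x 0%N + r 0%N) => _ [m _ <-].
exists (sup (range x)) => n; apply/andP; split.
 by apply: ub_le_sup => //; exists n.
by apply: ge_sup; [exists (x 0%N), 0%N | move=> _ [m _ <-]].
Qed.

(** Goursat's quartering for an abstract [F]: by subadditivity one of the four quarters keeps a
    quarter of the value, and the nested rectangles so chosen share a point p. *)
Lemma bisection : exists p : R * R, [/\ a <= p.1 <= b, c <= p.2 <= d & forall n,
 exists s0 t0, [/\ a <= s0, s0 <= p.1 <= s0 + W n, s0 + W n <= b,
   [/\ c <= t0, t0 <= p.2 <= t0 + H n & t0 + H n <= d] &
   F a b c d / 4 ^+ n <= F s0 (s0 + W n) t0 (t0 + H n)]].
Proof.
pose next n p := xget p [set q | good n.+1 q /\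
 [/\ p.1 <= q.1, q.1 + W n.+1 <= p.1 + W n, p.2 <= q.2 & q.2 + H n.+1 <= p.2 + H n]].
pose cor := fix cor n : R * R := if n is m.+1 then next m (cor m) else (a, c).
have g n : good n (cor n).
 elim: n => [|n IH].
  by rewrite /good /W /H !expr0 !divr1 /= !subrKC; split.
 rewrite /= /next; case: xgetP => [y _ []//|no].
 by have [q q1 q2] := goodS IH; case: (no q).
have nx n : [/\ (cor n).1 <= (cor n.+1).1, (cor n.+1).1 + W n.+1 <= (cor n).1 + W n,
  (cor n).2 <= (cor n.+1).2 & (cor n.+1).2 + H n.+1 <= (cor n).2 + H n].
 rewrite /= /next; case: xgetP => [y _ []//|no].
 by have [q q1 q2] := goodS (g n); case: (no q).
have W0 n : 0 <= W n by rewrite /W divr_ge0 ?subr_ge0 ?exprn_ge0.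
have H0 n : 0 <= H n by rewrite /H divr_ge0 ?subr_ge0 ?exprn_ge0.
have [s hs] : exists y, forall n, (cor n).1 <= y <= (cor n).1 + W n.
 by apply: nested => // n; have [] := nx n.
have [t ht] : exists y, forall n, (cor n).2 <= y <= (cor n).2 + H n.
 by apply: nested => // n; have [] := nx n.
exists (s, t); split => [||n] /=.
- have [h1 h2 _ _ _] := g 0%N; have /andP[h3 h4] := hs 0%N.
 by rewrite (le_trans h1 h3) (le_trans h4 h2).
- have [_ _ h1 h2 _] := g 0%N; have /andP[h3 h4] := ht 0%N.
 by rewrite (le_trans h1 h3) (le_trans h4 h2).
- by exists (cor n).1, (cor n).2; have [] := g n; split.
Qed.

End Bisection.

Variables (U V : R -> R -> R) (a b c d : R).
Hypotheses (ab : a <= b) (cd : c <= d).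
Hypothesis diffUV : forall s t, a <= s <= b -> c <= t <= d ->
 exists al be ga, diff_at U s t al ga /\ diff_at V s t be al.

Let ctsU s : a <= s <= b -> cts_on (U s) c d.
Proof.
by move=> hs t ht; have [al [be [ga [h _]]]] := diffUV hs ht; exact: diff_cts1 h.
Qed.
Let ctsV t : c <= t <= d -> cts_on (V^~ t) a b.
Proof.
by move=> ht s hs; have [al [be [ga [_ h]]]] := diffUV hs ht; exact: diff_cts2 h.
Qed.

(** Counterclockwise circulation of the form V ds + U dt around the rectangle. The hypothesis
    [diffUV] says that U_s = V_t, that is, the form is closed at every point. *)
Let circ s0 s1 t0 t1 :=
 (itg (U s1) t0 t1 - itg (U s0) t0 t1) - (itg (V^~ t1) s0 s1 - itg (V^~ t0) s0 s1).

Let circ_split s0 s1 s2 t0 t1 t2 : a <= s0 -> s0 <= s1 -> s1 <= s2 -> s2 <= b ->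
 c <= t0 -> t0 <= t1 -> t1 <= t2 -> t2 <= d ->
 circ s0 s2 t0 t2 = circ s0 s1 t0 t1 + circ s0 s1 t1 t2 +
           circ s1 s2 t0 t1 + circ s1 s2 t1 t2.
Proof.
move=> h1 h2 h3 h4 k1 k2 k3 k4; rewrite /circ.
have S s : a <= s <= b -> itg (U s) t0 t2 = itg (U s) t0 t1 + itg (U s) t1 t2.
 by move=> hs; apply: itg_split => //; apply: cts_on_sub (ctsU hs).
have T t : c <= t <= d -> itg (V^~ t) s0 s2 = itg (V^~ t) s0 s1 + itg (V^~ t) s1 s2.
 by move=> ht; apply: itg_split => //; apply: cts_on_sub (ctsV ht).
have a2 : a <= s2 by rewrite (le_trans h1)// (le_trans h2).
have b0 : s0 <= b by rewrite (le_trans h2)// (le_trans h3).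
have c2 : c <= t2 by rewrite (le_trans k1)// (le_trans k2).
have d0 : t0 <= d by rewrite (le_trans k2)// (le_trans k3).
by rewrite !S ?T ?h1 ?a2 ?k1 ?c2 ?h4 ?k4 ?b0 ?d0//; ring.
Qed.

(** The affine parts of U and V contribute al * w * v to both differences and cancel, because U_s
    and V_t share the value [al]; what is left is the differentiability error integrated along the
    sides. *)
Let circ_small s t : a <= s <= b -> c <= t <= d -> forall e, 0 < e ->
 exists2 r : R, 0 < r & forall s0 s1 t0 t1, a <= s0 -> s0 <= s <= s1 -> s1 <= b ->
  c <= t0 -> t0 <= t <= t1 -> t1 <= d ->
  (s1 - s0) + (t1 - t0) < r ->
  `|circ s0 s1 t0 t1| <= e * ((s1 - s0) + (t1 - t0)) ^+ 2.
Proof.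
move=> hs ht e e0; have [al [be [ga [dU dV]]]] := diffUV hs ht.
have e20 : 0 < e / 2 by rewrite divr_gt0.
have [r r0 HU] := dU _ e20; have [r' r'0 HV] := dV _ e20.
exists (Num.min r r'); first by rewrite lt_min r0.
move=> s0 s1 t0 t1 as0 /andP[s0s ss1] s1b ct0 /andP[t0t tt1] t1d.
set w := s1 - s0; set v := t1 - t0; rewrite lt_min => /andP[wr wr'].
have s01 := le_trans s0s ss1; have t01 := le_trans t0t tt1.
have w0 : 0 <= w by rewrite subr_ge0.
have v0 : 0 <= v by rewrite subr_ge0.
have near x : s0 <= x <= s1 -> `|x - s| <= w.
 by move=> /andP[h1 h2]; rewrite ler_norml /w; apply/andP; split; lra.
have near' x : t0 <= x <= t1 -> `|x - t| <= v.
 by move=> /andP[h1 h2]; rewrite ler_norml /v; apply/andP; split; lra.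
have A : `|itg (fun y => U s1 y - U s0 y) t0 t1 - (al * w) * (t1 - t0)| <= (e * (w + v)) * (t1 - t0).
 apply: itg_close => //.
  move=> y /andP[y1 y2]; apply: cts_atB.
   by apply: ctsU; rewrite ?s1b ?andbT ?(le_trans ct0 y1) ?(le_trans y2 t1d)// (le_trans as0 s01).
  by apply: ctsU; rewrite ?as0 ?(le_trans ct0 y1) ?(le_trans y2 t1d)//= (le_trans s01 s1b).
 move=> y hy; have Y := near' _ hy.
 have N1 : `|s1 - s| <= w by apply: near; rewrite s01 lexx.
 have N0 : `|s0 - s| <= w by apply: near; rewrite s01 lexx.
 have Yr : `|y - t| < r by rewrite (le_lt_trans Y)// (le_lt_trans _ wr)// lerDr.
 have h1 := HU s1 y (le_lt_trans N1 (le_lt_trans _ wr)) Yr.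
 have h0 := HU s0 y (le_lt_trans N0 (le_lt_trans _ wr)) Yr.
 have {}h1 := h1 _; have {}h0 := h0 _.
 have wv : w <= w + v by rewrite lerDl.
 have {h1} := h1 wv; have {h0} := h0 wv.
 set X0 := _ - _ - _ - _; set X1 := _ - _ - _ - _ => h0 h1.
 rewrite (_ : U s1 y - U s0 y - al * w = X1 - X0); last by rewrite /X1 /X0 /w; ring.
 rewrite (le_trans (ler_normB _ _))//; nra.
have B : `|itg (fun y => V y t1 - V y t0) s0 s1 - (al * v) * (s1 - s0)| <= (e * (w + v)) * (s1 - s0).
 apply: itg_close => //.
  move=> y /andP[y1 y2]; apply: cts_atB.
   by apply: (ctsV (t := t1)); rewrite ?t1d ?andbT ?(le_trans as0 y1) ?(le_trans y2 s1b)// (le_trans ct0 t01).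
  by apply: (ctsV (t := t0)); rewrite ?ct0 ?(le_trans as0 y1) ?(le_trans y2 s1b)//= (le_trans t01 t1d).
 move=> y hy; have Y := near _ hy.
 have N1 : `|t1 - t| <= v by apply: near'; rewrite t01 lexx.
 have N0 : `|t0 - t| <= v by apply: near'; rewrite t01 lexx.
 have Yr : `|y - s| < r' by rewrite (le_lt_trans Y)// (le_lt_trans _ wr')// lerDl.
 have wv : v <= w + v by rewrite lerDr.
 have h1 := HV y t1 Yr (le_lt_trans N1 (le_lt_trans wv wr')).
 have h0 := HV y t0 Yr (le_lt_trans N0 (le_lt_trans wv wr')).
 move: h0 h1; set X0 := _ - _ - _ - _; set X1 := _ - _ - _ - _ => h0 h1.
 rewrite (_ : V y t1 - V y t0 - al * v = X1 - X0); last by rewrite /X1 /X0 /v; ring.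
 rewrite (le_trans (ler_normB _ _))//; nra.
rewrite itgB in A; last first.
- by apply: cts_on_sub (ctsU _) => //; rewrite as0; lra.
- by apply: cts_on_sub (ctsU _) => //; rewrite s1b andbT; lra.
rewrite itgB in B; last first.
- by apply: cts_on_sub (ctsV _) => //; rewrite ct0; lra.
- by apply: cts_on_sub (ctsV _) => //; rewrite t1d andbT; lra.
rewrite /circ -/w -/v in A B *.
set a1 := _ - itg (U s0) _ _ in A *; set b1 := _ - itg (V^~ t0) _ _ in B *.
rewrite (_ : a1 - b1 = (a1 - al * w * v) - (b1 - al * v * w)); last by ring.
rewrite (le_trans (ler_normB _ _))// (le_trans (lerD A B))//; nra.
Qed.

Lemma goursat : itg (U b) c d - itg (U a) c d = itg (V^~ d) a b - itg (V^~ c) a b.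
Proof.
apply/eqP; rewrite -subr_eq0; apply/negPn/negP => ne0.
have eta0 : 0 < `|circ a b c d| by rewrite normr_gt0.
have [|[s t] /= [sab tcd bis]] := bisection (F := fun s0 s1 t0 t1 => `|circ s0 s1 t0 t1|) ab cd.
 move=> s0 s1 s2 t0 t1 t2 h1 h2 h3 h4 k1 k2 k3 k4.
 rewrite (circ_split h1 h2 h3 h4 k1 k2 k3 k4).
 by do 3 ?[rewrite (le_trans (ler_normD _ _)) ?lerD2r //].
move: eta0 bis; set eta := `|circ a b c d| => eta0 bis.
set T := (b - a) + (d - c).
have T0 : 0 <= T by rewrite addr_ge0 ?subr_ge0.
have T1 : 0 < T + 1 by rewrite ltr_wpDl.
(* The rectangles found at step n have half-perimeter T / 2^n and circulation at least eta / 4^n,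
   while this choice of e allows at most (eta / 2) (T / (T + 1))^2 / 4^n. The shift by 1 covers the
   degenerate case T = 0. *)
have [r r0 Hr] := circ_small sab tcd
 (divr_gt0 (divr_gt0 eta0 (ltr0n R 2)) (exprn_gt0 2 T1)).
have [n hn] : exists n : nat, T / r < 2 ^+ n.
 exists (Num.truncn (T / r)).+1.
 apply: (lt_le_trans (truncnS_gt _)).
 by rewrite -natrX ler_nat ltnW // ltn_expl.
have [s0 [t0 [h1 hs h2 [h3 ht h4] h5]]] := bis n.
have p2 : 0 < 2 ^+ n :> R by rewrite exprn_gt0.
have := Hr _ _ _ _ h1 hs h2 h3 ht h4.
rewrite ![_ + _ / _ - _]addrAC !subrr !add0r -mulrDl -/T.
rewrite ltr_pdivrMr // -ltr_pdivrMl // mulrC => /(_ hn) h6.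
have := le_trans h5 h6.
rewrite expr_div_n -exprM mulnC exprM (_ : 2 ^+ 2 = 4 :> R); last by ring.
rewrite mulrA ler_pM2r ?invr_gt0 ?exprn_gt0 // -[_ * _ * T ^+ 2]mulrA => h7.
have h8 : T ^+ 2 <= (T + 1) ^+ 2 by rewrite ler_sqr ?nnegrE ?(ltW T1)// lerDl.
have h9 : ((T + 1) ^+ 2)^-1 * T ^+ 2 <= 1.
 by rewrite mulrC ler_pdivrMr ?mul1r ?exprn_gt0.
have : eta / 2 * (((T + 1) ^+ 2)^-1 * T ^+ 2) <= eta / 2.
 by rewrite ler_piMr // divr_ge0 // ltW.
move=> h10; have := le_trans h7 h10; rewrite ler_pdivlMr// => h11.
by move: eta0; rewrite ltNge => /negP; apply; move: h11; rewrite mulr_natr mulr2n gerDl.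
Qed.

End Goursat.

(** * Cauchy's theorem on annuli *)

Section Cauchy.
Variable R : realType.
Local Notation C := R[i].
Implicit Types (g f : C -> C) (z : C).

Definition cdiff g z (d : C) := forall e : R, 0 < e -> exists2 r : R, 0 < r &
 forall y, normc (y - z) < r -> normc (g y - g z - d * (y - z)) <= e * normc (y - z).

Lemma realC_gt0 (e : C) : 0 < e -> exists2 r : R, 0 < r & e = r%:C.
Proof.
case: e => a b; rewrite ltcE /= => /andP[/eqP b0 a0]; exists a => //.
by apply: eqc.
Qed.

Lemma derivable_cdiff f z : derivable (f : C^o -> C^o) (z : C^o) 1 ->
 exists d, cdiff f z d.
Proof.
move=> /cvg_ex[/= d /cvgrPdist_le H]; exists d => e e0.
have eC : 0 < e%:C :> C by rewrite ltcR.
have := H _ eC => -[/= r r0 Hr].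
have [q q0 rq] := realC_gt0 r0; exists q => // y yz.
have [->|ne] := eqVneq y z; first by rewrite !subrr mulr0 subrr normc0 mulr0.
have h0 : y - z != 0 by rewrite subr_eq0.
have := Hr (y - z); rewrite /ball_ /= => /(_ _ h0).
rewrite sub0r normrN rq !nc_def ltcR => /(_ yz).
rewrite /= [(y - z) *: _]mulr1 subrK lecR => h.
have -> : f y - f z - d * (y - z) = - (y - z) * (d - (y - z)^-1 *: (f y - f z : C^o)).
 by rewrite -[_ *: _]/(_ * _); field.
by rewrite normcM ncN mulrC ler_wpM2r.
Qed.

Lemma cdiff_derivable f z d : cdiff f z d -> derivable (f : C^o -> C^o) (z : C^o) 1.
Proof.
move=> H; apply/cvg_ex; exists d; apply/cvgrPdist_le => /= e e0.
have [r r0 ->] := realC_gt0 e0; have [q q0 Hq] := H _ r0.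
exists q%:C; first by rewrite /= ltcR.
move=> h; rewrite /ball_ /= sub0r normrN nc_def ltcR => hq h0.
have := Hq (h + z); rewrite addrK => /(_ hq) hh.
rewrite [h *: _]mulr1 lecR.
have E : d - h^-1 *: (f (h + z) - f z : C^o) = - h^-1 * (f (h + z) - f z - d * h).
 by rewrite -[_ *: _]/(_ * _); field.
by rewrite E normcM ncN normcV mulrC ler_pdivrMr ?nc_gt0.
Qed.

Lemma is_derive_eps (f : R -> R) (x df : R) : is_derive x 1 f df ->
 forall e, 0 < e -> exists2 d : R, 0 < d & forall h, `|h| < d ->
 `|f (x + h) - f x - df * h| <= e * `|h|.
Proof.
move=> [ex val] e e0; have := ex => /cvg_ex[/= l Hl].
have ld : l = df by rewrite -val; apply/esym/cvg_lim.
move: Hl => /cvgrPdist_le /(_ _ e0) => -[/= r r0 Hr].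
exists r => // h hr; have [->|h0] := eqVneq h 0.
 by rewrite addr0 subrr mulr0 subrr normr0 mulr0.
have := Hr h; rewrite /ball_ /= sub0r normrN => /(_ hr h0).
rewrite [h *: _]mulr1 ld => hh.
have -> : f (x + h) - f x - df * h = - h * (df - h^-1 *: (f (h + x) - f x)).
 by rewrite -[_ *: _]/(_ * _) [h + x]addrC; field.
by rewrite normrM normrN mulrC ler_wpM2r.
Qed.

Lemma expc_diff (e : R) : 0 < e -> exists2 d : R, 0 < d & forall h k : R,
 `|h| < d -> `|k| < d ->
 normc ((expR h)%:C * expi k - 1 - (h +i* k)) <= e * (`|h| + `|k|).
Proof.
wlog e1 : e / e < 1 => [hw e0|e0].
 have m0 : 0 < Num.min e 2^-1 by rewrite lt_min e0 /= invr_gt0.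
 have [|d d0 H] := hw _ _ m0; first by rewrite gt_min invf_lt1 // ltr1n orbT.
 exists d => // h k hd kd; rewrite (le_trans (H _ _ hd kd)) // ler_wpM2r ?addr_ge0//.
 by rewrite ge_min lexx.
have e50 : 0 < e / 5 by rewrite divr_gt0.
have [d1 d10 H1] := is_derive_eps (is_derive_expR (0 : R)) e50.
have [d2 d20 H2] := is_derive_eps (is_derive_cos (0 : R)) e50.
have [d3 d30 H3] := is_derive_eps (is_derive_sin (0 : R)) e50.
exists (Num.min (e / 5) (Num.min d1 (Num.min d2 d3))); first by rewrite !lt_min e50 d10 d20 d30.
move=> h k; rewrite !lt_min => /andP[h0 /andP[h1 /andP[h2 h3]]] /andP[k0 /andP[k1 /andP[k2 k3]]].
have := H1 _ h1; rewrite add0r expR0 mul1r => A1.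
have := H2 _ k2; rewrite add0r cos0 sin0 oppr0 mul0r subr0 => A2.
have := H3 _ k3; rewrite add0r cos0 sin0 mul1r subr0 => A3.
apply: (le_trans (nc_ReIm _)); rewrite !ReD !ImD !ReN !ImN /= !mul0r subr0 addr0.
set X := expR h in A1 *; set c := cos k in A2 *; set s := sin k in A3 *.
have c1 : `|c| <= 1 by rewrite ler_norml cos_geN1 cos_le1.
have E1 : X * c - 1 - h = (X - 1 - h) * c + (1 + h) * (c - 1) by ring.
have E2 : X * s - 0 - k = (X - 1 - h) * s + h * (s - k) + h * k + (s - k) by ring.
have s1 : `|s| <= 1 by rewrite ler_norml sin_geN1 sin_le1.
have hn := normr_ge0 h; have kn := normr_ge0 k.
have B1 : `|X * c - 1 - h| <= (e / 5) * `|h| + 2 * ((e / 5) * `|k|).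
 rewrite E1 (le_trans (ler_normD _ _))// lerD// normrM.
  by rewrite -[leRHS]mulr1 ler_pM.
 rewrite ler_pM// (le_trans (ler_normD _ _))// normr1; lra.
have B2 : `|X * s - 0 - k| <= (e / 5) * `|h| + (e / 5) * `|k| + (e / 5) * `|k| + (e / 5) * `|k|.
 rewrite E2 !(le_trans (ler_normD _ _))// lerD//.
 rewrite !(le_trans (ler_normD _ _))// lerD//.
  rewrite !(le_trans (ler_normD _ _))// lerD// normrM.
   by rewrite -[leRHS]mulr1 ler_pM.
  by rewrite -[leRHS]mul1r ler_pM//; lra.
 by rewrite normrM ler_wpM2r// ltW.
apply: (le_trans (lerD B1 B2)); have := mulr_ge0 (ltW e0) hn; lra.
Qed.

(** The exponential of s + i t: annuli about 0 become rectangles, so that [goursat] applies to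
    them. *)
Definition pol (s t : R) : C := (expR s)%:C * expi t.

Lemma nc_pol s t : normc (pol s t) = expR s.
Proof. by rewrite /pol normcM nc_expi mulr1 nc_real ger0_norm // expR_ge0. Qed.

(** With d * pol s t = al + i be the differential of [g] along [pol] is (al + i be)(ds + i dt). Its
    real and imaginary parts satisfy the Cauchy-Riemann equations in the form required by
    [goursat]. *)
Lemma pol_diff g (s t : R) d : cdiff g (pol s t) d ->
 exists al be, diff_at (fun s t => cRe (g (pol s t))) s t al (- be) /\
        diff_at (fun s t => cIm (g (pol s t))) s t be al.
Proof.
move=> Hg; set P := pol s t.
have key : forall e : R, 0 < e -> exists2 r : R, 0 < r & forall s' t',
  `|s' - s| < r -> `|t' - t| < r ->
  normc (g (pol s' t') - g P - d * P * ((s' - s) +i* (t' - t)))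
   <= e * (`|s' - s| + `|t' - t|).
 move=> e e0.
 set Q := expR s; have Q0 : 0 < Q by exact: expR_gt0.
 have D0 := nc_ge0 d.
 have e10 : 0 < e / (4 * Q) by rewrite divr_gt0 ?mulr_gt0.
 (* The bound 1 keeps [pol s' t' - P] of the order of the displacement; the other bound absorbs the
    factor [normc (d * P)]. *)
 have e20 : 0 < Num.min 1 (e / (2 * Q * (1 + normc d))).
  by rewrite lt_min ltr01 divr_gt0// mulr_gt0 ?mulr_gt0// ltr_wpDr.
 have [r1 r10 H1] := Hg _ e10; have [r2 r20 H2] := expc_diff e20.
 exists (Num.min r2 (r1 / (4 * Q))); first by rewrite lt_min r20 divr_gt0// mulr_gt0.
 move=> s' t'; rewrite !lt_min; set h := s' - s; set k := t' - t.
 move=> /andP[h2 h1] /andP[k2 k1].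
 have PE : pol s' t' = P * ((expR h)%:C * expi k).
  rewrite /P /pol mulrACA -RCM -expRD -expiD /h /k; congr ((expR _)%:C * expi _); ring.
 have E := H2 _ _ h2 k2.
 set w := h +i* k in E *; set E0 := _ - _ - _ in E.
 have hk : normc w <= `|h| + `|k| by rewrite (le_trans (nc_ReIm _)).
 have PP : pol s' t' - P = P * (w + E0) by rewrite PE /E0; ring.
 have hk0 : 0 <= `|h| + `|k| by rewrite addr_ge0.
 have NP : normc (pol s' t' - P) <= 2 * Q * (`|h| + `|k|).
  rewrite PP normcM nc_pol -/Q (mulrC 2) -mulrA ler_wpM2l ?(ltW Q0)// (le_trans (ncD _ _))//.
  by rewrite mulr_natl mulr2n lerD// (le_trans E)// ler_piMl // ge_min lexx.
 have := H1 (pol s' t'); have -> // : normc (pol s' t' - P) < r1.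
  apply: (le_lt_trans NP); rewrite ltr_pdivlMr ?mulr_gt0// in h1.
  rewrite ltr_pdivlMr ?mulr_gt0// in k1.
  by rewrite -(@ltr_pM2l _ 2)//; lra.
 move=> /(_ isT) G.
 have -> : g (pol s' t') - g P - d * P * w =
   (g (pol s' t') - g P - d * (pol s' t' - P)) + d * P * E0 by rewrite PP; ring.
 rewrite (le_trans (ncD _ _))// [e](splitr e) mulrDl lerD//.
  apply: (le_trans G); apply: (le_trans (ler_wpM2l _ NP)); first by rewrite ltW.
  by apply: le_of_eq; field; rewrite gt_eqF.
 rewrite (normcM (d * P)) (normcM d) (nc_pol s t : normc P = Q).
 apply: (le_trans (ler_wpM2l _ E)); first by rewrite mulr_ge0 // ltW.
 rewrite mulrA ler_wpM2r//.
 apply: (@le_trans _ _ (normc d * Q * (e / (2 * Q * (1 + normc d))))).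
  by rewrite ler_wpM2l ?ge_min ?lexx ?orbT// mulr_ge0// ltW.
 have -> : normc d * Q * (e / (2 * Q * (1 + normc d))) = (e / 2) * (normc d / (1 + normc d)).
  by field; rewrite !gt_eqF// ltr_wpDr.
 rewrite ler_piMr//; first by rewrite divr_ge0// ltW.
 by rewrite ler_pdivrMr ?ltr_wpDr// mul1r lerDr.
exists (cRe (d * P)), (cIm (d * P)); split => e e0;
 have [r r0 H] := key _ e0; exists r => // s' t' hs ht.
- apply: le_trans (H _ _ hs ht); apply: le_trans (nc_Re _).
 rewrite !ReD !ReN [cRe (d * P * _)]ReM /=.
 by apply: le_of_eq; congr (`|_|); ring.
- apply: le_trans (H _ _ hs ht); apply: le_trans (nc_Im _).
 rewrite !ImD !ImN [cIm (d * P * _)]ImM /=.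
 by apply: le_of_eq; congr (`|_|); ring.
Qed.

(** Not normalized: 2 pi times the mean value of [g] on the circle of radius [r]. *)
Definition cmean g (r : R) : C :=
 (itg (fun t => cRe (g (r%:C * expi t))) 0 (2 * pi)) +i*
 (itg (fun t => cIm (g (r%:C * expi t))) 0 (2 * pi)).

Lemma twopi_ge0 : 0 <= 2 * pi :> R.
Proof. by rewrite mulr_ge0 ?pi_ge0. Qed.

(** The rectangle [ln r1, ln r2] x [0, 2 pi] is the annulus cut along a radius; the two sides along
    the cut carry equal integrals and cancel. *)
Let cmean_constRe g (r1 r2 : R) : 0 < r1 -> r1 <= r2 ->
 (forall z, r1 <= normc z <= r2 -> exists d, cdiff g z d) ->
 cRe (cmean g r1) = cRe (cmean g r2).
Proof.
move=> r10 r12 dg; have r20 := lt_le_trans r10 r12.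
pose U s t := cRe (g (pol s t)); pose V s t := cIm (g (pol s t)).
have := @goursat R U V (ln r1) (ln r2) 0 (2 * pi).
rewrite ler_ln ?posrE// r12 twopi_ge0 => /(_ isT isT).
have H : forall s t, ln r1 <= s <= ln r2 -> 0 <= t <= 2 * pi ->
  exists al be ga, diff_at U s t al ga /\ diff_at V s t be al.
 move=> s t /andP[s1 s2] _.
 have [|d /pol_diff[al [be H]]] := dg (pol s t).
  by rewrite nc_pol -(lnK r10) -(lnK r20) !ler_expR s1.
 by exists al, be, (- be).
move=> /(_ H).
have -> : V^~ (2 * pi) = V^~ 0.
 by apply/funext => s; rewrite /V /pol expi2pi expi0.
have E r : 0 < r -> U (ln r) = (fun t => cRe (g (r%:C * expi t))).
 by move=> r0; apply/funext => t; rewrite /U /pol lnK.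
by rewrite [X in _ = X -> _]subrr !E// => /eqP; rewrite subr_eq0 => /eqP /esym.
Qed.

Lemma cdiffZ c g z d : cdiff g z d -> cdiff (fun y => c * g y) z (c * d).
Proof.
move=> H e e0; have N0 : 0 < normc c + 1 by rewrite ltr_wpDl.
have [r r0 Hr] := H _ (divr_gt0 e0 N0); exists r => // y /Hr h.
have -> : c * g y - c * g z - c * d * (y - z) = c * (g y - g z - d * (y - z)) by ring.
rewrite normcM (le_trans (ler_wpM2l _ h))// mulrA ler_wpM2r//.
by rewrite mulrCA ler_piMr ?(ltW e0)// ler_pdivrMr// mul1r lerDl.
Qed.

Lemma cmean_const g (r1 r2 : R) : 0 < r1 -> r1 <= r2 ->
 (forall z, r1 <= normc z <= r2 -> exists d, cdiff g z d) ->
 cmean g r1 = cmean g r2.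
Proof.
move=> r10 r12 dg; apply: eqc; first exact: cmean_constRe.
(* Multiplying by -i moves the imaginary part into the real part. *)
have := @cmean_constRe (fun y => (- 'i) * g y) r1 r2 r10 r12.
have E r : cRe (cmean (fun y => - 'i * g y) r) = cIm (cmean g r).
 rewrite /cmean; congr itg; apply/funext => t.
 by rewrite ReM /=; ring.
rewrite !E.
by apply => z /dg[d /(cdiffZ (- 'i)) H]; exists (- 'i * d).
Qed.

End Cauchy.

Section PowerSeries.
Variable R : realType.
Local Notation C := R[i].
Implicit Types (g f : C -> C) (z : C).

Definition cd g z := exists d, cdiff g z d.

Lemma cdP g z : cd g z <-> derivable (g : C^o -> C^o) (z : C^o) 1.
Proof. by split => [[d /cdiff_derivable]|/derivable_cdiff]. Qed.

Lemma cdM f g z : cd f z -> cd g z -> cd (fun y => f y * g y) z.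
Proof. move=> /cdP hf /cdP hg; apply/cdP.
have H := @derivableM C (C^o) f g z 1 hf hg; exact: H. Qed.

Lemma cdB f g z : cd f z -> cd g z -> cd (fun y => f y - g y) z.
Proof. move=> /cdP hf /cdP hg; apply/cdP.
have H := @derivableB C (C^o) (C^o) f g z 1 hf hg; exact: H. Qed.

Lemma cdV f z : f z != 0 -> cd f z -> cd (fun y => (f y)^-1) z.
Proof. move=> f0 /cdP hf; apply/cdP.
have H := @derivableV C (C^o) f z 1 f0 hf; exact: H. Qed.

Lemma cd_id z : cd id z. Proof. apply/cdP; exact: (@derivable_id C (C^o) z 1). Qed.

Lemma cd_cst c z : cd (fun=> c) z. Proof. apply/cdP; exact: (@derivable_cst C (C^o) (C^o) c z 1). Qed.

Lemma cdX f z n : cd f z -> cd (fun y => f y ^+ n) z.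
Proof.
move=> hf; elim: n => [|n IH]; first exact: cd_cst.
under eq_fun do rewrite exprS; exact: cdM.
Qed.

Lemma cd_near f g z : (exists2 r : R, 0 < r & forall y, normc (y - z) < r -> f y = g y) ->
 cd f z -> cd g z.
Proof.
move=> [r r0 fg] [d H]; exists d => e /H[r' r'0 Hr].
exists (Num.min r r'); first by rewrite lt_min r0.
move=> y; rewrite lt_min => /andP[h1 /Hr]; rewrite !fg// ?subrr ?normc0//.
Qed.

Definition ccont g z := forall e : R, 0 < e -> exists2 r : R, 0 < r &
 forall y, normc (y - z) < r -> normc (g y - g z) <= e.

Lemma cd_cont g z : cd g z -> ccont g z.
Proof.
move=> [d H] e e0; have [r r0 Hr] := H _ ltr01.
have D0 : 0 < 1 + normc d by rewrite ltr_wpDr.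
exists (Num.min r (e / (1 + normc d))); first by rewrite lt_min r0 divr_gt0.
move=> y; rewrite lt_min => /andP[h1 h2].
have -> : g y - g z = (g y - g z - d * (y - z)) + d * (y - z) by ring.
rewrite (le_trans (ncD _ _))// normcM (le_trans (lerD (Hr _ h1) (lexx _)))//.
by rewrite -mulrDl mulrC -ler_pdivlMr// ltW.
Qed.

Lemma pol_cont (s t : R) (e : R) : 0 < e -> exists2 r : R, 0 < r &
 forall s' t', `|s' - s| < r -> `|t' - t| < r -> normc (pol s' t' - pol s t) < e.
Proof.
move=> e0; set Q := expR s; have Q0 : 0 < Q := expR_gt0 s.
have [r r0 H] := expc_diff (ltr01 : 0 < 1 :> R).
exists (Num.min r (e / (8 * Q))); first by rewrite lt_min r0 divr_gt0// mulr_gt0.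
move=> s' t'; rewrite !lt_min => /andP[s1 s2] /andP[t1 t2].
set h := s' - s in s1 s2; set k := t' - t in t1 t2.
have -> : pol s' t' - pol s t = pol s t * (((expR h)%:C * expi k - 1 - (h +i* k)) + (h +i* k)).
 have -> : pol s' t' = pol s t * ((expR h)%:C * expi k).
  rewrite /pol mulrACA -RCM -expRD -expiD /h /k; congr ((expR _)%:C * expi _); ring.
 ring.
rewrite normcM nc_pol -/Q mulrC -ltr_pdivlMr// (le_lt_trans (ncD _ _))//.
have := H _ _ s1 t1; have := nc_ReIm (h +i* k); rewrite /= mul1r => h1 h2.
apply: (le_lt_trans (lerD h2 h1)).
rewrite ltr_pdivlMr ?mulr_gt0// in s2; rewrite ltr_pdivlMr ?mulr_gt0// in t2.
rewrite ltr_pdivlMr//; lra.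
Qed.

Definition cont_on_circle g (r : R) := forall z, normc z = r -> ccont g z.

Lemma circle_cts g r t : 0 < r -> cont_on_circle g r ->
 cts_at (fun t => cRe (g (r%:C * expi t))) t /\
 cts_at (fun t => cIm (g (r%:C * expi t))) t.
Proof.
move=> r0 gr; have gz := gr (r%:C * expi t) _.
have {}gz : ccont g (r%:C * expi t).
 by apply: gz; rewrite normcM nc_expi mulr1 nc_real ger0_norm// ltW.
have E u : r%:C * expi u = pol (ln r) u by rewrite /pol lnK.
split => e e0; have [q q0 H] := gz _ e0; have [d d0 H'] := pol_cont (ln r) t q0;
 exists d => // y yd.
- rewrite -ReN -ReD (le_trans (nc_Re _))// H// !E H'// subrr normr0//.
- rewrite -ImN -ImD (le_trans (nc_Im _))// H// !E H'// subrr normr0//.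
Qed.

Lemma cmeanB f g r : 0 < r -> cont_on_circle f r -> cont_on_circle g r ->
 cmean (fun z => f z - g z) r = cmean f r - cmean g r.
Proof.
move=> r0 hf hg; apply: eqc; rewrite ?ReD ?ImD ?ReN ?ImN /= -itgB;
 try (by move=> t _; have [] := circle_cts t r0 hf);
 try (by move=> t _; have [] := circle_cts t r0 hg).
- by congr itg; apply/funext => t; rewrite ReD ReN.
- by congr itg; apply/funext => t; rewrite ImD ImN.
Qed.

(** The factor 2 is the price of bounding the real and the imaginary part separately. *)
Lemma cmean_bound_arc g r c (B : R) : 0 < r -> cont_on_circle g r ->
 (forall t, 0 <= t <= 2 * pi -> normc (g (r%:C * expi t) - c) <= B) ->
 normc (cmean g r - (2 * pi)%:C * c) <= 2 * (2 * pi * B).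
Proof.
move=> r0 hg gB; have tp := @twopi_ge0 R.
apply: (le_trans (nc_ReIm _)); rewrite ReD ImD ReN ImN ReZ ImZ [leRHS]mulr_natl [leRHS]mulr2n.
have close (T : R) (u : R -> R) (k : R) : 0 <= T -> (forall t, cts_at u t) ->
  (forall t, 0 <= t <= T -> `|u t - k| <= B) -> `|itg u 0 T - T * k| <= T * B.
 move=> T0 cu ub; have := @itg_close R u 0 T k B T0 (fun x _ => cu x) ub.
 by rewrite subr0 (mulrC k) (mulrC B).
apply: lerD; apply: close => // t.
- by have [] := circle_cts t r0 hg.
- by move=> /gB; apply: le_trans; rewrite -ReN -ReD nc_Re.
- by have [] := circle_cts t r0 hg.
- by move=> /gB; apply: le_trans; rewrite -ImN -ImD nc_Im.
Qed.

Lemma cmean_bound g r c (B : R) : 0 < r -> cont_on_circle g r ->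
 (forall z, normc z = r -> normc (g z - c) <= B) ->
 normc (cmean g r - (2 * pi)%:C * c) <= 2 * (2 * pi * B).
Proof.
move=> r0 hg gB; apply: cmean_bound_arc => // t _; apply: gB.
by rewrite normcM nc_expi mulr1 nc_real ger0_norm// ltW.
Qed.

Lemma cmean_dist g r r' (B : R) : 0 < r -> 0 < r' ->
 cont_on_circle g r -> cont_on_circle g r' ->
 (forall t, 0 <= t <= 2 * pi -> normc (g (r%:C * expi t) - g (r'%:C * expi t)) <= B) ->
 normc (cmean g r - cmean g r') <= 2 * (2 * pi * B).
Proof.
move=> r0 r'0 hg hg' gB; have tp := @twopi_ge0 R.
have close (T : R) (u v : R -> R) : 0 <= T -> (forall t, cts_at u t) -> (forall t, cts_at v t) ->
  (forall t, 0 <= t <= T -> `|u t - v t| <= B) -> `|itg u 0 T - itg v 0 T| <= T * B.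
 move=> T0 cu cv ub; rewrite -itgB//.
 have := @itg_close R (fun t => u t - v t) 0 T 0 B T0 (fun x _ => cts_atB (cu x) (cv x)).
 by rewrite mul0r !subr0 (mulrC B); apply => x /ub; rewrite subr0.
apply: (le_trans (nc_ReIm _)); rewrite ReD ImD ReN ImN [leRHS]mulr_natl [leRHS]mulr2n.
apply: lerD; apply: close => // t.
- by have [] := circle_cts t r0 hg.
- by have [] := circle_cts t r'0 hg'.
- by move=> /gB; apply: le_trans; rewrite -ReN -ReD nc_Re.
- by have [] := circle_cts t r0 hg.
- by have [] := circle_cts t r'0 hg'.
- by move=> /gB; apply: le_trans; rewrite -ImN -ImD nc_Im.
Qed.

(** Only continuity at each point of the circle is assumed; compactness of the angle interval makes
    it uniform. *)
Lemma cmean_cont g r0 (e : R) : 0 < r0 -> 0 < e -> cont_on_circle g r0 ->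
 exists2 d : R, 0 < d & forall r, 0 < r -> `|r - r0| < d -> cont_on_circle g r ->
  normc (cmean g r - cmean g r0) <= 2 * (2 * pi * e).
Proof.
move=> r00 e0 gc.
have /compact_near_coveringP cov := @segment_compact R 0 (2 * pi).
pose P (s t : R) := normc (g (pol s t) - g (pol (ln r0) t)) <= e.
have := cov R (nbhs (ln r0)) P _ => /(_ _)[].
 move=> t _.
 have np : normc (pol (ln r0) t) = r0 by rewrite nc_pol lnK.
 have [q q0 H] := gc _ np (e / 2) (divr_gt0 e0 (ltr0n R 2)).
 have [d d0 H'] := pol_cont (ln r0) t q0.
 exists ([set t' | `|t' - t| < d], [set s | `|s - ln r0| < d]) => /=.
  split; by exists d => // y /=; rewrite distrC.
 move=> [t' s] [/= ht hs]; rewrite /P.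
 have h1 := H _ (H' _ _ hs ht).
 have h2 := H _ (H' (ln r0) t' _ ht); rewrite subrr normr0 in h2.
 rewrite (le_trans (nc_triangle (g (pol (ln r0) t)) _ _))// [e in leRHS]splitr.
 by rewrite lerD// ncBC h2.
move=> d /= d0 Hd.
have := @continuous_ln R r0 r00 => /cvgrPdist_lt /(_ _ d0)[d' /= d'0 Hd'].
exists d' => // r rp rd gr; apply: cmean_dist => // t ht.
have E u v : 0 < u -> u%:C * expi v = pol (ln u) v by move=> u0; rewrite /pol lnK.
rewrite !E//; apply: (Hd (ln r)); last by rewrite /= in_itv.
by rewrite /= Hd'//= distrC.
Qed.

(** The mean is constant for radii below |z0| and for radii above |z0|, since h is differentiable
    off z0. Continuity of h joins the two ranges at |z0| and, as the radius tends to 0, gives the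
    value 2 pi h 0 = 0. *)
Lemma cmean_vanish h z0 : normc z0 < 1 -> h 0 = 0 ->
 (forall z, normc z < 1 -> ccont h z) ->
 (forall z, normc z < 1 -> z != z0 -> cd h z) ->
 forall r, normc z0 < r < 1 -> cmean h r = 0.
Proof.
move=> z01 h0 hc hd.
have circ r : r < 1 -> cont_on_circle h r by move=> r1 z zr; apply: hc; rewrite zr.
have zero (x : C) : (forall e, 0 < e -> normc x <= 2 * (2 * pi * e)) -> x = 0.
 move=> H; apply/eqP; rewrite -nc_eq0 eq_le nc_ge0 andbT leNgt; apply/negP => x0.
 have p0 : 0 < pi :> R := pi_gt0 R.
 move: (pi) p0 H => P p0 H; have p1 := lt0r_neq0 p0.
 have := H (normc x / (8 * P)) (divr_gt0 x0 (mulr_gt0 (ltr0n R 8) p0)).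
 have -> : 2 * (2 * P * (normc x / (8 * P))) = normc x / 2 by field.
 lra.
have inner r : 0 < r < 1 -> (forall z, normc z <= r -> z != 0 -> z != z0) -> cmean h r = 0.
 move=> /andP[r0 r1] hr; apply: zero => e e0.
 have n01 : normc (0 : C) < 1 by rewrite normc0.
 have [d d0 H] := hc 0 n01 _ e0.
 pose q := Num.min r (d / 2).
 have q0 : 0 < q by rewrite lt_min r0 divr_gt0.
 have qr : q <= r by rewrite ge_min lexx.
 have qd : q < d by rewrite gt_min; apply/orP; right; lra.
 rewrite -(@cmean_const R h q r q0 qr) => [|z /andP[z1 z2]]; last first.
  apply: hd; first exact: le_lt_trans r1.
  by apply: hr => //; rewrite -nc_eq0 gt_eqF// (lt_le_trans q0).
 have := @cmean_bound h q 0 e q0 (circ _ (le_lt_trans qr r1)).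
 rewrite mulr0 subr0; apply => z zq.
 by have := H z; rewrite !subr0 h0 subr0 zq => ->.
have mid r : 0 < r -> r < 1 -> r = normc z0 -> cmean h r = 0.
 move=> r0 r1 rz; apply: zero => e e0.
 have [d d0 H] := cmean_cont r0 e0 (circ _ r1).
 pose q := Num.max (r / 2) (r - d / 2).
 have qr : q < r by rewrite gt_max; apply/andP; split; lra.
 have q0 : 0 < q by rewrite lt_max divr_gt0.
 have qd : `|q - r| < d.
  rewrite ltr0_norm ?subr_lt0// opprB ltrBlDr -ltrBlDl lt_max.
  by apply/orP; right; lra.
 have := H q q0 qd (circ _ (lt_trans qr r1)).
 rewrite [cmean h q]inner ?sub0r ?ncN//; first by rewrite q0 (lt_trans qr).
 move=> z zq _; apply/eqP => zz; move: zq; rewrite zz -rz leNgt qr //.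
move=> r /andP[zr r1].
have [z00|z0n] := eqVneq z0 0.
 apply: inner; rewrite ?r1 ?andbT; last by move=> z _; rewrite z00.
 by rewrite z00 normc0 in zr.
have n0 : 0 < normc z0 by rewrite nc_gt0.
apply: zero => e e0; have [d d0 H] := cmean_cont n0 e0 (circ _ z01).
pose q := Num.min r (normc z0 + d / 2).
have qz : normc z0 < q by rewrite lt_min zr; lra.
have qr : q <= r by rewrite ge_min lexx.
have q0 := lt_trans n0 qz.
rewrite -(@cmean_const R h q r q0 qr) => [|z /andP[z1 z2]]; last first.
 apply: hd; first exact: le_lt_trans r1.
 by apply/eqP => zz; move: (lt_le_trans qz z1); rewrite zz ltxx.
have qd : `|q - normc z0| < d.
 rewrite gtr0_norm ?subr_gt0// ltrBlDl gt_min; apply/orP; right; lra.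
have := H q q0 qd (circ _ (le_lt_trans qr r1)).
by rewrite (mid _ n0 z01 erefl) subr0.
Qed.

End PowerSeries.

(** * Cauchy's formula and Taylor expansion in the unit disc *)

Section Taylor.
Variable R : realType.
Local Notation C := R[i].
Implicit Types (g f : C -> C) (z : C) (a : nat -> C).

Definition psum a M z := \sum_(m < M) a m * z ^+ m.

Definition hsum a z (s : C) := forall e : R, 0 < e -> exists N, forall M, (N <= M)%N ->
 normc (s - psum a M z) <= e.

Lemma geo_small (K q e : R) : 0 <= q < 1 -> 0 < e -> exists N, forall M, (N <= M)%N ->
 K * q ^+ M <= e.
Proof.
move=> /andP[q0 q1] e0.
have q1' : `|q| < 1 by rewrite ger0_norm.
have /cvgrPdist_le /(_ _ e0)[N _ H] := cvg_geometric K q1'.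
exists N => M NM; have := H M NM; rewrite /= sub0r normrN.
by apply: le_trans; exact: ler_norm.
Qed.

Lemma small_eq0 (K : R) (x : C) : (forall e, 0 < e -> normc x <= K * e) -> x = 0.
Proof.
move=> H; apply/eqP; rewrite -nc_eq0 eq_le nc_ge0 andbT leNgt; apply/negP => x0.
have K1 : 0 < 2 * (`|K| + 1) by rewrite mulr_gt0// ltr_wpDl.
have := H (normc x / (2 * (`|K| + 1))) (divr_gt0 x0 K1).
rewrite mulrA ler_pdivlMr// => h; have := ler_norm K; nra.
Qed.

Lemma ccircle_bound g r : 0 < r -> cont_on_circle g r ->
 exists2 B : R, 0 <= B & forall t, 0 <= t <= 2 * pi -> normc (g (r%:C * expi t)) <= B.
Proof.
move=> r0 gc; have /compact_near_coveringP cov := @segment_compact R 0 (2 * pi).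
pose P (B t : R) := normc (g (r%:C * expi t)) <= B.
have E v : r%:C * expi v = pol (ln r) v by rewrite /pol lnK.
have := cov R (+oo : set_system R)%R P _ => /(_ _)[].
 move=> t _.
 have np : normc (pol (ln r) t) = r by rewrite nc_pol lnK.
 have [q q0 H] := gc _ np 1 ltr01; have [d d0 H'] := pol_cont (ln r) t q0.
 exists ([set t' | `|t' - t| < d], [set B | normc (g (pol (ln r) t)) + 1 <= B]) => /=.
  split; last by apply: nbhs_pinfty_ge; exact: num_real.
  by exists d => // y /=; rewrite distrC.
 move=> [t' B] [/= ht hB]; rewrite /P E (le_trans _ hB)// addrC -lerBlDr.
 apply: (le_trans (ncB_ge _ _)); apply: H; apply: H' => //; by rewrite subrr normr0.
move=> M [Mr HM]; exists (Num.max 0 (M + 1)); first by rewrite le_max lexx.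
move=> t ht; have : M < M + 1 by rewrite ltrDl.
move=> /HM /(_ t); rewrite /= in_itv /= => /(_ ht) h.
by rewrite le_max; apply/orP; right.
Qed.

Lemma itgZ (c : R) (u : R -> R) (x y : R) : cts_on u x y ->
 itg (fun t => c * u t) x y = c * itg u x y.
Proof. by move=> hu; apply: RintegralZl => //; exact: cts_on_integrable. Qed.

Lemma cts_atZ (c : R) (u : R -> R) (x : R) : cts_at u x -> cts_at (fun t => c * u t) x.
Proof.
move=> ux e e0; have N0 : 0 < `|c| + 1 by rewrite ltr_wpDl.
have [d d0 H] := ux _ (divr_gt0 e0 N0); exists d => // y /H h.
rewrite -mulrBr normrM (le_trans (ler_wpM2l _ h))// mulrCA ler_piMr ?(ltW e0)//.
by rewrite ler_pdivrMr// mul1r lerDl.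
Qed.

Lemma ccontZ c g z : ccont g z -> ccont (fun y => c * g y) z.
Proof.
move=> H e e0; have N0 : 0 < normc c + 1 by rewrite ltr_wpDl.
have [r r0 Hr] := H _ (divr_gt0 e0 N0); exists r => // y /Hr h.
rewrite -mulrBr normcM (le_trans (ler_wpM2l _ h))// mulrCA ler_piMr ?(ltW e0)//.
by rewrite ler_pdivrMr// mul1r lerDl.
Qed.

Lemma cmeanZ c g r : 0 < r -> cont_on_circle g r ->
 cmean (fun z => c * g z) r = c * cmean g r.
Proof.
move=> r0 hg.
have ct (T : R) (u v : R -> R) (x y : R) : (forall t, cts_at u t) -> (forall t, cts_at v t) ->
  itg (fun t => x * u t - y * v t) 0 T = x * itg u 0 T - y * itg v 0 T.
 move=> hu hv; rewrite itgB ?itgZ// => t _; by [exact: hu|exact: hv|apply: cts_atZ].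
apply: eqc; rewrite ?ReM ?ImM /=.
- rewrite -ct; try (by move=> t; have [] := circle_cts t r0 hg).
 by congr itg; apply/funext => t; rewrite ReM.
- rewrite -[X in _ = _ + X]opprK -mulNr -ct; try (by move=> t; have [] := circle_cts t r0 hg).
 by congr itg; apply/funext => t; rewrite ImM mulNr opprK.
Qed.

Lemma cmeanD f g r : 0 < r -> cont_on_circle f r -> cont_on_circle g r ->
 cmean (fun z => f z + g z) r = cmean f r + cmean g r.
Proof.
move=> r0 hf hg; have hg' : cont_on_circle (fun z => -1 * g z) r.
 by move=> z /hg; exact: ccontZ.
have := cmeanB r0 hf hg'; rewrite cmeanZ// mulN1r opprK => <-.
by congr cmean; apply/funext => z; rewrite mulN1r opprK.
Qed.

Lemma cmean_eq g g' r : 0 <= r -> (forall z, normc z = r -> g z = g' z) -> cmean g r = cmean g' r.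
Proof.
move=> r0 E; have {}E t : g (r%:C * expi t) = g' (r%:C * expi t).
 by apply: E; rewrite normcM nc_expi mulr1 nc_real ger0_norm.
by apply: eqc; rewrite /=; congr itg; apply/funext => t; rewrite E.
Qed.

Lemma ccontD f g z : ccont f z -> ccont g z -> ccont (fun y => f y + g y) z.
Proof.
move=> hf hg e e0; have e20 : 0 < e / 2 by rewrite divr_gt0.
have [r r0 H] := hf _ e20; have [r' r'0 H'] := hg _ e20.
exists (Num.min r r'); first by rewrite lt_min r0.
move=> y; rewrite lt_min => /andP[/H h /H' h'].
rewrite (_ : _ - _ = (f y - f z) + (g y - g z)); last by ring.
by rewrite (le_trans (ncD _ _))// [e]splitr lerD.
Qed.

Lemma cmean0 r : cmean (fun=> 0 : C) r = 0.
Proof. by apply: eqc; rewrite /= itg_cst ?twopi_ge0// mul0r. Qed.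

Lemma cmean_sum (F : nat -> C -> C) r M : 0 < r -> (forall m, cont_on_circle (F m) r) ->
 cmean (fun z => \sum_(m < M) F m z) r = \sum_(m < M) cmean (F m) r.
Proof.
move=> r0 hF; elim: M => [|M IH].
 by rewrite big_ord0; under eq_fun do rewrite big_ord0; exact: cmean0.
rewrite big_ord_recr /= -IH -cmeanD//.
 by congr cmean; apply/funext => z; rewrite big_ord_recr.
move=> z zr; elim: {IH} M => [|M IH].
 by under eq_fun do rewrite big_ord0; apply/cd_cont/cd_cst.
by under eq_fun do rewrite big_ord_recr /=; apply: ccontD => //; exact: hF.
Qed.

(** The function is differentiable outside the disc of radius |z0|, so the radius may be increased
    without changing the mean; at infinity the integrand tends to 1. *)
Lemma cmean_cauchy_kernel z0 r : normc z0 < r ->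
 cmean (fun z => z / (z - z0)) r = (2 * pi)%:C.
Proof.
move=> zr; have r0 := le_lt_trans (nc_ge0 z0) zr.
apply/eqP; rewrite -subr_eq0; apply/eqP/(@small_eq0 (2 * (2 * pi))) => e e0.
have cdk z : normc z0 < normc z -> cd (fun z => z / (z - z0)) z.
 move=> h; apply: cdM; first exact: cd_id.
 apply: cdV; last by apply: cdB; [exact: cd_id|exact: cd_cst].
 by apply/eqP => /eqP; rewrite subr_eq0 => /eqP zz; rewrite zz ltxx in h.
pose q := Num.max r (normc z0 + normc z0 / e).
have q0 : 0 < q by rewrite lt_max r0.
have rq : r <= q by rewrite le_max lexx.
rewrite (@cmean_const R _ r q r0 rq) => [|z /andP[z1 _]]; last first.
 by apply: cdk; exact: lt_le_trans z1.
rewrite -mulrA; have := @cmean_bound R (fun z => z / (z - z0)) q 1 e q0.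
rewrite mulr1; apply => z zq; first by apply/cd_cont/cdk; rewrite zq (lt_le_trans zr).
have nz : normc z0 < normc z by rewrite zq (lt_le_trans zr).
have ne : z - z0 != 0.
 by apply/eqP => /eqP; rewrite subr_eq0 => /eqP zz; rewrite zz ltxx in nz.
rewrite (_ : z / (z - z0) - 1 = z0 / (z - z0)); last by field.
rewrite normcM normcV ler_pdivrMr ?nc_gt0// mulrC -ler_pdivrMr//.
apply: le_trans (ncB_ge _ _); rewrite zq lerBrDr addrC le_max.
by rewrite lexx orbT.
Qed.

(** Cauchy's formula is the vanishing of the mean of z (f z - f z0) / (z - z0), a function
    differentiable off z0 and zero at 0. Expanding z / (z - z0) as a finite geometric series in z0 /
    z gives the partial sum and a remainder of order (|z0| / r)^M. *)
Theorem taylor f : analytic_on_disc f ->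
 exists a, forall z, normc z < 1 -> hsum a z (f z).
Proof.
move=> fan; have fd z : normc z < 1 -> cd f z by move=> /fan /cdP.
have cdm m z : normc z < 1 -> z != 0 -> cd (fun z => f z * (z^-1) ^+ m) z.
 move=> z1 z0; apply: cdM; first exact: fd.
 by apply: cdX; apply: cdV => //; exact: cd_id.
(* The circle of radius 1/2 serves all points z0 at once; [am] below moves the means to a circle
   that encloses z0. *)
exists (fun m => ((2 * pi)^-1)%:C * cmean (fun z => f z * (z^-1) ^+ m) (2^-1)).
move=> z0 z01 e e0.
pose r := Num.max (2^-1) ((1 + normc z0) / 2).
have r1 : r < 1 by rewrite gt_max; apply/andP; split; lra.
have zr : normc z0 < r by rewrite lt_max; apply/orP; right; lra.
have hr : 2^-1 <= r by rewrite le_max lexx.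
have r0 : 0 < r by apply: lt_le_trans hr; rewrite invr_gt0.
have P0 : 0 < 2 * pi :> R by rewrite mulr_gt0// pi_gt0.
have am m : cmean (fun z => f z * (z^-1) ^+ m) (2^-1) = cmean (fun z => f z * (z^-1) ^+ m) r.
 apply: cmean_const => //.
 move=> z /andP[z1 z2]; apply: cdm; first exact: le_lt_trans r1.
 by rewrite -nc_eq0 gt_eqF// (lt_le_trans _ z1)// invr_gt0.
have [d0 fd0] := fd _ z01.
(* The value at z0 is the limit of the quotient, which makes h continuous there. *)
pose h z := if z == z0 then z0 * d0 else z * (f z - f z0) / (z - z0).
have hcd z : normc z < 1 -> z != z0 -> cd h z.
 move=> z1 zz; apply: (@cd_near R (fun z => z * (f z - f z0) / (z - z0))).
  exists (normc (z - z0)); first by rewrite nc_gt0 subr_eq0.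
  move=> y yz; rewrite /h; case: eqP => // yz0.
  by rewrite yz0 ncBC ltxx in yz.
 apply: cdM; first apply: cdM.
 - exact: cd_id.
 - by apply: cdB; [exact: fd|exact: cd_cst].
 - apply: cdV; first by rewrite subr_eq0.
  by apply: cdB; [exact: cd_id|exact: cd_cst].
have hc0 : ccont h z0.
 move=> u u0; have u20 : 0 < u / 2 by rewrite divr_gt0.
 have [q q0 H] := fd0 _ u20.
 have N0 : 0 < normc d0 + 1 by rewrite ltr_wpDl.
 exists (Num.min (Num.min q (1 - normc z0)) (u / 2 / (normc d0 + 1))).
  by rewrite !lt_min q0 subr_gt0 z01 divr_gt0.
 move=> y; rewrite !lt_min => /andP[/andP[yq y1] yu].
 rewrite /h eqxx; case: eqP => [_|/eqP ne]; first by rewrite subrr normc0 ltW.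
 have ne' : y - z0 != 0 by rewrite subr_eq0.
 have -> : y * (f y - f z0) / (y - z0) - z0 * d0 =
  y * ((f y - f z0 - d0 * (y - z0)) / (y - z0)) + d0 * (y - z0) by field.
 have ny : normc y <= 1.
  have := nc_triangle z0 y 0; rewrite !subr0; move: y1; lra.
 rewrite (le_trans (ncD _ _))// [u]splitr lerD//.
  rewrite normcM -[leRHS]mul1r ler_pM//.
  by rewrite normcM normcV ler_pdivrMr ?nc_gt0// H.
 rewrite normcM; apply: (le_trans (ler_wpM2l (nc_ge0 d0) (ltW yu))).
 rewrite mulrCA ler_piMr ?(ltW u20)//.
 by rewrite ler_pdivrMr// mul1r lerDl.
have hc z : normc z < 1 -> ccont h z.
 move=> z1; have [->//|ne] := eqVneq z z0; apply: cd_cont; exact: hcd.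
have h0 : h 0 = 0.
 by rewrite /h; case: eqP => [<-|_]; rewrite ?mul0r.
have hm : cmean h r = 0 by apply: cmean_vanish h0 hc hcd _ _; rewrite ?zr.
pose w z := z0 / z.
pose rem M z := f z * w z ^+ M * (z / (z - z0)).
have nz z : normc z = r -> z != 0 by move=> zr'; rewrite -nc_eq0 zr' gt_eqF.
have nz0 z : normc z = r -> z - z0 != 0.
 by move=> zr'; rewrite subr_eq0; apply/eqP => zz; rewrite -zz zr' ltxx in zr.
have geo M z : normc z = r -> f z * z / (z - z0) =
  \sum_(m < M) z0 ^+ m * (f z * (z^-1) ^+ m) + rem M z.
 move=> zr'; have z_0 := nz _ zr'; have z_z0 := nz0 _ zr'.
 have wz : w z - 1 != 0.
  by rewrite /w (_ : _ - 1 = - (z - z0) / z) ?mulf_neq0 ?oppr_eq0 ?invr_eq0//; field.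
 rewrite (eq_bigr (fun m : 'I_M => f z * (w z) ^+ m)) => [|m _]; last first.
  by rewrite /w exprMn; ring.
 rewrite -mulr_sumr -[\sum_(i < M) _](mulKf wz) -subrX1 /rem.
 have kz : z / (z - z0) = - (w z - 1)^-1.
  have -> : w z - 1 = - ((z - z0) / z) by rewrite /w; field.
  by rewrite invrN opprK invf_div.
 rewrite kz -[f z * z / _]mulrA kz; ring.
have cr g : (forall z, normc z = r -> cd g z) -> cont_on_circle g r.
 by move=> H z zr'; apply/cd_cont/H.
have z1 z : normc z = r -> normc z < 1 by move=> ->.
have cd_m m z : normc z = r -> cd (fun z => f z * (z^-1) ^+ m) z.
 by move=> zr'; apply: cdm; [exact: z1|exact: nz].
have cdk z : normc z = r -> cd (fun z => z / (z - z0)) z.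
 move=> zr'; apply: cdM; first exact: cd_id.
 by apply: cdV; [exact: nz0|apply: cdB; [exact: cd_id|exact: cd_cst]].
have cdrem M z : normc z = r -> cd (rem M) z.
 move=> zr'; apply: cdM; last exact: cdk.
 apply: cdM; first exact/fd/z1.
 apply: cdX; apply: cdM; first exact: cd_cst.
 by apply: cdV; [exact: nz|exact: cd_id].
have main M : (2 * pi)%:C * f z0 =
  \sum_(m < M) z0 ^+ m * cmean (fun z => f z * (z^-1) ^+ m) r + cmean (rem M) r.
 have E : cmean h r = cmean (fun z => (\sum_(m < M) z0 ^+ m * (f z * (z^-1) ^+ m) + rem M z)
   - f z0 * (z / (z - z0))) r.
  apply: cmean_eq; first exact: ltW.
  move=> z zr'; rewrite -geo// /h; case: eqP => [zz|_].
   by have := nz0 _ zr'; rewrite zz subrr eqxx.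
  ring.
 rewrite hm in E; move: E; rewrite cmeanB//; last first.
 - by apply: cr => z zr'; apply: cdM; [exact: cd_cst|exact: cdk].
 - move=> z zr'; apply: ccontD; last by apply/cd_cont/cdrem.
  elim: M => [|M IH]; first by under eq_fun do rewrite big_ord0; apply/cd_cont/cd_cst.
  under eq_fun do rewrite big_ord_recr /=; apply: ccontD => //.
  by apply/ccontZ/cd_cont/cd_m.
 rewrite cmeanD//; last 2 first.
 - move=> z zr'.
  elim: M => [|M IH]; first by under eq_fun do rewrite big_ord0; apply/cd_cont/cd_cst.
  under eq_fun do rewrite big_ord_recr /=; apply: ccontD => //.
  by apply/ccontZ/cd_cont/cd_m.
 - exact/cr/cdrem.
 rewrite (@cmean_sum (fun m z => z0 ^+ m * (f z * (z^-1) ^+ m)))//; last by move=> m z zr'; apply/ccontZ/cd_cont/cd_m.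
 rewrite cmeanZ//; last exact: cr.
 rewrite cmean_cauchy_kernel// => /esym/eqP; rewrite subr_eq0 => /eqP E.
 rewrite mulrC -E; congr (_ + _); apply: eq_bigr => m _.
 by rewrite cmeanZ//; apply: cr; exact: cd_m.
have [B B0 HB] := ccircle_bound r0 (cr _ (fun z zr' => fd _ (z1 _ zr'))).
pose q := normc z0 / r.
have q01 : 0 <= q < 1 by rewrite divr_ge0 ?(ltW r0)//= ltr_pdivrMr// mul1r.
pose K := B * (r / (r - normc z0)).
have rem_bd M : normc (cmean (rem M) r) <= 2 * (2 * pi * (K * q ^+ M)).
 have := @cmean_bound_arc R (rem M) r 0 (K * q ^+ M) r0 (cr _ (cdrem M)).
 rewrite mulr0 subr0; apply => t ht; rewrite subr0 /rem /w.
 have nr : normc (r%:C * expi t) = r.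
  by rewrite normcM nc_expi mulr1 nc_real ger0_norm// ltW.
 rewrite normcM normcM ncX normcM normcM !normcV nr /K /q -[B * _ * _]mulrAC.
 apply: ler_pM; rewrite ?mulr_ge0 ?exprn_ge0 ?divr_ge0 ?invr_ge0 ?nc_ge0 ?(ltW r0)//.
  by rewrite ler_wpM2r ?exprn_ge0 ?divr_ge0 ?(ltW r0)// HB.
 rewrite ler_wpM2l ?(ltW r0)// lef_pV2 ?posrE ?subr_gt0 ?nc_gt0 ?nz0//.
 by rewrite -{1}nr ncB_ge.
have [N HN] := geo_small (2 * K) q01 e0.
exists N => M NM; rewrite /psum.
have E : f z0 - \sum_(m < M) ((2 * pi)^-1)%:C *
   cmean (fun z => f z * z^-1 ^+ m) 2^-1 * z0 ^+ m = ((2 * pi)^-1)%:C * cmean (rem M) r.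
 have P0C : (2 * pi)%:C != 0 :> C.
  by rewrite -nc_eq0 nc_real normr_eq0 gt_eqF.
 have VC : ((2 * pi)^-1)%:C = ((2 * pi)%:C)^-1 :> C by rewrite fmorphV.
 apply: (mulfI P0C); rewrite mulrBr (main M) VC mulVKf// mulr_sumr addrAC.
 rewrite -[RHS]add0r; congr (_ + _); apply/eqP; rewrite subr_eq0; apply/eqP.
 by apply: eq_bigr => m _; rewrite am -mulrA mulVKf// mulrC.
rewrite E normcM nc_real ger0_norm ?invr_ge0 ?(ltW P0)// ler_pdivrMl//.
apply: (le_trans (rem_bd M)); rewrite mulrCA ler_pM2l//.
by rewrite mulrA HN.
Qed.

End Taylor.

(** * Rotation invariance of the area *)

Section Pushforward.
Context d1 d2 (T1 : measurableType d1) (T2 : measurableType d2) (R : realType).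
Variables (m : {measure set T1 -> \bar R}) (f : T1 -> T2).
Hypothesis mf : measurable_fun setT f.

Definition pmeas : {measure set T2 -> \bar R} :=
 measure_function_pushforward__canonical__measure_function_Measure m mf.
Lemma pmeasE A : pmeas A = m (f @^-1` A). Proof. by []. Qed.
Lemma integral_pmeas (D : set T2) (g : T2 -> \bar R) : measurable D -> measurable_fun D g -> (forall y, D y -> 0 <= g y)%E ->
 (\int[pmeas]_(y in D) g y = \int[m]_(x in f @^-1` D) g (f x))%E.
Proof. by move=> mD mg g0; apply: ge0_integral_pushforward => // y; rewrite inE; exact: g0. Qed.
End Pushforward.

Section LebesgueInvariance.
Variable R : realType.
Local Notation lam := (@lebesgue_measure R).
Local Open Scope ereal_scope.

Lemma affine_measurable (k c : R) : measurable_fun [set: R] (fun x : R => k * x + c)%R.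
Proof. by apply: measurable_funD => //; apply: measurable_funM. Qed.

Lemma lebesgue_affine (k c : R) (A : set R) : (0 < k)%R -> measurable A ->
 lam ((fun x => k * x + c)%R @^-1` A) = (k^-1)%:E * lam A.
Proof.
move=> k0 mA.
have k0' : (0 <= k)%R := ltW k0.
pose phi : measurableTypeR R -> measurableTypeR R := (fun x => k * x + c)%R.
have mphi : measurable_fun [set: measurableTypeR R] phi by exact: affine_measurable.
have kk : k%:E * (k^-1)%:E = 1 by rewrite -EFinM divff// gt_eqF.
suff H : lam A = k%:E * lam (phi @^-1` A).
 by rewrite H muleA -EFinM mulVf ?gt_eqF// mul1e.
pose nu := mscale (NngNum k0') (pmeas lam mphi).
have -> : k%:E * lam (phi @^-1` A) = nu A by [].
apply: (@lebesgue_measure_unique R (nu) _ A mA) => _ [[a b] _ <-].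
have E : phi @^-1` `]a, b]%classic = `]((a - c) / k)%R, ((b - c) / k)%R]%classic.
 apply/seteqP; split => x; rewrite /phi /= !in_itv /=.
  by move=> /andP[h1 h2]; rewrite ltr_pdivrMr// ler_pdivlMr// mulrC; apply/andP; split; lra.
 by rewrite ltr_pdivrMr// ler_pdivlMr// mulrC => /andP[h1 h2]; apply/andP; split; lra.
transitivity (k%:E * lam `]((a - c) / k)%R, ((b - c) / k)%R]%classic); last first.
 exact: (congr1 (fun S : set R => k%:E * lam S) (esym E)).
transitivity (if (a < b)%R then (b - a)%R%:E else 0).
 by have := lebesgue_measure_itv `]a, b]; rewrite /= lte_fin.
have := lebesgue_measure_itv `]((a - c) / k)%R, ((b - c) / k)%R]; rewrite /= lte_fin => ->.
rewrite ltr_pM2r ?invr_gt0// ltrD2r; case: ifP => _; last by rewrite mule0.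
by rewrite -EFinD -EFinM; congr (_%:E); field; rewrite gt_eqF.
Qed.

Lemma lebesgue_translate (c : R) (A : set R) : measurable A ->
 lam ((fun x => x + c)%R @^-1` A) = lam A.
Proof.
move=> mA; have := lebesgue_affine c (ltr01 : (0 < 1)%R) mA.
by rewrite invr1 mul1e; under eq_fun do rewrite mul1r.
Qed.

Local Notation lam2 := (lam \x lam)%E.
Local Notation T := (measurableTypeR R).

Lemma lebesgue2_swap (A : set (T * T)) : measurable A ->
 lam2 ((fun x : T * T => (x.2, x.1)) @^-1` A) = lam2 A.
Proof.
move=> mA; have msw : measurable_fun [set: T * T] (fun x : T * T => (x.2, x.1)).
 by apply: measurable_fun_pair => /=; [exact: measurable_snd|exact: measurable_fst].
pose nu := pmeas lam2 msw.
have -> : lam2 ((fun x : T * T => (x.2, x.1)) @^-1` A) = nu A by [].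
symmetry; apply: (@product_measure_unique _ _ _ _ R lam lam nu) => // X Y mX mY.
transitivity (lam2 (Y `*` X)).
 by apply: (congr1 lam2); apply/seteqP; split => -[x y] /= [? ?].
by rewrite [LHS]product_measure1E// muleC.
Qed.

Lemma lebesgue2_scale (k : R) (A : set (T * T)) : (0 < k)%R -> measurable A ->
 lam2 ((fun x : T * T => (k * x.1, k * x.2)%R : T * T) @^-1` A) = (k^-1 ^+ 2)%:E * lam2 A.
Proof.
move=> k0 mA; have k20 : (0 <= k ^+ 2)%R by rewrite exprn_ge0// ltW.
pose phi (x : T * T) : T * T := (k * x.1, k * x.2)%R.
have mphi : measurable_fun [set: T * T] phi.
 by apply: measurable_fun_pair => /=; apply: measurable_funM.
suff H : lam2 A = (k ^+ 2)%:E * lam2 (phi @^-1` A).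
 by rewrite H muleA -EFinM exprVn mulVf ?mul1e// expf_neq0// gt_eqF.
pose nu := mscale (NngNum k20) (pmeas lam2 mphi).
have -> : (k ^+ 2)%:E * lam2 (phi @^-1` A) = nu A by [].
apply: (@product_measure_unique _ _ _ _ R lam lam nu) => // X Y mX mY.
have mpre (Z : set T) : measurable Z -> measurable ((fun x => k * x + 0)%R @^-1` Z).
 by move=> mZ; rewrite -[X in measurable X]setTI; exact: affine_measurable.
transitivity ((k ^+ 2)%:E * lam2 (((fun x => k * x + 0)%R @^-1` X) `*` ((fun x => k * x + 0)%R @^-1` Y))).
 by apply: (congr1 (fun S => _ * lam2 S)); apply/seteqP; split => -[x y] /=; rewrite !addr0.
have EX := lebesgue_affine 0 k0 mX; have EY := lebesgue_affine 0 k0 mY.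
transitivity ((k ^+ 2)%:E * ((k^-1)%:E * lam X * ((k^-1)%:E * lam Y))).
 rewrite -EX -EY; apply: (congr1 (fun u => _ * u)).
 by apply: product_measure1E; exact: mpre.
have -> : (k^-1)%:E * lam X * ((k^-1)%:E * lam Y) = (k^-1 * k^-1)%:E * (lam X * lam Y) by rewrite muleACA.
have kk : (k ^+ 2 * (k^-1 * k^-1) = 1)%R by field; rewrite gt_eqF.
by rewrite muleA -EFinM kk mul1e.
Qed.

(** Fubini: each vertical section is translated. *)
Lemma lebesgue2_shear (a : R) (A : set (T * T)) : measurable A ->
 lam2 ((fun x : T * T => (x.1, x.2 + a * x.1)%R : T * T) @^-1` A) = lam2 A.
Proof.
move=> mA; rewrite /product_measure1 /=; apply: eq_integral => x _ /=.
have -> : xsection ((fun x : T * T => (x.1, x.2 + a * x.1)%R : T * T) @^-1` A) x =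
  (fun y => y + a * x)%R @^-1` xsection A x.
 by apply/seteqP; split => y /=; rewrite !xsectionP.
by rewrite lebesgue_translate//; exact: measurable_xsection.
Qed.

Lemma lebesgue2_shear' (a : R) (A : set (T * T)) : measurable A ->
 lam2 ((fun x : T * T => (x.1 + a * x.2, x.2)%R : T * T) @^-1` A) = lam2 A.
Proof.
move=> mA; have msw : measurable_fun [set: T * T] (fun x : T * T => (x.2, x.1)).
 by apply: measurable_fun_pair => /=; [exact: measurable_snd|exact: measurable_fst].
have mB : measurable ((fun x : T * T => (x.2, x.1)) @^-1` A).
 by rewrite -[X in measurable X]setTI; exact: msw.
rewrite -(lebesgue2_swap mA) -(lebesgue2_shear a mB).
apply/esym; apply: lebesgue2_swap.
rewrite -[X in measurable X]setTI; apply: (_ : measurable_fun _ _) => //.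
apply: measurable_fun_pair => /=; last exact: measurable_snd.
apply: measurable_funD; first exact: measurable_fst.
by apply: measurable_funM => //; exact: measurable_snd.
Qed.

End LebesgueInvariance.

Section AreaInvariance.
Variable R : realType.
Local Notation C := R[i].
Local Notation lam := (@lebesgue_measure R).
Local Notation lam2 := (lam \x lam)%E.
Lemma real_scaleC (k x y : R) : k%:C * (x +i* y) = (k * x) +i* (k * y).
Proof. by apply: eqc; rewrite ?ReM ?ImM /=; ring. Qed.

Local Open Scope ereal_scope.

Definition pair_of_complex (z : C) : R * R := (cRe z, cIm z).

Lemma pair_of_complexK : cancel (@complex_of_pair R) pair_of_complex.
Proof. by case. Qed.

Lemma measurable_pair_of_complex : measurable_fun [set: C] pair_of_complex.
Proof.
move=> _ A mA; rewrite setTI /measurable /= /complex_measurable /=.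
by rewrite -comp_preimage (_ : _ \o _ = id)// funeqE; exact: pair_of_complexK.
Qed.

Lemma area_map (phi : R * R -> R * R) (f : C -> C) (A : set C) :
 (forall x, f (complex_of_pair x) = complex_of_pair (phi x)) ->
 (forall B, measurable B -> measurable (phi @^-1` B)) ->
 (forall B, measurable B -> lam2 (phi @^-1` B) = lam2 B) ->
 measurable A -> measurable (f @^-1` A) /\ area (f @^-1` A) = area A.
Proof.
move=> E mphi lphi mA.
have P : @complex_of_pair R @^-1` (f @^-1` A) = phi @^-1` (@complex_of_pair R @^-1` A).
 by apply/seteqP; split => x /=; rewrite E.
split; first by rewrite /measurable /= /complex_measurable /= P; exact: mphi.
by rewrite /area P lphi.
Qed.

Lemma area_shear_re (a : R) (A : set C) : measurable A ->
 let f (z : C) := (cRe z +i* (cIm z + a * cRe z)%R)%C in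
 measurable (f @^-1` A) /\ area (f @^-1` A) = area A.
Proof.
move=> mA f; apply: (@area_map (fun x => (x.1, x.2 + a * x.1)%R)) => // B mB.
 rewrite -[X in measurable X]setTI; apply: (_ : measurable_fun _ _) => //.
 apply: measurable_fun_pair => /=; first exact: measurable_fst.
 apply: measurable_funD; first exact: measurable_snd.
 by apply: measurable_funM => //; exact: measurable_fst.
exact: lebesgue2_shear.
Qed.

Lemma area_shear_im (a : R) (A : set C) : measurable A ->
 let f (z : C) := ((cRe z + a * cIm z)%R +i* cIm z)%C in
 measurable (f @^-1` A) /\ area (f @^-1` A) = area A.
Proof.
move=> mA f; apply: (@area_map (fun x => (x.1 + a * x.2, x.2)%R)) => // B mB.
 rewrite -[X in measurable X]setTI; apply: (_ : measurable_fun _ _) => //.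
 apply: measurable_fun_pair => /=; last exact: measurable_snd.
 apply: measurable_funD; first exact: measurable_fst.
 by apply: measurable_funM => //; exact: measurable_snd.
exact: lebesgue2_shear'.
Qed.

(* A rotation is a product of three shears, unless its half-angle has zero cosine. *)
Let rot_aux (t : R) (A : set C) : cos (t / 2) != 0%R -> measurable A ->
 measurable ((fun z => expi t * z)%R @^-1` A) /\ area ((fun z => expi t * z)%R @^-1` A) = area A.
Proof.
move=> c0 mA; set s := sin t; set h := (- (sin (t / 2) / cos (t / 2)))%R.
have [m1 a1] := area_shear_im h mA.
have [m2 a2] := area_shear_re s m1.
have [m3 a3] := area_shear_im h m2.
set B := _ @^-1` (_ @^-1` (_ @^-1` A)) in m3 a3.
have -> : (fun z => expi t * z)%R @^-1` A = B; last by split; [exact: m3|exact: (etrans a3 (etrans a2 a1))].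
have t2 : t = (t / 2 + t / 2)%R by lra.
have st : (sin t = sin (t / 2) * cos (t / 2) + cos (t / 2) * sin (t / 2))%R by rewrite {1}t2 sinD.
have ct : (cos t = cos (t / 2) * cos (t / 2) - sin (t / 2) * sin (t / 2))%R by rewrite {1}t2 cosD.
have e1 : (1 + h * s = cos t)%R.
 rewrite /h /s st ct.
 have -> : (- (sin (t / 2) / cos (t / 2)) * (sin (t / 2) * cos (t / 2) + cos (t / 2) * sin (t / 2)) =
  - (2 * sin (t / 2) * sin (t / 2)))%R by field.
 by have := cos2Dsin2 (t / 2); rewrite !expr2; lra.
have sc : (s = - h * (1 + cos t))%R.
 rewrite /h opprK /s st ct.
 have := cos2Dsin2 (t / 2); move: (sin _) (cos _) c0 => x y y0 xy.
 apply: (mulIf y0).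
 have -> : (x / y * (1 + (y * y - x * x)) * y = x * (1 + (y * y - x * x)))%R by field.
 have xx : (x * x = 1 - y * y)%R by rewrite -!expr2 -xy; ring.
 by rewrite xx; ring.
have E (z : C) : (expi t * z = ((cRe z + h * cIm z) + h * (cIm z + s * (cRe z + h * cIm z)))
  +i* (cIm z + s * (cRe z + h * cIm z)))%R%C.
 apply: eqc; rewrite ?ReM ?ImM /= -e1 -/s.
  by rewrite [X in (_ - X * _)%R]sc -e1; ring.
 ring.
by apply/seteqP; split => z /=; rewrite /B /= E.
Qed.

(** If cos (t / 2) = 0 then cos (t / 4) does not vanish, so the rotation is performed in two steps
    of angle t / 2. *)
Lemma rotation_area (t : R) (A : set C) : measurable A ->
 measurable ((fun z => expi t * z)%R @^-1` A) /\ area ((fun z => expi t * z)%R @^-1` A) = area A.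
Proof.
move=> mA; have [c0|] := eqVneq (cos (t / 2)) 0%R; last by move=> c0; exact: rot_aux.
have c1 : cos (t / 2 / 2) != 0%R.
 apply/eqP => c1; have := cosD (t / 2 / 2) (t / 2 / 2).
 rewrite -splitr c0 c1 mul0r sub0r => /eqP; rewrite eq_sym oppr_eq0 -expr2 sqrf_eq0 => /eqP s0.
 have := cos2Dsin2 (t / 2 / 2); rewrite c1 s0 expr0n addr0 => /eqP.
 by rewrite eq_sym oner_eq0.
have [m1 a1] := rot_aux c1 mA; have [m2 a2] := rot_aux c1 m1.
have E : (fun z => expi (t / 2) * z)%R @^-1` ((fun z => expi (t / 2) * z)%R @^-1` A) =
     (fun z => expi t * z)%R @^-1` A.
 by apply/seteqP; split => z /=; rewrite mulrA -expiD -splitr.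
by rewrite -E; split; [exact: m2|exact: (etrans a2 a1)].
Qed.

Lemma rotation_measurable (t : R) : measurable_fun [set: C] (fun z : C => expi t * z)%R.
Proof. by move=> _ A mA; rewrite setTI; have [] := rotation_area t mA. Qed.

Lemma scale_area (k : R) (A : set C) : (0 < k)%R -> measurable A ->
 area ((fun z => k%:C%C * z)%R @^-1` A) = (k^-1 ^+ 2)%:E * area A.
Proof.
move=> k0 mA; rewrite /area muleCA -lebesgue2_scale//; apply: (congr1 (fun S => _ * lam2 S)).
by apply/seteqP; split => -[x y] /=; rewrite /complex_of_pair /= real_scaleC.
Qed.

Lemma measurable_Re : measurable_fun [set: C] (@cRe R).
Proof.
rewrite (_ : @cRe R = fst \o pair_of_complex)//.
by apply: measurableT_comp; [exact: measurable_fst|exact: measurable_pair_of_complex].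
Qed.

Lemma measurable_Im : measurable_fun [set: C] (@cIm R).
Proof.
rewrite (_ : @cIm R = snd \o pair_of_complex)//.
by apply: measurableT_comp; [exact: measurable_snd|exact: measurable_pair_of_complex].
Qed.

Lemma measurable_normc : measurable_fun [set: C] (@normc R).
Proof.
rewrite (_ : @normc R = Num.sqrt \o (fun z => cRe z ^+ 2 + cIm z ^+ 2)%R); last first.
 by apply/funext => -[].
apply: measurableT_comp; first by apply: continuous_measurable_fun; exact: sqrt_continuous.
by apply: measurable_funD; apply: measurable_funX; [exact: measurable_Re|exact: measurable_Im].
Qed.

End AreaInvariance.

(** * Measures with a density and integration of radial functions *)

Section Density.
Context d (T : measurableType d) (R : realType) (mu : {measure set T -> \bar R}).
Variable g : T -> R.
Hypotheses (mg : measurable_fun [set: T] g) (g0 : forall x, 0 <= g x).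
Local Open Scope ereal_scope.

(** The proofs about [g] are arguments, so that the measure instance below is available for every
    such density. *)
Definition mdens of measurable_fun [set: T] g & (forall x, 0 <= g x)%R :=
 fun A : set T => \int[mu]_(x in A) (g x)%:E.
Local Notation nu := (mdens mg g0).

Let mge D : measurable_fun D (EFin \o g).
Proof. by apply: measurable_funTS; exact/measurable_EFinP. Qed.

Let nu0 : nu set0 = 0. Proof. by rewrite /mdens integral_set0. Qed.
Let nu_ge0 A : 0 <= nu A.
Proof. by apply: integral_ge0 => x _; rewrite lee_fin. Qed.
Let nu_sigma_additive : semi_sigma_additive nu.
Proof.
move=> F mF tF mUF; rewrite /mdens ge0_integral_bigcup//; last by move=> x _; rewrite lee_fin.
by apply: is_cvg_ereal_nneg_natsum_cond => n _ _; apply: integral_ge0 => x _; rewrite lee_fin.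
Qed.

HB.instance Definition _ := isMeasure.Build _ _ _ nu nu0 nu_ge0 nu_sigma_additive.

Import HBNNSimple.

Lemma integral_mdens (D : set T) (f : T -> \bar R) : measurable D ->
 measurable_fun D f -> (forall x, D x -> 0 <= f x) ->
 \int[nu]_(x in D) f x = \int[mu]_(x in D) (f x * (g x)%:E).
Proof.
move=> mD mf f0; pose h := nnsfun_approx mD mf.
have fE x : D x -> (EFin \o h n) x @[n --> \oo] --> f x.
 by move=> Dx; exact: cvg_nnsfun_approx.
have h0 n x : 0 <= (h n x)%:E by rewrite lee_fin.
have nd x : nondecreasing_seq (fun n => (h n x)%:E).
 by move=> a b ab; rewrite lee_fin; exact/lefP/nd_nnsfun_approx.
have mh n : measurable_fun D (EFin \o h n).
 by apply/measurable_EFinP; exact: measurable_funTS.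
transitivity (limn (fun n => \int[nu]_(x in D) (h n x)%:E)).
 rewrite -monotone_convergence//.
 by apply: eq_integral => x /[!inE] Dx; apply/esym/cvg_lim => //; exact: fE.
transitivity (limn (fun n => \int[mu]_(x in D) ((h n x)%:E * (g x)%:E))); last first.
 rewrite -monotone_convergence//.
 - apply: eq_integral => x /[!inE] Dx; apply/cvg_lim => //.
  by apply: cvgeZr => //; exact: fE.
 - by move=> n; apply: emeasurable_funM; [exact: mh|exact: mge].
 - by move=> n x _; rewrite mule_ge0// lee_fin.
 - by move=> x _ a b ab; rewrite lee_wpmul2r ?lee_fin//; exact: nd.
congr (limn _); apply/funext => n.
transitivity (\int[nu]_(x in D)
  (\sum_(y \in range (h n)) (y * \1_(h n @^-1` [set y]) x)%:E)).
 by apply: eq_integral => t tE; rewrite /= fimfunE -fsumEFin.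
have indich m r : measurable_fun D (fun x => (r * \1_(h m @^-1` [set r]) x)%:E).
 by apply: (measurable_comp measurableT) => //; exact: measurable_funM.
rewrite ge0_integral_fsum//; last by move=> m y Ey; exact: nnfun_muleindic_ge0.
transitivity (\int[mu]_(x in D) (\sum_(y \in range (h n))
  (y * \1_(h n @^-1` [set y]) x)%:E * (g x)%:E)); last first.
 apply: eq_integral => x _.
 rewrite -ge0_mule_fsuml => [|y]; last exact: nnfun_muleindic_ge0.
 by rewrite fsumEFin // -(fimfunE _ x).
rewrite ge0_integral_fsum//; last 2 first.
- by move=> y; apply: emeasurable_funM => //; exact: mge.
- by move=> m y Ey; rewrite mule_ge0 ?lee_fin// -lee_fin nnfun_muleindic_ge0.
apply: eq_fsbigr => r rhn.
under eq_integral do rewrite EFinM.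
rewrite integralZl_indic_nnsfun// integral_indic//.
have mS : measurable (h n @^-1` [set r]).
 by rewrite -[X in measurable X]setTI; exact: measurable_funP.
under [RHS]eq_integral do rewrite EFinM -muleA.
have [r0|r0] := leP 0%R r; last first.
 have -> : h n @^-1` [set r] = set0.
  by rewrite preimage_nnfun0.
 rewrite set0I measure0 mule0; under eq_integral do rewrite indicE in_set0 mul0e mule0.
 by rewrite integral0.
rewrite ge0_integralZl//; last 2 first.
- apply: emeasurable_funM; last exact: mge.
 by apply/measurable_EFinP; exact: measurable_indic.
- by move=> x _; rewrite mule_ge0 ?lee_fin.
congr (_ * _); rewrite /mdens setIC.
rewrite [RHS](eq_integral (fun x => ((fun x => (g x)%:E) \_ (h n @^-1` [set r])) x)).
 by rewrite -integral_mkcondr.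
move=> x _; rewrite /patch indicE; case: ifP => _; by rewrite ?mul1e ?mul0e.
Qed.

End Density.

Section Radial.
Variable R : realType.

Lemma is_derive_scaled_sqr (k r : R) : is_derive r 1 (fun r : R => k * r ^+ 2) (2 * k * r).
Proof.
have H : is_derive r 1 (k \*: ((@id R) ^+ 2)) (2 * k * r).
 by apply: is_derive_eq; rewrite /GRing.scale /=; ring.
exact: H.
Qed.

Lemma continuous_scaled_sqr (k r : R) : {for r, continuous (fun r : R => k * r ^+ 2)}.
Proof.
have [h _] := is_derive_scaled_sqr k r.
by apply: differentiable_continuous; apply/derivable1_diffP.
Qed.

Local Notation C := R[i].
Local Notation lam := (@lebesgue_measure R).
Local Open Scope ereal_scope.

Lemma measurable_disc (r : R) : measurable [set z : C | normc z < r]%R.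
Proof.
have := @measurable_normc R measurableT `]-oo, r[%classic.
rewrite setTI (_ : normc (R:=R) @^-1` _ = [set z : C | normc z < r]%R).
 by apply; exact: measurable_itv.
by apply/seteqP; split => z /=; rewrite in_itv.
Qed.

Lemma measurable_unit_disc : measurable (@unit_disc R).
Proof. exact: measurable_disc. Qed.

Definition kap : R := fine (area (@unit_disc R)).

Let rect (a b : R) (ab : (a < b)%R) :
 (lam \x lam) (`[a, b]%classic `*` `[a, b]%classic) = ((b - a) ^+ 2)%:E.
Proof.
have L : lam `[a, b]%classic = (b - a)%:E.
 by have := lebesgue_measure_itv `[a, b]; rewrite /= lte_fin ab => ->.
transitivity (lam `[a, b]%classic * lam `[a, b]%classic).
 by apply: product_measure1E.
by rewrite L -EFinM expr2.
Qed.

(** The disc lies between the squares of sides 1 and 2 centred at 0. *)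
Lemma kap_area : area (@unit_disc R) = kap%:E /\ (0 < kap)%R.
Proof.
have p0 : (0 < pi :> R)%R := pi_gt0 R.
have up : area (@unit_disc R) <= (pi^-1 * 4)%:E.
 rewrite EFinM lee_wpmul2l ?lee_fin ?invr_ge0 ?(ltW p0)//.
 have -> : (4 = (1 - -1) ^+ 2 :> R)%R by ring.
 rewrite -rect; last by lra.
 apply: le_measure; rewrite ?inE//.
 - exact: measurable_unit_disc.
 - exact: measurableX.
 - move=> [x y] /=; rewrite /unit_disc /= => h; rewrite !in_itv /=.
  have := nc_Re (x +i* y)%C; have := nc_Im (x +i* y)%C => /= h1 h2.
  by rewrite -!ler_norml; split; apply: le_trans (ltW h).
have lo : (pi^-1 * 1)%:E <= area (@unit_disc R).
 rewrite EFinM lee_wpmul2l ?lee_fin ?invr_ge0 ?(ltW p0)//.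
 have -> : (1 = (2^-1 - - 2^-1) ^+ 2 :> R)%R by field.
 rewrite -rect; last by lra.
 apply: le_measure; rewrite ?inE//.
 - exact: measurableX.
 - exact: measurable_unit_disc.
 - move=> [x y] /=; rewrite !in_itv /= -!ler_norml => -[h1 h2].
  rewrite /unit_disc /= -[X in (_ < X)%R]sqrtr1 ltr_sqrt//.
  rewrite -real_normK ?num_real// -[(y ^+ 2)%R]real_normK ?num_real//.
  have := normr_ge0 x; have := normr_ge0 y; nra.
have fin : area (@unit_disc R) \is a fin_num.
 by rewrite ge0_fin_numE ?measure_ge0// (le_lt_trans up)// ltry.
rewrite /kap fineK//; split => //.
by rewrite fine_gt0// (lt_le_trans _ lo)/= ?lte_fin ?mulr1 ?invr_gt0// -ge0_fin_numE ?measure_ge0.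
Qed.

Lemma area_disc (r : R) : (0 <= r)%R -> area [set z : C | normc z < r]%R = (kap * r ^+ 2)%:E.
Proof.
rewrite le_eqVlt => /orP[/eqP<-|r0].
 rewrite expr0n mulr0 (_ : [set z : C | _]%R = set0) ?measure0//.
 by rewrite -subset0 => z /=; rewrite ltNge nc_ge0.
have [E _] := kap_area.
have S : [set z : C | normc z < r]%R = (fun z => (r^-1)%:C%C * z)%R @^-1` (@unit_disc R).
 apply/seteqP; split => z /=; rewrite /unit_disc /= normcM nc_real ger0_norm ?invr_ge0 ?(ltW r0)//.
  by rewrite ltr_pdivrMl// mulr1.
 by rewrite ltr_pdivrMl// mulr1.
rewrite S scale_area ?invr_gt0//; last exact: measurable_unit_disc.
by rewrite invrK E -EFinM mulrC.
Qed.

Lemma rotation_integral (t : R) (D : set C) (f : C -> \bar R) : measurable D ->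
 (forall z, D z -> D (expi t * z)%R) -> (forall z, D (expi t * z)%R -> D z) ->
 measurable_fun D f -> (forall z, D z -> 0 <= f z) ->
 \int[area]_(z in D) f (expi t * z)%R = \int[area]_(z in D) f z.
Proof.
move=> mD D1 D2 mf f0.
have mrot := @rotation_measurable R t.
have PD : (fun z => expi t * z)%R @^-1` D = D.
 by apply/seteqP; split => z /=; [exact: D2|exact: D1].
have E := integral_pmeas area mrot mD mf f0.
rewrite PD in E; rewrite -E.
apply: eq_measure_integral => A mA AD; rewrite pmeasE.
by have [] := @rotation_area R t A mA.
Qed.

(** Density of the modulus: the image of [area] on the disc under [normc]. *)
Let g (r : R) : R := if (0 <= r < 1)%R then (2 * kap * r)%R else 0%R.
Let g0 r : (0 <= g r)%R.
Proof.
rewrite /g; case: ifP => // /andP[r0 _]; have [_ k0] := kap_area.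
by rewrite !mulr_ge0// ltW.
Qed.
Let mg : measurable_fun [set: R] g.
Proof.
rewrite /g; apply: measurable_fun_ifT => //.
by apply: measurable_and; [exact: measurable_fun_ler|exact: measurable_fun_ltr].
Qed.

Let int_g (x : R) : (0 <= x < 1)%R ->
 \int[lam]_(r in `[x, +oo[) (g r)%:E = (kap * (1 - x ^+ 2))%:E.
Proof.
move=> /andP[x0 x1].
rewrite (_ : `[x, +oo[%classic = `[x, 1%R[%classic `|` `[1%R, +oo[%classic); last first.
 by rewrite -itv_bndbnd_setU// bnd_simp ltW.
rewrite ge0_integral_setU//=; last 3 first.
- by apply: measurable_funTS; exact/measurable_EFinP.
- by move=> r _; rewrite lee_fin.
- apply/disj_set2P; rewrite -subset0 => r [] /=; rewrite !in_itv /= andbT => /andP[_ h1] h2.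
 by move: (lt_le_trans h1 h2); rewrite ltxx.
rewrite [X in _ + X](eq_integral (cst 0)) => [|r]; last first.
 by rewrite inE /= in_itv /= andbT => h; rewrite /g ltNge h andbF.
rewrite integral_cst// mul0e adde0.
transitivity (\int[lam]_(r in `[x, 1%R[) (2 * kap * r)%:E).
 apply: eq_integral => r; rewrite inE /= in_itv /= => /andP[h1 h2].
 by rewrite /g h2 (le_trans x0).
rewrite integral_itv_bndo_bndc; last first.
 by apply/measurable_EFinP; apply: measurable_funTS; exact: measurable_funM.
rewrite (@continuous_FTC2 _ _ (fun r : R => kap * r ^+ 2)%R)//.
- by rewrite -EFinD expr1n mulr1 mulrBr mulr1.
- by apply: continuous_subspaceT; exact: mulrl_continuous.
- split.
 + by move=> r _; have [] := is_derive_scaled_sqr kap r.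
 + by apply: cvg_at_right_filter; exact: continuous_scaled_sqr.
 + by apply: cvg_at_left_filter; exact: continuous_scaled_sqr.
- by move=> r _; rewrite derive1E; have [_ ->] := is_derive_scaled_sqr kap r.
Qed.

(** Both measures give kap (1 - x^2) to the half-line [x, +oo[ when 0 <= x < 1; half-lines generate
    the Borel sets and are stable under intersection, which determines the image measure. *)
Lemma radial_integral (f : R -> \bar R) : measurable_fun [set: R] f ->
 (forall r, 0 <= f r) ->
 \int[area]_(z in @unit_disc R) f (normc z) =
 \int[lam]_(r in `[0%R, 1%R[) (f r * (2 * kap * r)%:E).
Proof.
move=> mf f0; have [kE k0] := kap_area; have k0' := ltW k0.
have mD := measurable_unit_disc.
have mI : measurable_fun [set: C] (\1_(@unit_disc R) : C -> R) by exact: measurable_indic.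
have I0 (z : C) : (0 <= \1_(@unit_disc R) z :> R)%R by [].
have mN : measurable_fun [set: C] (@normc R : C -> measurableTypeR R) by exact: measurable_normc.
pose P := pmeas (mdens area mI I0) mN.
have PE (A : set R) : measurable A -> P A = area ((@normc R @^-1` A) `&` @unit_disc R).
 move=> mA; have mNA : measurable (@normc R @^-1` A).
  by rewrite -[X in measurable X]setTI; exact: measurable_normc.
 transitivity (\int[area]_(z in @normc R @^-1` A) (\1_(@unit_disc R) z)%:E) => //.
 by rewrite integral_indic// setIC.
have PQ (A : set R) : measurable A -> P A = mdens lam mg g0 A.
 apply: (@measure_unique _ R (measurableTypeR R) (RGenCInfty.G (R := R))
  (fun k => `[(- k%:R)%R, +oo[%classic) _ _ _ _ P (mdens lam mg g0)).
 - exact: RGenCInfty.measurableE.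
 - move=> _ _ [x ->] [y ->]; exists (Num.max x y); apply/seteqP; split => r /=.
   by rewrite !in_itv /= !andbT ge_max => -[-> ->].
  by rewrite !in_itv /= !andbT ge_max => /andP[-> ->].
 - by move=> k; exists (- k%:R)%R.
 - rewrite -subTset => x _; exists (Num.truncn `|x|%R).+1 => //=.
  rewrite in_itv /= andbT lerNl.
  by rewrite (le_trans _ (ltW (truncnS_gt _)))// -normrN ler_norm.
 - move=> _ [x ->]; rewrite PE// -[RHS]/(\int[lam]_(r in `[x, +oo[) (g r)%:E).
  have [x0|x0] := leP 0%R x; last first.
   have -> : @normc R @^-1` `[x, +oo[%classic `&` @unit_disc R = @unit_disc R.
    rewrite setIidr// => z _ /=; rewrite in_itv /= andbT.
    exact: le_trans (ltW x0) (nc_ge0 z).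
   rewrite kE (_ : `[x, +oo[%classic = `[x, 0%R[%classic `|` `[0%R, +oo[%classic); last first.
    by rewrite -itv_bndbnd_setU// bnd_simp ltW.
   rewrite ge0_integral_setU//=; last 3 first.
   + by apply: measurable_funTS; exact/measurable_EFinP.
   + by move=> r _; rewrite lee_fin.
   + apply/disj_set2P; rewrite -subset0 => r [] /=; rewrite !in_itv /= andbT => /andP[_ h1] h2.
    by move: (lt_le_trans h1 h2); rewrite ltxx.
   rewrite (eq_integral (cst 0)) => [|r]; last first.
    by rewrite inE /= in_itv /= => /andP[_ h]; rewrite /g leNgt h.
   rewrite integral_cst// mul0e add0e int_g ?lexx ?ltr01//.
   by rewrite expr0n subr0 mulr1.
  have [x1|x1] := leP 1%R x.
   rewrite (_ : _ `&` _ = set0) ?measure0; last first.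
    rewrite -subset0 => z [] /=; rewrite in_itv /= andbT => h1 h2.
    by move: (lt_le_trans h2 (le_trans x1 h1)); rewrite ltxx.
   rewrite (eq_integral (cst 0)) ?integral_cst ?mul0e// => r.
   rewrite inE /= in_itv /= andbT => h.
   by rewrite /g [(r < 1)%R]ltNge (le_trans x1 h) andbF.
  rewrite int_g ?x0//.
  have -> : @normc R @^-1` `[x, +oo[%classic `&` @unit_disc R =
   @unit_disc R `\` [set z : C | normc z < x]%R.
   apply/seteqP; split => z /=; rewrite in_itv /= andbT => -[h1 h2]; split => //.
    by apply/negP; rewrite -leNgt.
   by rewrite leNgt; apply/negP.
  rewrite measureD//; last 2 first.
  + exact: measurable_disc.
  + by have : area (@unit_disc R) < +oo by rewrite kE ltry.
  rewrite setIidr; last by move=> z /= h; exact: lt_trans h x1.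
  transitivity (area (@unit_disc R) - area [set z : C | normc z < x]%R) => //.
  by rewrite kE area_disc// -EFinB mulrBr mulr1.
 - move=> k; rewrite PE//; apply: (@le_lt_trans _ _ (area (@unit_disc R))).
   apply: le_measure; rewrite ?inE//.
   apply: measurableI => //; rewrite -[X in measurable X]setTI.
   by apply: measurable_normc => //; exact: measurable_itv.
  by rewrite kE ltry.
transitivity (\int[P]_(r in [set: R]) f r).
 rewrite integral_pmeas// preimage_setT integral_mdens//; last first.
  by apply: measurableT_comp => //; exact: measurable_normc.
 rewrite [LHS]integral_mkcond; apply: eq_integral => z _.
 by rewrite /patch indicE; case: ifP => _; rewrite ?mule1 ?mule0.
rewrite (eq_measure_integral (mdens lam mg g0)); last first.
 by move=> A mA _; exact: PQ.
rewrite integral_mdens//.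
rewrite [RHS]integral_mkcond; apply: eq_integral => r _.
rewrite /patch mem_setE in_itv /= /g; case: ifP => // _; by rewrite mule0.
Qed.

End Radial.

(** * Weighted square integrable functions *)

Lemma eqCR0 (R : realType) (x : R) : (x%:C == 0 :> R[i]) = (x == 0).
Proof. by rewrite eq_complex /= eqxx andbT. Qed.

Section WeightedInnerProduct.
Variable R : realType.
Local Notation C := R[i].
Local Notation D := (@unit_disc R).
Variables (m : {measure set C -> \bar R}) (v : C -> R).
Hypotheses (mv : measurable_fun D v) (v0 : forall z, D z -> 0 <= v z).
Implicit Types (f g h : C -> C).

Let mD : measurable D := @measurable_unit_disc R.

Definition mcf f := measurable_fun D (fun z => cRe (f z)) /\
          measurable_fun D (fun z => cIm (f z)).

Definition L2 f := mcf f /\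
 (\int[m]_(z in D) (normc (f z) ^+ 2 * v z)%:E < +oo)%E.

Definition Qn f : R := \int[m]_(z in D) (normc (f z) ^+ 2 * v z).

Definition ip f g : C := cintegral m D (fun z => f z * conjc (g z) * (v z)%:C).

Lemma mcfZD (c : C) f g : mcf f -> mcf g -> mcf (fun z => c * f z + g z).
Proof.
move=> [f1 f2] [g1 g2]; split.
- under eq_fun do rewrite ReD ReM.
 apply: measurable_funD => //; apply: measurable_funB; exact: measurable_funM.
- under eq_fun do rewrite ImD ImM.
 by apply: measurable_funD => //; apply: measurable_funD; exact: measurable_funM.
Qed.

Lemma mcfM f g : mcf f -> mcf g -> mcf (fun z => f z * g z).
Proof.
move=> [f1 f2] [g1 g2]; split.
- by under eq_fun do rewrite ReM; apply: measurable_funB; exact: measurable_funM.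
- by under eq_fun do rewrite ImM; apply: measurable_funD; exact: measurable_funM.
Qed.

Lemma mcf_conj f : mcf f -> mcf (fun z => conjc (f z)).
Proof.
move=> [f1 f2]; split; under eq_fun do rewrite /=.
 by rewrite (_ : (fun z => _) = (fun z => cRe (f z)))//; apply/funext => z; case: (f z).
rewrite (_ : (fun z => _) = (fun z => - cIm (f z))); first exact: measurable_funN.
by apply/funext => z; case: (f z).
Qed.

Lemma mcf_real (u : C -> R) : measurable_fun D u -> mcf (fun z => (u z)%:C).
Proof. by move=> mu; split => //=; exact: measurable_cst. Qed.

Lemma mcf_cst (c : C) : mcf (fun=> c). Proof. by split; exact: measurable_cst. Qed.

Lemma mcf_normc f : mcf f -> measurable_fun D (fun z => normc (f z)).
Proof.
move=> [f1 f2].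
rewrite (_ : (fun z => _) = Num.sqrt \o (fun z => cRe (f z) ^+ 2 + cIm (f z) ^+ 2)).
 apply: measurableT_comp; first by apply: continuous_measurable_fun; exact: sqrt_continuous.
 by apply: measurable_funD; exact: measurable_funX.
by apply/funext => z /=; case: (f z).
Qed.

Let m2 f : mcf f -> measurable_fun D (fun z => (normc (f z) ^+ 2 * v z)%:E).
Proof.
move=> mf; apply/measurable_EFinP; apply: measurable_funM => //.
by apply: measurable_funX; exact: mcf_normc.
Qed.

Let pos2 f z : D z -> 0 <= normc (f z) ^+ 2 * v z.
Proof. by move=> Dz; rewrite mulr_ge0 ?exprn_ge0 ?v0. Qed.

Lemma L2_integrable f : L2 f ->
 m.-integrable D (EFin \o (fun z => normc (f z) ^+ 2 * v z)).
Proof.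
move=> [mf fin]; apply/integrableP; split; first exact: m2.
under eq_integral => z /[!inE] Dz do rewrite /= ger0_norm ?pos2//.
exact: fin.
Qed.

Lemma Qn_ge0 f : 0 <= Qn f.
Proof. by apply: Rintegral_ge0 => z Dz; exact: pos2. Qed.

Lemma QnE f : L2 f -> (Qn f)%:E = (\int[m]_(z in D) (normc (f z) ^+ 2 * v z)%:E)%E.
Proof.
move=> [mf fin]; rewrite /Qn /Rintegral fineK// ge0_fin_numE//.
by apply: integral_ge0 => z Dz; rewrite lee_fin pos2.
Qed.

Lemma cintegrable_dom f (u : C -> R) : mcf f -> m.-integrable D (EFin \o u) ->
 (forall z, D z -> normc (f z) <= u z) -> cintegrable m D f.
Proof.
move=> [f1 f2] iu fu; split; apply: (le_integrable mD _ _ iu) => /=.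
- exact/measurable_EFinP.
- move=> z Dz; rewrite /= lee_fin (le_trans (nc_Re _))// (le_trans (fu z Dz))//.
 exact: ler_norm.
- exact/measurable_EFinP.
- move=> z Dz; rewrite /= lee_fin (le_trans (nc_Im _))// (le_trans (fu z Dz))//.
 exact: ler_norm.
Qed.

Lemma cint_linear (c : C) f g : cintegrable m D f -> cintegrable m D g ->
 cintegral m D (fun z => c * f z + g z) = c * cintegral m D f + cintegral m D g.
Proof.
move=> [f1 f2] [g1 g2].
have iz (k : R) (u : C -> R) : m.-integrable D (EFin \o u) ->
  m.-integrable D (EFin \o (fun z => k * u z)).
 by move=> iu; have := integrableZl mD k iu; apply: eq_integrable.
have ib (u1 u2 : C -> R) : m.-integrable D (EFin \o u1) -> m.-integrable D (EFin \o u2) ->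
  m.-integrable D (EFin \o (fun z => u1 z - u2 z)).
 by move=> i1 i2; have := integrableB mD i1 i2; apply: eq_integrable.
have idd (u1 u2 : C -> R) : m.-integrable D (EFin \o u1) -> m.-integrable D (EFin \o u2) ->
  m.-integrable D (EFin \o (fun z => u1 z + u2 z)).
 by move=> i1 i2; have := integrableD mD i1 i2; apply: eq_integrable.
apply: eqc; rewrite ?ReD ?ImD ?ReM ?ImM /=.
- under eq_Rintegral do rewrite ReD ReM.
 rewrite RintegralD//; last by apply: ib; exact: iz.
 by rewrite RintegralB ?RintegralZl//; exact: iz.
- under eq_Rintegral do rewrite ImD ImM.
 rewrite RintegralD//; last by apply: idd; exact: iz.
 by rewrite RintegralD ?RintegralZl//; exact: iz.
Qed.

Lemma cintegrable_linear (c : C) f g : cintegrable m D f -> cintegrable m D g ->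
 cintegrable m D (fun z => c * f z + g z).
Proof.
move=> [f1 f2] [g1 g2].
have iz (k : R) (u : C -> R) : m.-integrable D (EFin \o u) ->
  m.-integrable D (EFin \o (fun z => k * u z)).
 by move=> iu; have := integrableZl mD k iu; apply: eq_integrable.
split.
- have := integrableD mD (integrableB mD (iz (cRe c) _ f1) (iz (cIm c) _ f2)) g1.
 by apply: eq_integrable => // z _; rewrite /= ReD ReM.
- have := integrableD mD (integrableD mD (iz (cRe c) _ f2) (iz (cIm c) _ f1)) g2.
 by apply: eq_integrable => // z _; rewrite /= ImD ImM.
Qed.

Lemma cint_conj f : cintegrable m D f ->
 cintegral m D (fun z => conjc (f z)) = conjc (cintegral m D f).
Proof.
move=> [_ f2]; apply: eqc => /=.
 by apply: eq_Rintegral => z _; case: (f z).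
rewrite -mulN1r -RintegralZl//; apply: eq_Rintegral => z _.
by case: (f z) => a b /=; rewrite mulN1r.
Qed.

Lemma cint_le f (u : C -> R) : cintegrable m D f -> m.-integrable D (EFin \o u) ->
 (forall z, D z -> normc (f z) <= u z) ->
 normc (cintegral m D f) <= \int[m]_(z in D) u z.
Proof.
move=> fi iu fu; set I := cintegral m D f.
have u0 : 0 <= \int[m]_(z in D) u z.
 by apply: Rintegral_ge0 => z Dz; exact: le_trans (nc_ge0 _) (fu z Dz).
have [->|I0] := eqVneq I 0; first by rewrite normc0.
have n0 : 0 < normc I by rewrite nc_gt0.
have z0i : cintegrable m D (fun=> 0 : C).
 by split; rewrite (_ : (fun=> _) = cst 0%E)//; exact: integrable0.
(* A unimodular factor that makes the integral real and nonnegative. *)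
pose c : C := conjc I / (normc I)%:C.
have nc1 : normc c = 1.
 by rewrite normcM nc_conj normcV nc_real (ger0_norm (nc_ge0 I)) divff// lt0r_neq0.
have E := cint_linear c fi z0i.
have cI : c * I = (normc I)%:C.
 have nn : (normc I)%:C != 0 :> C by rewrite eqCR0 gt_eqF.
 by rewrite /c mulrAC [conjc I * I]mulrC mul_conj expr2 RCM mulfK.
have Z : cintegral m D (fun=> 0 : C) = 0.
 by apply: eqc; rewrite /= /Rintegral; under eq_integral do rewrite /=;
  rewrite integral0.
rewrite -/I cI Z addr0 in E.
have -> : normc I = cRe (cintegral m D (fun z => c * f z + 0)) by rewrite E.
rewrite /=; apply: le_Rintegral => //.
 by have [] := cintegrable_linear c fi z0i.
move=> z Dz; rewrite (le_trans (ler_norm _))// (le_trans (nc_Re _))// addr0 normcM nc1 mul1r.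
exact: fu.
Qed.

Lemma L2ZD (c : C) f g : L2 f -> L2 g -> L2 (fun z => c * f z + g z).
Proof.
move=> lf lg; have [mf _] := lf; have [mg _] := lg.
split; first exact: mcfZD.
have := integrableD mD (integrableZl mD (2 * normc c ^+ 2) (L2_integrable lf))
 (integrableZl mD 2 (L2_integrable lg)).
move=> /integrableP[_]; apply: le_lt_trans; apply: ge0_le_integral => //=.
- by move=> z Dz; rewrite lee_fin mulr_ge0 ?exprn_ge0 ?nc_ge0 ?v0.
- by apply: (m2 (f := fun z => c * f z + g z)); exact: mcfZD.
- apply/measurable_EFinP; apply: measurableT_comp => //.
 by apply: measurable_funD; apply: measurable_funM => //; apply/measurable_EFinP; exact: m2.
- move=> z Dz; rewrite lee_fin.
 apply: le_trans (ler_norm _); rewrite !mulrA -mulrDl ler_wpM2r ?v0//.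
 apply: le_trans (nc_sqrD_le _ _) _; rewrite normcM le_eqVlt; apply/orP; left.
 by apply/eqP; ring.
Qed.

Lemma L2_0 : L2 (fun=> 0).
Proof.
split; first exact: mcf_cst.
by under eq_integral do rewrite normc0 expr0n mul0r; rewrite integral0.
Qed.

Lemma L2Z (c : C) f : L2 f -> L2 (fun z => c * f z).
Proof.
by move=> lf; have := L2ZD c lf L2_0; under eq_fun do rewrite addr0.
Qed.

Lemma L2D f g : L2 f -> L2 g -> L2 (fun z => f z + g z).
Proof. by move=> lf lg; have := L2ZD 1 lf lg; under eq_fun do rewrite mul1r. Qed.

Lemma L2B f g : L2 f -> L2 g -> L2 (fun z => f z - g z).
Proof.
move=> lf lg; have := L2ZD (-1) lg lf.
by rewrite (_ : (fun z => -1 * g z + f z) = (fun z => f z - g z))//; apply/funext => z; ring.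
Qed.

Lemma L2_sum (I : Type) (r : seq I) (F : I -> C -> C) : (forall i, L2 (F i)) ->
 L2 (fun z => \sum_(i <- r) F i z).
Proof.
move=> lF; elim: r => [|i r IH]; first by under eq_fun do rewrite big_nil; exact: L2_0.
by under eq_fun do rewrite big_cons; exact: L2D.
Qed.

Let half_sum f g (t : R) z : 0 < t -> D z ->
 normc (f z * conjc (g z) * (v z)%:C) <=
 2^-1 * t * (normc (f z) ^+ 2 * v z) + 2^-1 * t^-1 * (normc (g z) ^+ 2 * v z).
Proof.
move=> t0 Dz; rewrite !normcM nc_conj nc_real ger0_norm ?v0//.
rewrite [2^-1 * t * (_ * _)]mulrA [2^-1 * t^-1 * (_ * _)]mulrA -mulrDl ler_wpM2r ?v0//.
set x := normc (f z); set y := normc (g z).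
have -> : 2^-1 * t * x ^+ 2 + 2^-1 / t * y ^+ 2 = 2^-1 * t^-1 * (t * x - y) ^+ 2 + x * y.
 by field; rewrite gt_eqF.
by rewrite lerDr mulr_ge0 ?sqr_ge0// mulr_ge0 ?invr_ge0// ltW.
Qed.

Let half_int f g (t : R) : L2 f -> L2 g -> m.-integrable D (EFin \o (fun z =>
 2^-1 * t * (normc (f z) ^+ 2 * v z) + 2^-1 * t^-1 * (normc (g z) ^+ 2 * v z))).
Proof.
move=> lf lg; have := integrableD mD (integrableZl mD (2^-1 * t) (L2_integrable lf))
 (integrableZl mD (2^-1 / t) (L2_integrable lg)).
by apply: eq_integrable => // z _.
Qed.

Lemma ip_int f g : L2 f -> L2 g ->
 cintegrable m D (fun z => f z * conjc (g z) * (v z)%:C).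
Proof.
move=> lf lg; apply: cintegrable_dom (half_int 1 lf lg) _.
- apply: mcfM; last exact: mcf_real.
 by apply: mcfM; [case: lf|apply: mcf_conj; case: lg].
- by move=> z Dz; exact: half_sum.
Qed.

Lemma ip_linear (c : C) f g h : L2 f -> L2 g -> L2 h ->
 ip (fun z => c * f z + g z) h = c * ip f h + ip g h.
Proof.
move=> lf lg lh; rewrite /ip -cint_linear; try exact: ip_int.
by congr cintegral; apply/funext => z; ring.
Qed.

Lemma ip_conj f g : L2 f -> L2 g -> ip g f = conjc (ip f g).
Proof.
move=> lf lg; rewrite /ip -cint_conj; last exact: ip_int.
congr cintegral; apply/funext => z.
by rewrite !conjM conjK conjc_real [X in X * _]mulrC.
Qed.

Lemma ip_linear_r (c : C) f g h : L2 f -> L2 g -> L2 h ->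
 ip h (fun z => c * f z + g z) = conjc c * ip h f + ip h g.
Proof.
move=> lf lg lh; rewrite ip_conj//; last exact: L2ZD.
by rewrite ip_linear// conjD conjM -!ip_conj.
Qed.

Lemma ip0 f : ip (fun=> 0) f = 0.
Proof.
rewrite /ip; under eq_fun do rewrite !mul0r.
by apply: eqc; rewrite /= /Rintegral; under eq_integral do rewrite /=; rewrite integral0.
Qed.

Lemma ip_sum (I : Type) (r : seq I) (c : I -> C) (F : I -> C -> C) h :
 (forall i, L2 (F i)) -> L2 h ->
 ip (fun z => \sum_(i <- r) c i * F i z) h = \sum_(i <- r) c i * ip (F i) h.
Proof.
move=> lF lh; elim: r => [|i r IH].
 by under eq_fun do rewrite big_nil; rewrite ip0 big_nil.
under eq_fun do rewrite big_cons.
rewrite ip_linear ?big_cons ?IH//.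
by apply: L2_sum => j; exact: L2Z.
Qed.

Lemma ip_sum_r (I : Type) (r : seq I) (c : I -> C) (F : I -> C -> C) h :
 (forall i, L2 (F i)) -> L2 h ->
 ip h (fun z => \sum_(i <- r) c i * F i z) = \sum_(i <- r) conjc (c i) * ip h (F i).
Proof.
move=> lF lh; rewrite ip_conj//; last by apply: L2_sum => i; exact: L2Z.
rewrite ip_sum// conj_sum; apply: eq_bigr => i _.
by rewrite conjM -ip_conj.
Qed.

Lemma ip_self f : ip f f = (Qn f)%:C.
Proof.
apply: eqc; rewrite /ip /Qn /=.
 by apply: eq_Rintegral => z _; rewrite mul_conj -RCM.
rewrite (@eq_Rintegral _ _ _ _ _ (cst 0)) => [|z _]; last by rewrite mul_conj -RCM.
by rewrite /Rintegral integral0.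
Qed.

Lemma ip_le f g (t : R) : 0 < t -> L2 f -> L2 g ->
 normc (ip f g) <= 2^-1 * t * Qn f + 2^-1 * t^-1 * Qn g.
Proof.
move=> t0 lf lg.
have := cint_le (ip_int lf lg) (half_int t lf lg) (fun z => half_sum f g t0).
rewrite RintegralD//.
- rewrite !RintegralZl//; exact: L2_integrable.
- have := integrableZl mD (2^-1 * t) (L2_integrable lf).
 by apply: eq_integrable => // z _.
- have := integrableZl mD (2^-1 / t) (L2_integrable lg).
 by apply: eq_integrable => // z _.
Qed.

(** The bound [ip_le] is used at t = |ip f g| / Qn f. When Qn f = 0 the value t = (Qn g + 1) / |ip f
    g| already contradicts a nonzero inner product. *)
Lemma ip_CS f g : L2 f -> L2 g -> normc (ip f g) ^+ 2 <= Qn f * Qn g.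
Proof.
move=> lf lg; have F0 := Qn_ge0 f; have G0 := Qn_ge0 g; have I0 := nc_ge0 (ip f g).
have H t : 0 < t -> normc (ip f g) <= 2^-1 * t * Qn f + 2^-1 * t^-1 * Qn g.
 by move=> t0; exact: ip_le.
move: (normc (ip f g)) (Qn f) (Qn g) F0 G0 I0 H => x F G F0 G0 x0 H.
rewrite leNgt; apply/negP => lt.
have xp : 0 < x.
 by rewrite lt_neqAle x0 andbT; apply/eqP => xz; move: lt; rewrite -xz expr0n ltNge mulr_ge0.
have F1 : 0 < F.
 rewrite lt_neqAle F0 andbT; apply/eqP => Fz.
 have := H ((G + 1) / x) (divr_gt0 (ltr_wpDl G0 ltr01) xp).
 rewrite -Fz mulr0 add0r invf_div => /(ler_wpM2r (ltW (ltr_wpDl G0 ltr01 : 0 < G + 1))).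
 rewrite (_ : 2^-1 * (x / (G + 1)) * G * (G + 1) = 2^-1 * x * G); last by field; rewrite gt_eqF// ltr_wpDl.
 by nra.
have := H (x / F) (divr_gt0 xp F1); rewrite invf_div => /(ler_wpM2r (ltW xp)).
rewrite (_ : (_ + _) * x = 2^-1 * (x ^+ 2 + F * G)); last by field; rewrite !gt_eqF.
by nra.
Qed.

End WeightedInnerProduct.

(** * Radial doubling weights *)

Section WeightFacts.
Variables (R : realType) (w : R[i] -> R).
Hypothesis hw : class_Dhat w.
Local Notation C := R[i].
Local Notation D := (@unit_disc R).
Local Notation lam := (@lebesgue_measure R).
Local Open Scope ereal_scope.

Lemma Dhat_ge0 z : D z -> (0 <= w z)%R. Proof. by case: hw => -[] + _ _ _ _; exact. Qed.

Lemma Dhat_meas : measurable_fun D w.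
Proof. by case: hw => -[_ /integrableP[/measurable_EFinP]]. Qed.

Lemma unit_disc_real (s : R) : (0 <= s < 1)%R -> D s%:C%R.
Proof. by move=> /andP[s0 s1]; rewrite /unit_disc /mkset nc_real ger0_norm. Qed.

Let phi_ge0 s : (0 <= s < 1)%R -> (0 <= w s%:C)%R.
Proof. by move=> h; apply: Dhat_ge0; exact: unit_disc_real. Qed.

Lemma measurable_RC : measurable_fun [set: measurableTypeR R] (fun s : measurableTypeR R => s%:C%R : C).
Proof.
move=> _ A mA; rewrite setTI.
have mp : measurable_fun [set: measurableTypeR R]
  (fun s : measurableTypeR R => (s, 0%R : measurableTypeR R)).
 by apply: measurable_fun_pair => //; exact: measurable_cst.
by have := mp measurableT _ mA; rewrite setTI.
Qed.

Let mphi : measurable_fun (`[0%R, 1%R[%classic : set (measurableTypeR R)) (fun s : measurableTypeR R => w s%:C%R).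
Proof.
apply: (measurable_comp (F := D) _ _ Dhat_meas); first exact: measurable_unit_disc.
- by move=> _ [s /= s01 <-]; apply: unit_disc_real; move: s01; rewrite in_itv.
- by apply: measurable_funS measurable_RC.
Qed.

Let mphix x : (0 <= x)%R -> measurable_fun (`[x, 1%R[%classic : set (measurableTypeR R)) (fun s : measurableTypeR R => w s%:C%R).
Proof.
move=> x0; apply: measurable_funS mphi => //.
by move=> s /=; rewrite !in_itv/= => /andP[/(le_trans x0) -> ->].
Qed.

Lemma radial_weight (g : R -> R) : measurable_fun [set: R] g ->
 (forall r, (0 <= r < 1)%R -> (0 <= g r)%R) ->
 \int[area]_(z in D) (g (normc z) * w z)%:E =
 \int[lam]_(r in `[0%R, 1%R[) (g r * w r%:C * (2 * kap R * r))%:E.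
Proof.
move=> mg g0.
pose f := (fun r : measurableTypeR R => (g r * w r%:C%R)%:E) \_ (`[0%R, 1%R[%classic : set (measurableTypeR R)).
have mf : measurable_fun [set: measurableTypeR R] f.
 apply/(measurable_restrictT _ _).1 => //; apply/measurable_EFinP.
 by apply: measurable_funM => //; exact: measurable_funS mg.
have fE r : (0 <= r < 1)%R -> f r = (g r * w r%:C%R)%:E.
 by move=> h; rewrite /f patchE mem_set//= in_itv.
transitivity (\int[area]_(z in D) f (normc z)).
 apply: eq_integral => z; rewrite inE => Dz; rewrite fE ?nc_ge0//=.
 by have [_ hr _ _] := hw; rewrite -hr.
rewrite radial_integral//; last first.
 move=> r; rewrite /f patchE; case: ifPn => // /set_mem/=; rewrite in_itv/= => h.
 by rewrite lee_fin mulr_ge0 ?g0 ?phi_ge0.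
by apply: eq_integral => r; rewrite inE/= in_itv/= => h; rewrite fE.
Qed.

(** Real-valued tail integral; [hatE] below identifies it with [weight_hat] once finiteness is
    known. *)
Definition hat (r : R) : R := (\int[lam]_(s in `[r, 1%R[) w s%:C)%R.

Let hatle x y : (0 <= x <= y)%R -> weight_hat w y <= weight_hat w x.
Proof.
move=> /andP[x0 xy]; apply: ge0_subset_integral => //=.
- by apply/measurable_EFinP; exact: mphix.
- move=> s; rewrite in_itv/= => /andP[xs s1]; rewrite lee_fin phi_ge0// s1 andbT.
 exact: le_trans xs.
- by move=> s /=; rewrite !in_itv/= => /andP[/(le_trans xy) -> ->].
Qed.

Let kap0 : (0 < kap R)%R. Proof. by have [] := kap_area R. Qed.

(** On [1/2, 1[ the factor 2 kap s of the area element is at least kap, so integrability on the disc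
    bounds this tail. *)
Let hat_half_fin : weight_hat w 2^-1 < +oo.
Proof.
have wfin : \int[area]_(z in D) (1 * w z)%:E < +oo.
 have [[_ /integrableP[_ +]] _ _ _] := hw; apply: le_lt_trans; apply: ge0_le_integral => //.
 - exact: measurable_unit_disc.
 - by move=> z Dz; rewrite lee_fin mul1r Dhat_ge0.
 - by apply/measurable_EFinP; under eq_fun do rewrite mul1r; exact: Dhat_meas.
 - by apply: measurableT_comp => //; apply/measurable_EFinP; exact: Dhat_meas.
 - by move=> z Dz; rewrite mul1r lee_fin ler_norm.
rewrite (radial_weight (g := fun=> 1%R)) in wfin => //.
have : (kap R)%:E * weight_hat w 2^-1 < +oo.
 apply: le_lt_trans wfin; rewrite /weight_hat -ge0_integralZl//=.
 - have ss : (`[2^-1%R, 1%R[%classic : set R) `<=` `[0%R, 1%R[.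
   by move=> s /=; rewrite !in_itv/= => /andP[h ->]; rewrite (le_trans _ h).
  apply: (@le_trans _ _ (\int[lam]_(s in `[2^-1%R, 1%R[) (1 * w s%:C%R * (2 * kap R * s))%:E)).
  + apply: ge0_le_integral => //=.
   * move=> s; rewrite in_itv/= => /andP[s1 s2].
    by rewrite mule_ge0 ?lee_fin ?(ltW kap0)// phi_ge0// s2 (le_trans _ s1).
   * apply/measurable_EFinP; apply: measurable_funM => //.
    by apply: mphix.
   * apply/measurable_EFinP; apply: measurable_funM => //.
    by apply: measurable_funM => //; exact: mphix.
   * move=> s; rewrite in_itv/= => /andP[s1 s2]; rewrite -EFinM lee_fin mul1r mulrC.
    have p0 : (0 <= w s%:C)%R by rewrite phi_ge0// s2 (le_trans _ s1).
    by rewrite ler_wpM2l// mulrAC ler_peMl ?(ltW kap0)//; lra.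
  + apply: ge0_subset_integral => //=.
   * apply/measurable_EFinP; apply: measurable_funM => //.
    by apply: measurable_funM => //; exact: mphix.
   * move=> s; rewrite in_itv/= => s01.
    rewrite lee_fin !mulr_ge0 ?phi_ge0 ?(ltW kap0)//.
    by case/andP : s01.
 - by apply/measurable_EFinP; exact: mphix.
 - move=> s; rewrite in_itv/= => /andP[s1 s2].
  by rewrite lee_fin phi_ge0// s2 (le_trans _ s1).
 - by rewrite lee_fin ltW.
case: (weight_hat w 2^-1) => //.
- by move=> r _; rewrite ltry.
- by rewrite gt0_muley// lte_fin.
Qed.

(** Near 0 the area element degenerates; the doubling condition at r = 0 bounds the whole integral
    by its tail from 1/2. *)
Let hat_fin x : (0 <= x)%R -> weight_hat w x \is a fin_num.
Proof.
move=> x0; rewrite ge0_fin_numE.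
 apply: (@le_lt_trans _ _ (weight_hat w 0)); first by apply: hatle; rewrite lexx.
 have [_ _ _ [K K0 /(_ 0%R)]] := hw; rewrite lexx ltr01 => /(_ isT).
 rewrite addr0 div1r => /le_lt_trans; apply.
 rewrite -(@fineK _ (weight_hat w 2^-1)) ?ltry// ge0_fin_numE//.
 apply: integral_ge0 => s /=; rewrite in_itv/= => /andP[s1 s2].
 by rewrite lee_fin phi_ge0// s2 (le_trans _ s1).
apply: integral_ge0 => s /=; rewrite in_itv/= => /andP[s1 s2].
by rewrite lee_fin phi_ge0// s2 (le_trans _ s1).
Qed.

Let hatE x : (0 <= x)%R -> weight_hat w x = (hat x)%:E.
Proof. by move=> x0; rewrite -(fineK (hat_fin x0)). Qed.

Lemma hat_int x : (0 <= x)%R -> lam.-integrable `[x, 1%R[ (EFin \o (fun s : R => w s%:C%R)).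
Proof.
move=> x0; apply/integrableP; split; first by apply/measurable_EFinP; exact: mphix.
have := hat_fin x0; rewrite ge0_fin_numE; last first.
 apply: integral_ge0 => s /=; rewrite in_itv/= => /andP[s1 s2].
 by rewrite lee_fin phi_ge0// s2 (le_trans _ s1).
apply: le_lt_trans; apply: le_of_eq.
apply: eq_integral => s; rewrite inE/= in_itv/= => /andP[s1 s2].
by rewrite ger0_norm// phi_ge0// s2 (le_trans _ s1).
Qed.

Lemma hat_noninc x y : (0 <= x <= y)%R -> (hat y <= hat x)%R.
Proof.
move=> h; have /andP[x0 xy] := h.
by rewrite -lee_fin -!hatE ?(le_trans x0)//; exact: hatle.
Qed.

Lemma hat_ge0 x : (0 <= x)%R -> (0 <= hat x)%R.
Proof.
move=> x0; apply: Rintegral_ge0 => s /=; rewrite in_itv/= => /andP[s1 s2].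
by rewrite phi_ge0// s2 (le_trans _ s1).
Qed.

Lemma hat_doubling : exists2 K : R, (1 <= K)%R &
 forall x, (0 <= x < 1)%R -> (hat x <= K * hat ((1 + x) / 2))%R.
Proof.
have [_ _ _ [K K0 H]] := hw; exists (Num.max 1 K)%R; first by rewrite le_max lexx.
move=> x x01; have := H x x01; have /andP[x0 x1] := x01.
have y0 : (0 <= (1 + x) / 2)%R by lra.
rewrite !hatE// -EFinM lee_fin => /le_trans; apply.
by rewrite ler_wpM2r ?hat_ge0// le_max lexx orbT.
Qed.

(** Iterating the doubling condition from 0 gives hat 0 <= K^n hat (1 - 2^-n). A zero of hat would
    therefore force hat 0 = 0, and w would vanish almost everywhere. *)
Lemma hat_gt0 x : (0 <= x < 1)%R -> (0 < hat x)%R.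
Proof.
move=> /andP[x0 x1]; rewrite lt_neqAle hat_ge0// andbT; apply/eqP => hx.
have [K K1 HK] := hat_doubling.
have hp n : (hat 0 <= K ^+ n * hat (1 - 2^-1 ^+ n))%R.
 elim: n => [|n IH]; first by rewrite !expr0 subrr mul1r.
 have p0 : (0 < 2^-1 ^+ n :> R)%R by rewrite exprn_gt0// invr_gt0.
 have p1 : (2^-1 ^+ n <= 1 :> R)%R by rewrite exprn_ile1// invf_le1// ler1n.
 apply: (le_trans IH); rewrite exprSr -mulrA ler_wpM2l ?exprn_ge0 ?(le_trans _ K1)//.
 apply: (le_trans (HK _ _)); first by apply/andP; split; lra.
 rewrite (_ : (1 + (1 - 2^-1 ^+ n)) / 2 = 1 - 2^-1 ^+ n.+1)%R//.
 by rewrite exprS; field.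
have x1' : (0 < 1 - x)%R by rewrite subr_gt0.
have h2 : (0 <= (2^-1 : R) < 1)%R by apply/andP; split; lra.
have [n nx] := geo_small 1 h2 x1'.
have h0 : hat 0 = 0%R.
 apply/eqP; rewrite eq_le hat_ge0// andbT (le_trans (hp n))//.
 rewrite -(mulr0 (K ^+ n)%R) ler_wpM2l ?exprn_ge0 ?(le_trans _ K1)//.
 rewrite [leRHS]hx; apply: hat_noninc; rewrite x0/=.
 by have := nx n (leqnn n); rewrite mul1r; lra.
have [_ _ + _] := hw; apply.
have D0 : \int[area]_(z in D) (1 * w z)%:E = 0.
 rewrite (radial_weight (g := fun=> 1%R))//.
 apply/eqP; rewrite eq_le; apply/andP; split; last first.
  apply: integral_ge0 => s /=; rewrite in_itv/= => s01.
  by rewrite lee_fin !mulr_ge0 ?phi_ge0 ?(ltW kap0)//; case/andP : s01.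
 rewrite (_ : 0 = (2 * kap R)%:E * weight_hat w 0); last by rewrite hatE// h0 mule0.
 rewrite /weight_hat -ge0_integralZl//=.
 - apply: ge0_le_integral => //=.
  + move=> s; rewrite in_itv/= => s01.
   by rewrite lee_fin !mulr_ge0 ?phi_ge0 ?(ltW kap0)//; case/andP : s01.
  + apply/measurable_EFinP; apply: measurable_funM => //.
    by apply: measurable_funM => //; exact: mphix.
  + by apply/measurable_EFinP; apply: measurable_funM => //; exact: mphix.
  + move=> s; rewrite in_itv/= => s01; rewrite -EFinM lee_fin mul1r mulrC.
   rewrite ler_wpM2r ?phi_ge0// ler_piMr ?mulr_ge0 ?(ltW kap0)//.
   by case/andP : s01 => _ /ltW.
 - by apply/measurable_EFinP; exact: mphix.
 - by rewrite lee_fin mulr_ge0// ltW.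
have mD := @measurable_unit_disc R.
have /(ae_eq_integral_abs _ mD _).1 : \int[area]_(z in D) `|(w z)%:E| = 0.
 rewrite -[RHS]D0; apply: eq_integral => z; rewrite inE => Dz.
 by rewrite mul1r/= ger0_norm// Dhat_ge0.
move=> /(_ _)[]; first by apply/measurable_EFinP; exact: Dhat_meas.
move=> N [mN N0 hN]; exists N; split=> // z zh; apply: hN => /=.
by apply: contra_not zh => h Dz; have [] := h Dz.
Qed.

End WeightFacts.

(** * Dyadic numbers and elementary decay estimates *)

Section Dyadic.
Variable R : realType.
Definition dy n : R := 2^-1 ^+ n.
Lemma dy_gt0 n : 0 < dy n. Proof. by rewrite exprn_gt0// invr_gt0. Qed.
Lemma dy_ge0 n : 0 <= dy n. Proof. exact/ltW/dy_gt0. Qed.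
Lemma dy_le1 n : dy n <= 1. Proof. by rewrite exprn_ile1// invf_le1// ler1n. Qed.
Lemma dyS n : dy n.+1 = dy n / 2. Proof. by rewrite /dy exprSr. Qed.
Lemma dyD n m : dy (n + m) = dy n * dy m. Proof. by rewrite /dy exprD. Qed.
Lemma dyV n : dy n = (2 ^+ n)^-1. Proof. by rewrite /dy exprVn. Qed.
Lemma dy_le m n : (m <= n)%N -> dy n <= dy m.
Proof. by move=> mn; rewrite -(subnKC mn) dyD ger_pMr ?dy_gt0 ?dy_le1. Qed.
Lemma dy_nat n : dy n * (2 ^ n)%:R = 1.
Proof. by rewrite dyV natrX mulVf// expf_neq0// pnatr_eq0. Qed.
Lemma dy_small (e : R) : 0 < e -> exists n, dy n <= e.
Proof.
move=> e0; have h2 : 0 <= (2^-1 : R) < 1 by apply/andP; split; lra.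
by have [n /(_ n (leqnn n))] := geo_small 1 h2 e0; rewrite mul1r; exists n.
Qed.

Lemma bernoulli (x : R) n : 0 <= x <= 1 -> 1 - n%:R * x <= (1 - x) ^+ n.
Proof.
move=> /andP[x0 x1]; elim: n => [|n IH]; first by rewrite mul0r subr0 expr0.
have : (1 - n%:R * x) * (1 - x) <= (1 - x) ^+ n.+1 by rewrite exprSr ler_wpM2r// subr_ge0.
have nx : 0 <= n%:R * x ^+ 2 by rewrite mulr_ge0// exprn_ge0.
by apply: le_trans; rewrite -natr1; lra.
Qed.

(* (1 - x)^N <= exp(- N x), and exp(t) dominates every power of t. *)
Lemma power_decay (q : nat) (x : R) (N : nat) : 0 < x <= 1 -> (0 < N)%N -> (0 < q)%N ->
 (1 - x) ^+ N <= q`!%:R * (N%:R * x)^-1 ^+ q.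
Proof.
move=> /andP[x0 x1] N0 q0; have Nx : 0 < N%:R * x by rewrite mulr_gt0 ?ltr0n.
apply: (@le_trans _ _ (expR (- x) ^+ N)).
 apply: lerXn2r; rewrite ?nnegrE ?subr_ge0 ?expR_ge0//.
 exact: expR_ge1Dx.
rewrite -expRM_natl mulrN expRN exprVn -[q`!%:R]invrK -invfM lef_pV2 ?posrE ?expR_gt0//; last first.
 by rewrite mulr_gt0 ?exprn_gt0// invr_gt0 ltr0n fact_gt0.
have := expR_ge1Dxn q.-1 (ltW Nx); rewrite prednK//; apply: le_trans.
by rewrite mulrC lerDr.
Qed.
End Dyadic.
Arguments dy {R}.

(** * Size of the associated weight on dyadic annuli *)

Section WeightIntegrals.
Variables (R : realType) (w : R[i] -> R).
Hypothesis hw : class_Dhat w.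
Local Notation C := R[i].
Local Notation D := (@unit_disc R).
Local Notation lam := (@lebesgue_measure R).
Local Notation hat := (hat w).

Let phi_ge0 s : 0 <= s < 1 -> 0 <= w s%:C.
Proof. by move=> h; apply: Dhat_ge0; rewrite //; exact: unit_disc_real. Qed.

Lemma wint (g : R -> R) x B : 0 <= x -> measurable_fun [set: R] g ->
 (forall s, x <= s < 1 -> `|g s| <= B) ->
 lam.-integrable `[x, 1[ (EFin \o (fun s : R => g s * w s%:C)).
Proof.
move=> x0 mg gB; have hi := hat_int hw x0.
have hB : lam.-integrable `[x, 1[ (fun s : R => B%:E * (w s%:C)%:E)%E by exact: integrableZl.
apply: le_integrable hB => //.
 apply/measurable_EFinP; apply: measurable_funM.
  exact: measurable_funS mg.
 by move/integrableP : hi => [/measurable_EFinP].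
move=> s /=; rewrite in_itv/= => h; rewrite lee_fin !normrM ler_wpM2r//.
exact: le_trans (gB s h) (ler_norm _).
Qed.

Let hat_intZ (k : R) x : 0 <= x ->
 lam.-integrable `[x, 1[ (EFin \o (fun s : R => k * w s%:C)).
Proof. by move=> x0; apply: (wint (g := fun=> k) (B := `|k|)). Qed.

Lemma wint_split (u : R -> R) x y : x <= y < 1 -> lam.-integrable `[x, 1[ (EFin \o u) ->
 \int[lam]_(s in `[x, 1[) u s = \int[lam]_(s in `[x, y[) u s + \int[lam]_(s in `[y, 1[) u s.
Proof.
move=> /andP[xy y1] ui.
have U : [set` `[x, 1[] = [set` `[x, y[] `|` [set` `[y, 1[] :> set R.
 by rewrite -itv_bndbnd_setU ?bnd_simp// ltW.
rewrite U Rintegral_setU//; first by rewrite -U.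
apply/disj_setPS => s [] /=; rewrite !in_itv/= => /andP[_ sy] /andP[ys _].
by move: sy; rewrite ltNge ys.
Qed.

Lemma wint_sub (u : R -> R) x y : x <= y < 1 -> lam.-integrable `[x, 1[ (EFin \o u) ->
 (forall s, x <= s < 1 -> 0 <= u s) ->
 \int[lam]_(s in `[y, 1[) u s <= \int[lam]_(s in `[x, 1[) u s.
Proof.
move=> h ui u0; rewrite (wint_split h ui) lerDr; apply: Rintegral_ge0 => s /=.
by rewrite in_itv/= => /andP[s1 s2]; apply: u0; rewrite s1; case/andP : h => _; exact: lt_trans.
Qed.

Definition Hn n : R := hat (1 - dy n).

Lemma dy_range n : 0 <= (1 - dy n : R) < 1.
Proof. by rewrite subr_ge0 dy_le1 ltrBlDr ltrDl dy_gt0. Qed.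

Lemma Hn_gt0 n : 0 < Hn n. Proof. by apply: hat_gt0 => //; exact: dy_range. Qed.

Lemma Hn_noninc m n : (m <= n)%N -> Hn n <= Hn m.
Proof.
move=> mn; apply: hat_noninc => //; have /andP[-> _] := dy_range m.
by rewrite lerD2l lerN2 dy_le.
Qed.

Lemma Hn_doubling : exists2 K : R, 1 <= K & forall n d, Hn n <= K ^+ d * Hn (n + d).
Proof.
have [K K1 HK] := hat_doubling hw; exists K => // n; elim=> [|d IH].
 by rewrite addn0 expr0 mul1r.
apply: (le_trans IH); rewrite exprSr -mulrA ler_wpM2l ?exprn_ge0 ?(le_trans _ K1)//.
apply: (le_trans (HK _ (dy_range _))); rewrite addnS /Hn dyS.
by rewrite (_ : (1 + (1 - dy (n + d))) / 2 = 1 - dy (n + d) / 2)//; field.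
Qed.

Lemma ln_lb (x : R) : 0 < x -> 1 - x^-1 <= ln x.
Proof.
move=> x0; rewrite -[leRHS]opprK -lnV ?posrE// lerNr opprB.
have := @le_ln1Dx R (x^-1 - 1); rewrite addrCA subrr addr0; apply.
by rewrite ltrDr invr_gt0.
Qed.

Lemma ln_ub (x : R) : 0 < x -> ln x <= x - 1.
Proof.
by move=> x0; have := @le_ln1Dx R (x - 1); rewrite addrCA subrr addr0; apply; rewrite ltrDr.
Qed.

Let star_int rho : 0 < rho < 1 ->
 lam.-integrable `[rho, 1[ (EFin \o (fun s : R => w s%:C * ln (s / rho) * s)).
Proof.
move=> /andP[r0 r1].
have mg : measurable_fun [set: measurableTypeR R] (fun s : measurableTypeR R => ln (s / rho) * s).
 apply: measurable_funM => //; apply: measurableT_comp; first exact: measurable_ln.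
 by apply: measurable_funM.
have gb s : rho <= s < 1 -> `|ln (s / rho) * s| <= rho^-1.
 move=> /andP[s0 s1]; have sp : 0 < s by exact: lt_le_trans s0.
 have q1 : 1 <= s / rho by rewrite ler_pdivlMr// mul1r.
 have l0 : 0 <= ln (s / rho) by rewrite ln_ge0.
 rewrite ger0_norm ?mulr_ge0 ?(ltW sp)//.
 have l1 := ln_ub (lt_le_trans ltr01 q1).
 apply: (@le_trans _ _ (ln (s / rho))); first by rewrite ler_piMr// ltW.
 rewrite (le_trans l1)// lerBlDr (@le_trans _ _ (rho^-1))//.
  by rewrite ler_piMl ?invr_ge0 ?ltW.
 by rewrite lerDl.
have := wint (ltW r0) mg gb; apply: eq_integrable => // s _ /=.
by congr (_%:E); rewrite mulrC mulrA.
Qed.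

(** On the half of [r, 1[ nearest to 1, s log (s / r) >= s - r >= (1 - r) / 2. *)
Lemma star_lb (z : C) : 0 < normc z < 1 ->
 (1 - normc z) / 2 * hat ((1 + normc z) / 2) <= weight_star w z.
Proof.
move=> h; rewrite /weight_star; have si := star_int h; move: h si.
set r := normc z => /[dup] h /andP[r0 r1] si.
have y0 : 0 <= (1 + r) / 2 by lra.
have ui (x : R) : 0 <= x -> lam.-integrable `[x, 1[ (EFin \o (fun s : R => (1 - r) / 2 * w s%:C)).
 move=> x0; exact: hat_intZ.
have ry : r <= (1 + r) / 2 < 1 by apply/andP; split; lra.
have sp s : r <= s < 1 -> 0 <= w s%:C * ln (s / r) * s.
 move=> /andP[s0 s1]; have s2 : 0 <= s by exact: le_trans (ltW r0) s0.
 rewrite mulr_ge0// mulr_ge0//; first by rewrite phi_ge0// s2.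
 by rewrite ln_ge0// ler_pdivlMr// mul1r.
apply: le_trans (wint_sub ry si sp).
rewrite /hat -RintegralZl//; last exact: hat_int.
apply: le_Rintegral => //; first exact: ui.
 apply: integrableS si => //= s /=; rewrite !in_itv/= => /andP[+ ->]; rewrite andbT.
 by apply: le_trans; case/andP : ry.
move=> s /=; rewrite in_itv/= => /andP[s0 s1].
have s2 : 0 < s by apply: lt_le_trans s0; lra.
rewrite -mulrA mulrC ler_wpM2l ?phi_ge0 ?s1 ?(ltW s2)//.
have := ln_lb (divr_gt0 s2 r0); rewrite invf_div => /(ler_wpM2r (ltW s2)).
rewrite mulrBl mul1r divfK ?gt_eqF//; lra.
Qed.

Lemma star_ub (z : C) : 0 < normc z < 1 ->
 weight_star w z <= ((normc z)^-1 - 1) * hat (normc z).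
Proof.
move=> h; rewrite /weight_star; have si := star_int h; move: h si.
set r := normc z => /[dup] h /andP[r0 r1] si.
rewrite /hat -RintegralZl//; last exact/hat_int/ltW.
apply: le_Rintegral => //.
 exact/hat_intZ/ltW.
move=> s /=; rewrite in_itv/= => /andP[s0 s1].
have s2 : 0 < s by exact: lt_le_trans s0.
rewrite -mulrA mulrC ler_wpM2r ?phi_ge0 ?s1 ?(ltW s2)//.
have q1 : 1 <= s / r by rewrite ler_pdivlMr// mul1r.
apply: (@le_trans _ _ (ln (s / r))); first by rewrite ler_piMr ?ln_ge0// ltW.
rewrite (le_trans (ln_ub (lt_le_trans ltr01 q1)))// lerD2r ler_piMl ?invr_ge0 ?ltW//.
Qed.

(** On this annulus 1 - |z| exceeds 2^-(n+1) and (1 + |z|) / 2 stays below 1 - 2^-(n+2); two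
    doublings return to [Hn n]. *)
Lemma star_cell : exists2 c : R, 0 < c & forall n (z : C), 0 < normc z -> 1 - dy n <= normc z < 1 - dy n.+1 ->
 c * (dy n * Hn n) <= weight_star w z.
Proof.
have [K K1 HK] := Hn_doubling; have K0 : 0 < K by exact: lt_le_trans K1.
exists (4^-1 / K ^+ 2) => [|n z z0 /andP[z1 z2]]; first by rewrite divr_gt0 ?exprn_gt0// invr_gt0.
have d0 := @dy_gt0 R n.
have zz : normc z < 1 by move: z2; rewrite dyS; lra.
apply: le_trans (star_lb _); last by rewrite z0.
have h1 : Hn n.+2 <= hat ((1 + normc z) / 2).
 by apply: hat_noninc => //; apply/andP; split; move: z2; rewrite !dyS; lra.
have h2 : Hn n / K ^+ 2 <= hat ((1 + normc z) / 2).
 apply: le_trans h1; rewrite ler_pdivrMr ?exprn_gt0// mulrC.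
 by have := HK n 2%N; rewrite addn2.
have h3 : dy n / 4 <= (1 - normc z) / 2 by move: z2; rewrite dyS; lra.
rewrite (_ : _ * _ = dy n / 4 * (Hn n / K ^+ 2)); last by field; rewrite gt_eqF.
by apply: ler_pM => //; rewrite ?divr_ge0 ?exprn_ge0 ?(ltW K0) ?(ltW d0) ?(ltW (Hn_gt0 _)).
Qed.

(** The condition n > 0 keeps |z| >= 1/2, away from the logarithmic singularity of the associated
    weight at 0. *)
Lemma star_cell_ub n (z : C) : (0 < n)%N -> 1 - dy n <= normc z < 1 ->
 weight_star w z <= 2 * (dy n * Hn n).
Proof.
move=> n0 /andP[z1 z2]; have d0 := @dy_gt0 R n.
have d1 : dy n <= (2^-1 : R) by have := @dy_le R 1 n n0; rewrite /dy expr1.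
have z0 : 2^-1 <= normc z by lra.
have zp : 0 < normc z by lra.
apply: (le_trans (star_ub _)); first by rewrite zp.
rewrite mulrA; apply: ler_pM.
- by rewrite subr_ge0 invf_ge1// ltW.
- by apply: hat_ge0 => //; exact: ltW.
- have i2 : (normc z)^-1 <= 2 by rewrite -[2]invrK lef_pV2 ?posrE.
 have -> : (normc z)^-1 - 1 = (normc z)^-1 * (1 - normc z).
  by rewrite mulrBr mulr1 mulVf// gt_eqF.
 by apply: ler_pM; [rewrite invr_ge0 ltW|rewrite subr_ge0 ltW| |lra].
- by apply: hat_noninc => //; rewrite z1 andbT; have /andP[] := dy_range n.
Qed.

Lemma normc_dyadic_point n k : normc (@dyadic_point R n k) = if n == 0%N then 2^-1 else 1 - dy n.
Proof.
rewrite /dyadic_point; case: ifPn => n0; first by rewrite nc_real ger0_norm.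
have -> : dyadic_length R n / (2 * pi) = dy n.
 have p0 := pi_gt0 R; rewrite /dyadic_length dyV; move: (pi : R) p0 => T T0.
 by rewrite mulrAC divff ?mul1r// mulf_neq0// gt_eqF.
rewrite normcM nc_expi mulr1 nc_real ger0_norm//.
by have /andP[] := dy_range n.
Qed.

(** Level 0 is treated apart: its point is 1/2 instead of the centre of the disc. *)
Lemma star_dyadic : exists c C : R, [/\ 0 < c, 0 < C & forall n k,
 c * (dy n * Hn n) <= weight_star w (dyadic_point n k) <= C * (dy n * Hn n)].
Proof.
have [c c0 Hc] := star_cell; have [K K1 HK] := Hn_doubling.
have K0 : 0 < K by exact: lt_le_trans K1.
exists (Num.min c (4^-1 / K ^+ 2)), 2; split => //.
 by rewrite lt_min c0 divr_gt0 ?exprn_gt0// invr_gt0.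
move=> n k; have zE := normc_dyadic_point n k.
have p0 : 0 <= dy n * Hn n by rewrite mulr_ge0 ?dy_ge0// ltW// Hn_gt0.
have [n0|n0] := eqVneq n 0%N.
 rewrite {}n0 eqxx in zE p0 *.
 have zr : 0 < normc (@dyadic_point R 0 k) < 1 by rewrite zE; apply/andP; split; lra.
 apply/andP; split.
  apply: (@le_trans _ _ (4^-1 / K ^+ 2 * (dy 0 * Hn 0))).
   by rewrite ler_wpM2r// ge_min lexx orbT.
  apply: le_trans (star_lb zr); rewrite zE.
  have h1 : Hn 0 / K ^+ 2 <= hat ((1 + 2^-1) / 2).
   rewrite ler_pdivrMr ?exprn_gt0// mulrC (le_trans (HK 0%N 2%N))//.
   by rewrite ler_wpM2l ?exprn_ge0 ?(ltW K0)// /Hn /dy add0n exprS expr1; apply: hat_noninc => //; apply/andP; split; lra.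
  have -> : dy 0 = 1 :> R by rewrite /dy expr0.
  rewrite (_ : _ * _ = 4^-1 * (Hn 0 / K ^+ 2)); last by field; rewrite gt_eqF.
  rewrite (_ : (1 - 2^-1) / 2 = 4^-1 :> R); last by field.
  by rewrite ler_wpM2l.
 apply: (le_trans (star_ub zr)); rewrite zE invrK (_ : 2 - 1 = 1); last by lra.
 have -> : dy 0 = 1 :> R by rewrite /dy expr0.
 rewrite !mul1r; have h1 : hat 2^-1 <= Hn 0.
  by apply: hat_noninc => //; rewrite /dy expr0 subrr; apply/andP; split; lra.
 by have := Hn_gt0 0; lra.
rewrite (negbTE n0) in zE; have d0 := @dy_gt0 R n.
have d1 : dy n <= (2^-1 : R) by have := @dy_le R 1 n; rewrite lt0n n0 /dy expr1; exact.
apply/andP; split.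
 apply: le_trans (Hc n _ _ _); rewrite ?zE; last 2 first.
 - by lra.
 - by rewrite lexx dyS/=; lra.
 by rewrite ler_wpM2r// ge_min lexx.
by apply: star_cell_ub; rewrite ?lt0n// zE lexx; lra.
Qed.

End WeightIntegrals.

(** * Moments of the weight *)

Section Moments.
Variables (R : realType) (w : R[i] -> R).
Hypothesis hw : class_Dhat w.
Local Notation C := R[i].
Local Notation D := (@unit_disc R).
Local Notation lam := (@lebesgue_measure R).
Local Notation hat := (hat w).
Local Notation Hn := (Hn w).

Let phi_ge0 s : 0 <= s < 1 -> 0 <= w s%:C.
Proof. by move=> h; apply: Dhat_ge0; rewrite //; exact: unit_disc_real. Qed.

Lemma mcf_X m : @mcf R (fun z => z ^+ m).
Proof.
elim: m => [|m IH]; first by under eq_fun do rewrite expr0; exact: mcf_cst.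
under eq_fun do rewrite exprS; apply: mcfM => //.
split; apply: measurable_funTS; [exact: measurable_Re|exact: measurable_Im].
Qed.

Lemma L2_bounded f B : @mcf R f -> (forall z, D z -> normc (f z) <= B) -> L2 area w f.
Proof.
move=> mf fB; split => //.
have [[_ wi] _ _ _] := hw.
have : area.-integrable D (fun z => (B ^+ 2)%:E * (w z)%:E)%E.
 by apply: integrableZl => //; exact: measurable_unit_disc.
move=> /integrableP[m1]; apply: le_lt_trans; apply: ge0_le_integral => //.
- exact: measurable_unit_disc.
- by move=> z Dz; rewrite lee_fin mulr_ge0 ?exprn_ge0 ?nc_ge0 ?(Dhat_ge0 hw Dz).
- apply/measurable_EFinP; apply: measurable_funM; last exact: Dhat_meas.
 by apply: measurable_funX; exact: mcf_normc.
- exact: measurableT_comp.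
- move=> z Dz; rewrite -EFinM lee_fin (le_trans _ (ler_norm _))//.
 by rewrite ler_wpM2r ?(Dhat_ge0 hw Dz)// lerXn2r ?nnegrE ?nc_ge0 ?fB// (le_trans (nc_ge0 _) (fB z Dz)).
Qed.

Lemma L2_X m : L2 area w (fun z => z ^+ m).
Proof.
apply: (L2_bounded (B := 1)); first exact: mcf_X.
by move=> z; rewrite /unit_disc /mkset ncX => /ltW h; rewrite exprn_ile1// nc_ge0.
Qed.

Definition Wm m : R := Qn area w (fun z => z ^+ m).

Definition Jm N x : R := \int[lam]_(s in `[x, 1[) (s ^+ N * w s%:C).

Lemma Jm_int N x : 0 <= x -> lam.-integrable `[x, 1[ (EFin \o (fun s : R => s ^+ N * w s%:C)).
Proof.
move=> x0; apply: (wint hw (g := fun s => s ^+ N) (B := 1)) => //.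
move=> s /andP[s0 s1]; have sp := le_trans x0 s0.
by rewrite ger0_norm ?exprn_ge0// exprn_ile1// ltW.
Qed.

Lemma WmJ m : Wm m = 2 * kap R * Jm (2 * m).+1 0.
Proof.
rewrite /Wm /Qn /Jm -RintegralZl//; last exact: Jm_int.
rewrite /Rintegral; congr fine.
rewrite (eq_integral (fun z => ((normc z) ^+ (2 * m) * w z)%:E)); last first.
 by move=> z _; rewrite ncX -exprM mulnC.
rewrite (radial_weight hw (g := fun r => r ^+ (2 * m))) => [| |r /andP[r0 _]]; first last.
- by rewrite exprn_ge0.
- by apply: measurable_funX.
by apply: eq_integral => r _; congr EFin; rewrite exprS; ring.
Qed.

Lemma Jm_lb N x : 0 <= x < 1 -> x ^+ N * hat x <= Jm N 0.
Proof.
move=> /andP[x0 x1]; apply: (@le_trans _ _ (Jm N x)).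
 rewrite /hat -RintegralZl//; last exact: hat_int.
 apply: le_Rintegral => //; last 2 first.
 - exact: Jm_int.
 - move=> s /=; rewrite in_itv/= => /andP[s0 s1]; have sp := le_trans x0 s0.
  by rewrite ler_wpM2r ?phi_ge0 ?sp// lerXn2r.
 apply: (wint hw (g := fun=> x ^+ N) (B := `|x ^+ N|)) => //.
apply: wint_sub; first by rewrite x0.
 exact: Jm_int.
by move=> s /[dup] h /andP[s0 _]; rewrite mulr_ge0 ?exprn_ge0 ?phi_ge0.
Qed.

Lemma Jm_ub N x : 0 <= x < 1 -> Jm N x <= hat x.
Proof.
move=> /andP[x0 x1]; apply: le_Rintegral => //; [exact: Jm_int|exact: hat_int|].
move=> s /=; rewrite in_itv/= => /andP[s0 s1]; have sp := le_trans x0 s0.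
by rewrite ler_piMl ?phi_ge0 ?sp// exprn_ile1// ltW.
Qed.

Lemma Jm_split N x y : 0 <= x -> x <= y < 1 -> Jm N x <= y ^+ N * hat x + Jm N y.
Proof.
move=> x0 h; have /andP[xy y1] := h.
rewrite /Jm (wint_split h (Jm_int N x0)) lerD2r.
have yi : lam.-integrable `[x, 1[ (EFin \o (fun s : R => y ^+ N * w s%:C)).
 by apply: (wint hw (g := fun=> y ^+ N) (B := `|y ^+ N|)).
have ss : ([set` `[x, y[] : set R) `<=` [set` `[x, 1[].
 by move=> s /=; rewrite !in_itv/= => /andP[-> /lt_trans]; exact.
have y0 : 0 <= y by exact: le_trans xy.
rewrite /hat -RintegralZl//; last exact: hat_int.
rewrite (wint_split h yi) ler_wpDr//.
 apply: Rintegral_ge0 => s /=; rewrite in_itv/= => /andP[s0 s1].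
 by rewrite mulr_ge0 ?exprn_ge0 ?phi_ge0// (le_trans y0).
apply: le_Rintegral => //.
- by apply: integrableS (Jm_int N x0).
- by apply: integrableS yi.
- move=> s /=; rewrite in_itv/= => /andP[s0 s1].
 have sp := le_trans x0 s0.
 by rewrite ler_wpM2r ?lerXn2r ?nnegrE ?(ltW s1)// phi_ge0// sp (lt_trans s1).
Qed.

Let kap0 : 0 < kap R. Proof. by have [] := kap_area R. Qed.

Lemma Wm_lb_hat m x : 0 <= x < 1 -> 2 * kap R * (x ^+ (2 * m).+1 * hat x) <= Wm m.
Proof. by move=> h; rewrite WmJ ler_wpM2l ?Jm_lb// mulr_ge0// ltW. Qed.

(** At the radius 1 - 2^-(n+3) the power s^(2m+1) is at least 1/2 by Bernoulli's inequality, since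
    (2m+1) 2^-(n+3) <= 1/2; three doublings account for [K ^+ 3]. *)
Lemma Wm_lb : exists2 c : R, 0 < c & forall n m, (m < 2 ^ n.+1)%N -> c * Hn n <= Wm m.
Proof.
have [K K1 HK] := Hn_doubling hw; have K0 : 0 < K by exact: lt_le_trans K1.
exists (kap R / K ^+ 3) => [|n m mn]; first by rewrite divr_gt0// exprn_gt0.
have h3 := dy_range R (n + 3).
apply: le_trans (Wm_lb_hat m h3).
have hb : 2^-1 <= (1 - dy (n + 3)) ^+ (2 * m).+1 :> R.
 apply: le_trans (bernoulli _ _); last by rewrite dy_le1 dy_ge0.
 have e1 : dy (n + 3) * (2 ^ (n + 3))%:R = 1 :> R by exact: dy_nat.
 have e2 : (2 * m).+1%:R * 2 <= (2 ^ (n + 3))%:R :> R.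
  rewrite -natrM ler_nat expnD (_ : 2 ^ 3 = 8)%N//.
  by move: mn; rewrite expnS; lia.
 have := ler_wpM2l (@dy_ge0 R (n + 3)) e2; rewrite e1; lra.
have e3 : Hn n / K ^+ 3 <= Hn (n + 3) by rewrite ler_pdivrMr ?exprn_gt0// mulrC.
rewrite -mulrA [2 * _]mulrC -mulrA ler_wpM2l ?(ltW kap0)//.
apply: (@le_trans _ _ (2 * (2^-1 * (Hn n / K ^+ 3)))).
 by rewrite mulrA mulfV// mul1r mulrC.
rewrite ler_wpM2l// ler_pM ?divr_ge0 ?exprn_ge0 ?(ltW K0)//.
exact/ltW/Hn_gt0.
Qed.

Lemma Wm_gt0 m : 0 < Wm m.
Proof.
have [c c0 /(_ m m)] := Wm_lb; have h : (m < 2 ^ m.+1)%N by rewrite (ltn_trans (ltn_expl m (ltnSn 1)))// ltn_exp2l.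
by move=> /(_ h); apply: lt_le_trans; rewrite mulr_gt0// Hn_gt0.
Qed.

(** The range of radii is cut at 1 - 2^-(n-d). Going inwards, hat may grow like K^d, but the power
    s^(2m+1) decays faster than any power of 2^-d. *)
Lemma Wm_ub : exists2 C : R, 0 < C & forall n m, (2 ^ n <= m)%N -> Wm m <= C * Hn n.
Proof.
have [K K1 HK] := Hn_doubling hw; have K0 : 0 < K by exact: lt_le_trans K1.
(* This choice makes growth times decay geometric: [dy d.+1 ^+ q * K ^+ d.+1 <= dy d.+1]. *)
have [q q0 Kq] : exists2 q, (0 < q)%N & 2 * K <= 2 ^+ q.
 exists (Num.truncn K).+2 => //; rewrite exprS ler_wpM2l// (le_trans (ltW (truncnS_gt K)))//.
 by rewrite -natrX ler_nat ltnW// ltn_expl.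
exists (2 * kap R * (1 + q`!%:R)) => [|n m mn].
 by rewrite !mulr_gt0// ltr_wpDr.
rewrite WmJ -[leRHS]mulrA ler_wpM2l ?mulr_ge0 ?(ltW kap0)//.
(* [1 - dy d] is the sum of the first d of these geometric bounds, so the estimate stays uniform in
   d. *)
have key d : (d <= n)%N -> Jm (2 * m).+1 (1 - dy (n - d)) <= (1 + q`!%:R * (1 - dy d)) * Hn n.
 elim: d => [_|d IH dn].
  by rewrite subn0 /dy expr0 subrr mulr0 addr0 mul1r Jm_ub// dy_range.
 have r1 := dy_range R (n - d.+1); have r2 := dy_range R (n - d).
 have nd : (n - d = (n - d.+1).+1)%N by lia.
 have r3 : 1 - dy (n - d.+1) <= (1 - dy (n - d) : R) < 1.
  by case/andP: r2 => _ ->; rewrite andbT lerD2l lerN2 dy_le// leq_sub2l.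
 apply: le_trans (Jm_split _ _ r3) _; first by case/andP : r1.
 have hle : hat (1 - dy (n - d.+1)) <= K ^+ d.+1 * Hn n.
  by have := HK (n - d.+1)%N d.+1; rewrite subnK.
 have pd : (1 - dy (n - d)) ^+ (2 * m).+1 <= q`!%:R * (dy d.+1) ^+ q :> R.
  have := @power_decay R q (dy (n - d)) (2 * m).+1; rewrite dy_gt0 dy_le1 => /(_ isT isT q0).
  move=> /le_trans; apply; rewrite ler_wpM2l//.
  apply: lerXn2r; rewrite ?nnegrE ?invr_ge0 ?mulr_ge0 ?dy_ge0//.
  rewrite -[leRHS]invrK lef_pV2 ?posrE ?invr_gt0 ?dy_gt0 ?mulr_gt0 ?dy_gt0//.
  rewrite dyV invrK; apply: (@le_trans _ _ ((2 ^ n.+1)%:R * dy (n - d))).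
   have e1 := @dy_nat R (n - d); rewrite mulrC.
   rewrite (_ : (2 ^ n.+1 = 2 ^ (n - d) * 2 ^ d.+1)%N); last by rewrite -expnD addnS subnK// ltnW.
   by rewrite natrM mulrA e1 mul1r natrX.
  by rewrite ler_wpM2r ?dy_ge0// ler_nat expnS (leq_trans (leq_mul (leqnn 2) mn)).
 apply: (@le_trans _ _ (q`!%:R * dy d.+1 ^+ q * (K ^+ d.+1 * Hn n) + (1 + q`!%:R * (1 - dy d)) * Hn n)).
  apply: lerD; last by apply: IH; exact: ltnW.
  apply: ler_pM => //; first by rewrite exprn_ge0//; case/andP : r2.
  by apply: hat_ge0 => //; case/andP : r1.
 have kd : dy d.+1 ^+ q * K ^+ d.+1 <= dy d.+1.
  rewrite /dy -exprM mulnC exprM -exprMn lerXn2r ?nnegrE ?mulr_ge0 ?exprn_ge0 ?(ltW K0) ?invr_ge0//.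
  rewrite exprVn mulrC ler_pdivrMr ?exprn_gt0//; lra.
 have Hp := Hn_gt0 hw n; have f0 : 0 <= q`!%:R :> R by [].
 have := ler_wpM2l f0 (ler_wpM2r (ltW Hp) kd).
 move: (dy d.+1 ^+ q) (K ^+ d.+1) => a b; rewrite dyS.
 move: (dy d) (Hn n) (q`!%:R) => x h f; lra.
have := key n (leqnn n); rewrite subnn /dy expr0 subrr => /le_trans; apply.
by rewrite ler_wpM2r ?(ltW (Hn_gt0 hw n))// lerD2l ler_piMr// gerBl.
Qed.
End Moments.

(** * Coefficients and kernels of the Bergman space *)

Section PowerSeries.
Variable R : realType.
Local Notation C := R[i].
Local Notation D := (@unit_disc R).
Implicit Types (a b : nat -> C) (z s : C) (f : C -> C).

Lemma psumS a M z : psum a M.+1 z = psum a M z + a M * z ^+ M.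
Proof. by rewrite /psum big_ord_recr. Qed.

Lemma psumD a M d z : psum a (M + d) z = psum a M z + \sum_(i < d) a (M + i)%N * z ^+ (M + i).
Proof. by rewrite /psum big_split_ord. Qed.

Lemma hsum_uniq a z s s' : hsum a z s -> hsum a z s' -> s = s'.
Proof.
move=> h h'; apply/eqP; rewrite -subr_eq0; apply/eqP/(@small_eq0 _ 2) => e e0.
have [N HN] := h e e0; have [N' HN'] := h' e e0.
have h1 := HN _ (leq_maxl N N'); have h2 := HN' _ (leq_maxr N N').
rewrite (le_trans (nc_triangle (psum a (maxn N N') z) _ _))//.
by rewrite [normc (psum _ _ _ - _)]ncBC; lra.
Qed.

(** Radius of convergence at least 1, in Abel's form. *)
Definition rad a := forall r : R, 0 <= r < 1 -> exists2 B : R, 0 <= B & forall m, normc (a m) * r ^+ m <= B.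

Lemma hsum_rad a f : (forall z, D z -> hsum a z (f z)) -> rad a.
Proof.
move=> h r /andP[r0 r1].
have Dr : D r%:C by rewrite /unit_disc /mkset nc_real ger0_norm.
have [N HN] := h _ Dr 1 ltr01.
have S0 : 0 <= \sum_(k < N) normc (a k) * r ^+ k.
 by apply: sumr_ge0 => i _; rewrite mulr_ge0 ?exprn_ge0 ?nc_ge0.
exists (2 + \sum_(k < N) normc (a k) * r ^+ k); first exact: addr_ge0.
move=> m; have [Nm|mN] := leqP N m.
 have h1 := HN m Nm; have h2 := HN m.+1 (leqW Nm).
 have -> : normc (a m) * r ^+ m = normc (psum a m.+1 r%:C - psum a m r%:C).
  by rewrite psumS addrAC subrr add0r normcM ncX nc_real ger0_norm.
 apply: le_trans (nc_triangle (f r%:C) _ _) _.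
 by rewrite ncBC; lra.
rewrite (bigD1 (Ordinal mN))//= addrCA lerDl addr_ge0// sumr_ge0// => i _.
by rewrite mulr_ge0 ?exprn_ge0 ?nc_ge0.
Qed.

Lemma geo_sum_le (q : R) M : 0 <= q < 1 -> \sum_(i < M) q ^+ i <= (1 - q)^-1.
Proof.
move=> /andP[q0 q1]; rewrite -[leRHS]mul1r ler_pdivlMr ?subr_gt0//.
have E : (\sum_(i < M) q ^+ i) * (1 - q) = 1 - q ^+ M.
 elim: M => [|M IH]; first by rewrite big_ord0 mul0r expr0 subrr.
 by rewrite big_ord_recr/= mulrDl IH exprS; ring.
by rewrite E gerBl exprn_ge0.
Qed.

Lemma psum_tail a z (K q : R) : 0 <= q < 1 -> (forall m, normc (a m * z ^+ m) <= K * q ^+ m) ->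
 forall M d, normc (psum a (M + d) z - psum a M z) <= K / (1 - q) * q ^+ M.
Proof.
move=> q01 h M d; have /andP[q0 q1] := q01.
have K0 : 0 <= K by have := h 0%N; rewrite !expr0 !mulr1; apply: le_trans; exact: nc_ge0.
rewrite psumD addrAC subrr add0r (le_trans (nc_sum _ _ _))//.
apply: (@le_trans _ _ (\sum_(i < d) K * q ^+ M * q ^+ i)).
 by apply: ler_sum => i _; rewrite (le_trans (h _))// exprD mulrA.
rewrite -mulr_sumr mulrAC; apply: ler_pM => //; rewrite ?mulr_ge0 ?exprn_ge0//.
 by apply: sumr_ge0 => i _; rewrite exprn_ge0.
by rewrite ler_wpM2l ?geo_sum_le.
Qed.

Lemma hsum_tail a z s (K q : R) : 0 <= q < 1 -> (forall m, normc (a m * z ^+ m) <= K * q ^+ m) ->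
 hsum a z s -> forall M, normc (s - psum a M z) <= K / (1 - q) * q ^+ M.
Proof.
move=> q01 h hs M; apply/ler_addgt0Pr => e e0; have [N HN] := hs e e0.
have h1 := HN _ (leq_addl M N); have h2 := psum_tail q01 h M N.
by rewrite (le_trans (nc_triangle (psum a (M + N) z) _ _))// addrC lerD.
Qed.

Let geo_real (u : nat -> R) (K q : R) : 0 <= q < 1 -> (forall m, `|u m| <= K * q ^+ m) ->
 exists s : R, forall e, 0 < e -> exists N, forall M, (N <= M)%N -> `|s - \sum_(m < M) u m| <= e.
Proof.
move=> /andP[q0 q1] h.
have cv : cvgn (series u).
 apply: normed_cvg; apply: (series_le_cvg (v_ := geometric K q)) => //=.
 - by move=> n; apply: le_trans (h n); exact: normr_ge0.
 - by apply: is_cvg_geometric_series; rewrite ger0_norm.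
exists (limn (series u)) => e e0.
have /cvgrPdist_le/(_ _ e0)[N _ HN] := cv.
exists N => M NM; have := HN M NM; rewrite /series/= big_mkord//.
Qed.

Lemma hsum_ex a z (K q : R) : 0 <= q < 1 -> (forall m, normc (a m * z ^+ m) <= K * q ^+ m) ->
 exists s, hsum a z s.
Proof.
move=> q01 h.
have [s1 H1] := geo_real q01 (fun m => le_trans (nc_Re _) (h m)).
have [s2 H2] := geo_real q01 (fun m => le_trans (nc_Im _) (h m)).
exists (s1 +i* s2) => e e0; have e2 : 0 < e / 2 by rewrite divr_gt0.
have [N1 A1] := H1 _ e2; have [N2 A2] := H2 _ e2.
exists (maxn N1 N2) => M; rewrite geq_max => /andP[/A1 B1 /A2 B2].
rewrite (le_trans (nc_ReIm _))// (splitr e) lerD//.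
 by rewrite ReD ReN /psum Re_sum.
by rewrite ImD ImN /psum Im_sum.
Qed.

Lemma rad_geo a (r : R) : rad a -> 0 <= r < 1 -> exists K q : R, [/\ 0 <= K, 0 <= q < 1 &
 forall z m, normc z <= r -> normc (a m * z ^+ m) <= K * q ^+ m].
Proof.
move=> ra /andP[r0 r1]; pose p := (1 + r) / 2.
have p01 : 0 <= p < 1 by apply/andP; rewrite /p; split; lra.
have pp : 0 < p by rewrite /p; lra.
have [B B0 HB] := ra p p01; exists B, (r / p); split => //.
 by rewrite divr_ge0 ?(ltW pp)//= ltr_pdivrMr// mul1r /p; lra.
move=> z m zr; rewrite normcM ncX.
apply: (@le_trans _ _ (normc (a m) * r ^+ m)); first by rewrite ler_wpM2l ?nc_ge0// lerXn2r// nnegrE nc_ge0.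
have -> : normc (a m) * r ^+ m = normc (a m) * p ^+ m * (r / p) ^+ m.
 by rewrite -mulrA -exprMn mulrCA mulfV ?mulr1// gt_eqF.
by rewrite ler_wpM2r ?HB// exprn_ge0// divr_ge0// ltW.
Qed.

Let rad_geo_z a z : rad a -> D z -> exists K q : R, [/\ 0 <= K, 0 <= q < 1 &
 forall z' m, normc z' <= normc z -> normc (a m * z' ^+ m) <= K * q ^+ m].
Proof. by move=> ra Dz; apply: rad_geo => //; rewrite nc_ge0. Qed.

Lemma rad_hsum a z : rad a -> D z -> exists s, hsum a z s.
Proof.
move=> ra Dz; have [K [q [K0 q01 h]]] := rad_geo_z ra Dz.
by apply: (hsum_ex q01) => m; exact: h.
Qed.

Lemma rad_unif a f z : (forall z, D z -> hsum a z (f z)) -> D z ->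
 forall e, 0 < e -> exists N, forall M, (N <= M)%N ->
 forall z', normc z' <= normc z -> normc (f z' - psum a M z') <= e.
Proof.
move=> h Dz e e0; have [K [q [K0 q01 hq]]] := rad_geo_z (hsum_rad h) Dz.
have [N HN] := geo_small (K / (1 - q)) q01 e0.
exists N => M NM z' zz; have Dz' : D z' by exact: le_lt_trans Dz.
apply: le_trans (HN M NM); apply: (hsum_tail q01 _ (h _ Dz')) => m.
exact: hq.
Qed.

Lemma mcf_psum a M : @mcf R (psum a M).
Proof.
elim: M => [|M IH].
 by rewrite (_ : psum a 0 = fun=> 0); [exact: mcf_cst|apply/funext => z; rewrite /psum big_ord0].
rewrite (_ : psum a M.+1 = fun z => a M * z ^+ M + psum a M z); last first.
 by apply/funext => z; rewrite psumS addrC.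
by apply: mcfZD => //; exact: mcf_X.
Qed.

Lemma mcf_hsum a f : (forall z, D z -> hsum a z (f z)) -> @mcf R f.
Proof.
move=> h; split.
- apply: (@measurable_fun_cvg _ _ _ _ (fun M z => cRe (psum a M z))).
  by move=> M; have [] := mcf_psum a M.
 move=> z Dz; apply/cvgrPdist_le => e e0; have [N HN] := h z Dz e e0.
 exists N => // M /= NM; rewrite -ReN -ReD; exact: le_trans (nc_Re _) (HN M NM).
- apply: (@measurable_fun_cvg _ _ _ _ (fun M z => cIm (psum a M z))).
  by move=> M; have [] := mcf_psum a M.
 move=> z Dz; apply/cvgrPdist_le => e e0; have [N HN] := h z Dz e e0.
 exists N => // M /= NM; rewrite -ImN -ImD; exact: le_trans (nc_Im _) (HN M NM).
Qed.

Let dnum (z : C) m : C := m%:R * z ^+ m.-1.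

(** Expanded in powers of h, the left side starts at h^2 and is majorized by the same expression in
    r and d, all of whose coefficients are nonnegative. Replacing d by t d gains t^2. *)
Let taylor1 (z h : C) (r d t : R) m : normc z = r -> 0 < d -> 0 <= t <= 1 -> normc h = t * d ->
 normc ((z + h) ^+ m - z ^+ m - dnum z m * h) <=
  t ^+ 2 * ((r + d) ^+ m - r ^+ m - m%:R * d * r ^+ m.-1).
Proof.
move=> zr d0 /andP[t0 t1] hd; have r0 : 0 <= r by rewrite -zr nc_ge0.
rewrite /dnum; elim: m => [|m IH].
 by rewrite !(expr0, subrr, mul0r, subr0, normc0, mulr0).
have -> : (z + h) ^+ m.+1 - z ^+ m.+1 - m.+1%:R * z ^+ m.+1.-1 * h =
  (z + h) * ((z + h) ^+ m - z ^+ m - m%:R * z ^+ m.-1 * h) + m%:R * z ^+ m.-1 * h ^+ 2.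
 case: m {IH} => [|m]; first by rewrite /= !expr0 !expr1; ring.
 by rewrite /= !exprS -[m.+2%:R]natr1; ring.
apply: (le_trans (ncD _ _)); rewrite !normcM !ncX zr hd.
have -> : normc (m%:R : C) = m%:R :> R by rewrite -(rmorph_nat (real_complex R)) nc_real ger0_norm.
have h1 : normc (z + h) <= r + d.
 by rewrite (le_trans (ncD _ _))// zr hd lerD2l ler_piMl// ltW.
apply: (@le_trans _ _ ((r + d) * (t ^+ 2 * ((r + d) ^+ m - r ^+ m - m%:R * d * r ^+ m.-1)) +
  m%:R * r ^+ m.-1 * (t * d) ^+ 2)).
 by rewrite lerD2r; apply: ler_pM => //; exact: nc_ge0.
apply: le_of_eq.
case: m {IH} => [|m]; first by rewrite /= !expr0 !expr1; ring.
by rewrite /= !exprS -[m.+2%:R]natr1; ring.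
Qed.

(** Termwise differentiation: [taylor1] with t = |y - z| / d makes the error at most t^2 times a
    convergent series, hence quadratic in y - z. *)
Lemma rad_analytic a f : (forall z, D z -> hsum a z (f z)) -> analytic_on_disc f.
Proof.
move=> h z Dz; have ra := hsum_rad h; set r := normc z.
have r0 : 0 <= r by exact: nc_ge0.
have r1 : r < 1 by [].
pose d := (1 - r) / 2; have d0 : 0 < d by rewrite /d; lra.
have rd01 : 0 <= r + d < 1 by rewrite /d; apply/andP; split; lra.
have [K [q [K0 q01 hq]]] := rad_geo ra rd01; have /andP[q0 q1] := q01.
have hq' m : normc (a m) * (r + d) ^+ m <= K * q ^+ m.
 have := hq (r + d)%:C m; rewrite normcM ncX nc_real ger0_norm; last by case/andP : rd01.
 by apply.
(* For t = 1 and real points the right side of [taylor1] is nonnegative, which bounds the derived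
   series by the original one at the radius r + d. *)
have pow m : m%:R * d * r ^+ m.-1 <= (r + d) ^+ m.
 have := @taylor1 z 0 r d 0 m erefl d0; rewrite lexx ler01 => /(_ isT).
 rewrite normc0 mul0r => /(_ erefl) _.
 have := @taylor1 r%:C d%:C r d 1 m; rewrite !nc_real !ger0_norm ?(ltW d0)// mul1r lexx ler01.
 move=> /(_ erefl d0 isT erefl)/(le_trans (nc_ge0 _)).
 by rewrite expr1n mul1r => H; have := exprn_ge0 m r0; lra.
have [g hg] : exists g, hsum (fun m => a m * dnum z m) 1 g.
 apply: (@hsum_ex _ _ (K / d) q) => // m; rewrite expr1n mulr1 /dnum !normcM ncX -/r.
 have -> : normc (m%:R : C) = m%:R :> R by rewrite -(rmorph_nat (real_complex R)) nc_real ger0_norm.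
 rewrite mulrAC ler_pdivlMr// (le_trans _ (hq' m))// -!mulrA ler_wpM2l ?nc_ge0//.
 by rewrite [_ * d]mulrC mulrA pow.
apply/cdP; exists g => e e0.
pose L := K / (1 - q) / d ^+ 2.
have L0 : 0 <= L by rewrite !divr_ge0 ?exprn_ge0 ?subr_ge0 ?(ltW q1) ?(ltW d0).
exists (Num.min d (e / (L + 1))).
 by rewrite lt_min d0 divr_gt0// ltr_wpDl.
move=> y; rewrite lt_min => /andP[yd ye]; set k := y - z.
have yE : y = z + k by rewrite /k addrC subrK.
pose t := normc k / d; have t0 : 0 <= t by rewrite divr_ge0 ?nc_ge0 ?ltW.
have t1 : t <= 1 by rewrite ler_pdivrMr// mul1r ltW.
have kt : normc k = t * d by rewrite /t divfK// gt_eqF.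
have Dy : D y.
 rewrite /unit_disc /mkset yE (le_lt_trans (ncD _ _))// -/r.
 by case/andP : rd01 => _; apply: le_lt_trans; rewrite lerD2l ltW.
have key : normc (f y - f z - g * k) <= t ^+ 2 * (K / (1 - q)).
 apply/ler_addgt0Pr => u u0; have u4 : 0 < u / 3 by rewrite divr_gt0.
 have u5 : 0 < u / 3 / (normc k + 1) by rewrite divr_gt0// ltr_wpDl ?nc_ge0.
 have [N1 H1] := h y Dy _ u4; have [N2 H2] := h z Dz _ u4; have [N3 H3] := hg _ u5.
 pose M := maxn N1 (maxn N2 N3).
 have {}H1 := H1 M (leq_maxl _ _).
 have {}H2 := H2 M (leq_trans (leq_maxl _ _) (leq_maxr _ _)).
 have {}H3 := H3 M (leq_trans (leq_maxr _ _) (leq_maxr _ _)).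
 rewrite (_ : f y - f z - g * k = (psum a M y - psum a M z - psum (fun m => a m * dnum z m) M 1 * k)
  + ((f y - psum a M y) - (f z - psum a M z) - (g - psum (fun m => a m * dnum z m) M 1) * k)); last by ring.
 apply: (le_trans (ncD _ _)); apply: lerD.
  rewrite /psum mulr_suml -sumrB -sumrB; apply: (le_trans (nc_sum _ _ _)).
  apply: (@le_trans _ _ (\sum_(m < M) t ^+ 2 * (K * q ^+ m))).
   apply: ler_sum => m _; rewrite expr1n mulr1 -mulrA -!mulrBr normcM yE.
   have := @taylor1 z k r d t m erefl d0; rewrite t0 t1 => /(_ isT kt).
   move=> /(ler_wpM2l (nc_ge0 (a m)))/le_trans; apply.
   rewrite mulrCA ler_wpM2l ?exprn_ge0//; apply: le_trans (hq' m).
   rewrite ler_wpM2l ?nc_ge0// -addrA gerDl -opprD oppr_le0 addr_ge0 ?exprn_ge0//.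
   by rewrite mulr_ge0 ?exprn_ge0// mulr_ge0// ltW.
  rewrite -mulr_sumr -mulr_sumr ler_wpM2l ?exprn_ge0// ler_wpM2l//; exact: geo_sum_le.
 rewrite (le_trans (ncB _ _))// (_ : u = u / 3 + u / 3 + u / 3); last by field.
 rewrite lerD//; first by rewrite (le_trans (ncB _ _))// lerD.
 rewrite normcM; apply: (@le_trans _ _ (u / 3 / (normc k + 1) * (normc k + 1))).
  by apply: ler_pM; rewrite ?nc_ge0// lerDl.
 by rewrite divfK// gt_eqF// ltr_wpDl ?nc_ge0.
apply: (le_trans key); rewrite /t exprMn exprVn.
rewrite (_ : _ * _ = normc k * (normc k * L)); last by rewrite /L; field; rewrite ?gt_eqF// subr_gt0.
rewrite mulrC ler_wpM2r ?nc_ge0//.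
have : normc k * (L + 1) <= e by rewrite -ler_pdivlMr ?ltW// ltr_wpDl.
by apply: le_trans; rewrite ler_wpM2l ?nc_ge0// lerDl.
Qed.

End PowerSeries.

(** * Parseval's identity in the weighted space *)

Section WeightedParseval.
Variables (R : realType) (w : R[i] -> R).
Hypothesis hw : class_Dhat w.
Local Notation C := R[i].
Local Notation D := (@unit_disc R).
Local Notation Wm := (Wm w).
Local Notation Qn := (Qn area w).
Implicit Types (a b : nat -> C) (z s : C) (f : C -> C).

Let mD : measurable D := @measurable_unit_disc R.
Let mw := Dhat_meas hw.
Let w0 := Dhat_ge0 hw.

Definition En f : \bar R := (\int[area]_(z in D) (normc (f z) ^+ 2 * w z)%:E)%E.

Let mE f : @mcf R f -> measurable_fun D (fun z => (normc (f z) ^+ 2 * w z)%:E).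
Proof.
move=> mf; apply/measurable_EFinP; apply: measurable_funM => //.
by apply: measurable_funX; exact: mcf_normc.
Qed.

Let pos f z : D z -> 0 <= normc (f z) ^+ 2 * w z.
Proof. by move=> Dz; rewrite mulr_ge0 ?exprn_ge0 ?nc_ge0 ?w0. Qed.

Lemma QnEn f : L2 area w f -> (Qn f)%:E = En f.
Proof. by move=> lf; rewrite QnE. Qed.

Lemma disc_rot t z : D (expi t * z) <-> D z.
Proof. by rewrite /unit_disc /mkset normcM nc_expi mul1r. Qed.

Lemma weight_rot t z : D z -> w (expi t * z) = w z.
Proof.
move=> Dz; have [_ hr _ _] := hw.
by rewrite hr ?disc_rot// [RHS]hr// normcM nc_expi mul1r.
Qed.

Lemma zeta_expi N k : exists t : R, zeta R N ^+ k = expi t.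
Proof. by eexists; rewrite zetaX. Qed.

Lemma mcf_rot t f : @mcf R f -> @mcf R (fun z => f (expi t * z)).
Proof.
move=> [f1 f2]; have h : forall u : C -> R, measurable_fun D u -> measurable_fun D (fun z => u (expi t * z)).
 move=> u mu; apply: (measurable_comp (F := D)) => //.
 - by move=> _ [z Dz <-]; apply/disc_rot.
 - by apply: measurable_funTS; exact: rotation_measurable.
by split; [exact: (h (fun z => cRe (f z)))|exact: (h (fun z => cIm (f z)))].
Qed.

(** Area and weight are invariant under rotations. For a polynomial with at most N terms, the
    average over the N-th roots of unity removes the cross terms of |f|^2 pointwise, before
    integration. *)
Lemma avg_rot N f : @mcf R f ->
 (N%:R%:E * En f)%E =
 (\int[area]_(z in D) ((\sum_(k < N) normc (f (zeta R N ^+ k * z)) ^+ 2) * w z)%:E)%E.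
Proof.
move=> mf.
transitivity (\sum_(k < N) \int[area]_(z in D) (normc (f (zeta R N ^+ k * z)) ^+ 2 * w z)%:E)%E; last first.
 rewrite -ge0_integral_sum//.
 - by apply: eq_integral => z _; rewrite sumEFin mulr_suml.
 - move=> k; have [t ->] := zeta_expi N k; apply: (mE (f := fun z => f (expi t * z))).
  exact: mcf_rot.
 - by move=> k z Dz; rewrite lee_fin mulr_ge0 ?exprn_ge0 ?nc_ge0 ?w0.
rewrite (eq_bigr (fun=> En f)) => [|k _].
 by rewrite sumr_const card_ord mule_natl.
have [t ->] := zeta_expi N k.
transitivity (\int[area]_(z in D) (fun z => (normc (f z) ^+ 2 * w z)%:E) (expi t * z)%R)%E.
 by apply: eq_integral => z; rewrite inE => Dz; rewrite weight_rot.
apply: rotation_integral => //.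
- by move=> z Dz; apply/disc_rot.
- by move=> z /disc_rot.
- exact: mE.
- by move=> z Dz; rewrite lee_fin mulr_ge0 ?exprn_ge0 ?nc_ge0 ?w0.
Qed.

Lemma L2_psum a M : L2 area w (psum a M).
Proof. by apply: L2_sum => // i; apply: L2Z => //; exact: L2_X. Qed.

Lemma int_coefs a M :
 (\int[area]_(z in D) ((\sum_(m < M) normc (a m * z ^+ m) ^+ 2) * w z)%:E)%E =
 (\sum_(m < M) normc (a m) ^+ 2 * Wm m)%:E.
Proof.
rewrite -sumEFin.
transitivity (\sum_(m < M) \int[area]_(z in D) (normc (a m * z ^+ m) ^+ 2 * w z)%:E)%E.
 rewrite -ge0_integral_sum//.
 - by apply: eq_integral => z _; rewrite sumEFin mulr_suml.
 - move=> k; apply: (mE (f := fun z => a k * z ^+ k)).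
  by apply: mcfM; [exact: mcf_cst|exact: mcf_X].
 - by move=> k z Dz; rewrite lee_fin mulr_ge0 ?exprn_ge0 ?nc_ge0 ?w0.
apply: eq_bigr => m _.
rewrite EFinM QnEn; last exact: L2_X.
rewrite /En -ge0_integralZl//.
- apply: eq_integral => z _; rewrite -EFinM; congr EFin.
 by rewrite normcM; ring.
- by apply: (mE (f := fun z => z ^+ m)); exact: mcf_X.
- by move=> z Dz; rewrite lee_fin mulr_ge0 ?exprn_ge0 ?nc_ge0 ?w0.
- by rewrite lee_fin exprn_ge0 ?nc_ge0.
Qed.

Lemma parseval_pol a M : Qn (psum a M) = \sum_(m < M) normc (a m) ^+ 2 * Wm m.
Proof.
have N0 : (0 < M.+1)%N by [].
have := avg_rot M.+1 (mcf_psum a M).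
rewrite (eq_integral (fun z => (M.+1%:R%:E * ((\sum_(m < M) normc (a m * z ^+ m) ^+ 2) * w z)%:E)%E)); last first.
 move=> z _; rewrite -EFinM; congr EFin; rewrite mulrA; congr (_ * _).
 rewrite -(parseval_le (fun m => a m * z ^+ m) (leqnSn M)); apply: eq_bigr => k _.
 congr (normc _ ^+ 2); apply: eq_bigr => m _.
 by rewrite exprMn mulrA mulrAC.
rewrite ge0_integralZl//; last 2 first.
- apply/measurable_EFinP; apply: measurable_funM => //.
 apply: measurable_sum => i; apply: measurable_funX; apply: mcf_normc.
 by apply: mcfM; [exact: mcf_cst|exact: mcf_X].
- by move=> z Dz; rewrite lee_fin mulr_ge0 ?w0// sumr_ge0// => i _; rewrite exprn_ge0 ?nc_ge0.
rewrite int_coefs -QnEn; last exact: L2_psum.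
rewrite -!EFinM => -[]; apply: mulfI; by rewrite pnatr_eq0.
Qed.

Lemma le_einf (u : nat -> \bar R) (x : R) : (forall e : R, 0 < e -> exists N, forall n, (N <= n)%N ->
 ((x - e)%:E <= u n)%E) -> (x%:E <= limn_einf u)%E.
Proof.
move=> h; apply/lee_addgt0Pr => e e0; have [N HN] := h e e0.
rewrite -leeBlDr// -EFinB limn_einf_lim; apply: lime_ge; first exact: is_cvg_einfs.
exists N => // n /= Nn; apply: le_ereal_inf_tmp => _ [k /= nk <-].
by apply: HN; exact: leq_trans nk.
Qed.

Lemma einf_le (u : nat -> \bar R) (x : \bar R) : (forall n, (u n <= x)%E) -> (limn_einf u <= x)%E.
Proof.
move=> h; rewrite limn_einf_lim; apply: lime_le; first exact: is_cvg_einfs.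
near=> n; apply: ge_ereal_inf; exists (u n); last exact: h.
by exists n => /=.
Unshelve. all: by end_near. Qed.

Let sqr_close (x y d : R) : 0 <= x -> 0 <= y -> 0 <= d -> x - y <= d -> x ^+ 2 - y ^+ 2 <= 2 * d * x.
Proof.
move=> x0 y0 d0 h; have [xy|yx] := leP x y.
 apply: (@le_trans _ _ 0); first by rewrite subr_le0 lerXn2r.
 by rewrite mulr_ge0// mulr_ge0.
by rewrite subr_sqr; nra.
Qed.

Let pick_delta (B c e : R) : 0 <= B -> 0 <= c -> 0 < e -> exists2 d : R, 0 < d & 2 * d * B * c <= e.
Proof.
move=> B0 c0 e0; have P : 0 < 2 * B * c + 1 by rewrite ltr_wpDl// mulr_ge0// mulr_ge0.
exists (e / (2 * B * c + 1)); first by rewrite divr_gt0.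
rewrite (_ : _ * _ = e * (2 * B * c) / (2 * B * c + 1)); last by field; rewrite gt_eqF.
by rewrite ler_pdivrMr// ler_pM2l// lerDl.
Qed.

Let pt_ub a f z (c e : R) : (forall z, D z -> hsum a z (f z)) -> D z -> 0 <= c -> 0 < e ->
 exists N, forall n, (N <= n)%N -> normc (f z) ^+ 2 * c - e <= normc (psum a n z) ^+ 2 * c.
Proof.
move=> h Dz c0 e0; have [d d0 hd] := pick_delta (nc_ge0 (f z)) c0 e0.
have [N HN] := h z Dz d d0; exists N => n Nn.
have h1 := le_trans (ncB_ge _ _) (HN n Nn).
have := sqr_close (nc_ge0 _) (nc_ge0 _) (ltW d0) h1 => /(ler_wpM2r c0).
rewrite mulrBl; lra.
Qed.

Let pt_lb a f z (c e : R) M : (forall z, D z -> hsum a z (f z)) -> D z -> 0 <= c -> 0 < e ->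
 exists N, forall n, (N <= n)%N -> (\sum_(m < M) normc (a m * z ^+ m) ^+ 2) * c - e <=
  n.+1%:R^-1 * (\sum_(k < n.+1) normc (f (zeta R n.+1 ^+ k * z)) ^+ 2) * c.
Proof.
move=> h Dz c0 e0; have z01 : 0 <= normc z < 1 by rewrite nc_ge0.
have [K [q [K0 q01 hq]]] := rad_geo (hsum_rad h) z01.
pose B := K / (1 - q); have /andP[q0 q1] := q01.
have B0 : 0 <= B by rewrite divr_ge0// subr_ge0 ltW.
have PB M' z' : normc z' <= normc z -> normc (psum a M' z') <= B.
 move=> zz; rewrite (le_trans (nc_sum _ _ _))//.
 apply: (@le_trans _ _ (\sum_(m < M') K * q ^+ m)); first by apply: ler_sum => m _; exact: hq.
 by rewrite -mulr_sumr ler_wpM2l// geo_sum_le.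
have [d d0 hd] := pick_delta B0 c0 e0.
have [N1 HN1] := rad_unif h Dz d0.
exists (maxn M N1) => n; rewrite geq_max => /andP[Mn N1n].
have n0 : 0 < n.+1%:R :> R by rewrite ltr0n.
have key : n.+1%:R * \sum_(m < M) normc (a m * z ^+ m) ^+ 2 <=
  \sum_(k < n.+1) normc (f (zeta R n.+1 ^+ k * z)) ^+ 2 + n.+1%:R * (2 * d * B).
 apply: (@le_trans _ _ (n.+1%:R * \sum_(m < n) normc (a m * z ^+ m) ^+ 2)).
  rewrite ler_pM2l// -(subnKC Mn) big_split_ord/= lerDl sumr_ge0// => i _.
  by rewrite exprn_ge0 ?nc_ge0.
 rewrite -(parseval_le (fun m => a m * z ^+ m) (leqnSn n)).
 rewrite -[n.+1 in X in _ <= _ + X]card_ord mulr_natl -sumr_const -big_split/=.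
 apply: ler_sum => k _; set z' := zeta R n.+1 ^+ k * z.
 have zz : normc z' <= normc z by rewrite /z' normcM ncX nc_zeta expr1n mul1r.
 have -> : \sum_(m < n) a m * z ^+ m * (zeta R n.+1 ^+ k) ^+ m = psum a n z'.
  by apply: eq_bigr => m _; rewrite /z' exprMn mulrA mulrAC.
 have h1 := le_trans (ncB_ge (psum a n z') (f z')) (_ : normc (psum a n z' - f z') <= d).
 have {}h1 := h1 (eq_ind_r (fun x => x <= d) (HN1 n N1n z' zz) (ncBC _ _)).
 have := sqr_close (nc_ge0 _) (nc_ge0 _) (ltW d0) h1.
 rewrite lerBlDl => /le_trans; apply; rewrite lerD2l; apply: ler_wpM2l; [by rewrite mulr_ge0// (ltW d0)|exact: PB].
have i0 : 0 <= n.+1%:R^-1 :> R by rewrite invr_ge0 ltW.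
have := ler_wpM2r c0 (ler_wpM2l i0 key); rewrite mulrDr !mulrA mulVf ?gt_eqF// mul1r mulrDl.
move=> H; rewrite lerBlDr (le_trans H)// lerD2l (le_trans _ hd)// mul1r mulrA.
by rewrite lexx.
Qed.

Lemma measurable_limn_einf (F : nat -> C -> \bar R) : (forall n, measurable_fun D (F n)) ->
 measurable_fun D (fun z => limn_einf (F^~ z)).
Proof.
move=> mF; rewrite /limn_einf; apply: measurableT_comp => //.
apply: (measurable_fun_limn_esup (f := fun n x => (- F n x)%E)) => n.
exact: measurableT_comp.
Qed.

(** Fatou's lemma along the partial sums, whose energies are known. *)
Lemma parseval_ub a f B : (forall z, D z -> hsum a z (f z)) ->
 (forall M, \sum_(m < M) normc (a m) ^+ 2 * Wm m <= B) -> L2 area w f /\ Qn f <= B.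
Proof.
move=> h hB; have mf := mcf_hsum h.
have EB : (En f <= B%:E)%E.
 pose F n z := (normc (psum a n z) ^+ 2 * w z)%:E.
 apply: (@le_trans _ _ (\int[area]_(z in D) limn_einf (F^~ z))%E).
  apply: ge0_le_integral => //.
  - by move=> z Dz; rewrite lee_fin mulr_ge0 ?exprn_ge0 ?nc_ge0 ?w0.
  - exact: mE.
  - by apply: measurable_limn_einf => n; apply: mE; exact: mcf_psum.
  - move=> z Dz; apply: le_einf => e e0.
   have [N HN] := pt_ub h Dz (w0 Dz) e0.
   by exists N => n Nn; rewrite lee_fin HN.
 apply: (le_trans (@fatou _ _ _ area D mD F _ _)).
 - by move=> n; apply: mE; exact: mcf_psum.
 - by move=> n z Dz; rewrite lee_fin mulr_ge0 ?exprn_ge0 ?nc_ge0 ?w0.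
 apply: einf_le => n; rewrite -[X in (X <= _)%E]/(En (psum a n)) -QnEn; last exact: L2_psum.
 by rewrite lee_fin parseval_pol.
have lf : L2 area w f by split => //; apply: le_lt_trans EB _; rewrite ltry.
by split => //; rewrite -lee_fin QnEn.
Qed.

(** Fatou's lemma along the averages over n + 1 rotations: their integrals all equal the energy of
    f, and on each circle f is uniformly close to a polynomial of degree below n + 1, so the lower
    limit of the averages dominates every truncated square sum. *)
Lemma parseval_lb a f : (forall z, D z -> hsum a z (f z)) -> L2 area w f ->
 forall M, \sum_(m < M) normc (a m) ^+ 2 * Wm m <= Qn f.
Proof.
move=> h lf M; have mf := mcf_hsum h.
rewrite -lee_fin -int_coefs QnEn//.
pose F N z := ((N.+1%:R^-1)%:E * ((\sum_(k < N.+1) normc (f (zeta R N.+1 ^+ k * z)) ^+ 2) * w z)%:E)%E.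
have mF N : measurable_fun D (fun z => ((\sum_(k < N.+1) normc (f (zeta R N.+1 ^+ k * z)) ^+ 2) * w z)%:E).
 apply/measurable_EFinP; apply: measurable_funM => //.
 apply: measurable_sum => k; apply: measurable_funX; have [t ->] := zeta_expi N.+1 k.
 by apply: (mcf_normc (f := fun z => f (expi t * z))); exact: mcf_rot.
have F0 N z : D z -> (0 <= ((\sum_(k < N.+1) normc (f (zeta R N.+1 ^+ k * z)) ^+ 2) * w z)%:E)%E.
 by move=> Dz; rewrite lee_fin mulr_ge0 ?w0// sumr_ge0// => i _; rewrite exprn_ge0 ?nc_ge0.
have FE N : (\int[area]_(z in D) F N z)%E = En f.
 rewrite /F (ge0_integralZl area mD (mF N) (F0 N)) ?lee_fin ?invr_ge0//.
 rewrite -avg_rot// muleA -EFinM mulVf ?mul1e// pnatr_eq0//.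
apply: (@le_trans _ _ (\int[area]_(z in D) limn_einf (F^~ z))%E).
 apply: ge0_le_integral => //.
 - move=> z Dz; rewrite lee_fin mulr_ge0 ?w0// sumr_ge0// => i _; rewrite exprn_ge0 ?nc_ge0//.
 - apply/measurable_EFinP; apply: measurable_funM => //.
  apply: measurable_sum => i; apply: measurable_funX; apply: mcf_normc.
  by apply: mcfM; [exact: mcf_cst|exact: mcf_X].
 - by apply: measurable_limn_einf => n; apply: measurable_funeM; exact: mF.
 - move=> z Dz; apply: le_einf => e e0.
  have [N HN] := pt_lb M h Dz (w0 Dz) e0.
  by exists N => n Nn; rewrite /F -EFinM lee_fin mulrA HN.
apply: (le_trans (@fatou _ _ _ area D mD F _ _)).
- by move=> n; apply: measurable_funeM; exact: mF.
- by move=> n z Dz; rewrite mule_ge0 ?F0// lee_fin invr_ge0.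
by apply: einf_le => n; rewrite FE.
Qed.

End WeightedParseval.

(** * The Bergman space as a sequence space, and its reproducing kernels *)

Section BergmanCoefficients.
Variables (R : realType) (w : R[i] -> R).
Hypothesis hw : class_Dhat w.
Local Notation C := R[i].
Local Notation D := (@unit_disc R).
Local Notation Wm := (Wm w).
Local Notation Qn := (Qn area w).
Local Notation ip := (ip area w).
Local Notation L2 := (L2 area w).
Implicit Types (a b : nat -> C) (z s : C) (f g : C -> C).

Let mw := Dhat_meas hw.
Let w0 := Dhat_ge0 hw.
Let W0 := Wm_gt0 hw.

Definition ell2 a := exists B : R, forall M, \sum_(m < M) normc (a m) ^+ 2 * Wm m <= B.

Let term0 a m : 0 <= normc (a m) ^+ 2 * Wm m.
Proof. by rewrite mulr_ge0 ?exprn_ge0 ?nc_ge0// ltW. Qed.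

(** The moments decay more slowly than any geometric sequence, since the weight charges every
    neighbourhood of the circle. *)
Lemma ell2_rad a : ell2 a -> rad a.
Proof.
move=> [B HB] r /andP[r0 r1].
pose x := (1 + r) / 2; have x01 : 0 <= x < 1 by rewrite /x; apply/andP; split; lra.
have xp : 0 < x by rewrite /x; lra.
have k0 : 0 < kap R by have [] := kap_area R.
have h0 : 0 < 2 * kap R * (x * hat w x) by apply: mulr_gt0; [exact: mulr_gt0|apply: mulr_gt0 => //; exact: hat_gt0].
have B0 : 0 <= B by have := HB 0%N; rewrite big_ord0.
pose c := 2 * kap R * (x * hat w x).
exists (B / c + 1); first by rewrite addr_ge0// divr_ge0// ltW.
move=> m; have h1 : normc (a m) ^+ 2 * Wm m <= B.
 apply: le_trans (HB m.+1); rewrite big_ord_recr/= lerDr.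
 by apply: sumr_ge0 => i _.
have h2 := Wm_lb_hat hw m x01.
have h3 : (normc (a m) * x ^+ m) ^+ 2 <= B / c.
 rewrite ler_pdivlMr//; apply: le_trans h1.
 rewrite exprMn -mulrA ler_wpM2l ?exprn_ge0 ?nc_ge0//.
 apply: le_trans h2; rewrite /c -exprM exprS mulnC; move: (x ^+ (2 * m)) => y.
 by apply: le_of_eq; ring.
have h4 : normc (a m) * r ^+ m <= normc (a m) * x ^+ m.
 by rewrite ler_wpM2l ?nc_ge0// lerXn2r ?nnegrE// ?(ltW xp)// /x; lra.
apply: (le_trans h4); have := nc_ge0 (a m); have := exprn_ge0 m (ltW xp).
move: (normc (a m)) (x ^+ m) h3 => u v h3 v0 u0.
have uv : 0 <= u * v by exact: mulr_ge0.
move: (u * v) uv h3 => t t0 h3.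
have [t1|t1] := leP t 1; first by rewrite (le_trans t1)// lerDr divr_ge0// ltW.
by apply: (@le_trans _ _ (t ^+ 2)); [rewrite expr2 ler_peMl// ltW|rewrite (le_trans h3)// lerDl].
Qed.

Definition mkf a : C -> C^o := fun z => if z \in D then xget 0 (hsum a z) else 0.

Lemma mkf_hsum a z : rad a -> D z -> hsum a z (mkf a z).
Proof.
move=> ra Dz; rewrite /mkf mem_set//; have [s hs] := rad_hsum ra Dz.
by apply: (@xgetPex _ (0 : C) (hsum a z)); exists s.
Qed.

Lemma mkf_out a z : ~ D z -> mkf a z = 0.
Proof. by move=> nD; rewrite /mkf memNset. Qed.

Lemma mkf_uniq a f : (forall z, D z -> hsum a z (f z)) -> (forall z, ~ D z -> f z = 0) -> f = mkf a.
Proof.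
move=> h h0; apply/funext => z; have [Dz|nD] := pselect (D z).
 by apply: hsum_uniq (h z Dz) _; apply: mkf_hsum => //; exact: hsum_rad h.
by rewrite h0// mkf_out.
Qed.

Lemma ell2_hsum a : ell2 a -> forall z, D z -> hsum a z (mkf a z).
Proof. by move=> ea z Dz; apply: mkf_hsum => //; exact: ell2_rad. Qed.

Lemma ell2_space a : ell2 a -> bergman_space w (mkf a).
Proof.
move=> ea; have h := ell2_hsum ea; split; first exact: rad_analytic h.
 by move=> z; exact: mkf_out.
by case: ea => B /(parseval_ub hw h)[[]].
Qed.

Lemma ell2_L2 a : ell2 a -> L2 (mkf a).
Proof.
move=> ea; have h := ell2_hsum ea; split; first exact: mcf_hsum h.
by have [] := ell2_space ea.
Qed.

Lemma space_ell2 f : bergman_space w f -> exists2 a, ell2 a & f = mkf a.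
Proof.
move=> [an out fin]; have [a h] := taylor an.
exists a; last exact: mkf_uniq.
exists (Qn f); apply: (parseval_lb hw h); split => //; exact: mcf_hsum h.
Qed.

Lemma Qn_mkf_ub a B : (forall M, \sum_(m < M) normc (a m) ^+ 2 * Wm m <= B) -> Qn (mkf a) <= B.
Proof.
move=> h; have ea : ell2 a by exists B.
by have [] := parseval_ub hw (ell2_hsum ea) h.
Qed.

Lemma Qn_mkf_lb a M : ell2 a -> \sum_(m < M) normc (a m) ^+ 2 * Wm m <= Qn (mkf a).
Proof. by move=> ea; apply: (parseval_lb hw (ell2_hsum ea)); exact: ell2_L2. Qed.

Lemma hsum_trunc a M z s : hsum a z s ->
 hsum (fun m => if (m < M)%N then 0 else a m) z (s - psum a M z).
Proof.
move=> h e e0; have [N HN] := h e e0; exists (maxn M N) => M'.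
rewrite geq_max => /andP[MM' NM']; apply: le_trans (HN M' NM').
rewrite -(subnKC MM') !psumD (_ : psum (fun m => if (m < M)%N then 0 else a m) M z = 0); last first.
 by rewrite /psum big1// => i _; rewrite ltn_ord mul0r.
rewrite add0r; apply: le_of_eq; congr normc.
rewrite opprD addrA; congr (_ - _); apply: eq_bigr => i _.
by rewrite ltnNge leq_addr.
Qed.

Lemma Qn_tail a (e : R) : ell2 a -> 0 < e -> exists M0, forall M, (M0 <= M)%N ->
 Qn (fun z => mkf a z - psum a M z) <= e.
Proof.
move=> ea e0; have ra := ell2_rad ea.
pose S := [set x | exists M, x = \sum_(m < M) normc (a m) ^+ 2 * Wm m].
have hS : has_sup S.
 split; first by exists 0, 0%N; rewrite big_ord0.
 by case: ea => B HB; exists B => _ [M ->].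
have [_ [M0 ->] h0] := sup_adherent e0 hS.
exists M0 => M M0M.
have hs z : D z -> hsum (fun m => if (m < M)%N then 0 else a m) z (mkf a z - psum a M z).
 by move=> Dz; apply: hsum_trunc; exact: mkf_hsum.
have [] // := parseval_ub hw (B := e) hs.
move=> M'; have : \sum_(m < M + M') normc (a m) ^+ 2 * Wm m <= sup S.
 by apply: ub_le_sup; [case: hS|exists (M + M')%N].
have : \sum_(m < M0) normc (a m) ^+ 2 * Wm m <= \sum_(m < M) normc (a m) ^+ 2 * Wm m.
 by rewrite -(subnKC M0M) big_split_ord/= lerDl sumr_ge0.
have : \sum_(m < M') normc (if (m < M)%N then 0 else a m) ^+ 2 * Wm m <=
 \sum_(m < M + M') normc (if (m < M)%N then 0 else a m) ^+ 2 * Wm m.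
 rewrite addnC big_split_ord/= lerDl sumr_ge0// => i _.
 by rewrite mulr_ge0 ?exprn_ge0 ?nc_ge0// ltW.
rewrite !big_split_ord/= [X in _ <= X + _ -> _]big1; last first.
 by move=> i _; rewrite ltn_ord normc0 expr0n mul0r.
rewrite [X in _ <= 0 + X -> _](eq_bigr (fun i : 'I_M' => normc (a (M + i)%N) ^+ 2 * Wm (M + i)%N)); last first.
 by move=> i _; rewrite ltnNge leq_addr.
lra.
Qed.

(** Polarization: Parseval gives the norm of c z^m + z^i, hence Re (c <z^m, z^i>) = 0 for c = 1 and
    for c = i. *)
Lemma ip_XX i m : ip (fun z => z ^+ i) (fun z => z ^+ m) = if i == m then (Wm m)%:C else 0.
Proof.
have [->|im] := eqVneq i m; first by rewrite ip_self.
have li := L2_X hw i; have lm := L2_X hw m.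
have key (c : C) : cRe (c * ip (fun z => z ^+ m) (fun z => z ^+ i)) = 0.
 pose a k := if k == i then 1 else if k == m then c else 0 : C.
 have E : (fun z => c * z ^+ m + z ^+ i) = psum a (i + m).+1.
  apply/funext => z; rewrite /psum.
  have ii : (i < (i + m).+1)%N by rewrite ltnS leq_addr.
  have mm : (m < (i + m).+1)%N by rewrite ltnS leq_addl.
  rewrite (bigD1 (Ordinal ii))//= (bigD1 (Ordinal mm))/=; last by rewrite eq_sym.
  rewrite big1 => [|k /andP[k1 k2]].
   by rewrite /a eqxx eq_sym (negbTE im) eqxx mul1r addr0 addrC.
  move: k1 k2; rewrite -!val_eqE/= /a => /negbTE -> /negbTE ->.
  by rewrite mul0r.
 have Q : Qn (psum a (i + m).+1) = Wm i + normc c ^+ 2 * Wm m.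
  rewrite (parseval_pol hw).
  have ii : (i < (i + m).+1)%N by rewrite ltnS leq_addr.
  have mm : (m < (i + m).+1)%N by rewrite ltnS leq_addl.
  rewrite (bigD1 (Ordinal ii))//= (bigD1 (Ordinal mm))/=; last by rewrite eq_sym.
  rewrite big1 => [|k /andP[k1 k2]].
   by rewrite /a eqxx eq_sym (negbTE im) eqxx normc1 expr1n mul1r addr0.
  move: k1 k2; rewrite -!val_eqE/= /a => /negbTE -> /negbTE ->.
  by rewrite normc0 expr0n mul0r.
 have := ip_self area w (psum a (i + m).+1); rewrite Q -E.
 rewrite ip_linear//; last exact: L2ZD.
 rewrite !ip_linear_r// !ip_self [ip (fun z => z ^+ i) (fun z => z ^+ m)]ip_conj//.
 move=> /(congr1 (@cRe R)).
 rewrite mulrDr mulrA mul_conj -RCM !ReD.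
 rewrite -conjM [cRe (conjc _)](_ : _ = cRe (c * ip (fun z => z ^+ m) (fun z => z ^+ i))); last by case: (_ * _).
 have e1 (x : R) : cRe x%:C = x by [].
 rewrite !e1 -/(Wm m) -/(Wm i); move: (cRe (c * _)) (Wm i) (normc c ^+ 2 * Wm m) => X A B; lra.
have k1 := key 1; have k2 := key 'i%C; rewrite mul1r in k1.
rewrite ip_conj//; move: k1 k2; case: (ip _ _) => x y /= -> /eqP.
rewrite mul0r sub0r mul1r oppr_eq0 => /eqP ->; by rewrite oppr0.
Qed.

Lemma ip_psum_X a M m : (m < M)%N -> ip (psum a M) (fun z => z ^+ m) = a m * (Wm m)%:C.
Proof.
move=> mM; rewrite /psum ip_sum//; try exact: L2_X.
 rewrite (bigD1 (Ordinal mM))//= ip_XX eqxx big1 ?addr0// => k km.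
 by rewrite ip_XX; move: km; rewrite -val_eqE/= => /negbTE ->; rewrite mulr0.
Qed.

Lemma ip_lim f g (u : nat -> C -> C) : L2 f -> L2 g -> (forall n, L2 (u n)) ->
 (forall e, 0 < e -> exists M0, forall M, (M0 <= M)%N -> Qn (fun z => f z - u M z) <= e) ->
 forall e, 0 < e -> exists M0, forall M, (M0 <= M)%N -> normc (ip f g - ip (u M) g) <= e.
Proof.
move=> lf lg lu h e e0.
have G0 : 0 < Qn g + 1 by rewrite ltr_wpDl ?Qn_ge0.
have [M0 HM] := h (e ^+ 2 / (Qn g + 1)) (divr_gt0 (exprn_gt0 2 e0) G0).
exists M0 => M MM.
have -> : ip f g - ip (u M) g = ip (fun z => f z - u M z) g.
 rewrite (_ : (fun z => f z - u M z) = (fun z => (-1) * u M z + f z)); last first.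
  by apply/funext => z; rewrite mulN1r addrC.
 by rewrite ip_linear// mulN1r addrC.
have := ip_CS mw w0 (L2B mw w0 lf (lu M)) lg.
have := HM M MM; rewrite ler_pdivlMr//.
have := Qn_ge0 area w0 (fun z => f z - u M z); have := Qn_ge0 area w0 g.
move: (Qn g) (Qn _) (normc _) (nc_ge0 (ip (fun z => f z - u M z) g)) => G F X X0 GG FF h1 h2.
rewrite -(@ler_pXn2r _ 2)// ?nnegrE ?(ltW e0)// (le_trans h2)//.
by apply: le_trans h1; rewrite ler_wpM2l// lerDl.
Qed.

Lemma ip_mkf_X a m : ell2 a -> ip (mkf a) (fun z => z ^+ m) = a m * (Wm m)%:C.
Proof.
move=> ea; apply/eqP; rewrite -subr_eq0; apply/eqP/(@small_eq0 _ 1) => e e0.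
have [M0 HM] := ip_lim (ell2_L2 ea) (L2_X hw m) (fun M => L2_psum hw a M) (fun e => @Qn_tail a e ea) e0.
rewrite mul1r -(ip_psum_X a (leq_maxr M0 m.+1)); exact: HM (leq_maxl _ _).
Qed.

Lemma ip_mkf a g : ell2 a -> L2 g -> forall e, 0 < e -> exists M0, forall M, (M0 <= M)%N ->
 normc (ip (mkf a) g - \sum_(m < M) a m * ip (fun z => z ^+ m) g) <= e.
Proof.
move=> ea lg e e0.
have [M0 HM] := ip_lim (ell2_L2 ea) lg (fun M => L2_psum hw a M) (fun e => @Qn_tail a e ea) e0.
exists M0 => M MM; rewrite -ip_sum//; first exact: HM.
by move=> i; exact: L2_X.
Qed.

Lemma mkf_psum a M : (forall m, (M <= m)%N -> a m = 0) -> forall z, D z -> mkf a z = psum a M z.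
Proof.
move=> h z Dz; have hp N : (M <= N)%N -> psum a N z = psum a M z.
 by move=> MN; rewrite -(subnKC MN) psumD big1 ?addr0// => i _; rewrite h ?mul0r// leq_addr.
have hs z' : D z' -> hsum a z' (psum a M z').
 move=> _ e e0; exists M => N MN; rewrite -(subnKC MN) psumD big1 => [|i _].
  by rewrite addr0 subrr normc0 ltW.
 by rewrite h ?mul0r// leq_addr.
by apply: hsum_uniq (hs z Dz); apply: mkf_hsum => //; exact: hsum_rad hs.
Qed.

(** Taylor coefficients of the reproducing kernel at z: the monomials are orthogonal with squared
    norms [Wm m]. *)
Definition kc z m : C := conjc z ^+ m / (Wm m)%:C.

(** The moments are bounded below by a multiple of s^(2m+1); with s^2 = (1 + r) / 2 > r the ratio is
    geometric. *)
Lemma kc_bound (r : R) : 0 <= r < 1 -> exists K q : R, [/\ 0 <= K, 0 <= q < 1 &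
 forall m, r ^+ m / Wm m <= K * q ^+ m].
Proof.
move=> /andP[r0 r1]; pose s := Num.sqrt ((1 + r) / 2).
have s2 : s ^+ 2 = (1 + r) / 2 by rewrite sqr_sqrtr//; lra.
have s0 : 0 < s by rewrite sqrtr_gt0; lra.
have s1 : s < 1 by rewrite -(@ltr_pXn2r _ 2)// ?nnegrE ?(ltW s0)// s2 expr1n; lra.
have s01 : 0 <= s < 1 by rewrite (ltW s0) s1.
have k0 : 0 < kap R by have [] := kap_area R.
pose c := 2 * kap R * (s * hat w s); have c0 : 0 < c by apply: mulr_gt0; [exact: mulr_gt0|apply: mulr_gt0 => //; exact: hat_gt0].
have p0 : 0 < (1 + r) / 2 by lra.
exists c^-1, (r / ((1 + r) / 2)); split; first by rewrite invr_ge0 ltW.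
 by rewrite divr_ge0 ?(ltW p0)//= ltr_pdivrMr// mul1r; lra.
move=> m; have := Wm_lb_hat hw m s01.
rewrite exprS exprM s2 => h; set p := (1 + r) / 2 in p0 h *; clearbody p.
have {}h : c * p ^+ m <= Wm m.
 by apply: le_trans h; rewrite /c; apply: le_of_eq; ring.
apply: (@le_trans _ _ (r ^+ m / (c * p ^+ m))).
 rewrite ler_wpM2l ?exprn_ge0// lef_pV2 ?posrE// mulr_gt0// exprn_gt0//.
have E : r ^+ m / (c * p ^+ m) = c^-1 * (r / p) ^+ m.
 by rewrite exprMn exprVn invfM mulrCA.
by rewrite E.
Qed.

Let nc_kc z m : normc (kc z m) = normc z ^+ m / Wm m.
Proof.
by rewrite /kc normcM normcV ncX nc_conj nc_real ger0_norm// ltW.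
Qed.

Lemma kc_ell2 z : D z -> ell2 (kc z).
Proof.
move=> Dz; have r1 : 0 <= normc z ^+ 2 < 1.
 by rewrite exprn_ge0 ?nc_ge0//= exprn_ilt1 ?nc_ge0.
have [K [q [K0 q01 H]]] := kc_bound r1.
exists (K / (1 - q)) => M; apply: (@le_trans _ _ (\sum_(m < M) K * q ^+ m)); last first.
 by rewrite -mulr_sumr ler_wpM2l// geo_sum_le.
apply: ler_sum => m _; apply: le_trans (H m); rewrite nc_kc.
apply: le_of_eq; rewrite expr_div_n -!exprM mulnC.
by field; rewrite gt_eqF.
Qed.

Lemma kernel_tail z : D z -> exists K q : R, [/\ 0 <= K, 0 <= q < 1 &
 forall M x, D x -> normc (mkf (kc z) x - psum (kc z) M x) <= K * q ^+ M].
Proof.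
move=> Dz; have r1 : 0 <= normc z < 1 by rewrite nc_ge0.
have [K [q [K0 q01 H]]] := kc_bound r1; have /andP[q0 q1] := q01.
exists (K / (1 - q)), q; split => //; first by rewrite divr_ge0// subr_ge0 ltW.
move=> M x Dx; apply: (hsum_tail q01) => [m|]; last first.
 by apply: mkf_hsum => //; apply: ell2_rad; exact: kc_ell2.
rewrite normcM nc_kc ncX; apply: le_trans (H m).
by rewrite ler_piMr ?divr_ge0 ?exprn_ge0 ?nc_ge0 ?(ltW (W0 _))// exprn_ile1 ?nc_ge0// ltW.
Qed.

Lemma reproducing f z : bergman_space w f -> D z -> f z = ip f (mkf (kc z)).
Proof.
move=> /space_ell2[a ea ->] Dz; have ek := kc_ell2 Dz.
apply: hsum_uniq (ell2_hsum ea Dz) _ => e e0.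
have [M0 HM] := ip_mkf ea (ell2_L2 ek) e0; exists M0 => M /HM.
rewrite /psum; congr (normc (_ - _) <= _); apply: eq_bigr => m _.
rewrite ip_conj//; [|exact: ell2_L2|exact: L2_X].
rewrite ip_mkf_X// /kc divfK; last by rewrite eqCR0 gt_eqF.
by rewrite conjX conjK.
Qed.

(** Any function K with the defining property satisfies K x = conj (B_x z), by pairing it with the
    kernel at x; this pins down the chosen value. *)
Lemma bergman_kernelE z : D z -> bergman_kernel w z = mkf (kc z).
Proof.
move=> Dz.
pose P := [set K | bergman_space w K /\ forall f, bergman_space w f -> f z = bergman_inner w f K].
have PK : P (mkf (kc z)).
 by split; [exact/ell2_space/kc_ell2|move=> f sf; exact: reproducing].
have key K : P K -> forall x, D x -> K x = conjc (mkf (kc x) z).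
 move=> [sK hK] x Dx; rewrite (reproducing sK Dx).
 have sx : bergman_space w (mkf (kc x)) by exact/ell2_space/kc_ell2.
 rewrite (hK _ sx); have [b eb Kb] := space_ell2 sK.
 by rewrite ip_conj//; [exact/ell2_L2/kc_ell2|rewrite Kb; exact: ell2_L2].
have PB : P (bergman_kernel w z) by apply: (@xgetPex _ _ P); exists (mkf (kc z)).
apply/funext => x; have [Dx|nDx] := pselect (D x); first by rewrite (key _ PB)// (key _ PK).
by have [[_ out _] _] := PB; rewrite out// mkf_out.
Qed.

End BergmanCoefficients.

(** * Taylor coefficients of the Toeplitz operator *)

Section ToeplitzCoefficients.
Variables (R : realType) (w : R[i] -> R) (mu : {measure set R[i] -> \bar R}).
Hypothesis hw : class_Dhat w.
Local Notation C := R[i].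
Local Notation D := (@unit_disc R).
Local Notation Wm := (Wm w).
Local Notation one := (fun=> 1 : R).
Local Notation X m := (fun z : C => z ^+ m).
Implicit Types (a b : nat -> C) (z s : C) (f g : C -> C).

Let W0 := Wm_gt0 hw.

Lemma ell2_fin a M : (forall m, (M <= m)%N -> a m = 0) -> ell2 w a.
Proof.
move=> h; exists (\sum_(m < M) normc (a m) ^+ 2 * Wm m) => M'.
apply: (@le_trans _ _ (\sum_(m < M + M') normc (a m) ^+ 2 * Wm m)).
 rewrite addnC big_split_ord/= lerDl sumr_ge0// => i _.
 by rewrite mulr_ge0 ?exprn_ge0 ?nc_ge0// ltW.
rewrite big_split_ord/= gerDl big1// => i _.
by rewrite h ?leq_addr// normc0 expr0n mul0r.
Qed.

Lemma mkf_lin (c : C) a b : rad a -> rad b ->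
 mkf (fun m => c * a m + b m) = (fun z => c * mkf a z + mkf b z).
Proof.
move=> ra rb; symmetry; apply: mkf_uniq => z Dz; last first.
 by rewrite !mkf_out// mulr0 addr0.
move=> e e0; have c0 : 0 < normc c + 1 by rewrite ltr_wpDl ?nc_ge0.
have [N1 H1] := mkf_hsum ra Dz (divr_gt0 (divr_gt0 e0 (ltr0Sn R 1)) c0).
have [N2 H2] := mkf_hsum rb Dz (divr_gt0 e0 (ltr0Sn R 1)).
exists (maxn N1 N2) => M; rewrite geq_max => /andP[/H1 h1 /H2 h2].
rewrite (_ : _ - _ = c * (mkf a z - psum a M z) + (mkf b z - psum b M z)); last first.
 rewrite /psum (eq_bigr (fun m : 'I_M => c * (a m * z ^+ m) + b m * z ^+ m)).
  by rewrite big_split/= -mulr_sumr; ring.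
 by move=> m _; ring.
rewrite (le_trans (ncD _ _))// (splitr e) lerD// normcM.
apply: (@le_trans _ _ ((normc c + 1) * (e / 2 / (normc c + 1)))).
 by apply: ler_pM; rewrite ?nc_ge0// lerDl.
by rewrite mulrCA mulfV ?mulr1// gt_eqF.
Qed.

Lemma Qn_fin a M : (forall m, (M <= m)%N -> a m = 0) ->
 Qn area w (mkf a) = \sum_(m < M) normc (a m) ^+ 2 * Wm m.
Proof.
move=> h; rewrite -(parseval_pol hw); apply: eq_Rintegral => z; rewrite inE => Dz.
by rewrite (mkf_psum h).
Qed.

(** For f = 1 and z = 0 the integrand is the constant 1 / Wm 0. *)
Lemma finite_measure_of_toeplitz : toeplitz_defined w mu -> (mu D < +oo)%E.
Proof.
move=> td.
pose d m : C := (m == 0%N)%:R.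
have dfin m : (1 <= m)%N -> d m = 0 by case: m.
have D0 : D (0 : C) by rewrite /unit_disc /mkset normc0.
have := td _ _ (ell2_space hw (ell2_fin dfin)) D0.
move=> [+ _]; have kE z : D z -> toeplitz_integrand w (mkf d) 0 z = ((Wm 0)^-1)%:C.
 move=> Dz; rewrite /toeplitz_integrand bergman_kernelE//.
 rewrite (mkf_psum dfin)// (@mkf_psum _ _ 1)//; last first.
  by case=> // m _; rewrite /kc conjc0 expr0n mul0r.
 rewrite /psum !big_ord1 /kc !expr0 /d !mulr1 !mul1r.
 by rewrite -[((Wm 0)%:C)^-1]fmorphV conjc_real.
move=> /integrableP[_].
rewrite (eq_integral (cst (`|(Wm 0)^-1|%:E)%E)); last first.
 by move=> z; rewrite inE => Dz; rewrite kE.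
rewrite integral_cst; last exact: measurable_unit_disc.
rewrite ger0_norm; last by rewrite invr_ge0 ltW.
have := W0 0; rewrite -invr_gt0; case: (mu D) => //= [r|] w0 h; first by rewrite ltry.
by move: h; rewrite gt0_muley// lte_fin.
Qed.

Section FiniteMeasure.
Hypothesis muD : (mu D < +oo)%E.

Lemma L2mu_bounded f B : @mcf R f -> (forall z, D z -> normc (f z) <= B) -> L2 mu one f.
Proof.
move=> mf fB; split => //; have mD := @measurable_unit_disc R.
have : (\int[mu]_(z in D) (cst ((B ^+ 2)%:E) z) < +oo)%E.
 rewrite integral_cst//.
 by apply: lte_mul_pinfty => //; rewrite lee_fin exprn_even_ge0.
apply: le_lt_trans; apply: ge0_le_integral => //.
- by move=> z Dz; rewrite lee_fin mulr1 exprn_ge0 ?nc_ge0.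
- apply/measurable_EFinP; apply: measurable_funM => //.
 by apply: measurable_funX; exact: mcf_normc.
- by move=> z Dz; rewrite lee_fin mulr1 lerXn2r ?nnegrE ?nc_ge0 ?fB// (le_trans (nc_ge0 _) (fB z Dz)).
Qed.

Lemma Qmu_le f B : @mcf R f -> (forall z, D z -> normc (f z) <= B) ->
 Qn mu one f <= B ^+ 2 * fine (mu D).
Proof.
move=> mf fB; have mD := @measurable_unit_disc R.
rewrite -lee_fin QnE//; last exact: L2mu_bounded fB.
rewrite EFinM fineK ?ge0_fin_numE// -integral_cst//.
apply: ge0_le_integral => //.
- by move=> z Dz; rewrite lee_fin mulr1 exprn_ge0 ?nc_ge0.
- apply/measurable_EFinP; apply: measurable_funM => //.
 by apply: measurable_funX; exact: mcf_normc.
- by move=> z Dz; rewrite lee_fin mulr1 lerXn2r ?nnegrE ?nc_ge0 ?fB// (le_trans (nc_ge0 _) (fB z Dz)).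
Qed.

Lemma L2mu_X m : L2 mu one (X m).
Proof.
apply: (L2mu_bounded (B := 1)); first exact: mcf_X.
by move=> z; rewrite /unit_disc /mkset ncX => /ltW h; rewrite exprn_ile1// nc_ge0.
Qed.

Let m1 : measurable_fun D one. Proof. exact: measurable_cst. Qed.
Let o0 z : D z -> 0 <= (1 : R). Proof. by []. Qed.

Lemma L2mu_psum a M : L2 mu one (psum a M).
Proof. by apply: L2_sum => // i; apply: L2Z => //; exact: L2mu_X. Qed.

(** Coefficients of T_mu f, obtained by inserting the series of the kernel into the integral. *)
Definition tc f m : C := ip mu one f (X m) / (Wm m)%:C.

Let kernel_bounded z : D z -> L2 mu one (mkf (kc w z)).
Proof.
move=> Dz; have ek := kc_ell2 hw Dz; have [K [q [K0 q01 H]]] := kernel_tail hw Dz.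
apply: (L2mu_bounded (B := K)); first exact: mcf_hsum (ell2_hsum hw ek).
by move=> x Dx; have := H 0%N x Dx; rewrite /psum big_ord0 subr0 expr0 mulr1.
Qed.

Lemma toeplitz_ip f z : D z -> toeplitz_operator w mu f z = ip mu one f (mkf (kc w z)).
Proof.
move=> Dz; rewrite /toeplitz_operator mem_set// /ip; congr cintegral.
by apply/funext => x; rewrite /toeplitz_integrand bergman_kernelE// mulr1.
Qed.

Lemma toeplitz_definedP : (forall f, bergman_space w f -> L2 mu one f) -> toeplitz_defined w mu.
Proof.
move=> h f z sf Dz; have := ip_int m1 o0 (h f sf) (kernel_bounded Dz).
by congr cintegrable; apply/funext => x; rewrite /toeplitz_integrand bergman_kernelE// mulr1.
Qed.

(** For fixed z the kernel series converges uniformly on the whole disc, because |z| < 1;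
    Cauchy-Schwarz for the finite measure mu passes to the limit under the integral. *)
Lemma toeplitz_hsum f z : L2 mu one f -> D z -> hsum (tc f) z (toeplitz_operator w mu f z).
Proof.
move=> lf Dz e e0; rewrite toeplitz_ip//.
have ek := kc_ell2 hw Dz; have [K [q [K0 q01 H]]] := kernel_tail hw Dz.
pose B := Qn mu one f * fine (mu D).
have B0 : 0 <= B by rewrite mulr_ge0 ?Qn_ge0 ?fine_ge0.
have eB : 0 < e / (B + 1) by rewrite divr_gt0// ltr_wpDl.
pose d := e / (B + 1).
have [N HN] := geo_small K q01 eB; exists N => M NM.
have lk := kernel_bounded Dz; have lp := L2mu_psum (kc w z) M.
have -> : psum (tc f) M z = ip mu one f (psum (kc w z) M).
 rewrite [in RHS]/psum ip_sum_r//; last exact: L2mu_X.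
 apply: eq_bigr => m _; rewrite /tc /kc.
 rewrite conjM conjX conjK (_ : conjc ((Wm m)%:C^-1) = (Wm m)%:C^-1); last first.
  by rewrite -[((Wm m)%:C)^-1]fmorphV conjc_real.
 by ring.
have -> : ip mu one f (mkf (kc w z)) - ip mu one f (psum (kc w z) M) =
  ip mu one f (fun x => mkf (kc w z) x - psum (kc w z) M x).
 rewrite (_ : (fun x => _ - _) = (fun x => (-1) * psum (kc w z) M x + mkf (kc w z) x)); last first.
  by apply/funext => x; rewrite mulN1r addrC.
 have c1 : conjc (-1) = -1 :> C by apply: eqc; rewrite /= ?oppr0.
 by rewrite ip_linear_r// c1 mulN1r addrC.
have lB := L2B m1 o0 lk lp.
have := ip_CS m1 o0 lf lB.
have {}H x : D x -> normc (mkf (kc w z) x - psum (kc w z) M x) <= d.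
 by move=> Dx; exact: le_trans (H M x Dx) (HN M NM).
have := Qmu_le (proj1 lB) H.
have := Qn_ge0 mu o0 f; have m0 : 0 <= fine (mu D) by exact: fine_ge0.
have x0 := nc_ge0 (ip mu one f (fun x => mkf (kc w z) x - psum (kc w z) M x)).
move: (normc _) x0 => x x0 F0 G1 G2.
have h1 : x ^+ 2 <= d ^+ 2 * B.
 apply: (le_trans G2); rewrite /B mulrCA ler_wpM2l//.
have dB : d * (B + 1) = e by rewrite /d divfK// gt_eqF// ltr_wpDl.
rewrite -(@ler_pXn2r _ 2)// ?nnegrE ?(ltW e0)// (le_trans h1)// -dB.
rewrite [(d * (B + 1)) ^+ 2]exprMn; apply: ler_wpM2l; first by rewrite exprn_ge0// ltW.
by rewrite expr2; nra.
Qed.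

Lemma toeplitz_mkf f : L2 mu one f -> rad (tc f) /\ toeplitz_operator w mu f = mkf (tc f).
Proof.
move=> lf; split; first by apply: (hsum_rad (f := toeplitz_operator w mu f)) => z Dz; exact: toeplitz_hsum.
apply: mkf_uniq => z Dz; first exact: toeplitz_hsum.
by rewrite /toeplitz_operator memNset.
Qed.

End FiniteMeasure.
End ToeplitzCoefficients.

(** * Dyadic cells *)

Section Cells.
Variable R : realType.
Local Notation C := R[i].
Local Notation D := (@unit_disc R).
Local Notation cell := (@dyadic_rectangle R).
Implicit Types (z : C) (t x : R).

Let pi0 : 0 < 2 * pi :> R. Proof. by rewrite mulr_gt0// pi_gt0. Qed.

Lemma sin_le_id x : 0 <= x -> `|sin x| <= x.
Proof.
move=> x0; have cs : {within `[0, x], continuous (@sin R)}.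
 by apply: continuous_subspaceT; exact: continuous_sin.
have [c _] := @MVT_segment R (@sin R) (@cos R) 0 x x0 (fun y _ => is_derive_sin y) cs.
rewrite sin0 !subr0 => ->; rewrite normrM (ger0_norm x0) ler_piMl//.
by rewrite ler_norml cos_geN1 cos_le1.
Qed.

Lemma nc_expi_sub1 x : normc (expi x - 1 : C) <= `|x|.
Proof.
rewrite -(@ler_pXn2r _ 2)// ?nnegrE ?nc_ge0//.
(* The chord of the arc x has length 2 |sin (x / 2)|. *)
have E : normc (expi x - 1 : C) ^+ 2 = (2 * `|sin (`|x| / 2)|) ^+ 2.
 have n2 (r : R) : `|r| ^+ 2 = r ^+ 2 by rewrite -normrX ger0_norm ?sqr_ge0.
 have xE : `|x| = (`|x| / 2) *+ 2 by rewrite mulr2n -splitr.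
 rewrite exprMn n2 nc_sqr /= oppr0 addr0.
 have -> : cos x = cos `|x| by case: (ger0P x) => // _; rewrite cosN.
 have -> : sin x ^+ 2 = sin `|x| ^+ 2 by case: (ger0P x) => // _; rewrite sinN sqrrN.
 rewrite [in LHS]xE cos_mulr2n sin_mulr2n; set y := `|x| / 2.
 have := cos2Dsin2 y; rewrite !mulr2n; move: (cos y) (sin y) => c s h.
 have {h}h : c ^+ 2 = 1 - s ^+ 2 by rewrite -h addrK.
 by rewrite (_ : (c * s + c * s) ^+ 2 = 4 * c ^+ 2 * s ^+ 2); [rewrite h; ring|ring].
rewrite E lerXn2r ?nnegrE ?mulr_ge0//.
by rewrite mulrC -ler_pdivlMr// sin_le_id// divr_ge0.
Qed.

Lemma polar_ex z : exists2 t, 0 <= t < 2 * pi & z = (normc z)%:C * expi t.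
Proof.
have [->|z0] := eqVneq z 0; first by exists 0; rewrite ?lexx ?pi0// normc0 mul0r.
have n0 : 0 < normc z by rewrite nc_gt0.
pose c := cRe z / normc z; pose s := cIm z / normc z.
have cs : c ^+ 2 + s ^+ 2 = 1.
 by rewrite /c /s !exprMn -mulrDl -nc_sqr -exprMn divff ?expr1n// gt_eqF.
have c1 : -1 <= c <= 1.
 by rewrite -ler_norml -(@ler_pXn2r _ 2)// ?nnegrE// -normrX ger0_norm ?sqr_ge0// expr1n -cs lerDl sqr_ge0.
have ca : cos (acos c) = c by rewrite acosK// in_itv.
have sa : sin (acos c) = `|s| by rewrite sin_acos// -cs addrAC subrr add0r sqrtr_sqr.
have zE t : cos t = c -> sin t = s -> z = (normc z)%:C * expi t.
 move=> hc hs; apply: eqc; rewrite ?ReM ?ImM /= hc hs /c /s mul0r ?subr0 ?addr0;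
  by rewrite mulrCA mulfV ?mulr1// gt_eqF.
have a0 := acos_ge0 c1; have ap := acos_lepi c1; have p0 := pi_gt0 R.
have [s0|s0] := leP 0 s.
 exists (acos c); last by apply: zE => //; rewrite sa ger0_norm.
 by rewrite a0/=; lra.
have apos : 0 < acos c.
 rewrite lt_neqAle a0 andbT; apply/eqP => h; move: sa; rewrite -h sin0 => /esym/eqP.
 by rewrite normr_eq0 lt_eqF.
have p2 : 2 * pi = pi *+ 2 :> R by rewrite mulr_natl.
exists (2 * pi - acos c); first by apply/andP; split; lra.
apply: zE; first by rewrite addrC p2 (cosD2pi (- acos c)) cosN.
by rewrite addrC p2 (sinD2pi (- acos c)) sinN sa ltr0_norm// opprK.
Qed.

Lemma expi_inj t t' : 0 <= t < 2 * pi -> 0 <= t' < 2 * pi -> expi t = expi t' :> C -> t = t'.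
Proof.
wlog tt : t t' / t <= t'.
 move=> H h h' E; have [le|/ltW le] := leP t t'; first exact: H.
 by apply/esym; apply: H.
move=> /andP[t0 t1] /andP[t0' t1'] [] ec es; apply/eqP; rewrite eq_le tt/= leNgt; apply/negP => lt.
have h1 : cos (t' - t) = 1 by rewrite cosB ec es -!expr2 cos2Dsin2.
have h2 : 0 < sin ((t' - t) / 2) by apply: sin_gt0_pi; apply/andP; split; lra.
have : cos (((t' - t) / 2) *+ 2) = 1 by rewrite mulr2n -splitr.
rewrite cos_mulr2n; have := cos2Dsin2 ((t' - t) / 2); rewrite mulr2n.
by have := exprn_gt0 2 h2; lra.
Qed.

Definition ang n k : R := 2 * pi * k%:R / 2 ^+ n.

Lemma ang_ge0 n k : 0 <= ang n k. Proof. by rewrite divr_ge0 ?exprn_ge0// mulr_ge0// ltW. Qed.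

Lemma ang_le n k k' : (k <= k')%N -> ang n k <= ang n k'.
Proof. by move=> kk; rewrite ler_wpM2r ?invr_ge0 ?exprn_ge0// ler_wpM2l ?(ltW pi0)// ler_nat. Qed.

Lemma ang_full n : ang n (2 ^ n) = 2 * pi.
Proof. by rewrite /ang natrX mulfK// expf_neq0// pnatr_eq0. Qed.

Lemma angS n k : ang n k.+1 = ang n k + 2 * pi * dy n.
Proof. by rewrite /ang dyV -natr1; ring. Qed.

Lemma ang_double n k : ang n.+1 k.*2 = ang n k.
Proof.
rewrite /ang -muln2 natrM exprS; move: (2 ^+ n) (exprn_gt0 n (ltr0Sn R 1)) => y y0.
by field; rewrite gt_eqF.
Qed.

Lemma zeta_ang n k : zeta R (2 ^ n) ^+ k = expi (ang n k).
Proof. by rewrite zetaX natrX. Qed.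

Let dl n : dyadic_length R n / (2 * pi) = dy n.
Proof.
rewrite /dyadic_length dyV; move: (2 * pi) pi0 => T T0.
by rewrite mulrAC divff ?mul1r// gt_eqF.
Qed.

Let dl2 n : dyadic_length R n / (4 * pi) = dy n.+1.
Proof.
rewrite dyS -dl (_ : 4 * pi = 2 * (2 * pi)) ?invfM; last by ring.
by rewrite mulrCA mulrC.
Qed.

Definition annulus n : set C := [set z | 1 - dy n <= normc z < 1 - dy n.+1].

Definition sector n k : set C :=
 [set z | exists2 t, ang n k <= t < ang n k.+1 & z = (normc z)%:C * expi t].

Lemma cellE n k : cell n k = annulus n `&` sector n k.
Proof.
apply/seteqP; split => z; rewrite /dyadic_rectangle /polar_rectangle /= dl dl2.
 move=> [Dz [_ [t tt <-] zE] h]; split => //; exists t => //.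
move=> [h [t tt zE]]; split => //.
 by case/andP: h => _ /lt_trans; apply; rewrite gtrBl dy_gt0.
by exists (expi t) => //; exists t => //; rewrite ?in_itv.
Qed.

Lemma cell_disc n k : cell n k `<=` D. Proof. by move=> z []. Qed.

Lemma cell_norm n k z : cell n k z -> 1 - dy n <= normc z < 1 - dy n.+1.
Proof. by rewrite cellE => -[]. Qed.

Lemma annulus_inj n n' z : annulus n z -> annulus n' z -> n = n'.
Proof.
wlog nn : n n' / (n <= n')%N.
 by move=> H h h'; have [le|/ltnW le] := leqP n n'; [exact: H|apply/esym/H].
move=> /andP[_ h] /andP[h' _]; apply/eqP; rewrite eqn_leq nn/= leqNgt; apply/negP => lt.
by have := dy_le R lt; move: (le_lt_trans h' h); lra.
Qed.

Lemma cell_inj n k n' k' z : (k < 2 ^ n)%N -> (k' < 2 ^ n')%N ->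
 cell n k z -> cell n' k' z -> (n, k) = (n', k').
Proof.
rewrite !cellE => kn kn' [h [t /andP[t0 t1] zE]] [h' [t' /andP[t0' t1'] zE']].
have E := annulus_inj h h'; rewrite -{}E in t0' t1' kn' h' *.
case: n => [|n] in t0 t1 kn t0' t1' kn' h h' *.
 by move: kn kn'; rewrite expn0 !ltnS !leqn0 => /eqP -> /eqP ->.
have z0 : normc z != 0.
 rewrite gt_eqF//; case/andP: h => h _; apply: lt_le_trans h.
 by rewrite dyS; have := dy_le1 R n; lra.
have tt : t = t'.
 apply: expi_inj.
 - by rewrite (le_trans (ang_ge0 n.+1 k) t0)/= (lt_le_trans t1)// -(ang_full n.+1) ang_le.
 - by rewrite (le_trans (ang_ge0 n.+1 k') t0')/= (lt_le_trans t1')// -(ang_full n.+1) ang_le.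
 - apply: (@mulfI _ (normc z)%:C); last by rewrite -zE -zE'.
  by rewrite eqCR0.
suff -> : k = k' by [].
case: (ltngtP k k') => [kk|kk|//]; exfalso.
 by have := ang_le n.+1 kk; move: t1 t0'; rewrite tt; move: (ang _ _) (ang _ _) => u v; lra.
by have := ang_le n.+1 kk; move: t0 t1'; rewrite tt; move: (ang _ _) (ang _ _) => u v; lra.
Qed.

Lemma cell_cover z : D z -> exists n k, (k < 2 ^ n)%N /\ cell n k z.
Proof.
move=> Dz; have z1 : 0 < 1 - normc z by rewrite subr_gt0.
have ex : exists n, dy n.+1 < 1 - normc z.
 have [n hn] := dy_small (divr_gt0 z1 (ltr0Sn R 1)).
 by exists n; rewrite dyS; have := @dy_gt0 R n; lra.
case: (ex_minnP ex) => n hn hmin.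
have an : annulus n z.
 apply/andP; split; last by lra.
 case: n hn hmin => [|n] hn hmin; first by rewrite /dy expr0 subrr nc_ge0.
 rewrite lerBlDr -lerBlDl leNgt; apply/negP => lt.
 by have := hmin n lt; rewrite ltnn.
have [t /andP[t0 t1] zE] := polar_ex z.
have q0 : 0 < 2 ^+ n :> R by rewrite exprn_gt0.
pose y := t * 2 ^+ n / (2 * pi); have y0 : 0 <= y.
 by rewrite divr_ge0 ?(ltW pi0)// mulr_ge0 ?(ltW q0).
have /andP[k0 k1] := truncn_itv y0; set k := Num.truncn y in k0 k1.
have tE : t = 2 * pi * y / 2 ^+ n.
 rewrite /y; move: (2 * pi) pi0 (2 ^+ n) q0 => T T0 q q0; field; by rewrite !gt_eqF.
exists n, k; split.
 rewrite -(@ltr_nat R) (le_lt_trans k0)// ltr_pdivrMr// natrX mulrC ltr_pM2l//.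
rewrite cellE; split => //; exists t => //; rewrite /ang tE.
apply/andP; split.
 by rewrite ler_wpM2r ?invr_ge0 ?(ltW q0)// ler_wpM2l ?(ltW pi0).
by rewrite ltr_pM2r ?invr_gt0// ltr_pM2l.
Qed.

Let sin_interval (a b t : R) : 0 <= a -> a < b -> b <= 2 * pi -> b - a <= pi / 2 -> 0 <= t < 2 * pi ->
 (0 <= sin (t - a)) && (sin (t - b) < 0) = (a <= t < b).
Proof.
move=> a0 ab b1 ba /andP[t0 t1]; have p0 := pi_gt0 R.
have sn x : - pi < x < 0 -> sin x < 0.
 by move=> h; rewrite -oppr_gt0 -sinN sin_gt0_pi//; lra.
have sn2 x : pi < x < 2 * pi -> sin x < 0.
 move=> h; have := sn (x - 2 * pi); rewrite (_ : 2 * pi = pi *+ 2); last by rewrite mulr_natl.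
 rewrite -(sinD2pi (x - pi *+ 2)) subrK; apply.
 by rewrite -mulr_natl; lra.
have sp x : 0 <= x <= pi -> 0 <= sin x by exact: sin_ge0_pi.
have sp2 x : - (2 * pi) <= x <= - pi -> 0 <= sin x.
 move=> h; rewrite -(sinD2pi x) -mulr_natl; apply: sp; lra.
apply/idP/idP => [/andP[h1 h2]|/andP[h1 h2]]; last first.
 by apply/andP; split; [apply: sp; lra|apply: sn; lra].
apply/andP; split; [rewrite leNgt|rewrite ltNge]; apply/negP => lt.
 have [hl|hl] := ltP (- pi) (t - a).
  by have := sn (t - a); rewrite hl/= subr_lt0 lt ltNge h1 => /(_ isT).
 by move: h2; rewrite ltNge sp2//; apply/andP; split; lra.
have [hl|hl] := leP (t - b) pi.
 by move: h2; rewrite ltNge sp//; apply/andP; split; lra.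
by have := sn2 (t - a); rewrite [sin _ < 0]ltNge h1 => H; have : false by apply: H; apply/andP; split; lra.
Qed.

Let Im_rot z (a t : R) : z = (normc z)%:C * expi t -> cIm (z * conjc (expi a)) = normc z * sin (t - a).
Proof.
by move=> {1}->; rewrite -mulrA ImM /= sinB mul0r addr0; ring.
Qed.

(** Linear description of a sector away from 0, used for measurability; it is correct for openings
    of at most pi / 2, that is, from level 2 on. *)
Definition halfplanes n k : set C :=
 [set z | 0 <= cIm (z * conjc (expi (ang n k))) /\ cIm (z * conjc (expi (ang n k.+1))) < 0].

Lemma sector_halfplanes n k z : (2 <= n)%N -> (k < 2 ^ n)%N -> z != 0 ->
 sector n k z <-> halfplanes n k z.
Proof.
move=> n2 kn z0; have p0 := pi_gt0 R.
have nz : 0 < normc z by rewrite nc_gt0.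
have a0 := ang_ge0 n k; have aS := angS n k.
have d2 : dy n <= 4^-1 :> R.
 by apply: (le_trans (dy_le R n2)); rewrite /dy exprS expr1; lra.
have d0 := @dy_gt0 R n.
have h1 : ang n k < ang n k.+1 by rewrite aS ltrDl mulr_gt0.
have h2 : ang n k.+1 <= 2 * pi by rewrite -(ang_full n) ang_le.
have h3 : ang n k.+1 - ang n k <= pi / 2.
 rewrite aS addrAC subrr add0r (@le_trans _ _ (2 * pi * 4^-1))//; first by rewrite ler_wpM2l// ltW.
 by apply: le_of_eq; field.
have key t : 0 <= t < 2 * pi -> z = (normc z)%:C * expi t ->
  halfplanes n k z <-> ang n k <= t < ang n k.+1.
 move=> tt zE; rewrite -(sin_interval a0 h1 h2 h3 tt) /halfplanes /= !(Im_rot _ zE).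
 rewrite (pmulr_rge0 _ nz) (pmulr_rlt0 _ nz); split; [by move=> [-> ->]|by move=> /andP].
split.
 move=> [t tt zE]; apply/(key t) => //; case/andP: tt => t0 t1.
 by rewrite (le_trans a0 t0) (lt_le_trans t1 h2).
have [t tt zE] := polar_ex z.
by move=> /(key t tt zE) h; exists t.
Qed.

Lemma measurable_annulus n : measurable (annulus n).
Proof.
have -> : annulus n = [set z : C | normc z < 1 - dy n.+1] `\` [set z : C | normc z < 1 - dy n].
 apply/seteqP; split => z /=.
  by move=> /andP[h1 h2]; split => //; apply/negP; rewrite -leNgt.
 by move=> [h1 /negP]; rewrite -leNgt => h2; rewrite /annulus /mkset h2 h1.
by apply: measurableD; exact: measurable_disc.
Qed.

Let mcf_lin (c : C) : measurable_fun [set: C] (fun z : C => cIm (z * c)).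
Proof.
rewrite (_ : (fun z => _) = (fun z => cRe z * cIm c + cIm z * cRe c)); last first.
 by apply/funext => z; rewrite ImM.
by apply: measurable_funD; apply: measurable_funM => //; [exact: measurable_Re|exact: measurable_Im].
Qed.

Lemma measurable_halfplanes n k : measurable (halfplanes n k).
Proof.
have -> : halfplanes n k =
  (fun z : C => cIm (z * conjc (expi (ang n k)))) @^-1` `[0, +oo[ `&`
  (fun z : C => cIm (z * conjc (expi (ang n k.+1)))) @^-1` `]-oo, 0[.
 by apply/seteqP; split => z /=; rewrite !in_itv/= andbT.
by apply: measurableI; rewrite -[X in measurable X]setTI; apply: mcf_lin.
Qed.

(** Level 0 is a full annulus, and a sector of level 1 is the union of two sectors of level 2. *)
Lemma measurable_cell n k : (k < 2 ^ n)%N -> measurable (cell n k).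
Proof.
move=> kn; rewrite cellE; case: n => [|n] in kn *.
 rewrite (_ : _ `&` _ = annulus 0); first exact: measurable_annulus.
 apply/seteqP; split => [z []//|z h]; split => //.
 have [t tt zE] := polar_ex z; exists t => //.
 move: kn; rewrite expn0 ltnS leqn0 => /eqP ->.
 by rewrite /ang mulr0 mul0r expr0 divr1 mulr1.
have z0 z : annulus n.+1 z -> z != 0.
 move=> /andP[h _]; rewrite -nc_gt0; apply: lt_le_trans h.
 by rewrite dyS; have := dy_le1 R n; lra.
case: n => [|n] in kn z0 *.
 have e1 : ang 2 k.*2 = ang 1 k by exact: ang_double.
 have e2 : ang 2 k.*2.+2 = ang 1 k.+1 by rewrite -doubleS; exact: ang_double.
 have k4 : (k.*2.+1 < 2 ^ 2)%N by move: kn; rewrite !expnS expn0; lia.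
 rewrite (_ : _ `&` _ = annulus 1 `&` (halfplanes 2 k.*2 `|` halfplanes 2 k.*2.+1)).
  by apply: measurableI; [exact: measurable_annulus|apply: measurableU; exact: measurable_halfplanes].
 apply/seteqP; split => z [h hz]; split => //.
  case: hz => t /andP[t0 t1] zE; have [lt|le] := ltP t (ang 2 k.*2.+1).
   by left; apply/sector_halfplanes => //; [exact: ltnW|exact: z0|exists t => //; rewrite e1 t0].
  by right; apply/sector_halfplanes => //; [exact: z0|exists t => //; rewrite e2 le].
 case: hz => /sector_halfplanes[]//; try (exact: z0); try exact: ltnW.
  move=> t /andP[t0 t1] zE; exists t => //; rewrite -e1 t0 (lt_le_trans t1)// -e2 ang_le//.
 by move=> t /andP[t0 t1] zE; exists t => //; rewrite -e2 t1 andbT (le_trans _ t0)// -e1 ang_le.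
rewrite (_ : _ `&` _ = annulus n.+2 `&` halfplanes n.+2 k).
 by apply: measurableI; [exact: measurable_annulus|exact: measurable_halfplanes].
by apply/seteqP; split => z [h hz]; split => //; apply/sector_halfplanes => //; exact: z0.
Qed.

(** The radius contributes at most dy n and the angle at most 2 pi dy n, with 2 pi < 8. *)
Lemma cell_node n k z : cell n k z -> normc (1 - z * conjc (zeta R (2 ^ n) ^+ k)) <= 9 * dy n.
Proof.
rewrite cellE zeta_ang => -[/andP[h1 h2] [t /andP[t0 t1] zE]].
have -> : z * conjc (expi (ang n k)) = (normc z)%:C * expi (t - ang n k).
 by rewrite {1}zE expiB mulrA.
rewrite (_ : _ - _ = (1 - (normc z)%:C) - (normc z)%:C * (expi (t - ang n k) - 1)); last by ring.
have d0 := @dy_gt0 R n; have d1 := @dy_gt0 R n.+1.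
apply: (le_trans (ncB _ _)); rewrite normcM nc_real ger0_norm ?nc_ge0//.
rewrite (_ : 1 - (normc z)%:C = (1 - normc z)%:C); last by rewrite RCB.
rewrite nc_real ger0_norm; last by lra.
have e1 := nc_expi_sub1 (t - ang n k); rewrite ger0_norm ?subr_ge0// in e1.
have e2 : normc z * normc (expi (t - ang n k) - 1 : C) <= 8 * dy n.
 apply: (@le_trans _ _ (1 * (2 * pi * dy n))).
  apply: ler_pM; rewrite ?nc_ge0//; first by lra.
  by apply: (le_trans e1); move: t1; rewrite angS; lra.
 rewrite mul1r ler_wpM2r ?(ltW d0)//; have := pihalf_lt2 R; lra.
lra.
Qed.

End Cells.

(** * From the Schatten class to the cell sums *)

Section DiagonalDominance.
Variable R : realType.
Local Notation C := R[i].

(* A colouring minimizing the monochromatic weight: moving [k] to another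
  colour cannot decrease it, so averaging over the colours bounds each
  monochromatic row sum. *)
Lemma coloring (N M : nat) (A : 'I_N -> 'I_N -> R) : (forall k l, A k l = A l k) ->
 exists chi : 'I_N -> 'I_M.+1, forall k,
  M.+1%:R * \sum_(l | (l != k) && (chi l == chi k)) A k l <= \sum_(l | l != k) A k l.
Proof.
move=> sA.
pose S (chi : 'I_N -> 'I_M.+1) k c := \sum_(l | (l != k) && (chi l == c)) A k l.
pose Phi (chi : {ffun 'I_N -> 'I_M.+1}) := \sum_k S chi k (chi k).
pose chi0 : {ffun 'I_N -> 'I_M.+1} := [ffun=> ord0].
case: (@arg_minP _ _ _ chi0 predT Phi isT) => chi _ hmin.
exists chi => k.
pose rest (x : {ffun 'I_N -> 'I_M.+1}) :=
 \sum_(i | i != k) \sum_(l | [&& l != i, x l == x i & l != k]) A i l.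
have split (x : {ffun 'I_N -> 'I_M.+1}) : Phi x = S x k (x k) + S x k (x k) + rest x.
 rewrite /Phi (bigD1 k)//= -addrA; congr (_ + _).
 have E i : i != k -> S x i (x i) =
   (if x i == x k then A k i else 0) + \sum_(l | [&& l != i, x l == x i & l != k]) A i l.
  move=> ik; rewrite /S (bigID (fun l => l == k))/=; congr (_ + _); last first.
   by apply: eq_bigl => l; rewrite andbA.
  case: ifPn => h.
   rewrite (big_pred1 k) ?(sA k)// => l /=; have [->|lk] := eqVneq l k; last by rewrite ?andbF.
   by have ki : k != i; [rewrite eq_sym|rewrite ki (eq_sym (x k)) h].
  rewrite big_pred0// => l; apply/negP => /andP[/andP[_ h1] /eqP lk].
  by move: h; rewrite -lk eq_sym h1.
 rewrite (eq_bigr _ E) big_split/=; congr (_ + _).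
 by rewrite -big_mkcondr/=; apply: eq_bigl.
have le c : S chi k (chi k) <= S chi k c.
 pose chi' : {ffun 'I_N -> 'I_M.+1} := [ffun l => if l == k then c else chi l].
 have := hmin chi' isT; rewrite !split.
 have -> : rest chi' = rest chi.
  apply: eq_bigr => i ik; apply: eq_bigl => l; rewrite !ffunE (negbTE ik).
  by case: (eqVneq l k) => lk; rewrite ?andbF.
 have -> : S chi' k (chi' k) = S chi k c.
  rewrite /S !ffunE eqxx; apply: eq_bigl => l; rewrite ffunE.
  by case: eqVneq.
 move: (S _ _ _) (S _ _ _) (rest _) => x y z; lra.
apply: (@le_trans _ _ (\sum_c S chi k c)).
 rewrite -/(S chi k (chi k)); apply: (@le_trans _ _ (\sum_(c < M.+1) S chi k (chi k))).
  by rewrite sumr_const card_ord mulr_natl.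
 by apply: ler_sum => c _; exact: le.
apply: le_of_eq; rewrite /S.
rewrite (exchange_big_dep (fun l => l != k))/=; last by move=> c l _ /andP[].
apply: eq_bigr => l lk; rewrite (big_pred1 (chi l))// => c.
by rewrite lk /= eq_sym.
Qed.

(** Chebyshev's inequality keeps at least half of the rows, those with sum at most 2 B; [coloring]
    divides the off-diagonal sums by the number of colours, and the largest colour class loses only
    that same factor in cardinality. *)
Lemma good_subset (N M : nat) (A : 'I_N -> 'I_N -> R) (B : R) : 0 < B ->
 (forall k l, A k l = A l k) -> (forall k l, 0 <= A k l) ->
 \sum_k \sum_l A k l <= B * N%:R ->
 exists S : {set 'I_N}, (N <= 2 * M.+1 * #|S|)%N /\
  forall k, k \in S -> M.+1%:R * \sum_(l in S | l != k) A k l <= 2 * B.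
Proof.
move=> B0 sA A0 hA; have [chi hchi] := coloring M sA.
pose G := [set k | \sum_l A k l <= 2 * B]%SET.
have G1 : (N <= 2 * #|G|)%N.
 have h1 : (2 * B) * #|(~: G)%SET|%:R <= B * N%:R.
  apply: le_trans hA; rewrite (bigID (mem (~: G)%SET))/= ler_wpDr//.
   by apply: sumr_ge0 => k _; apply: sumr_ge0.
  rewrite mulr_natr -sumr_const; apply: ler_sum => k.
  by rewrite !inE -ltNge => /ltW.
 have h2 : (2 * #|(~: G)%SET| <= N)%N.
  by rewrite -(ler_nat R) natrM -(ler_pM2l B0) mulrA [B * 2]mulrC.
 by move: (cardsC G); rewrite card_ord; lia.
pose Gc c := [set k in G | chi k == c]%SET.
have [c hc] : exists c, (#|G| <= M.+1 * #|Gc c|)%N.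
 apply/existsP; apply: contraT; rewrite negb_exists => /forallP h.
 have E : #|G| = (\sum_c #|Gc c|)%N.
  rewrite -sum1_card (partition_big chi predT)//=; apply: eq_bigr => c _.
  by rewrite -sum1_card; apply: eq_bigl => k; rewrite !inE.
 have : (\sum_(c < M.+1) M.+1 * #|Gc c| <= \sum_(c < M.+1) #|G|.-1)%N.
  by apply: leq_sum => c _; have := h c; rewrite -ltnNge; case: #|G|.
 rewrite -big_distrr/= -E big_const_ord iter_addn_0 mulnC leq_pmul2r//.
 by have := h ord0; rewrite -ltnNge; case: #|G| => // n _; rewrite ltnn.
exists (Gc c); split.
 by apply: (leq_trans G1); rewrite -mulnA leq_mul2l.
move=> k; rewrite !inE => /andP[kG /eqP kc].
have h0 : \sum_(l | l != k) A k l <= 2 * B.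
 by apply: le_trans kG; rewrite [leRHS](bigID (fun l => l != k))/= lerDl sumr_ge0.
apply: le_trans h0; apply: le_trans (hchi k); rewrite ler_wpM2l//.
rewrite [leRHS](bigID (fun l => l \in G))/= ler_wpDr ?sumr_ge0//.
apply: le_of_eq; apply: eq_bigl => l.
by rewrite !inE kc; case: (l == k); rewrite ?andbF ?andbT//= andbC.
Qed.

Lemma exists_kernel (r N : nat) (a : 'I_N -> 'I_r -> C) : (r < N)%N ->
 exists2 c : 'I_N -> C, exists k, c k != 0 & forall i, \sum_k c k * a k i = 0.
Proof.
move=> rN; pose A : 'M[C]_(N, r) := \matrix_(k, i) a k i.
have : kermx A != 0.
 rewrite -mxrank_eq0 mxrank_ker -lt0n subn_gt0.
 exact: leq_ltn_trans (rank_leq_col A) rN.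
move=> /matrix0Pn[i [j hij]]; exists (fun k => kermx A i k); first by exists j.
move=> i1; have := congr1 (fun X : 'M[C]_(N, r) => X i i1) (mulmx_ker A).
rewrite [LHS]mxE [RHS]mxE => E; rewrite -[RHS]E; apply: eq_bigr => k _.
by rewrite [A k i1]mxE.
Qed.

Lemma nc_sum_sqr_lb (T : finType) (S : {set T}) (x : T -> C) :
 \sum_(k in S) normc (x k) ^+ 2 - \sum_(k in S) \sum_(l in S | l != k) normc (x k) * normc (x l)
 <= normc (\sum_(k in S) x k) ^+ 2.
Proof.
have E : normc (\sum_(k in S) x k) ^+ 2 =
  \sum_(k in S) \sum_(l in S) cRe (x k * conjc (x l)).
 have e1 : normc (\sum_(k in S) x k) ^+ 2 = cRe ((\sum_(k in S) x k) * conjc (\sum_(k in S) x k)).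
  by rewrite mul_conj.
 rewrite e1 conj_sum mulr_suml Re_sum; apply: eq_bigr => k _.
 by rewrite mulr_sumr Re_sum.
rewrite E -sumrB; apply: ler_sum => k kS.
rewrite [leRHS](bigD1 k)//= mul_conj lerD//.
rewrite -sumrN; apply: ler_sum => l _.
have := nc_Re (x k * conjc (x l)); rewrite normcM nc_conj ler_norml => /andP[].
by [].
Qed.

(** Off the diagonal x_k x_l <= (x_k^2 + x_l^2) / 2, and symmetry turns both halves into row
    sums. *)
Lemma dominance (T : finType) (S : {set T}) (x : T -> R) (a : T -> T -> R) (c d : R) :
 (forall k l, a k l = a l k) -> (forall k, k \in S -> c <= a k k) ->
 (forall k l, 0 <= a k l) ->
 (forall k, k \in S -> \sum_(l in S | l != k) a k l <= d) ->
 (c - d) * \sum_(k in S) x k ^+ 2 <=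
 \sum_(k in S) x k ^+ 2 * a k k - \sum_(k in S) \sum_(l in S | l != k) x k * x l * a k l.
Proof.
move=> sa ha a0 hd; rewrite mulrBl lerB//.
 by rewrite mulr_sumr; apply: ler_sum => k kS; rewrite mulrC ler_wpM2l ?sqr_ge0// ha.
apply: (@le_trans _ _ (\sum_(k in S) \sum_(l in S | l != k)
  (2^-1 * (x k ^+ 2 * a k l) + 2^-1 * (x l ^+ 2 * a k l)))).
 apply: ler_sum => k _; apply: ler_sum => l _.
 by have := mulr_ge0 (a0 k l) (sqr_ge0 (x k - x l)); rewrite sqrrB mulrDr mulrBr; lra.
under eq_bigr do rewrite big_split/=.
rewrite big_split/=.
have -> : \sum_(k in S) \sum_(l in S | l != k) 2^-1 * (x l ^+ 2 * a k l) =
     \sum_(k in S) \sum_(l in S | l != k) 2^-1 * (x k ^+ 2 * a k l).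
 rewrite (exchange_big_dep (mem S))/=; last by move=> k l _ /andP[].
 apply: eq_bigr => l lS; apply: eq_big => [k|k _]; last by rewrite sa.
 by rewrite lS eq_sym.
rewrite -big_split/= mulr_sumr; apply: ler_sum => k kS.
rewrite -big_split/= (eq_bigr (fun l => x k ^+ 2 * a k l)) => [|l _]; last by field.
by rewrite -mulr_sumr mulrC ler_wpM2r ?sqr_ge0// hd.
Qed.

Lemma sum_divn (s : nat -> R) (d N : nat) :
 \sum_(k < d * N) s (k %/ d)%N = d%:R * \sum_(r < N) s r.
Proof.
elim: N => [|N IH]; first by rewrite muln0 !big_ord0 mulr0.
rewrite mulnS addnC big_split_ord/= IH big_ord_recr/= mulrDr; congr (_ + _).
rewrite (eq_bigr (fun=> s N)) => [|i _]; first by rewrite sumr_const card_ord mulr_natl.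
by rewrite mulnC divnMDl ?(leq_ltn_trans _ (ltn_ord i))// divn_small ?addn0.
Qed.

Lemma seq_min (T : eqType) (m : T -> R) (F : seq T) : (0 < size F)%N ->
 exists2 j0, j0 \in F & forall j, j \in F -> m j0 <= m j.
Proof.
elim: F => // a F IH _; case: F IH => [_|b F /(_ isT)[j1 j1F hj1]].
 by exists a; rewrite ?mem_head// => j; rewrite inE => /eqP ->.
have [le|/ltW le] := leP (m a) (m j1).
 exists a; rewrite ?mem_head// => j; rewrite inE => /predU1P[-> //|/hj1].
 exact: le_trans.
exists j1; first by rewrite inE j1F orbT.
by move=> j; rewrite inE => /predU1P[-> //|/hj1].
Qed.

(* Remove from [F] the index of a minimal value. *)
Lemma decreasing_sum (T : choiceType) (m : T -> R) (s : nat -> R) (eta p : R) (d : nat) :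
 0 < p -> 0 < eta -> (0 < d)%N -> (forall j, 0 <= m j) -> (forall r, 0 <= s r) ->
 (forall (F : seq T) (t : R) r, uniq F -> 0 < t -> (forall j, j \in F -> t < m j) ->
   (r * d < size F)%N -> eta * t <= s r) ->
 forall F : seq T, uniq F -> \sum_(j <- F) m j `^ p <= eta^-1 `^ p * \sum_(k < size F) s (k %/ d)%N `^ p.
Proof.
move=> p0 e0 d0 m0 s0 H F; elim: {F}(size F) {-2}F (erefl (size F)) => [|n IH] F sF uF.
 by move/size0nil: sF => ->; rewrite big_nil big_ord0 mulr0.
have Fn0 : (0 < size F)%N by rewrite sF.
have [j0 j0F hj0] := seq_min m Fn0.
rewrite sF (big_rem j0)//= big_ord_recr/= mulrDr addrC lerD//.
 have sr : size (rem j0 F) = n by rewrite size_rem// sF.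
 by rewrite -sr; apply: IH => //; exact: rem_uniq.
have e1 : 0 < eta^-1 by rewrite invr_gt0.
have [z|z] := eqVneq (m j0) 0; first by rewrite z powR0 ?gt_eqF// mulr_ge0 ?powR_ge0.
have mp : 0 < m j0 by rewrite lt_neqAle eq_sym z m0.
rewrite -powRM ?(ltW e1)//; apply: ge0_ler_powR; rewrite ?nnegrE ?(ltW p0) ?mulr_ge0 ?(ltW e1)//.
rewrite mulrC ler_pdivlMr// mulrC.
have key t : 0 < t -> t < m j0 -> eta * t <= s (n %/ d)%N.
 move=> t0 tm; apply: (H F) => //; first by move=> j /hj0; exact: lt_le_trans.
 by rewrite sF ltnS leq_divM.
(* The hypothesis concerns thresholds strictly below [m j0]; the midpoint [t] excludes a gap. *)
rewrite leNgt; apply/negP => lt.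
pose t := (s (n %/ d)%N / eta + m j0) / 2.
have h1 : s (n %/ d)%N / eta < m j0 by rewrite ltr_pdivrMr// mulrC.
have h2 : 0 <= s (n %/ d)%N / eta by rewrite divr_ge0// ltW.
have := key t; rewrite /t; move: h1 h2; set y := _ / eta => h1 h2.
have sE : s (n %/ d)%N = eta * y by rewrite /y mulrCA mulfV ?mulr1// gt_eqF.
have t0 : 0 < (y + m j0) / 2 by lra.
have t1 : (y + m j0) / 2 < m j0 by lra.
by move=> /(_ t0 t1); rewrite sE ler_pM2l//; lra.
Qed.

End DiagonalDominance.

(** * Dirichlet kernels and atoms *)

Section Dirichlet.
Variable R : realType.
Local Notation C := R[i].
Implicit Types (u z : C).

Definition dir l u : C := \sum_(m < l) u ^+ m.

(** Coefficients of the squared Dirichlet kernel. *)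
Definition ec l i : nat := (\sum_(a < l) \sum_(b < l) ((a + b)%N == i))%N.

Lemma dir_sqr l u : dir l u ^+ 2 = \sum_(i < 2 * l) (ec l i)%:R * u ^+ i.
Proof.
rewrite expr2 /dir mulr_suml.
under [RHS]eq_bigr => i _.
 rewrite /ec natr_sum mulr_suml; under eq_bigr => a _ do rewrite natr_sum mulr_suml.
 over.
rewrite exchange_big; apply: eq_bigr => a _; rewrite mulr_sumr exchange_big.
apply: eq_bigr => b _.
have ab : (a + b < 2 * l)%N by rewrite mul2n -addnn; have := ltn_ord a; have := ltn_ord b; lia.
rewrite (bigD1 (Ordinal ab))//= eqxx mul1r big1 ?addr0 ?exprD// => i.
by rewrite -val_eqE/= eq_sym => /negbTE ->; rewrite mul0r.
Qed.

Lemma ec_le l i : (ec l i <= l)%N.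
Proof.
rewrite -[leqRHS]card_ord -sum1_card; apply: leq_sum => a _.
have [b /eqP ab|h] := pickP (fun b : 'I_l => (a + b)%N == i).
 rewrite (bigD1 b)//= ab eqxx big1// => b' bb'.
 apply/eqP; rewrite eqb0; apply: contra bb' => /eqP h.
 by apply/eqP/val_inj => /=; lia.
by rewrite big1// => b _; rewrite h.
Qed.

Lemma nc_dir_le l u : normc u <= 1 -> normc (dir l u) <= l%:R.
Proof.
move=> u1; rewrite (le_trans (nc_sum _ _ _))//.
rewrite -[leRHS](_ : \sum_(m < l) (1 : R) = _); last by rewrite sumr_const card_ord.
by apply: ler_sum => m _; rewrite ncX exprn_ile1 ?nc_ge0.
Qed.

Lemma nc_pow_sub1 m u : normc u <= 1 -> normc (1 - u ^+ m) <= m%:R * normc (1 - u).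
Proof.
move=> u1; elim: m => [|m IH]; first by rewrite expr0 subrr normc0 mul0r.
rewrite (_ : 1 - u ^+ m.+1 = (1 - u) + u * (1 - u ^+ m)); last by rewrite exprS; ring.
rewrite (le_trans (ncD _ _))// -natr1 mulrDl mul1r addrC lerD// normcM.
by apply: le_trans IH; rewrite ler_piMl ?nc_ge0.
Qed.

Lemma nc_dir_ge l u : normc u <= 1 -> l%:R * (1 - l%:R * normc (1 - u)) <= normc (dir l u).
Proof.
move=> u1.
have h : normc (l%:R - dir l u) <= l%:R * (l%:R * normc (1 - u)).
 rewrite (_ : l%:R - dir l u = \sum_(m < l) (1 - u ^+ m)); last first.
  by rewrite sumrB sumr_const card_ord.
 rewrite (le_trans (nc_sum _ _ _))//.
 apply: (@le_trans _ _ (\sum_(m < l) l%:R * normc (1 - u))).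
  apply: ler_sum => m _; rewrite (le_trans (nc_pow_sub1 _ u1))//.
  by rewrite ler_wpM2r ?nc_ge0// ler_nat ltnW.
 by rewrite sumr_const card_ord -[leLHS]mulr_natl.
have := ncB_ge (l%:R : C) (l%:R - dir l u); rewrite opprB addrCA subrr addr0.
have -> : normc (l%:R : C) = l%:R :> R by rewrite -(rmorph_nat (real_complex R)) nc_real ger0_norm.
lra.
Qed.

Lemma band_sum (V : nmodType) (F : nat -> V) L :
 \sum_(m < 2 ^ L.+1) F m = F 0%N + F 1%N + \sum_(n < L) \sum_(i < 2 ^ n.+1) F (2 ^ n.+1 + i)%N.
Proof.
elim: L => [|L IH].
 by rewrite big_ord0 addr0 expn1 !big_ord_recl big_ord0 addr0.
rewrite [in LHS]expnS mul2n -addnn big_split_ord/= IH big_ord_recr/=.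
by rewrite addrA.
Qed.

Lemma trunc_log_band n i : (i < 2 ^ n)%N -> trunc_log 2 (2 ^ n + i) = n.
Proof.
move=> h; apply: trunc_log_eq => //; rewrite leq_addr/= expnS mul2n -addnn ltn_add2l.
exact: h.
Qed.
(** From one level to the next [sg] drops at least by this factor, as [hat] is nonincreasing; it
    serves as the rate of decay in the level. *)
Definition rho : R := Num.sqrt 2^-1.
Lemma rho_gt0 : 0 < rho. Proof. by rewrite sqrtr_gt0 invr_gt0. Qed.
Lemma rho_sqr : rho ^+ 2 = 2^-1. Proof. by rewrite sqr_sqrtr. Qed.
Lemma rho_lt1 : rho < 1.
Proof. by rewrite -(@ltr_pXn2r _ 2)// ?nnegrE ?(ltW rho_gt0)// rho_sqr expr1n invf_lt1// ltr1n. Qed.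
End Dirichlet.
Arguments rho {R}.

Section Atoms.
Variables (R : realType) (w : R[i] -> R).
Hypothesis hw : class_Dhat w.
Local Notation C := R[i].
Local Notation D := (@unit_disc R).
Local Notation Wm := (Wm w).
Local Notation Hn := (Hn w).
Implicit Types (z : C) (c : nat -> nat -> C).

(** Comparable to the square root of the associated weight at the dyadic points of level n. *)
Definition sg n : R := Num.sqrt (dy n * Hn n).

Lemma sg_gt0 n : 0 < sg n.
Proof. by rewrite sqrtr_gt0 mulr_gt0 ?dy_gt0// Hn_gt0. Qed.

Lemma sg_sqr n : sg n ^+ 2 = dy n * Hn n.
Proof. by rewrite sqr_sqrtr// mulr_ge0 ?dy_ge0// ltW// Hn_gt0. Qed.

Definition node n k : C := zeta R (2 ^ (n + 5)) ^+ k.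

Lemma nc_node n k : normc (node n k) = 1.
Proof. by rewrite /node ncX nc_zeta expr1n. Qed.

(** The factor z^(2^(n+1)) places the frequencies in the band from 2^(n+1) up to 2^(n+2), so atoms
    of different levels are orthogonal. Squaring the Dirichlet kernel makes the atoms of one level
    summable at a point; the size at the peak is about 1 / sg n. *)
Definition atom n k z : C :=
 (dy n / sg n)%:C * z ^+ (2 ^ n.+1) * (dir (2 ^ n) (z * conjc (node n k)) ^+ 2 / (2 ^ n)%:R).

Definition gcn c n i : C :=
 (dy n / sg n)%:C * ((ec (2 ^ n) i)%:R / (2 ^ n)%:R) *
 \sum_(k < 2 ^ (n + 5)) c n k * conjc (node n k) ^+ i.

(** Taylor coefficients of the combination of atoms with coefficients [c], see [synth]. The band of
    [m] has number [(trunc_log 2 m).-1]; the frequencies 0 and 1 lie in no band. *)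
Definition gc c m : C := let n := (trunc_log 2 m).-1 in
 if (m < 2)%N then 0 else gcn c n (m - 2 ^ n.+1)%N.

Lemma gc_band c n i : (i < 2 ^ n.+1)%N -> gc c (2 ^ n.+1 + i)%N = gcn c n i.
Proof.
move=> h; rewrite /gc trunc_log_band//= ltnNge.
by rewrite (leq_trans _ (leq_addr _ _)) ?addKn// expnS leq_pmulr// expn_gt0.
Qed.

Lemma gc_fin c L : (forall n k, (L <= n)%N -> c n k = 0) -> forall m, (2 ^ L.+1 <= m)%N -> gc c m = 0.
Proof.
move=> h m hm; rewrite /gc; case: ifPn => // m2; rewrite /gcn big1 ?mulr0// => k _.
rewrite h ?mul0r//.
have : (L.+1 <= trunc_log 2 m)%N by apply: trunc_log_max.
by case: (trunc_log 2 m).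
Qed.

Lemma synth c L z :
 psum (gc c) (2 ^ L.+1) z = \sum_(n < L) \sum_(k < 2 ^ (n + 5)) c n k * atom n k z.
Proof.
rewrite /psum (band_sum (fun m => gc c m * z ^+ m)).
have -> : gc c 0 = 0 by [].
have -> : gc c 1 = 0 by [].
rewrite !mul0r !add0r.
apply: eq_bigr => n _.
under eq_bigr => i _ do rewrite gc_band// /gcn.
rewrite (eq_bigr (fun i : 'I_(2 ^ n.+1) => \sum_(k < 2 ^ (n + 5))
  c n k * ((dy n / sg n)%:C * z ^+ (2 ^ n.+1) / (2 ^ n)%:R * ((ec (2 ^ n) i)%:R * (z * conjc (node n k)) ^+ i)))).
 rewrite exchange_big; apply: eq_bigr => k _.
 rewrite -mulr_sumr -mulr_sumr; congr (_ * _).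
 rewrite /atom dir_sqr (_ : 2 * 2 ^ n = 2 ^ n.+1)%N; last by rewrite expnS.
 by move: (\sum_(i < _) _) => X; ring.
move=> i _; rewrite mulr_sumr mulr_suml; apply: eq_bigr => k _.
by rewrite exprMn exprD; ring.
Qed.

(** The bands are disjoint, so levels do not interact; inside a band [parseval_dual] bounds the sum
    over the nodes. The factor 32 is the oversampling 2^5 of [node]. *)
Lemma gc_norm : exists2 B : R, 0 < B & forall c L,
 \sum_(m < 2 ^ L.+1) normc (gc c m) ^+ 2 * Wm m <=
 B * \sum_(n < L) \sum_(k < 2 ^ (n + 5)) normc (c n k) ^+ 2.
Proof.
have [C1 C10 HW] := Wm_ub hw; exists (32 * C1); first by rewrite mulr_gt0.
move=> c L; rewrite (band_sum (fun m => normc (gc c m) ^+ 2 * Wm m)).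
have -> : gc c 0 = 0 by [].
have -> : gc c 1 = 0 by [].
rewrite normc0 expr0n !mul0r !add0r mulr_sumr; apply: ler_sum => n _.
have s0 := sg_gt0 n; have d0 := @dy_gt0 R n.
pose S i := \sum_(k < 2 ^ (n + 5)) c n k * conjc (node n k) ^+ i.
have q0 : 0 < dy n * Hn n by rewrite mulr_gt0// Hn_gt0.
have nd : dy n * (2 ^ n)%:R = 1 :> R by exact: dy_nat.
apply: (@le_trans _ _ (\sum_(i < 2 ^ n.+1) (dy n * C1) * normc (S i) ^+ 2)).
 apply: ler_sum => i _; rewrite gc_band// /gcn -/(S i).
 have hW : Wm (2 ^ n.+1 + i)%N <= C1 * Hn n.
  rewrite (le_trans (HW n.+1 _ (leq_addr _ _)))// ler_wpM2l ?(ltW C10)//.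
  exact: Hn_noninc.
 have e1 : normc ((ec (2 ^ n) i)%:R / (2 ^ n)%:R : C) <= 1.
  rewrite normcM normcV -!(rmorph_nat (real_complex R)) !nc_real !ger0_norm//.
  by rewrite ler_pdivrMr ?mul1r ?ler_nat ?ec_le// ltr0n expn_gt0.
 rewrite normcM [normc (_ * (_ / _))]normcM nc_real ger0_norm; last by rewrite divr_ge0// ltW.
 apply: (@le_trans _ _ ((dy n / sg n * 1 * normc (S i)) ^+ 2 * (C1 * Hn n))).
  have A0 : 0 <= dy n / sg n by rewrite divr_ge0// ltW.
  apply: ler_pM => //; first by rewrite exprn_ge0// mulr_ge0 ?nc_ge0// mulr_ge0 ?nc_ge0.
   by rewrite ltW// Wm_gt0.
  apply: lerXn2r; rewrite ?nnegrE; [by rewrite mulr_ge0 ?nc_ge0// mulr_ge0 ?nc_ge0|by rewrite mulr_ge0 ?nc_ge0// mulr_ge0|].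
  by rewrite ler_wpM2r ?nc_ge0// ler_wpM2l.
 rewrite mulr1 !exprMn exprVn sg_sqr; have h0 := Hn_gt0 hw n.
 apply: le_of_eq; move: (normc (S i)) (dy n) d0 (Hn n) h0 => x y y0 h h0.
 by field; rewrite !gt_eqF.
rewrite -mulr_sumr (_ : 32 * C1 * _ = C1 * (32 * \sum_(k < 2 ^ (n + 5)) normc (c n k) ^+ 2)); last by ring.
rewrite [dy n * C1]mulrC -[leLHS]mulrA ler_wpM2l ?(ltW C10)//.
have nn : (2 ^ n.+1 <= 2 ^ (n + 5))%N by rewrite leq_exp2l// -addn1 leq_add2l.
rewrite (big_ord_widen _ (fun i => normc (S i) ^+ 2) nn).
have := parseval_dual (fun k : 'I_(2 ^ (n + 5)) => c n k) (fun i => (i < 2 ^ n.+1)%N).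
rewrite -/(node _ _) => /(ler_wpM2l (ltW d0)) h; apply: (le_trans h).
rewrite mulrA expnD natrM mulrA nd mul1r ler_wpM2r// ?sumr_ge0// => k _.
by rewrite exprn_ge0 ?nc_ge0.
Qed.

Lemma mcf_atom n k : @mcf R (atom n k).
Proof.
have E : atom n k = fun z => ((dy n / sg n)%:C * z ^+ (2 ^ n.+1)) *
  (psum (fun m => conjc (node n k) ^+ m) (2 ^ n) z * psum (fun m => conjc (node n k) ^+ m) (2 ^ n) z * (2 ^ n)%:R^-1).
 apply/funext => z; rewrite /atom expr2 /dir /psum.
 by under eq_bigr => m _ do rewrite exprMn mulrC.
rewrite E; apply: mcfM.
 by apply: mcfM; [exact: mcf_cst|exact: mcf_X].
by apply: mcfM; [apply: mcfM; exact: mcf_psum|exact: mcf_cst].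
Qed.

Lemma nc_nat l : normc (l%:R : C) = l%:R :> R.
Proof. by rewrite -(rmorph_nat (real_complex R)) nc_real ger0_norm. Qed.

Let A0 n : 0 <= dy n / sg n.
Proof. by rewrite divr_ge0 ?dy_ge0// ltW// sg_gt0. Qed.

Lemma nc_atom n k z : normc (atom n k z) = dy n / sg n * normc z ^+ (2 ^ n.+1) *
 (normc (dir (2 ^ n) (z * conjc (node n k))) ^+ 2 / (2 ^ n)%:R).
Proof.
rewrite /atom normcM [normc (_ * z ^+ _)]normcM [normc (_ / _)]normcM normcV nc_nat.
by rewrite ncX ncX nc_real ger0_norm.
Qed.

Let dyE n : dy n = ((2 ^ n)%:R)^-1 :> R. Proof. by rewrite dyV natrX. Qed.
Let p0 n : 0 < (2 ^ n)%:R :> R. Proof. by rewrite ltr0n expn_gt0. Qed.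

Lemma atom_bounded n k z : D z -> normc (atom n k z) <= (sg n)^-1.
Proof.
move=> Dz; have s0 := sg_gt0 n.
have z1 : normc z <= 1 by exact: ltW.
have u1 : normc (z * conjc (node n k)) <= 1 by rewrite normcM nc_conj nc_node mulr1.
have h := nc_dir_le (2 ^ n) u1; have q0 := p0 n.
rewrite nc_atom; apply: (@le_trans _ _ (dy n / sg n * 1 * ((2 ^ n)%:R ^+ 2 / (2 ^ n)%:R))).
 apply: ler_pM.
 - by rewrite mulr_ge0// exprn_ge0// nc_ge0.
 - by rewrite divr_ge0 ?exprn_ge0 ?nc_ge0.
 - by apply: ler_wpM2l => //; rewrite exprn_ile1 ?nc_ge0.
 - by rewrite ler_wpM2r ?invr_ge0// lerXn2r ?nnegrE ?nc_ge0.
rewrite dyE; apply: le_of_eq.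
move: ((2 ^ n)%:R) q0 (sg n) s0 {h} => y y0 x x0; by field; rewrite !gt_eqF.
Qed.

(** Five extra levels make |1 - u| at most 9/32 of 2^-n, so the kernel keeps half of its maximum
    2^n, and the factor z^(2^(n+1)) keeps modulus at least 1/2; hence 8 = 2 * 2^2. *)
Lemma atom_lb n k z : dyadic_rectangle (n + 5) k z -> (8 * sg n)^-1 <= normc (atom n k z).
Proof.
move=> cz; have s0 := sg_gt0 n; have d0 := @dy_gt0 R n; have q0 := p0 n.
have Dz := cell_disc cz; have z1 : normc z <= 1 by exact: ltW.
have u1 : normc (z * conjc (node n k)) <= 1 by rewrite normcM nc_conj nc_node mulr1.
have nd : dy n * (2 ^ n)%:R = 1 :> R by exact: dy_nat.
have d5 : dy (n + 5) = dy n / 32 :> R by rewrite dyD {2}/dy !exprS expr0; field.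
have hn := cell_node cz; rewrite -/(node n k) d5 in hn.
have hd : (2 ^ n)%:R / 2 <= normc (dir (2 ^ n) (z * conjc (node n k))).
 apply: le_trans (nc_dir_ge _ u1); rewrite ler_wpM2l//.
 have := ler_wpM2l (ltW q0) hn; rewrite (_ : _ * (9 * _) = 9 / 32 * (dy n * (2 ^ n)%:R)); last by ring.
 by rewrite nd; lra.
have hz : 2^-1 <= normc z ^+ (2 ^ n.+1).
 have /andP[h1 _] := cell_norm cz; rewrite d5 in h1.
 apply: (@le_trans _ _ ((1 - dy n / 32) ^+ (2 ^ n.+1))); last first.
  by apply: lerXn2r; rewrite ?nnegrE ?nc_ge0//; have := dy_le1 R n; lra.
 apply: le_trans (bernoulli _ _); last by have := dy_le1 R n; lra.
 rewrite expnS natrM (_ : _ * (dy n / 32) = 2 / 32 * (dy n * (2 ^ n)%:R)); last by ring.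
 by rewrite nd; lra.
rewrite nc_atom; apply: (@le_trans _ _ (dy n / sg n * 2^-1 * (((2 ^ n)%:R / 2) ^+ 2 / (2 ^ n)%:R))).
 apply: le_of_eq; rewrite dyE.
 move: ((2 ^ n)%:R) q0 (sg n) s0 {nd hd} => y y0 x x0; by field; rewrite !gt_eqF.
apply: ler_pM.
- by rewrite mulr_ge0// invr_ge0.
- by rewrite divr_ge0 ?exprn_ge0 ?divr_ge0.
- by rewrite ler_wpM2l.
- by rewrite ler_wpM2r ?invr_ge0// lerXn2r ?nnegrE ?nc_ge0 ?divr_ge0.
Qed.

(* The sum over one level is a discrete Parseval identity. *)
Lemma atom_level n z : D z ->
 \sum_(k < 2 ^ (n + 5)) normc (atom n k z) <= 32 * (normc z ^+ (2 ^ n.+1) / sg n).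
Proof.
move=> Dz; have s0 := sg_gt0 n; have q0 := p0 n.
have z1 : normc z <= 1 by exact: ltW.
rewrite (eq_bigr (fun k : 'I_(2 ^ (n + 5)) => dy n / sg n * normc z ^+ (2 ^ n.+1) / (2 ^ n)%:R *
  normc (\sum_(m < 2 ^ n) (conjc z ^+ m) * (zeta R (2 ^ (n + 5)) ^+ k) ^+ m) ^+ 2)); last first.
 move=> k _; rewrite nc_atom.
 have -> : normc (dir (2 ^ n) (z * conjc (node n k))) =
   normc (\sum_(m < 2 ^ n) (conjc z ^+ m) * (zeta R (2 ^ (n + 5)) ^+ k) ^+ m).
  rewrite -nc_conj /dir conj_sum; congr normc; apply: eq_bigr => m _.
  by rewrite (conjX (z * _)) conjM conjK exprMn.
 by rewrite [_ / (2 ^ n)%:R in LHS]mulrC mulrA.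
rewrite -mulr_sumr.
rewrite (parseval_le (fun m => conjc z ^+ m)); last by rewrite leq_exp2l// leq_addr.
have hs : \sum_(m < 2 ^ n) normc (conjc z ^+ m) ^+ 2 <= (2 ^ n)%:R.
 rewrite -[leRHS](_ : \sum_(m < 2 ^ n) (1 : R) = _); last by rewrite sumr_const card_ord.
 by apply: ler_sum => m _; rewrite ncX nc_conj !exprn_ile1 ?exprn_ge0 ?nc_ge0 ?exprn_ile1 ?nc_ge0.
apply: (@le_trans _ _ (dy n / sg n * normc z ^+ (2 ^ n.+1) / (2 ^ n)%:R * ((2 ^ (n + 5))%:R * (2 ^ n)%:R))).
 apply: ler_wpM2l; last by rewrite ler_wpM2l.
 by rewrite divr_ge0// mulr_ge0// exprn_ge0// nc_ge0.
rewrite expnD natrM; apply: le_of_eq; rewrite dyE.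
have -> : (2 ^ 5)%:R = 32 :> R by [].
move: ((2 ^ n)%:R) q0 (sg n) s0 (normc z ^+ _) {hs} => y y0 x x0 u; by field; rewrite !gt_eqF.
Qed.

Lemma ex_pow2 (x : R) : exists2 q, (0 < q)%N & x <= 2 ^+ q.
Proof.
exists (Num.truncn x).+1 => //; rewrite (le_trans (ltW (truncnS_gt x)))//.
by rewrite -natrX ler_nat ltnW// ltn_expl.
Qed.

(** With truncated subtraction the exponent is |n - n'|: two geometric series. *)
Lemma two_sided (x : R) n' L : 0 <= x < 1 ->
 \sum_(n < L) x ^+ ((n - n') + (n' - n)) <= 2 / (1 - x).
Proof.
move=> x01; have /andP[x0 x1] := x01.
apply: (@le_trans _ _ (\sum_(n < n' + L) x ^+ ((n - n') + (n' - n)))).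
 rewrite addnC big_split_ord/= lerDl sumr_ge0// => i _; exact: exprn_ge0.
rewrite big_split_ord/= mulr2n mulrDl mul1r; apply: lerD; last first.
 rewrite (eq_bigr (fun i : 'I_L => x ^+ i)); first exact: geo_sum_le.
 by move=> i _; congr (_ ^+ _); lia.
rewrite (reindex_inj rev_ord_inj)/=; apply: le_trans (geo_sum_le n' x01).
apply: ler_sum => i _; have := ltn_ord i => h.
rewrite (_ : (_ + _)%N = i.+1); last by lia.
by rewrite exprS ler_piMl ?exprn_ge0// ltW.
Qed.

Lemma sg_lt n n' : (n <= n')%N -> sg n' <= Num.sqrt 2^-1 ^+ (n' - n) * sg n.
Proof.
move=> nn; have r0 : 0 <= Num.sqrt 2^-1 :> R by rewrite sqrtr_ge0.
rewrite -(@ler_pXn2r _ 2)// ?nnegrE ?mulr_ge0 ?exprn_ge0 ?(ltW (sg_gt0 _))//.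
have r2 : Num.sqrt 2^-1 ^+ 2 = 2^-1 :> R by rewrite sqr_sqrtr.
rewrite exprMn -exprM mulnC exprM r2 !sg_sqr mulrA.
apply: ler_pM; rewrite ?dy_ge0 ?(ltW (Hn_gt0 hw _))//; last exact: Hn_noninc.
by rewrite -/(dy (n' - n)) -dyD subnK.
Qed.

Lemma sg_gt : exists2 K : R, 1 <= K & forall n d, sg n <= K ^+ d * sg (n + d).
Proof.
have [K K1 HK] := Hn_doubling hw; have K0 : 0 < K by exact: lt_le_trans K1.
exists (2 * K) => [|n d]; first by lra.
have K20 : 0 <= 2 * K by lra.
rewrite -(@ler_pXn2r _ 2)// ?nnegrE ?mulr_ge0 ?exprn_ge0 ?(ltW (sg_gt0 _))//.
rewrite exprMn !sg_sqr; apply: (@le_trans _ _ ((2 * K) ^+ d * (dy (n + d) * Hn (n + d)))).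
 have -> : dy n = 2 ^+ d * dy (n + d) :> R.
  by rewrite dyD mulrCA [dy d]dyV mulfV ?mulr1// expf_neq0// pnatr_eq0.
 rewrite exprMn -!mulrA ler_wpM2l ?exprn_ge0// [leRHS]mulrCA ler_wpM2l ?dy_ge0//.
apply: ler_wpM2r; first by rewrite mulr_ge0 ?dy_ge0 ?(ltW (Hn_gt0 hw _)).
by rewrite expr2 ler_peMl ?exprn_ge0// exprn_ege1//; lra.
Qed.

Let rho12 : 2^-1 <= rho :> R.
Proof. by rewrite -(@rho_sqr R) expr2 ler_piMl// ltW ?rho_gt0 ?rho_lt1. Qed.

(** For n <= n' the decay comes from [sg] alone. For n > n' the ratio sg n' / sg n may grow like
    K^(n - n'), and |z|^(2^n), with |z| < 1 - 2^-(n'+1), is small enough to absorb it. *)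
Lemma sg_decay : exists2 B : R, 0 < B & forall n n' z, annulus n' z ->
 sg n' * normc z ^+ (2 ^ n) <= B * (rho ^+ ((n - n') + (n' - n)) * sg n).
Proof.
have [K K1 HK] := sg_gt; have K0 : 0 < K by exact: lt_le_trans K1.
have [q q0 Kq] := ex_pow2 (2 * K).
have r0 := @rho_gt0 R; have f0 : 0 <= q`!%:R * 2 ^+ q :> R by rewrite mulr_ge0 ?exprn_ge0.
exists (1 + q`!%:R * 2 ^+ q) => [|n n' z an]; first by rewrite ltr_wpDr.
have z1 : normc z <= 1 by case/andP: an => _ /ltW /le_trans; apply; rewrite gerBl dy_ge0.
have s0 := sg_gt0 n; have s0' := sg_gt0 n'.
have [le|lt] := leqP n n'.
 have e0 : (n - n' = 0)%N by apply/eqP; rewrite subn_eq0.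
 rewrite e0 add0n; have h := sg_lt le; rewrite -/rho in h.
 apply: (@le_trans _ _ (sg n')); first by rewrite ler_piMr ?(ltW s0')// exprn_ile1 ?nc_ge0.
 apply: (le_trans h); rewrite ler_peMl ?lerDl//.
 by apply: mulr_ge0; [apply: exprn_ge0; exact: ltW|exact: ltW].
pose d := (n - n')%N; have nE : n = (n' + d)%N by rewrite /d subnKC// ltnW.
have e0 : (n' - n = 0)%N by apply/eqP; rewrite subn_eq0 ltnW.
rewrite e0 addn0 -/d.
have hz : normc z ^+ (2 ^ n) <= q`!%:R * 2 ^+ q * dy d ^+ q.
 case/andP: an => _ hz; apply: (@le_trans _ _ ((1 - dy n'.+1) ^+ (2 ^ n))).
  by apply: lerXn2r; rewrite ?nnegrE ?nc_ge0 ?subr_ge0 ?dy_le1// ltW.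
 have := @power_decay R q (dy n'.+1) (2 ^ n); rewrite dy_gt0 dy_le1 expn_gt0 => /(_ isT isT q0) h.
 apply: (le_trans h); rewrite -mulrA -exprMn (_ : (_)^-1 = 2 * dy d)//.
 rewrite nE expnD natrM dyS; have e1 := @dy_nat R n'.
 rewrite (_ : _ * _ * _ = (dy n' * (2 ^ n')%:R) * (2 ^ d)%:R / 2); last by ring.
 by rewrite e1 mul1r invf_div dyV natrX.
have hs := HK n' d; rewrite -nE in hs.
have hd : dy d ^+ q <= dy d * (K ^+ d)^-1.
 rewrite ler_pdivlMr ?exprn_gt0// /dy -exprM mulnC exprM -exprMn lerXn2r ?nnegrE ?mulr_ge0 ?exprn_ge0 ?(ltW K0) ?invr_ge0//.
 rewrite exprVn mulrC ler_pdivrMr ?exprn_gt0//; lra.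
have h3 : dy d <= rho ^+ d :> R by apply: lerXn2r; rewrite ?nnegrE ?invr_ge0 ?(ltW r0).
apply: (@le_trans _ _ (K ^+ d * sg n * (q`!%:R * 2 ^+ q * (dy d * (K ^+ d)^-1)))).
 apply: ler_pM => //; [exact: ltW|by rewrite exprn_ge0 ?nc_ge0|].
 by apply: (le_trans hz); exact: ler_wpM2l.
rewrite (_ : _ * _ = q`!%:R * 2 ^+ q * (dy d * sg n)); last first.
 by have Kd : K ^+ d != 0 by [rewrite expf_neq0 ?gt_eqF]; move: (K ^+ d) Kd => x x0; field.
apply: ler_pM => //; first by rewrite mulr_ge0 ?dy_ge0 ?(ltW s0).
 by rewrite lerDr.
exact: (ler_wpM2r (ltW s0) h3).
Qed.

Lemma atom_sum : exists2 B : R, 0 < B & forall n' z L, annulus n' z ->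
 \sum_(n < L) \sum_(k < 2 ^ (n + 5)) normc (atom n k z) <= B / sg n'.
Proof.
have [B B0 HB] := sg_decay; have r01 : 0 <= (rho : R) < 1 by rewrite (ltW (@rho_gt0 R)) rho_lt1.
have r1 : 0 < 1 - (rho : R) by rewrite subr_gt0 rho_lt1.
exists (32 * B * (2 / (1 - rho))) => [|n' z L an].
 by apply: mulr_gt0; [exact: mulr_gt0|exact: divr_gt0].
have Dz : D z by case/andP: an => _ /lt_trans; apply; rewrite gtrBl dy_gt0.
have z1 : normc z <= 1 by exact: ltW.
have s0 := sg_gt0 n'.
apply: (@le_trans _ _ (\sum_(n < L) 32 * B / sg n' * rho ^+ ((n - n') + (n' - n)))); last first.
 rewrite -mulr_sumr [leRHS]mulrAC; apply: ler_wpM2l; last exact: two_sided.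
 by apply: divr_ge0; [apply: mulr_ge0 => //; exact: ltW|exact: ltW].
apply: ler_sum => n _; move: (nat_of_ord n) => {}n; apply: (le_trans (atom_level n Dz)).
have sn := sg_gt0 n; rewrite -[leRHS]mulrA -[leRHS]mulrA ler_wpM2l// mulrA ler_pdivrMr//.
rewrite (_ : B / _ * _ * _ = B * (rho ^+ ((n - n') + (n' - n)) * sg n) / sg n'); last by ring.
rewrite ler_pdivlMr// mulrC; apply: le_trans (HB n n' z an).
rewrite ler_wpM2l ?(ltW s0)// ler_wiXn2l ?nc_ge0// leq_exp2l//.
Qed.

End Atoms.

Section FiniteMeasureIntegrals.
Variables (R : realType) (mu : {measure set R[i] -> \bar R}).
Local Notation C := R[i].
Local Notation D := (@unit_disc R).
Hypothesis muD : (mu D < +oo)%E.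
Let mD : measurable D := @measurable_unit_disc R.

Lemma bdd_int (u : C -> R) B : measurable_fun D u -> (forall z, D z -> `|u z| <= B) ->
 mu.-integrable D (EFin \o u).
Proof.
move=> m1 uB; have ci : mu.-integrable D (EFin \o (fun=> B)).
 apply/integrableP; split; first exact: measurable_cst.
 rewrite (eq_integral (cst (`|B|%:E)))// integral_cst//.
 by apply: lte_mul_pinfty => //; rewrite lee_fin.
apply: le_integrable ci => //; first exact/measurable_EFinP.
by move=> z Dz; rewrite /= lee_fin (le_trans (uB z Dz))// ler_norm.
Qed.

Let Rint_sum_and (I : Type) (r : seq I) (P : pred I) (u : I -> C -> R) :
 (forall i, mu.-integrable D (EFin \o u i)) ->
 mu.-integrable D (EFin \o (fun z => \sum_(i <- r | P i) u i z)) /\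
 \int[mu]_(z in D) (\sum_(i <- r | P i) u i z) = \sum_(i <- r | P i) \int[mu]_(z in D) u i z.
Proof.
move=> iu.
elim: r => [|i r [IH1 IH2]].
 split.
  rewrite (_ : (fun z => _) = (fun=> 0)); last by apply/funext => z; rewrite big_nil.
  by rewrite (_ : EFin \o _ = cst 0%E)//; exact: integrable0.
 by rewrite big_nil; under eq_Rintegral do rewrite big_nil; rewrite /Rintegral integral0.
rewrite big_cons; under eq_Rintegral do rewrite big_cons.
rewrite (_ : (fun z => \sum_(j <- i :: r | P j) u j z) =
  (fun z => if P i then u i z + \sum_(j <- r | P j) u j z else \sum_(j <- r | P j) u j z)); last first.
 by apply/funext => z; rewrite big_cons.
case: (P i) => //; split; last by rewrite RintegralD// IH2.
by have := integrableD mD (iu i) IH1; apply: eq_integrable.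
Qed.

Lemma Rint_sum (I : Type) (r : seq I) (P : pred I) (u : I -> C -> R) :
 (forall i, mu.-integrable D (EFin \o u i)) ->
 \int[mu]_(z in D) (\sum_(i <- r | P i) u i z) = \sum_(i <- r | P i) \int[mu]_(z in D) u i z.
Proof. by move=> iu; have [] := Rint_sum_and r P iu. Qed.

Lemma int_sum (I : Type) (r : seq I) (P : pred I) (u : I -> C -> R) :
 (forall i, mu.-integrable D (EFin \o u i)) ->
 mu.-integrable D (EFin \o (fun z => \sum_(i <- r | P i) u i z)).
Proof. by move=> iu; have [] := Rint_sum_and r P iu. Qed.

Lemma Rint_indic (A : set C) (c : R) : measurable A -> A `<=` D ->
 \int[mu]_(z in D) (c * \1_A z) = c * fine (mu A).
Proof.
move=> mA AD; rewrite RintegralZl//; last first.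
 apply: (bdd_int (B := 1)); first exact: measurable_indic.
 by move=> z _; rewrite indicE; case: (_ \in _); rewrite ?normr1 ?normr0.
by congr (_ * _); rewrite /Rintegral integral_indic// setIidl.
Qed.
End FiniteMeasureIntegrals.

Section BergmanSubspace.
Variables (R : realType) (w : R[i] -> R).
Hypothesis hw : class_Dhat w.
Local Notation C := R[i].
Local Notation H := (bergman_space w).

Lemma ell2_lin (c : C) a b : ell2 w a -> ell2 w b -> ell2 w (fun m => c * a m + b m).
Proof.
move=> [A hA] [B hB]; exists (2 * normc c ^+ 2 * A + 2 * B) => M.
apply: (@le_trans _ _ (2 * normc c ^+ 2 * \sum_(m < M) normc (a m) ^+ 2 * Wm w m +
  2 * \sum_(m < M) normc (b m) ^+ 2 * Wm w m)).
 rewrite !mulr_sumr -big_split/=; apply: ler_sum => m _.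
 have h := nc_sqrD_le (c * a m) (b m); have W0 := ltW (Wm_gt0 hw m).
 apply: (le_trans (ler_wpM2r W0 h)); rewrite normcM; apply: le_of_eq; ring.
by apply: lerD; rewrite ler_wpM2l ?mulr_ge0 ?exprn_ge0 ?nc_ge0.
Qed.

Lemma space_lin (c : C) (f g : C -> C^o) : H f -> H g -> H (c *: f + g).
Proof.
move=> /(space_ell2 hw)[a ea ->] /(space_ell2 hw)[b eb ->].
have -> : c *: (mkf a : C -> C^o) + mkf b = mkf (fun m => c * a m + b m).
 rewrite mkf_lin; [by []|exact: (ell2_rad hw)|exact: (ell2_rad hw)].
by apply: ell2_space => //; exact: ell2_lin.
Qed.

Lemma space0 : H (0 : C -> C^o).
Proof.
have e0 : ell2 w (fun=> 0) by apply: (@ell2_fin _ _ hw _ 0).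
suff -> : (0 : C -> C^o) = mkf (fun=> 0) by exact: ell2_space.
apply: mkf_uniq => // z _ e e0'; exists 0%N => M _.
by rewrite /psum big1 ?subrr ?normc0 ?ltW// => i _; rewrite mul0r.
Qed.

Lemma space_sum (I : Type) (r : seq I) (c : I -> C) (f : I -> C -> C^o) :
 (forall i, H (f i)) -> H (\sum_(i <- r) c i *: f i).
Proof.
move=> hf; elim: r => [|i r IH]; first by rewrite big_nil; exact: space0.
by rewrite big_cons; exact: space_lin.
Qed.

Lemma linear_sum (F : (C -> C^o) -> (C -> C^o)) nrm : is_bounded_linear H nrm F ->
 forall (I : Type) (r : seq I) (c : I -> C) (f : I -> C -> C^o),
 (forall i, H (f i)) -> F (\sum_(i <- r) c i *: f i) = \sum_(i <- r) c i *: F (f i).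
Proof.
move=> [_ lF _] I r c f hf; elim: r => [|i r IH]; last first.
 by rewrite !big_cons lF ?IH//; exact: space_sum.
rewrite !big_nil; have := lF (-1) 0 0 space0 space0.
by rewrite scaler0 addr0 scaleN1r addNr.
Qed.
End BergmanSubspace.

Section InjectiveFamily.
Variables (R : realType) (N : nat) (e : 'I_N -> nat * nat).
Hypotheses (ei : injective e) (ev : forall j, ((e j).2 < 2 ^ ((e j).1 + 5))%N).

Lemma pick_sum (V : nmodType) L (F : nat -> nat -> V) j : ((e j).1 < L)%N ->
 \sum_(n < L) \sum_(k < 2 ^ (n + 5)) (if e j == (nat_of_ord n, nat_of_ord k) then F n k else 0) =
 F (e j).1 (e j).2.
Proof.
move=> jL; rewrite (bigD1 (Ordinal jL))//= (bigD1 (Ordinal (ev j)))//=.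
rewrite -surjective_pairing eqxx big1 ?addr0 => [|k kj]; last first.
 case: eqP => // E; have /= E2 := congr1 snd E; move: kj; rewrite -val_eqE/=.
 by rewrite E2 eqxx.
rewrite big1 ?addr0// => n nj; rewrite big1// => k _.
case: eqP => // E; have /= E1 := congr1 fst E; move: nj; rewrite -val_eqE/=.
by rewrite E1 eqxx.
Qed.

Lemma inj_sum L (F : nat -> nat -> R) : (forall j, (e j).1 < L)%N -> (forall n k, 0 <= F n k) ->
 \sum_j F (e j).1 (e j).2 <= \sum_(n < L) \sum_(k < 2 ^ (n + 5)) F n k.
Proof.
move=> eL F0; rewrite (eq_bigr _ (fun j _ => esym (pick_sum F (eL j)))).
rewrite exchange_big/=; apply: ler_sum => n _; rewrite exchange_big/=; apply: ler_sum => k _.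
have [j hj|h] := pickP (fun j => e j == (nat_of_ord n, nat_of_ord k)).
 rewrite (bigD1 j)//= hj big1 ?addr0// => j' jj; case: eqP => // E.
 by move: jj; rewrite -(inj_eq ei) E (eqP hj) eqxx.
by rewrite big1// => j _; rewrite h.
Qed.
End InjectiveFamily.

(** * Diagonal dominance on selected atoms *)

Section FrameLower.
Variables (R : realType) (w : R[i] -> R) (mu : {measure set R[i] -> \bar R}).
Hypotheses (hw : class_Dhat w) (muD : (mu unit_disc < +oo)%E).
Local Notation C := R[i].
Local Notation D := (@unit_disc R).
Local Notation one := (fun=> 1 : R).
Local Notation sg := (sg w).
Local Notation atom := (atom w).
Local Notation cell := (@dyadic_rectangle R).
Let mD : measurable D := @measurable_unit_disc R.

Let s0 n : 0 < sg n := sg_gt0 hw n.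

Lemma mu_fin A : measurable A -> A `<=` D -> mu A \is a fin_num.
Proof.
move=> mA AD; rewrite ge0_fin_numE//; apply: le_lt_trans muD.
by apply: le_measure => //; rewrite inE.
Qed.

(** On the selected cells mu is rescaled by [v] to have mass sg^2 per cell. The matrix of |g_k|
    |g_l| integrated against v mu then has diagonal entries bounded below and total sum O(N), with
    constants independent of t. [good_subset] makes it diagonally dominant, and v <= 1 / t converts
    back to mu. *)
Lemma frame_lower : exists (c : R) (d : nat), [/\ 0 < c, (0 < d)%N & forall (t : R) N (e : 'I_N -> nat * nat),
 0 < t -> injective e -> (forall j, ((e j).2 < 2 ^ ((e j).1 + 5))%N) ->
 (forall j, t * sg (e j).1 ^+ 2 < fine (mu (cell ((e j).1 + 5) (e j).2))) ->
 exists S : {set 'I_N}, (N <= d * #|S|)%N /\ forall x : 'I_N -> C,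
  c * \sum_(k in S) normc (x k) ^+ 2 <=
  t^-1 * Qn mu one (fun z => \sum_(k in S) x k * atom (e k).1 (e k).2 z)].
Proof.
have [B B0 hB] := atom_sum hw; have [K K1 HK] := sg_gt hw.
have K0 : 0 < K by exact: lt_le_trans K1.
pose B1 := (B * K ^+ 5) ^+ 2; have B10 : 0 < B1 by rewrite exprn_gt0// mulr_gt0// exprn_gt0.
(* Enough colours to bring the row sums, at most 2 B1 / (M + 1), down to 1/128, half of the diagonal
   bound 1/64. *)
pose M := Num.truncn (2 * B1 * 128).
exists (128^-1), (2 * M.+1)%N; split => // t N e t0 ei ev et.
pose mc j : R := fine (mu (cell ((e j).1 + 5) (e j).2)).
pose kp j := sg (e j).1 ^+ 2 / mc j.
have sp j : 0 < sg (e j).1 ^+ 2 by rewrite exprn_gt0.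
have mc0 j : 0 < mc j by apply: lt_trans (et j); rewrite mulr_gt0.
have kp0 j : 0 < kp j by rewrite divr_gt0.
have kpt j : kp j <= t^-1.
 rewrite /kp ler_pdivrMr// mulrC ler_pdivlMr// mulrC; exact/ltW/et.
pose A j := cell ((e j).1 + 5) (e j).2.
have mA j : measurable (A j) by exact: measurable_cell.
have AD j : A j `<=` D by move=> z; exact: cell_disc.
pose v z := \sum_j kp j * \1_(A j) z.
have mi j : measurable_fun D (fun z => kp j * \1_(A j) z).
 by apply: measurable_funM => //; exact: measurable_indic.
have mv : measurable_fun D v by exact: measurable_sum.
have one_in z : v z = 0 \/ exists2 j, A j z & v z = kp j.
 have [[j Aj]|no] := pselect (exists j, A j z).
  right; exists j => //; rewrite /v (bigD1 j)//= indicE mem_set// mulr1 big1 ?addr0// => j' jj.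
  rewrite indicE memNset ?mulr0// => Aj'; move/eqP: jj; apply; apply: ei.
  have := cell_inj (ev j) (ev j') Aj Aj' => -[/addIn h1 h2].
  by rewrite [e j]surjective_pairing [e j']surjective_pairing h1 h2.
 left; rewrite /v big1// => j _; rewrite indicE memNset ?mulr0// => Aj; apply: no; exists j.
 exact: Aj.
have v0 z : 0 <= v z by have [->|[j _ ->]] := one_in z; rewrite // ltW.
have vt z : v z <= t^-1 by have [->|[j _ ->]] := one_in z; rewrite ?invr_ge0 ?(ltW t0)//.
pose g j z := atom (e j).1 (e j).2 z.
have mg j : @mcf R (g j) by exact: mcf_atom.
have gb j z : D z -> normc (g j z) <= (sg (e j).1)^-1 by exact: atom_bounded.
pose G := \sum_j (sg (e j).1)^-1.
have G0 : 0 <= G by apply: sumr_ge0 => j _; rewrite invr_ge0 ltW.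
have gG j z : D z -> normc (g j z) <= G.
 move=> Dz; apply: (le_trans (gb j z Dz)); rewrite /G (bigD1 j)//= lerDl.
 by apply: sumr_ge0 => i _; rewrite invr_ge0 ltW.
have mng j : measurable_fun D (fun z => normc (g j z)) by exact: mcf_normc.
pose u k l z := normc (g k z) * normc (g l z) * v z.
have mu_ k l : measurable_fun D (u k l) by apply: measurable_funM => //; exact: measurable_funM.
have u0 k l z : 0 <= u k l z by rewrite mulr_ge0 ?mulr_ge0 ?nc_ge0.
have iu k l : mu.-integrable D (EFin \o u k l).
 apply: (bdd_int muD (B := G * G * t^-1)) => // z Dz; rewrite ger0_norm//.
 by apply: ler_pM; rewrite ?mulr_ge0 ?nc_ge0//; apply: ler_pM; rewrite ?nc_ge0// gG.
pose a k l := \int[mu]_(z in D) u k l z.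
have sa k l : a k l = a l k by apply: eq_Rintegral => z _; rewrite /u [normc (g k z) * _]mulrC.
have a0 k l : 0 <= a k l by apply: Rintegral_ge0.
(* The square of the lower bound 1 / (8 sg) of [atom_lb], times the mass sg^2. *)
have akk k : 64^-1 <= a k k.
 have -> : 64^-1 = (kp k * (64 * sg (e k).1 ^+ 2)^-1) * fine (mu (A k)) :> R.
  rewrite /kp -/(mc k); move: (mc k) (mc0 k) (sg (e k).1) (s0 (e k).1) => x x0 y y0.
  by field; rewrite !gt_eqF.
 rewrite -(Rint_indic muD)//; apply: le_Rintegral => //.
  apply: (bdd_int muD (B := `|kp k / (64 * sg (e k).1 ^+ 2)|)) => //.
   by apply: measurable_funM => //; exact: measurable_indic.
  by move=> z _; rewrite indicE normrM ler_piMr//; case: (_ \in _); rewrite ?normr1 ?normr0.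
 move=> z Dz; rewrite indicE; have [Az|nA] := boolP (z \in A k); last by rewrite mulr0.
 rewrite mulr1 /u; have Akz : A k z by rewrite inE in Az.
 have -> : v z = kp k.
  rewrite /v (bigD1 k)//= indicE mem_set// mulr1 big1 ?addr0// => j' jj.
  rewrite indicE memNset ?mulr0// => Aj'; move/eqP: jj; apply; apply: ei.
  have := cell_inj (ev k) (ev j') Akz Aj' => -[/addIn h1 h2].
  by rewrite [e k]surjective_pairing [e j']surjective_pairing h1 h2.
 rewrite mulrC ler_wpM2r ?(ltW (kp0 k))// -expr2.
 have h := atom_lb hw Akz; have s1 := s0 (e k).1.
 rewrite (_ : (64 * _)^-1 = (8 * sg (e k).1)^-1 ^+ 2); last first.
  by rewrite exprVn exprMn; congr (_ ^-1); congr (_ * _); rewrite expr2 -natrM.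
 by rewrite lerXn2r ?nnegrE ?invr_ge0 ?mulr_ge0 ?nc_ge0 ?(ltW s1).
(* The double sum is the integral of (sum_k |g_k|)^2 against v, and on a selected cell of level n +
   5 the inner sum is at most B / sg (n + 5) by [atom_sum], whatever N is. *)
have asum : \sum_k \sum_l a k l <= B1 * N%:R.
 have -> : \sum_k \sum_l a k l = \int[mu]_(z in D) ((\sum_k normc (g k z)) ^+ 2 * v z).
  have -> : \sum_k \sum_l a k l = \int[mu]_(z in D) (\sum_(p : 'I_N * 'I_N) u p.1 p.2 z).
   by rewrite pair_bigA/= Rint_sum.
  apply: eq_Rintegral => z _; rewrite expr2 mulr_suml mulr_suml -(pair_bigA _ (fun k l => u k l z))/=.
  by apply: eq_bigr => k _; rewrite [normc (g k z) * _]mulr_sumr mulr_suml.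
 pose cst j := kp j * (B / sg ((e j).1 + 5)) ^+ 2.
 have cst0 j : 0 <= cst j by rewrite mulr_ge0 ?(ltW (kp0 j))// exprn_ge0// divr_ge0 ?(ltW B0)// ltW.
 have cint j : mu.-integrable D (EFin \o (fun z => cst j * \1_(A j) z)).
  apply: (bdd_int muD (B := `|cst j|)) => //.
   by apply: measurable_funM => //; exact: measurable_indic.
  by move=> z _; rewrite indicE normrM ler_piMr//; case: (_ \in _); rewrite ?normr1 ?normr0.
 apply: (@le_trans _ _ (\int[mu]_(z in D) (\sum_j cst j * \1_(A j) z))).
  apply: le_Rintegral => //.
  - apply: (bdd_int muD (B := (N%:R * G) ^+ 2 * t^-1)) => //.
    by apply: measurable_funM => //; apply: measurable_funX; exact: measurable_sum.
   move=> z Dz; have h0 : 0 <= \sum_k normc (g k z) by apply: sumr_ge0 => k _; exact: nc_ge0.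
   rewrite ger0_norm ?mulr_ge0 ?exprn_ge0//; apply: ler_pM; rewrite ?exprn_ge0//.
   rewrite lerXn2r ?nnegrE ?mulr_ge0// (le_trans (ler_sum _ (fun k _ => gG k z Dz)))//.
   by rewrite sumr_const card_ord mulr_natl.
  - exact: int_sum.
  - move=> z Dz; have [->|[j Aj vE]] := one_in z.
    by rewrite mulr0; apply: sumr_ge0 => j _; rewrite mulr_ge0 ?cst0// indicE ler0n.
   rewrite vE [leRHS](bigD1 j)//= indicE mem_set// mulr1 -[leLHS]addr0 lerD//; last first.
    by apply: sumr_ge0 => i _; rewrite mulr_ge0 ?cst0// indicE ler0n.
   rewrite mulrC ler_wpM2l ?(ltW (kp0 j))// lerXn2r ?nnegrE ?divr_ge0 ?(ltW B0) ?(ltW (s0 _)) ?sumr_ge0//; first by move=> i _; exact: nc_ge0.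
   have an : annulus ((e j).1 + 5) z by move: Aj; rewrite /A cellE => -[].
   pose L := (\max_j (e j).1).+1.
   have eL i : ((e i).1 < L)%N by rewrite ltnS (leq_bigmax i).
   apply: le_trans (hB _ z L an).
   exact: (inj_sum ei ev (F := fun n k => normc (atom n k z)) eL (fun n k => nc_ge0 _)).
 rewrite Rint_sum//; apply: (@le_trans _ _ (\sum_(j < N) B1)); last first.
  by rewrite sumr_const card_ord mulr_natr.
 apply: ler_sum => j _; rewrite Rint_indic//.
 have -> : cst j * fine (mu (A j)) = (B * (sg (e j).1 / sg ((e j).1 + 5))) ^+ 2.
  rewrite /cst /kp -/(mc j); move: (mc j) (mc0 j) (sg _) (s0 ((e j).1 + 5)%N) => x x0 y y0.
  by field; rewrite !gt_eqF.
 rewrite /B1; apply: lerXn2r; rewrite ?nnegrE.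
 - by rewrite mulr_ge0 ?(ltW B0)// divr_ge0// ltW.
 - by rewrite mulr_ge0 ?(ltW B0)// exprn_ge0// ltW.
 - by rewrite ler_wpM2l ?(ltW B0)// ler_pdivrMr.
have [S [NS hS]] := good_subset M B10 sa a0 asum.
exists S; split => // x.
have hM : 2 * B1 * 128 <= M.+1%:R by rewrite ltW// truncnS_gt.
have rowS k : k \in S -> \sum_(l in S | l != k) a k l <= 128^-1.
 move=> kS; have := hS k kS; rewrite -ler_pdivlMl// => /le_trans; apply.
 by rewrite ler_pdivrMl// ler_pdivlMr.
have dom := dominance (fun k => normc (x k)) sa (fun k _ => akk k) a0 rowS.
have e64 : 64^-1 - 128^-1 = 128^-1 :> R by field.
rewrite e64 in dom; apply: (le_trans dom).
pose f z := \sum_(k in S) x k * g k z.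
pose X := \sum_j normc (x j).
have X0 : 0 <= X by apply: sumr_ge0 => j _; exact: nc_ge0.
have xX j : normc (x j) <= X by rewrite /X (bigD1 j)//= lerDl sumr_ge0// => i _; exact: nc_ge0.
have mf : @mcf R f.
 have E : f = fun z => \sum_(k <- enum S) x k * g k z by apply/funext => z; rewrite /f big_enum.
 rewrite E; elim: (enum S) => [|k r IH]; first by under eq_fun do rewrite big_nil; exact: mcf_cst.
 by under eq_fun do rewrite big_cons; apply: mcfZD.
have fb z : D z -> normc (f z) <= N%:R * (X * G).
 move=> Dz; rewrite (le_trans (nc_sum _ _ _))//.
 apply: (@le_trans _ _ (\sum_(k < N) X * G)); last by rewrite sumr_const card_ord mulr_natl.
 rewrite big_mkcond/=; apply: ler_sum => k _; case: ifP => _; last by rewrite mulr_ge0.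
 by rewrite normcM; apply: ler_pM; rewrite ?nc_ge0// gG.
have mnf : measurable_fun D (fun z => normc (f z)) by exact: mcf_normc.
have i1 : mu.-integrable D (EFin \o (fun z => normc (f z) ^+ 2 * v z)).
 apply: (bdd_int muD (B := (N%:R * (X * G)) ^+ 2 * t^-1)) => //.
  by apply: measurable_funM => //; exact: measurable_funX.
 move=> z Dz; rewrite ger0_norm ?mulr_ge0 ?exprn_ge0 ?nc_ge0//; apply: ler_pM; rewrite ?exprn_ge0 ?nc_ge0//.
 by rewrite lerXn2r ?nnegrE ?nc_ge0 ?fb// mulr_ge0// mulr_ge0.
have i2 : mu.-integrable D (EFin \o (fun z => normc (f z) ^+ 2 * 1)).
 apply: (bdd_int muD (B := (N%:R * (X * G)) ^+ 2)) => //.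
  by apply: measurable_funM => //; exact: measurable_funX.
 move=> z Dz; rewrite mulr1 ger0_norm ?exprn_ge0 ?nc_ge0//.
 by rewrite lerXn2r ?nnegrE ?nc_ge0 ?fb// mulr_ge0// mulr_ge0.
apply: (@le_trans _ _ (\int[mu]_(z in D) (normc (f z) ^+ 2 * v z))); last first.
 rewrite /Qn -RintegralZl//; apply: le_Rintegral => //.
  by have := integrableZl mD t^-1 i2; apply: eq_integrable.
 by move=> z Dz; rewrite mulr1 mulrC ler_wpM2r ?exprn_ge0 ?nc_ge0.
(* Signs of the quadratic form: the diagonal counts positively, every off-diagonal term
   negatively. *)
pose q (p : 'I_N * 'I_N) : R := if p.2 == p.1 then 1 else -1.
pose P (p : 'I_N * 'I_N) := (p.1 \in S) && (p.2 \in S).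
have E : \sum_(k in S) normc (x k) ^+ 2 * a k k - \sum_(k in S) \sum_(l in S | l != k) normc (x k) * normc (x l) * a k l =
  \int[mu]_(z in D) (\sum_(p | P p) q p * (normc (x p.1) * normc (x p.2)) * u p.1 p.2 z).
 rewrite Rint_sum; last first.
  move=> p; have := integrableZl mD (q p * (normc (x p.1) * normc (x p.2))) (iu p.1 p.2).
  by apply: eq_integrable.
 rewrite (eq_bigr (fun p => q p * (normc (x p.1) * normc (x p.2)) * a p.1 p.2)); last first.
  by move=> p _; rewrite RintegralZl.
 rewrite -(pair_big_dep (mem S) (fun k l => l \in S) (fun k l => q (k, l) * (normc (x k) * normc (x l)) * a k l))/=.
 rewrite -sumrB; apply: eq_bigr => k kS; rewrite [RHS](bigD1 k)//= /q/= eqxx mul1r expr2; congr (_ + _).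
 by rewrite -sumrN; apply: eq_bigr => l /andP[_ /negbTE ->]; rewrite mulN1r mulNr.
rewrite E; apply: le_Rintegral => //.
 apply: int_sum => p; have := integrableZl mD (q p * (normc (x p.1) * normc (x p.2))) (iu p.1 p.2).
 by apply: eq_integrable.
move=> z Dz.
have := nc_sum_sqr_lb S (fun k => x k * g k z) => /(ler_wpM2r (v0 z)); apply: le_trans.
rewrite -(pair_big_dep (mem S) (fun k l => l \in S) (fun k l => q (k, l) * (normc (x k) * normc (x l)) * u k l z))/=.
rewrite -sumrB mulr_suml; apply: ler_sum => k kS; rewrite [leLHS](bigD1 k)//= /q/= eqxx mul1r mulrBl.
rewrite /u [normc (x k * g k z)]normcM exprMn !expr2; apply: lerD.
 by apply: le_of_eq; ring.
rewrite mulr_suml -sumrN; apply: ler_sum => l /andP[_ /negbTE ->].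
by rewrite [normc (x l * g l z)]normcM; apply: le_of_eq; ring.
Qed.

End FrameLower.

Lemma Qn_sub (R : realType) (m : {measure set R[i] -> \bar R}) (v : R[i] -> R) (f g : R[i] -> R[i]) :
 measurable_fun unit_disc v -> (forall z, unit_disc z -> 0 <= v z) -> L2 m v f -> L2 m v g ->
 Qn m v (fun z => f z - g z) <= 2 * (Qn m v f + Qn m v g).
Proof.
move=> mv v0 lf lg; have mD := @measurable_unit_disc R.
have i1 := L2_integrable mv v0 lf; have i2 := L2_integrable mv v0 lg.
have i3 := L2_integrable mv v0 (L2B mv v0 lf lg).
have i12 : m.-integrable unit_disc (EFin \o (fun z => normc (f z) ^+ 2 * v z + normc (g z) ^+ 2 * v z)).
 by have := integrableD mD i1 i2; apply: eq_integrable.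
rewrite /Qn -RintegralD// -RintegralZl//; apply: le_Rintegral => //.
 by have := integrableZl mD 2 i12; apply: eq_integrable.
move=> z Dz; rewrite -mulrDl mulrA ler_wpM2r ?v0//.
by have := nc_sqrD_le (f z) (- g z); rewrite ncN.
Qed.

(** * Lower bounds for the singular values *)

Section SingularValueLower.
Variables (R : realType) (w : R[i] -> R) (mu : {measure set R[i] -> \bar R}).
Hypotheses (hw : class_Dhat w) (muD : (mu unit_disc < +oo)%E).
Local Notation C := R[i].
Local Notation D := (@unit_disc R).
Local Notation one := (fun=> 1 : R).
Local Notation sg := (sg w).
Local Notation atom := (atom w).
Local Notation cell := (@dyadic_rectangle R).
Local Notation H := (bergman_space w).
Local Notation T := (toeplitz_operator w mu).
Local Notation nrm := (bergman_norm w).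
Let mD : measurable D := @measurable_unit_disc R.
Let mw := Dhat_meas hw.
Let w0 := Dhat_ge0 hw.
Let m1 : measurable_fun D one. Proof. exact: measurable_cst. Qed.
Let o0 z : D z -> 0 <= (1 : R). Proof. by []. Qed.

Lemma ip_eqD (m : {measure set C -> \bar R}) v (f f' g g' : C -> C) :
 (forall z, D z -> f z = f' z) -> (forall z, D z -> g z = g' z) -> ip m v f g = ip m v f' g'.
Proof.
move=> h h'; apply: eqc; rewrite /ip /cintegral /=; apply: eq_Rintegral => z; rewrite inE => Dz;
 by rewrite h// h'.
Qed.

Lemma Qn_eqD (m : {measure set C -> \bar R}) v (f f' : C -> C) :
 (forall z, D z -> f z = f' z) -> Qn m v f = Qn m v f'.
Proof. by move=> h; apply: eq_Rintegral => z; rewrite inE => Dz; rewrite h. Qed.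

Lemma nrm_sqr (f : C -> C^o) : nrm f ^+ 2 = Qn area w f.
Proof. by rewrite /bergman_norm sqr_sqrtr// Qn_ge0. Qed.

Lemma L2_space (f : C -> C^o) : H f -> L2 area w f.
Proof. by move=> /(space_ell2 hw)[a ea ->]; exact: ell2_L2. Qed.

Lemma mcf_space (f : C -> C^o) : H f -> @mcf R f.
Proof. by move=> /L2_space[]. Qed.

Lemma L2mu_fin b M : (forall m, (M <= m)%N -> b m = 0) -> L2 mu one (mkf b).
Proof.
move=> hb; have eb : ell2 w b := ell2_fin hw hb.
have [mp _] := L2mu_psum muD b M.
pose B := \sum_(m < M) normc (b m).
apply: (L2mu_bounded muD (B := B)); first exact/mcf_space/ell2_space.
move=> z Dz; rewrite (mkf_psum hb)// (le_trans (nc_sum _ _ _))//; apply: ler_sum => m _.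
by rewrite normcM ncX ler_piMr ?nc_ge0// exprn_ile1 ?nc_ge0// ltW.
Qed.

(** Against a polynomial the pairing is a finite sum of coefficients, and those of T_mu f are given
    by [tc]. *)
Lemma toeplitz_form b M f : (forall m, (M <= m)%N -> b m = 0) -> L2 mu one f -> H (T f) ->
 ip area w (T f) (mkf b) = ip mu one f (mkf b).
Proof.
move=> hb lf HT; have [ra TE] := toeplitz_mkf hw muD lf.
have et : ell2 w (tc w mu f).
 exists (Qn area w (T f)) => N; apply: (parseval_lb hw (f := T f)); last exact: L2_space.
 by move=> z Dz; exact: toeplitz_hsum.
have lT := L2_space HT.
rewrite (ip_eqD area w (fun z _ => erefl (T f z)) (mkf_psum hb)).
rewrite (ip_eqD mu one (fun z _ => erefl (f z)) (mkf_psum hb)).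
rewrite /psum !ip_sum_r//; try (by move=> i; exact: L2_X); try (by move=> i; exact: L2mu_X).
apply: eq_bigr => m _; congr (_ * _).
by rewrite TE ip_mkf_X// /tc divfK// eqCR0 gt_eqF// Wm_gt0.
Qed.

(** An operator F of rank at most r annihilates some nonzero combination f of the more than r atoms
    in S. Then the norm of T - F is at least <T f, f> / |f|^2, where <T f, f> is the integral of
    |f|^2 against mu, bounded below by [frame_lower], and |f|^2 is bounded above by [gc_norm]. *)
Lemma frame_singular_value : is_bounded_linear H nrm T ->
 exists (c : R) (d : nat), [/\ 0 < c, (0 < d)%N & forall (t : R) N (e : 'I_N -> nat * nat) r,
 0 < t -> injective e -> (forall j, ((e j).2 < 2 ^ ((e j).1 + 5))%N) ->
 (forall j, t * sg (e j).1 ^+ 2 < fine (mu (cell ((e j).1 + 5) (e j).2))) ->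
 (r * d < N)%N -> c * t <= singular_value H nrm T r].
Proof.
move=> bT; have [c [d [c0 d0 hS]]] := frame_lower hw muD.
have [B B0 hB] := gc_norm hw.
exists (c / B), d; split => //; first exact: divr_gt0.
move=> t N e r t0 ei ev et rN; have [S [NS hx]] := hS t N e t0 ei ev et.
have rS : (r < #|S|)%N by rewrite -(ltn_pmul2l d0); apply: leq_trans NS; rewrite mulnC.
have bd0 : is_bounded_linear H nrm (fun=> 0 : C -> C^o).
 split; first by move=> f _; exact: space0.
  by move=> a f g _ _; rewrite scaler0 addr0.
 exists 0 => f _; rewrite mul0r le_eqVlt -sqrf_eq0 nrm_sqr; apply/orP; left; apply/eqP.
 by rewrite /Qn /Rintegral; under eq_integral do rewrite normc0 expr0n mul0r; rewrite integral0.
have nrm0 f : 0 <= nrm f by exact: sqrtr_ge0.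
apply: lb_le_inf.
 exists (op_norm H nrm (fun f => T f - 0)), (fun=> 0) => //; split => //.
 by exists (fun=> 0); split => [i|f _]; [exact: space0|exists (fun=> 0); rewrite big1// => i _; rewrite scale0r].
move=> _ [F [bF [h [Hh rF]]] <-].
have [_ lT [MT hMT]] := bT; have [HF lF [MF hMF]] := bF.
apply: lb_le_inf.
 (* A lower bound passes to the infimum only for a nonempty set of constants, so T - F has to be
    bounded. *)
 pose A := `|MT| + `|MF|; have A0 : 0 <= A by rewrite addr_ge0.
 exists (2 * A); split; first by rewrite mulr_ge0.
 move=> f Hf; rewrite -(@ler_pXn2r _ 2)// ?nnegrE ?mulr_ge0//.
 have HTf : H (T f) by case: bT => + _ _; exact.
 rewrite nrm_sqr; apply: (le_trans (Qn_sub mw w0 (L2_space HTf) (L2_space (HF f Hf)))).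
 rewrite -!nrm_sqr.
 have h1 : nrm (T f) <= A * nrm f.
  by rewrite (le_trans (hMT f Hf))// ler_wpM2r// (le_trans (ler_norm _))// lerDl.
 have h2 : nrm (F f) <= A * nrm f.
  by rewrite (le_trans (hMF f Hf))// ler_wpM2r// (le_trans (ler_norm _))// lerDr.
 have q1 : nrm (T f) ^+ 2 <= (A * nrm f) ^+ 2 by rewrite lerXn2r ?nnegrE ?mulr_ge0.
 have q2 : nrm (F f) ^+ 2 <= (A * nrm f) ^+ 2 by rewrite lerXn2r ?nnegrE ?mulr_ge0.
 rewrite -mulrA [(2 * _) ^+ 2]exprMn; lra.
move=> M0 [M00 hM0].
pose L := (\max_j (e j).1).+1.
have eL j : ((e j).1 < L)%N by rewrite ltnS (leq_bigmax j).
pose cf (x : 'I_N -> C) n k : C := \sum_j (if e j == (n, k) then x j else 0).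
have cfin x n k : (L <= n)%N -> cf x n k = 0.
 move=> Ln; rewrite /cf big1// => j _; case: eqP => // E.
 by have := eL j; rewrite E/= ltnNge Ln.
pose G (x : 'I_N -> C) : C -> C^o := mkf (gc w (cf x)).
have gfin x m : (2 ^ L.+1 <= m)%N -> gc w (cf x) m = 0 by apply: gc_fin => n k; exact: cfin.
have HG x : H (G x) by apply: ell2_space => //; exact: (ell2_fin hw (gfin x)).
have GE x z : D z -> G x z = \sum_j x j * atom (e j).1 (e j).2 z.
 move=> Dz; rewrite /G (mkf_psum (gfin x))// synth.
 under eq_bigr => n _.
  under eq_bigr => k _ do rewrite /cf mulr_suml.
  rewrite exchange_big/=; over.
 rewrite exchange_big/=; apply: eq_bigr => j _.
 rewrite -(pick_sum ev (fun n k => x j * atom n k z) (eL j)).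
 by apply: eq_bigr => n _; apply: eq_bigr => k _; case: ifP => // _; rewrite mul0r.
pose dlt (j i : 'I_N) : C := (i == j)%:R.
have Glin x : G x = \sum_j x j *: G (dlt j).
 apply/funext => z; have -> : (\sum_j x j *: G (dlt j)) z = \sum_j x j * G (dlt j) z.
  by elim/big_rec2: _ => // j a b _ <-.
 have [Dz|nD] := pselect (D z); last first.
  rewrite /G mkf_out// big1// => j _; rewrite mkf_out// mulr0//.
 rewrite GE//; apply: eq_bigr => j _; rewrite GE// (bigD1 j)//= /dlt eqxx mul1r big1 ?addr0// => i ij.
 by rewrite (negbTE ij) mul0r.
have /choice[a ha] : forall j, exists a : 'I_r -> C, F (G (dlt j)) = \sum_(i < r) a i *: h i.
 by move=> j; have [a aE] := rF _ (HG (dlt j)); exists a.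
(* The coefficients live on S and solve r linear equations in #|S| > r unknowns. *)
have [y [k0 yk0] hy] := exists_kernel (fun (k : 'I_#|S|) i => a (enum_val k) i) rS.
pose x (j : 'I_N) : C := \sum_(k < #|S|) (if enum_val k == j then y k else 0).
have xv k : x (enum_val k) = y k.
 rewrite /x (bigD1 k)//= eqxx big1 ?addr0// => k' kk; rewrite (inj_eq enum_val_inj).
 by rewrite (negbTE kk).
have xS j : j \notin S -> x j = 0.
 move=> jS; rewrite /x big1// => k _; case: eqP => // E.
 by move: jS; rewrite -E enum_valP.
have sumS (V : nmodType) (f : 'I_N -> V) : (forall j, j \notin S -> f j = 0) ->
  \sum_j f j = \sum_(k < #|S|) f (enum_val k).
 move=> f0; rewrite (bigID (mem S))/= addrC big1 ?add0r//.
 by rewrite big_enum_val.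
pose f := G x.
have Ff : F f = 0.
 rewrite /f Glin (linear_sum hw bF _ _ (fun j => HG (dlt j))).
 under eq_bigr => j _ do rewrite ha scaler_sumr.
 rewrite exchange_big/= big1// => i _.
 under eq_bigr => j _ do rewrite scalerA.
 rewrite -scaler_suml sumS; last by move=> j /xS ->; rewrite mul0r.
 under eq_bigr => k _ do rewrite xv.
 by rewrite hy scale0r.
have Hf : H f := HG x.
have lmu : L2 mu one f := L2mu_fin (gfin x).
have HTf : H (T f) by case: bT => + _ _; exact.
have Qmu : (Qn mu one f)%:C = ip area w (T f) f.
 by rewrite (toeplitz_form (gfin x) lmu HTf) ip_self.
have hT : nrm (T f) <= M0 * nrm f by have := hM0 f Hf; rewrite Ff subr0.
have Q0 := Qn_ge0 mu o0 f.
have Qle : Qn mu one f <= M0 * Qn area w f.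
 have := ip_CS mw w0 (L2_space HTf) (L2_space Hf); rewrite -Qmu nc_real ger0_norm// -!nrm_sqr.
 rewrite -exprMn ler_pXn2r ?nnegrE ?mulr_ge0// => /le_trans; apply.
 by rewrite expr2 mulrA ler_wpM2r.
pose X := \sum_(k in S) normc (x k) ^+ 2.
have X0 : 0 < X.
 rewrite /X (bigD1 (enum_val k0))/=; last exact: enum_valP.
 rewrite ltr_wpDr ?sumr_ge0//; first by move=> i _; rewrite exprn_ge0 ?nc_ge0.
 by rewrite xv exprn_gt0// nc_gt0.
have QB : Qn area w f <= B * X.
 rewrite /f /G (Qn_fin hw (gfin x)); apply: (le_trans (hB _ _)); rewrite ler_wpM2l ?(ltW B0)//.
 have -> : X = \sum_j normc (x j) ^+ 2.
  rewrite [RHS](bigID (mem S))/= [X in _ = _ + X]big1 ?addr0// => j /xS ->.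
  by rewrite normc0 expr0n.
 rewrite (eq_bigr _ (fun j _ => esym (pick_sum ev (fun _ _ => normc (x j) ^+ 2) (eL j)))).
 rewrite exchange_big/=; apply: ler_sum => n _; rewrite exchange_big/=; apply: ler_sum => k _.
 rewrite /cf; have [j hj|h'] := pickP (fun j => e j == (nat_of_ord n, nat_of_ord k)).
  have oth j' : j' != j -> e j' == (nat_of_ord n, nat_of_ord k) = false.
   by move=> jj; apply/negP => /eqP E; move: jj; rewrite -(inj_eq ei) E (eqP hj) eqxx.
  rewrite (bigD1 j)//= [leRHS](bigD1 j)//= hj !big1 ?addr0// => j' jj; by rewrite oth.
 by rewrite !big1 ?normc0 ?expr0n// => j _; rewrite h'.
have key := hx x.
have Qs : Qn mu one (fun z => \sum_(k in S) x k * atom (e k).1 (e k).2 z) = Qn mu one f.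
 apply: Qn_eqD => z Dz; rewrite /f GE// [RHS](bigID (mem S))/= [X in _ = _ + X]big1 ?addr0// => j /xS ->.
 by rewrite mul0r.
rewrite Qs -/X in key.
have k1 : c * t * X <= M0 * (B * X).
 apply: (@le_trans _ _ (Qn mu one f)).
  have := ler_wpM2l (ltW t0) key; rewrite [t * (t^-1 * _)]mulrA mulfV ?gt_eqF// mul1r.
  by rewrite [c * t]mulrC -mulrA.
 by apply: (le_trans Qle); rewrite ler_wpM2l.
rewrite mulrAC ler_pdivrMr//.
by move: k1; rewrite mulrA ler_pM2r.
Qed.

End SingularValueLower.

(** * From singular values to cell sums *)

Section ESumSeq.
Variables (R : realType) (T : choiceType).
Local Open Scope ereal_scope.

Lemma esum_le_seq (I : set T) (a : T -> \bar R) (B : \bar R) :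
 (forall F : seq T, uniq F -> (forall j, j \in F -> I j) -> \sum_(j <- F) a j <= B) ->
 \esum_(j in I) a j <= B.
Proof.
move=> h; apply: ge_ereal_sup => _ [A [fA AI] <-].
rewrite fsbig_finite//; apply: h; first exact: finmap.fset_uniq.
by move=> j; rewrite in_fset_set// inE => /AI.
Qed.

Lemma esum_seq_le (I : set T) (a : T -> \bar R) (F : seq T) : (forall j, 0 <= a j) ->
 uniq F -> (forall j, j \in F -> I j) -> \sum_(j <- F) a j <= \esum_(j in I) a j.
Proof.
move=> a0 uF FI; apply: ereal_sup_ubound; exists [set` F].
 by split; [exact: finite_seq|move=> j /= /FI].
by rewrite -fsbig_seq.
Qed.
End ESumSeq.

Lemma sum_uniq_sub (R : realType) (T : eqType) (F G : seq T) (f : T -> R) : uniq F ->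
 {subset F <= G} -> (forall j, 0 <= f j) -> \sum_(j <- F) f j <= \sum_(j <- G) f j.
Proof.
elim: F G => [|a F IH] G /=; first by move=> _ _ f0; rewrite big_nil sumr_ge0.
move=> /andP[aF uF] FG f0; have aG : a \in G by apply: FG; rewrite mem_head.
rewrite big_cons (big_rem a aG)/= lerD2l; apply: IH => // j jF.
have jG : j \in G by apply: FG; rewrite inE jF orbT.
have ja : j != a by apply: contraNneq aF => <-.
have := perm_mem (perm_to_rem aG) j; by rewrite jG inE (negbTE ja)/= => <-.
Qed.

Section AtoB.
Variables (R : realType) (w : R[i] -> R) (mu : {measure set R[i] -> \bar R}) (p : R).
Hypotheses (hw : class_Dhat w) (p0 : 0 < p).
Local Notation C := R[i].
Local Notation D := (@unit_disc R).
Local Notation sg := (sg w).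
Local Notation cell := (@dyadic_rectangle R).
Local Notation star := (weight_star w).
Local Notation H := (bergman_space w).
Local Notation T := (toeplitz_operator w mu).
Local Notation nrm := (bergman_norm w).

Lemma inf_ge0 (S : set R) : (forall x, S x -> 0 <= x) -> 0 <= inf S.
Proof.
move=> h; have [->|/set0P S0] := eqVneq S set0; first by rewrite inf0.
exact: lb_le_inf.
Qed.

Lemma singular_value_ge0 (S : (C -> C^o) -> C -> C^o) r : 0 <= singular_value H nrm S r.
Proof. by apply: inf_ge0 => _ [F _ <-]; apply: inf_ge0 => x []. Qed.

Definition ratio (j : nat * nat) : R := fine (mu (cell j.1 j.2)) / star (dyadic_point j.1 j.2).

Lemma star_dyadic_gt0 n k : 0 < star (@dyadic_point R n k).
Proof.
have [c [K [c0 _ /(_ n k) /andP[h _]]]] := star_dyadic hw; apply: lt_le_trans h.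
by rewrite mulr_gt0// mulr_gt0 ?dy_gt0 ?Hn_gt0.
Qed.

Lemma ratio_ge0 j : 0 <= ratio j.
Proof. by apply: divr_ge0; [exact: fine_ge0|exact/ltW/star_dyadic_gt0]. Qed.

Lemma ratioE : (mu D < +oo)%E -> forall j, (j.2 < 2 ^ j.1)%N ->
 poweR (mu (cell j.1 j.2) * ((star (dyadic_point j.1 j.2))^-1)%:E)%E p = ((ratio j) `^ p)%:E.
Proof.
move=> muD j jv; rewrite -(@fineK _ (mu (cell j.1 j.2))); last first.
 by apply: (mu_fin muD); [exact: measurable_cell|exact: cell_disc].
by rewrite -EFinM poweR_EFin.
Qed.

Lemma schatten_to_sum : toeplitz_in_schatten p w mu ->
 (\esum_(j in dyadic_indices)
  poweR (mu (cell j.1 j.2) * ((star (dyadic_point j.1 j.2))^-1)%:E) p < +oo)%E.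
Proof.
move=> [td [bT _ ss]]; have muD := finite_measure_of_toeplitz hw td.
have [c [d [c0 d0 hfr]]] := frame_singular_value hw muD bT.
pose s r := singular_value H nrm T r.
(* Indexed by atoms: the pair (n, k) stands for the cell of level n + 5. Invalid pairs get 0 and
   never exceed a positive threshold. *)
pose m (j : nat * nat) : R := if (j.2 < 2 ^ (j.1 + 5))%N then
 fine (mu (cell (j.1 + 5) j.2)) / sg j.1 ^+ 2 else 0.
have s20 n : 0 < sg n ^+ 2 by rewrite exprn_gt0// sg_gt0.
have m0 j : 0 <= m j by rewrite /m; case: ifP => // _; rewrite divr_ge0 ?fine_ge0// ltW.
have key (F : seq (nat * nat)) : uniq F ->
  \sum_(j <- F) m j `^ p <= c^-1 `^ p * \sum_(k < size F) s (k %/ d)%N `^ p.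
 apply: (decreasing_sum p0 c0 d0 m0 (fun r => singular_value_ge0 _ r)).
 move=> F' t r uF t0 ht rd.
 apply: (hfr t (size F') (fun i => nth (0%N, 0%N) F' i)) => //.
 - by move=> i j /eqP; rewrite nth_uniq// => /eqP/val_inj.
 - move=> j; have := ht _ (mem_nth (0%N, 0%N) (ltn_ord j)); rewrite /m.
  by case: ifP => // _ /(lt_trans t0); rewrite ltxx.
 - move=> j; have := ht _ (mem_nth (0%N, 0%N) (ltn_ord j)); rewrite /m.
  by case: ifP => [_|_ /(lt_trans t0)]; [rewrite ltr_pdivlMr|rewrite ltxx].
pose S := fine (\sum_(0 <= n <oo) ((s n) `^ p)%:E)%E.
have sp n : (0 <= ((s n) `^ p)%:E)%E by rewrite lee_fin powR_ge0.
have hS N : \sum_(r < N) s r `^ p <= S.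
 rewrite -lee_fin /S fineK; last by rewrite ge0_fin_numE// nneseries_ge0.
 rewrite -sumEFin -(big_mkord xpredT (fun n => (s n `^ p)%:E)).
 exact: (nneseries_lim_ge N).
have keyS (F : seq (nat * nat)) : uniq F -> \sum_(j <- F) m j `^ p <= c^-1 `^ p * (d%:R * S).
 move=> uF; apply: (le_trans (key F uF)); rewrite ler_wpM2l ?powR_ge0//.
 apply: (@le_trans _ _ (\sum_(k < d * size F) s (k %/ d)%N `^ p)).
  have [->|sF] := eqVneq (size F) 0%N; first by rewrite muln0 !big_ord0.
  rewrite (big_ord_widen (d * size F)%N (fun k => s (k %/ d)%N `^ p)) ?leq_pmull//.
  by rewrite [leRHS](bigID (fun k : 'I_(d * size F) => (k < size F)%N))/= lerDl sumr_ge0// => k _; exact: powR_ge0.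
 by rewrite (sum_divn (fun r => s r `^ p)) ler_wpM2l.
have [c1 [C1 [c10 C10 hst]]] := star_dyadic hw; have [K K1 HK] := sg_gt hw.
have K0 : 0 < K by exact: lt_le_trans K1.
(* The inequality sg n <= K^5 sg (n + 5) links an atom with its cell five levels deeper; squared, it
   gives [K ^+ 10]. *)
pose A := K ^+ 10 / c1; have A0 : 0 <= A by rewrite divr_ge0 ?exprn_ge0 ?(ltW K0) ?(ltW c10).
have rm n k : (k < 2 ^ (n + 5))%N -> ratio ((n + 5)%N, k) <= A * m (n, k).
 move=> kn; rewrite /ratio /m /= kn; have /andP[h _] := hst (n + 5)%N k.
 have q0 : 0 <= fine (mu (cell (n + 5) k)) by exact: fine_ge0.
 have h1 : sg n ^+ 2 <= A * star (dyadic_point (n + 5) k).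
  apply: (@le_trans _ _ ((K ^+ 5 * sg (n + 5)) ^+ 2)).
   by rewrite lerXn2r ?nnegrE ?mulr_ge0 ?exprn_ge0 ?(ltW K0) ?(ltW (sg_gt0 hw _)).
  rewrite exprMn -exprM sg_sqr// /A -mulrA ler_wpM2l ?exprn_ge0 ?(ltW K0)//.
  by rewrite ler_pdivlMl.
 rewrite mulrCA ler_wpM2l// -[leLHS]mul1r ler_pdivrMr ?star_dyadic_gt0//.
 by rewrite mulrAC ler_pdivlMr ?mul1r.
clearbody A.
(* The cells of levels 0 to 4 have no atom; there are finitely many of them, all of finite
   measure. *)
pose small := [seq (n, k) | n <- iota 0 5, k <- iota 0 32].
pose B := \sum_(j <- small) ratio j `^ p + A `^ p * (c^-1 `^ p * (d%:R * S)).
apply: (@le_lt_trans _ _ B%:E); last exact: ltry.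
apply: esum_le_seq => F uF hF.
rewrite (eq_big_seq (fun j => (ratio j `^ p)%:E)); last by move=> j /hF jv; rewrite ratioE.
rewrite sumEFin lee_fin (bigID (fun j : nat * nat => (j.1 < 5)%N))/=; apply: lerD.
 rewrite -big_filter; apply: sum_uniq_sub; first exact: filter_uniq.
  move=> [n k]; rewrite mem_filter/= => /andP[n5 /hF]; rewrite /dyadic_indices/= => kn.
  apply: allpairs_f; rewrite mem_iota//=.
  by rewrite add0n (leq_trans kn)// (_ : 32 = 2 ^ 5)%N// leq_exp2l// ltnW.
 by move=> j; exact: powR_ge0.
rewrite -big_filter; set F' := [seq _ <- F | _].
pose sh (j : nat * nat) := ((j.1 - 5)%N, j.2).
have uF' : uniq [seq sh j | j <- F'].
 rewrite map_inj_in_uniq ?filter_uniq// => -[n k] [n' k']; rewrite !mem_filter/= -!leqNgt.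
 move=> /andP[h _] /andP[h' _] [e1 ->]; congr (_, _).
 by rewrite -(subnK h) e1 subnK.
apply: le_trans (ler_wpM2l (powR_ge0 A p) (keyS _ uF')).
rewrite big_map mulr_sumr big_seq [leRHS]big_seq; apply: ler_sum => -[n k].
rewrite mem_filter/= -leqNgt => /andP[n5 /hF]; rewrite /dyadic_indices/= => kn.
rewrite -powRM//; apply: ge0_ler_powR; rewrite ?nnegrE; [exact: ltW|exact: ratio_ge0|exact: mulr_ge0|].
by have := @rm (n - 5)%N k; rewrite subnK//; apply.
Qed.

End AtoB.

(** * From the cell sums to the Schatten class *)

Section KernelSums.
Variable R : realType.
Local Notation C := R[i].
Implicit Types (u w : C) (t : R).

(** Angular decay factor at scale 2^-n: of order 1 when |1 - u| is below 2^-n, and of order 2^-n /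
    |1 - u| beyond. *)
Definition xk n u : R := (1 + 2 ^+ n * normc (1 - u))^-1.

Let den n u : 1 <= 1 + 2 ^+ n * normc (1 - u).
Proof. by rewrite lerDl mulr_ge0 ?exprn_ge0 ?nc_ge0. Qed.
Let den0 n u : 0 < 1 + 2 ^+ n * normc (1 - u).
Proof. exact: lt_le_trans (den n u). Qed.

Lemma xk_gt0 n u : 0 < xk n u. Proof. by rewrite invr_gt0. Qed.
Lemma xk_le1 n u : xk n u <= 1. Proof. by rewrite invf_le1. Qed.

Lemma xk_conj n u : xk n (conjc u) = xk n u.
Proof.
rewrite /xk -(nc_conj (1 - u)); congr (_^-1); congr (1 + _ * normc _).
by rewrite conjD; congr (_ + _); apply: eqc; case: u => a b; rewrite /= ?oppr0.
Qed.

Lemma nc_sub1_gt0 u : normc u < 1 -> 0 < normc (1 - u).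
Proof. by move=> h; have := ncB_ge (1 : C) u; rewrite normc1; lra. Qed.

(** With u = w zeta^k one has u^N = w^N, so 1 / (1 - u) is (1 - w^N)^-1 times a geometric sum of N
    terms, and Parseval evaluates the sum over k. *)
Lemma sum_inv_sqr N w : (0 < N)%N -> normc w < 1 ->
 \sum_(k < N) (normc (1 - w * zeta R N ^+ k))^-1 ^+ 2 =
 N%:R * (\sum_(m < N) normc w ^+ (2 * m)) / normc (1 - w ^+ N) ^+ 2.
Proof.
move=> N0 w1; have wN : normc (w ^+ N) < 1 by rewrite ncX exprn_ilt1 ?nc_ge0// -lt0n.
have p1 := nc_sub1_gt0 wN.
have -> : \sum_(m < N) normc w ^+ (2 * m) = \sum_(m < N) normc (w ^+ m) ^+ 2.
 by apply: eq_bigr => m _; rewrite ncX -exprM mulnC.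
have P := parseval_le (fun m => w ^+ m) (leqnn N); rewrite /= in P.
rewrite -P mulr_suml; apply: eq_bigr => k _ {P}.
set u := w * _; have u1 : normc u < 1 by rewrite /u normcM ncX nc_zeta expr1n mulr1.
have p2 := nc_sub1_gt0 u1.
have E : (\sum_(m < N) w ^+ m * (zeta R N ^+ k) ^+ m) * (1 - u) = 1 - w ^+ N.
 have -> : w ^+ N = u ^+ N by rewrite /u exprMn -exprM mulnC exprM zetaXN// expr1n mulr1.
 rewrite (eq_bigr (fun m : 'I_N => u ^+ m)); last by move=> m _; rewrite /u exprMn.
 elim: (N) => [|n IH]; first by rewrite big_ord0 mul0r expr0 subrr.
 by rewrite big_ord_recr/= mulrDl IH exprS; ring.
have /(congr1 (@normc R)) := E; rewrite normcM => <-.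
set X := normc (\sum_(_ < _) _); have X0 : X != 0.
 by apply: contraTneq p1 => Xz; rewrite -E normcM -/X Xz mul0r ltxx.
move: (normc (1 - u)) p2 => y y0; by field; rewrite X0 gt_eqF.
Qed.

Lemma decay1 (x : R) N : 0 <= x <= 1 -> (1 - x) ^+ N <= (1 + N%:R * x)^-1.
Proof.
move=> /andP[x0 x1]; have q0 : 0 < 1 + N%:R * x by rewrite ltr_wpDr ?mulr_ge0.
apply: (@le_trans _ _ (expR (- x) ^+ N)).
 by apply: lerXn2r; rewrite ?nnegrE ?subr_ge0 ?expR_ge0//; exact: expR_ge1Dx.
by rewrite -expRM_natl mulrN expRN lef_pV2 ?posrE ?expR_gt0// expR_ge1Dx.
Qed.

(** Moving w inwards by the factor 1 - 2^-n changes |1 - u| by at most 2^-n, which the summand 1 in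
    [xk] absorbs, and keeps |1 - v^N| >= 1/2, so that [sum_inv_sqr] applies. If m < n, the
    inequality xk n <= xk m reduces to n = m. *)
Lemma xk_sum n m w : normc w <= 1 ->
 \sum_(k < 2 ^ m) xk n (w * zeta R (2 ^ m) ^+ k) ^+ 2 <= 4 * 2 ^+ (m - n).
Proof.
wlog nm : n / (n <= m)%N.
 move=> H w1; have [|/ltnW mn] := leqP n m; first by move=> /H; apply.
 have e0 : (m - n = 0)%N by apply/eqP; rewrite subn_eq0.
 apply: le_trans (_ : \sum_(k < 2 ^ m) xk m (w * zeta R (2 ^ m) ^+ k) ^+ 2 <= _); last first.
  by have := H m (leqnn m) w1; rewrite subnn e0.
 apply: ler_sum => k _; rewrite lerXn2r ?nnegrE ?(ltW (xk_gt0 _ _))// lef_pV2 ?posrE//.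
 by rewrite lerD2l ler_wpM2r ?nc_ge0// -!natrX ler_nat leq_exp2l.
move=> w1; pose v := (1 - dy n)%:C * w.
have d0 := @dy_gt0 R n; have d1 := dy_le1 R n; have q0 : 0 < 2 ^+ n :> R by rewrite exprn_gt0.
have dq : 2 ^+ n * dy n = 1 :> R by rewrite dyV mulfV// gt_eqF.
have hv : normc v <= 1 - dy n.
 rewrite /v normcM nc_real ger0_norm ?subr_ge0//; rewrite ler_piMr ?subr_ge0//.
have v1 : normc v < 1 by lra.
have N0 : (0 < 2 ^ m)%N by rewrite expn_gt0.
have le1 k : xk n (w * zeta R (2 ^ m) ^+ k) ^+ 2 <= dy n ^+ 2 * (normc (1 - v * zeta R (2 ^ m) ^+ k))^-1 ^+ 2.
 rewrite -exprMn; set ze := zeta R (2 ^ m) ^+ k.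
 have z1 : normc ze = 1 by rewrite /ze ncX nc_zeta expr1n.
 have hp : 0 < normc (1 - v * ze) by apply: nc_sub1_gt0; rewrite normcM z1 mulr1.
 rewrite lerXn2r ?nnegrE ?(ltW (xk_gt0 _ _)) ?mulr_ge0 ?invr_ge0 ?(ltW d0) ?(ltW hp)//.
 rewrite /xk -[dy n]invrK -invfM lef_pV2 ?posrE ?mulr_gt0 ?invr_gt0//.
 rewrite dyV invrK; have : normc (1 - v * ze) <= normc (1 - w * ze) + dy n.
  rewrite (_ : 1 - v * ze = (1 - w * ze) + (dy n)%:C * (w * ze)); last by rewrite /v RCB; ring.
  rewrite (le_trans (ncD _ _))// lerD2l !normcM z1 mulr1 nc_real ger0_norm ?(ltW d0)//.
  by rewrite ler_piMr ?(ltW d0).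
 by move=> /(ler_wpM2l (ltW q0)); rewrite mulrDr dq [_ + 1]addrC.
apply: (@le_trans _ _ (\sum_(k < 2 ^ m) dy n ^+ 2 * (normc (1 - v * zeta R (2 ^ m) ^+ k))^-1 ^+ 2)).
 by apply: ler_sum => k _.
rewrite -mulr_sumr sum_inv_sqr//.
have hs : \sum_(i < 2 ^ m) normc v ^+ (2 * i) <= 2 ^+ n.
 apply: (@le_trans _ _ (\sum_(i < 2 ^ m) normc v ^+ i)).
  by apply: ler_sum => i _; rewrite mulnC exprM expr2 ler_piMl ?exprn_ge0 ?nc_ge0// exprn_ile1 ?nc_ge0// ltW.
 apply: (le_trans (geo_sum_le _ _)); first by rewrite nc_ge0.
 by rewrite -[2 ^+ n]invrK -dyV lef_pV2 ?posrE ?subr_gt0//; lra.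
have hN : 2^-1 <= normc (1 - v ^+ (2 ^ m)).
 have h1 : normc v ^+ (2 ^ m) <= 2^-1.
  apply: (@le_trans _ _ ((1 - dy n) ^+ (2 ^ m))).
   by apply: lerXn2r; rewrite ?nnegrE ?nc_ge0 ?subr_ge0.
  apply: (le_trans (decay1 _ _)); first by rewrite (ltW d0).
  rewrite lef_pV2 ?posrE ?ltr_wpDr ?mulr_ge0 ?(ltW d0)//.
  have e1 := @dy_nat R n; have : (2 ^ n)%:R <= (2 ^ m)%:R :> R by rewrite ler_nat leq_exp2l.
  by move=> /(ler_wpM2r (ltW d0)); rewrite [_ * dy n in X in X -> _]mulrC e1; lra.
 have := ncB_ge (1 : C) (v ^+ (2 ^ m)); rewrite normc1 ncX; lra.
have hp : 0 < normc (1 - v ^+ (2 ^ m)) by lra.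
apply: (@le_trans _ _ (dy n ^+ 2 * ((2 ^ m)%:R * 2 ^+ n * 4))).
 rewrite ler_wpM2l ?exprn_ge0 ?(ltW d0)//; apply: ler_pM.
 - by rewrite mulr_ge0// sumr_ge0// => i _; rewrite exprn_ge0 ?nc_ge0.
 - by rewrite invr_ge0 exprn_ge0// ltW.
 - by rewrite ler_wpM2l.
 - rewrite -[4]invrK lef_pV2 ?posrE ?exprn_gt0// ?invr_gt0//.
  by rewrite (_ : 4^-1 = 2^-1 ^+ 2) ?lerXn2r ?nnegrE ?(ltW hp)//; rewrite exprVn -natrX.
rewrite natrX -{1}(subnK nm) exprD expr2; have := dq.
move: (2 ^+ n) (dy n) (2 ^+ (m - n)) => a b c ab.
rewrite (_ : b * b * (c * a * a * 4) = 4 * c * (a * b) ^+ 2); last by ring.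
by rewrite ab expr1n mulr1.
Qed.

Lemma powR_x2 (x t : R) A : 0 < x <= 1 -> 2 <= A%:R * t -> (x ^+ A) `^ t <= x ^+ 2.
Proof.
move=> /andP[x0 x1] h.
rewrite /powR gt_eqF ?exprn_gt0// -[x ^+ 2]lnK ?posrE ?exprn_gt0// ler_expR !lnXn//.
have l0 : ln x <= 0 by exact: ln_le0.
move: (ln x) l0 => l l0; rewrite -[l *+ A]mulr_natl -[l *+ 2]mulr_natl.
rewrite (_ : t * (A%:R * l) = A%:R * t * l); last by ring.
exact: ler_wnM2r.
Qed.

(** Reference point of the cell j: the corner of smallest modulus and angle. In the estimates it
    replaces [dyadic_point], which sits at the midpoint angle and, on level 0, at 1/2. *)
Definition yj (j : nat * nat) : C := (1 - dy j.1)%:C * zeta R (2 ^ j.1) ^+ j.2.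
Definition nd (i : nat * nat) : C := zeta R (2 ^ i.1.+1) ^+ i.2.
(** Level decay times angular decay of order A; the exponent of [rho] is |i.1 - j.1|. *)
Definition Mx A (i j : nat * nat) : R :=
 rho ^+ ((i.1 - j.1) + (j.1 - i.1)) * xk i.1 (yj j * conjc (nd i)) ^+ A.

Lemma nc_yj j : normc (yj j) <= 1.
Proof.
rewrite /yj normcM ncX nc_zeta expr1n mulr1 nc_real ger0_norm ?subr_ge0 ?dy_le1//.
by rewrite gerBl dy_ge0.
Qed.

Lemma nc_nd i : normc (nd i) = 1. Proof. by rewrite /nd ncX nc_zeta expr1n. Qed.

Lemma Mx_gt0 A i j : 0 < Mx A i j.
Proof. by rewrite mulr_gt0 ?exprn_gt0 ?rho_gt0 ?xk_gt0. Qed.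

Lemma Mx_pow A t i j : 2 <= A%:R * t -> Mx A i j `^ t <=
 (rho `^ t) ^+ ((i.1 - j.1) + (j.1 - i.1)) * xk i.1 (yj j * conjc (nd i)) ^+ 2.
Proof.
move=> h; rewrite /Mx powRM ?exprn_ge0 ?(ltW (rho_gt0 R)) ?(ltW (xk_gt0 _ _))//.
set d := (_ + _)%N; have -> : (rho ^+ d) `^ t = (rho `^ t) ^+ d.
 by rewrite -powR_mulrn ?(ltW (rho_gt0 R))// -powRrM mulrC powRrM powR_mulrn ?powR_ge0.
by rewrite ler_wpM2l ?exprn_ge0 ?powR_ge0// powR_x2// xk_gt0 xk_le1.
Qed.

Lemma rho_pow_lt1 t : 0 < t -> 0 <= rho `^ t < 1.
Proof.
move=> t0; rewrite powR_ge0/= /powR gt_eqF ?rho_gt0//.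
by rewrite expR_lt1 pmulr_rlt0// ln_lt0// rho_gt0 rho_lt1.
Qed.

Lemma Mx_sum_i A t : 0 < t -> 2 <= A%:R * t -> exists2 K : R, 0 < K & forall j L,
 \sum_(n < L) \sum_(k < 2 ^ n.+1) Mx A (nat_of_ord n, nat_of_ord k) j `^ t <= K.
Proof.
move=> t0 At; have r01 := rho_pow_lt1 t0; have /andP[r0 r1] := r01.
exists (8 * (2 / (1 - rho `^ t))) => [|j L]; first by rewrite mulr_gt0// divr_gt0// subr_gt0.
apply: le_trans (ler_wpM2l _ (two_sided j.1 L r01)); last by [].
rewrite mulr_sumr; apply: ler_sum => n _.
apply: (@le_trans _ _ (\sum_(k < 2 ^ n.+1) (rho `^ t) ^+ ((n - j.1) + (j.1 - n)) *
  xk n (conjc (yj j) * zeta R (2 ^ n.+1) ^+ k) ^+ 2)).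
 apply: ler_sum => k _; apply: (le_trans (Mx_pow _ _ At)) => /=.
 by rewrite -xk_conj conjM conjK.
rewrite -mulr_sumr mulrC ler_wpM2r ?exprn_ge0//.
have := @xk_sum n n.+1 (conjc (yj j)); rewrite nc_conj nc_yj => /(_ isT) /le_trans; apply.
by rewrite subSnn expr1 -natrM.
Qed.

(** On level n the sum over the cells costs a factor 2^(n - i.1), so the level decay must beat 2:
    rho^t < 1/2 exactly when t > 2. *)
Lemma Mx_sum_j A t : 2 < t -> 2 <= A%:R * t -> exists2 K : R, 0 < K & forall i P,
 \sum_(n < P) \sum_(k < 2 ^ n) Mx A i (nat_of_ord n, nat_of_ord k) `^ t <= K.
Proof.
move=> t2 At; have t0 : 0 < t by lra.
have r01 := rho_pow_lt1 t0; have /andP[r0 _] := r01.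
have x1 : 0 <= 2 * rho `^ t < 1.
 have -> : t = 2 + (t - 2) by lra.
 have t20 : 0 < t - 2 by lra.
 rewrite powRD; last by apply/implyP => _; rewrite gt_eqF ?rho_gt0.
 rewrite powR_mulrn ?(ltW (rho_gt0 R))// rho_sqr mulrA mulfV// mul1r.
 exact: rho_pow_lt1.
have /andP[x0 x1'] := x1.
exists (4 * (2 / (1 - 2 * rho `^ t))) => [|i P]; first by rewrite mulr_gt0// divr_gt0// subr_gt0.
apply: le_trans (ler_wpM2l _ (two_sided i.1 P x1)); last by [].
rewrite mulr_sumr; apply: ler_sum => n _.
apply: (@le_trans _ _ (\sum_(k < 2 ^ n) (rho `^ t) ^+ ((n - i.1) + (i.1 - n)) *
  xk i.1 (((1 - dy n)%:C * conjc (nd i)) * zeta R (2 ^ n) ^+ k) ^+ 2)).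
 apply: ler_sum => k _; apply: (le_trans (Mx_pow _ _ At)) => /=.
 by rewrite addnC /yj/= mulrAC.
have w1 : normc ((1 - dy n)%:C * conjc (nd i)) <= 1.
 rewrite normcM nc_conj nc_nd mulr1 nc_real ger0_norm ?subr_ge0 ?dy_le1//.
 by rewrite gerBl dy_ge0.
rewrite -mulr_sumr; apply: (le_trans (ler_wpM2l _ (xk_sum i.1 n w1))); first exact: exprn_ge0.
rewrite mulrCA ler_wpM2l// exprMn mulrC ler_wpM2r ?exprn_ge0//.
by rewrite -!natrX ler_nat leq_exp2l// leq_addr.
Qed.
End KernelSums.
Arguments Mx {R}.

(** * Schur test for the decay matrix *)

Section Schur.
Variable R : realType.

Lemma powR_sum_le (I : Type) (r : seq I) (a : I -> R) (p : R) : 0 < p <= 1 -> (forall i, 0 <= a i) ->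
 (\sum_(i <- r) a i) `^ p <= \sum_(i <- r) a i `^ p.
Proof.
move=> /andP[p0 p1] a0; elim: r => [|i r IH]; first by rewrite !big_nil powR0// gt_eqF.
rewrite !big_cons; apply: (@le_trans _ _ (a i `^ p + (\sum_(j <- r) a j) `^ p)); last by rewrite lerD2l.
have : 0 <= \sum_(j <- r) a j by apply: sumr_ge0.
move: (a i) (a0 i) (\sum_(j <- r) _) => x x0 y y0.
have [/eqP|xy0] := eqVneq (x + y) 0.
 rewrite paddr_eq0// => /andP[/eqP -> /eqP ->]; rewrite addr0 powR0 ?gt_eqF// addr_ge0//.
have s0 : 0 < x + y by rewrite lt_neqAle eq_sym xy0 addr_ge0.
have key (v : R) : 0 <= v <= 1 -> v <= v `^ p.
 move=> /andP[v0 v1]; have [->|vn] := eqVneq v 0; first exact: powR_ge0.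
 have vp : 0 < v by rewrite lt_neqAle eq_sym vn.
 rewrite /powR (negbTE vn) -[leLHS]lnK ?posrE// ler_expR.
 by have := ln_le0 v1; nra.
have e1 (v : R) : 0 <= v -> v `^ p = (v / (x + y)) `^ p * (x + y) `^ p.
 by move=> v0; rewrite -powRM ?divr_ge0 ?(ltW s0)// divfK// gt_eqF.
rewrite (e1 x)// (e1 y)// -mulrDl ler_peMl ?powR_ge0//.
have h : x / (x + y) + y / (x + y) = 1 by rewrite -mulrDl divff// gt_eqF.
rewrite -h; apply: lerD; apply: key; rewrite divr_ge0 ?(ltW s0)//= ler_pdivrMr// mul1r ?lerDl ?lerDr//.
Qed.

Lemma powR_split (p y : R) : 0 < y -> y `^ p = y * y `^ (p - 1).
Proof.
move=> y0; rewrite -[y in y * _]powRr1 ?ltW// -powRD; first by congr (_ `^ _); lra.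
by apply/implyP => _; rewrite gt_eqF.
Qed.

(* [y <= s + y^p s^(1-p)] with [s] a fraction of the mean replaces Jensen. *)
Lemma mean_powR (J : Type) (r : seq J) (om y : J -> R) (p K : R) : 1 <= p -> 0 < K ->
 (forall j, 0 <= om j) -> (forall j, 0 <= y j) -> \sum_(j <- r) om j <= K ->
 (\sum_(j <- r) om j * y j) `^ p <= 2 * (2 * K) `^ (p - 1) * \sum_(j <- r) om j * y j `^ p.
Proof.
move=> p1 K0 om0 y0 hK; set Y := \sum_(j <- r) om j * y j.
have p0 : 0 < p by lra.
have Y0 : 0 <= Y by apply: sumr_ge0 => j _; rewrite mulr_ge0.
have Z0 : 0 <= \sum_(j <- r) om j * y j `^ p by apply: sumr_ge0 => j _; rewrite mulr_ge0 ?powR_ge0.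
have [Yz|Yn] := eqVneq Y 0; first by rewrite Yz powR0 ?gt_eqF// mulr_ge0// mulr_ge0 ?powR_ge0.
have Yp : 0 < Y by rewrite lt_neqAle eq_sym Yn.
have [s [s0 Ks]] : exists s, 0 < s /\ K * s = Y / 2.
 exists (Y / (2 * K)); split; first by rewrite divr_gt0 ?mulr_gt0.
 by field; rewrite gt_eqF.
have sp0 : 0 < s `^ (p - 1) by exact: powR_gt0.
have h j : y j * s `^ (p - 1) <= s * s `^ (p - 1) + y j `^ p.
 have [le|lt] := leP (y j) s; first by rewrite (le_trans (ler_wpM2r (ltW sp0) le))// lerDl powR_ge0.
 have yp : 0 < y j by exact: lt_trans lt.
 rewrite -[leLHS]add0r; apply: lerD; first by apply: mulr_ge0; exact: ltW.
 rewrite (powR_split p yp); apply: ler_wpM2l; first exact: ltW.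
 by apply: ge0_ler_powR; rewrite ?nnegrE ?(ltW s0) ?(ltW yp) ?(ltW lt) ?subr_ge0.
have h1 : Y * s `^ (p - 1) <= K * s * s `^ (p - 1) + \sum_(j <- r) om j * y j `^ p.
 apply: (@le_trans _ _ (\sum_(j <- r) om j * (s * s `^ (p - 1) + y j `^ p))).
  rewrite /Y mulr_suml; apply: ler_sum => j _; rewrite -mulrA.
  by apply: ler_wpM2l => //; exact: h.
 under eq_bigr do rewrite mulrDr.
 rewrite big_split/= lerD2r -mulr_suml -mulrA; apply: ler_wpM2r => //.
 by rewrite mulr_ge0 ?(ltW s0) ?(ltW sp0).
rewrite Ks in h1; have Ys : Y = 2 * K * s by rewrite -mulrA Ks; field.
rewrite (powR_split p Yp) {2}Ys powRM ?mulr_ge0 ?(ltW K0) ?(ltW s0)//.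
have k0 : 0 <= (2 * K) `^ (p - 1) by exact: powR_ge0.
rewrite (_ : Y * _ = (2 * K) `^ (p - 1) * (Y * s `^ (p - 1))); last by ring.
rewrite (_ : 2 * _ * _ = (2 * K) `^ (p - 1) * (2 * \sum_(j <- r) om j * y j `^ p)); last by ring.
by apply: ler_wpM2l => //; lra.
Qed.

Definition dl (f : nat -> nat) P : seq (nat * nat) := [seq (n, k) | n <- iota 0 P, k <- iota 0 (f n)].

Lemma dl_sum (V : nmodType) f P (F : nat * nat -> V) :
 \sum_(j <- dl f P) F j = \sum_(n < P) \sum_(k < f n) F (nat_of_ord n, nat_of_ord k).
Proof.
rewrite /dl big_allpairs_dep/= -(big_mkord xpredT (fun n => \sum_(k < f n) F (n, nat_of_ord k))).
rewrite /index_iota subn0; apply: eq_bigr => n _.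
by rewrite -(big_mkord xpredT (fun k => F (n, k))) /index_iota subn0.
Qed.

Lemma mem_dl f P n k : ((n, k) \in dl f P) = (n < P)%N && (k < f n)%N.
Proof.
apply/allpairsPdep/andP => [[n' [k' [h1 h2 [-> ->]]]]|[h1 h2]].
 by move: h1 h2; rewrite !mem_iota.
by exists n, k; rewrite !mem_iota.
Qed.

Definition jl P := dl (fun n => 2 ^ n)%N P.
Definition il L := dl (fun n => 2 ^ n.+1)%N L.

Definition Yp A (b : R) (m : nat * nat -> R) P i : R := \sum_(j <- jl P) m j * @Mx R A i j `^ b.

(** For p <= 1 subadditivity of the power is enough, with b = 1. For p > 1, M^b is split as M^ga
    M^(b - ga): ga > 2 makes the weights summable over j, and the exponent ga + (b - ga) p left
    after [mean_powR] only has to be positive to sum over i. The bound b < 2 leaves M^(2 - b) for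
    the Cauchy-Schwarz step in [embedding_bound]. *)
Lemma sum_Yp (p : R) : 0 < p -> exists (A : nat) (b K : R), [/\ 0 < b < 2, 2 <= A%:R * (2 - b), 0 < K &
 forall m, (forall j, 0 <= m j) -> forall L P,
 \sum_(i <- il L) Yp A b m P i `^ p <= K * \sum_(j <- jl P) m j `^ p].
Proof.
move=> p0; have [p1|/ltW p1] := leP p 1.
 have [A A0 hA] := ex_pow2 (2 / p + 2).
 have hAn : 2 / p + 2 <= (2 ^ A)%:R :> R by rewrite natrX.
 have q0 : 0 < 2 / p by rewrite divr_gt0.
 have h1 : 2 <= (2 ^ A)%:R * p by rewrite -ler_pdivrMr//; lra.
 have [K K0 hK] := @Mx_sum_i R _ _ p0 h1.
 exists (2 ^ A)%N, 1, K; split => //; first by apply/andP; split; lra.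
  by rewrite (_ : 2 - 1 = 1); lra.
 move=> m m0 L P.
 apply: (@le_trans _ _ (\sum_(i <- il L) \sum_(j <- jl P) m j `^ p * Mx (2 ^ A) i j `^ p)).
  apply: ler_sum => i _; rewrite /Yp.
  apply: le_trans (powR_sum_le _ _ _) _; first by rewrite p0.
   by move=> j; rewrite mulr_ge0 ?powR_ge0.
  apply: ler_sum => j _; by have M0 := ltW (@Mx_gt0 R (2 ^ A) i j); rewrite (powRr1 M0) powRM.
 rewrite exchange_big/= mulr_sumr; apply: ler_sum => j _.
 by rewrite -mulr_sumr mulrC ler_wpM2r ?powR_ge0// /il dl_sum hK.
(* Then ga + (b - ga) p = be, and b = 2 - p^-1 / 2 - p^-2 < 2. *)
pose be : R := 2^-1; pose ga : R := 2 + p^-1; pose b := be / p + ga * (1 - p^-1).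
have pi0 : 0 < p^-1 by rewrite invr_gt0.
have pi1 : p^-1 <= 1 by rewrite invf_le1.
have b2 : b < 2.
 by rewrite /b /be /ga; move: (p^-1) pi0 pi1 => x x0 x1; nra.
have b0 : 0 < b.
 by rewrite /b /be /ga; move: (p^-1) pi0 pi1 => x x0 x1; nra.
have [A A0 hA] := ex_pow2 (4 + 2 / (2 - b)).
have hAn : 4 + 2 / (2 - b) <= (2 ^ A)%:R :> R by rewrite natrX.
have b20 : 0 < 2 - b by lra.
have q0 : 0 < 2 / (2 - b) by rewrite divr_gt0.
have h1 : 2 <= (2 ^ A)%:R * be by rewrite /be; lra.
have h2 : 2 <= (2 ^ A)%:R * ga by rewrite /ga; nra.
have h3 : 2 <= (2 ^ A)%:R * (2 - b) by rewrite -ler_pdivrMr//; lra.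
have be0 : 0 < be by rewrite /be.
have ga2 : 2 < ga by rewrite /ga; lra.
have [K1 K10 hK1] := @Mx_sum_i R _ _ be0 h1.
have [K2 K20 hK2] := @Mx_sum_j R _ _ ga2 h2.
exists (2 ^ A)%N, b, (2 * (2 * K2) `^ (p - 1) * K1); split => //.
- by rewrite b0 b2.
- by rewrite !mulr_gt0// powR_gt0// mulr_gt0.
move=> m m0 L P.
apply: (@le_trans _ _ (\sum_(i <- il L) 2 * (2 * K2) `^ (p - 1) * \sum_(j <- jl P) m j `^ p * Mx (2 ^ A) i j `^ be)).
 apply: ler_sum => i _.
 have E j : m j * Mx (2 ^ A) i j `^ b = Mx (2 ^ A) i j `^ ga * (m j * Mx (2 ^ A) i j `^ (b - ga)).
  rewrite mulrCA -powRD; last by apply/implyP => _; rewrite gt_eqF ?Mx_gt0.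
  by rewrite addrC subrK.
 rewrite /Yp; under eq_bigr do rewrite E.
 apply: le_trans (mean_powR p1 K20 _ _ _) _.
 - by move=> j; exact: powR_ge0.
 - by move=> j; rewrite mulr_ge0 ?powR_ge0.
 - by rewrite /jl dl_sum hK2.
 rewrite ler_wpM2l ?mulr_ge0 ?powR_ge0//; apply: ler_sum => j _.
 rewrite [(m j * _) `^ p]powRM ?powR_ge0// -powRrM mulrCA -powRD; last by apply/implyP => _; rewrite gt_eqF ?Mx_gt0.
 rewrite (_ : ga + (b - ga) * p = be)//.
 by rewrite /b /ga; move: p0 {E}; clear; move=> p0; field; rewrite gt_eqF.
rewrite -mulr_sumr -[leRHS]mulrA ler_wpM2l ?mulr_ge0 ?powR_ge0//.
rewrite exchange_big/= mulr_sumr; apply: ler_sum => j _.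
by rewrite -mulr_sumr mulrC ler_wpM2r ?powR_ge0// /il dl_sum hK1.
Qed.
End Schur.

(** * Sampling on roots of unity and synthesis *)

Section DiscreteReproduction.
Variable R : realType.
Local Notation C := R[i].

(** Discrete convolution over the N-th roots of unity: up to the factor N, G acts as the identity on
    the frequencies from lo to hi. *)
Definition reproduces N lo hi (G : C -> C) := forall m z, (lo <= m < hi)%N ->
 \sum_(k < N) (zeta R N ^+ k) ^+ m * G (z * conjc (zeta R N ^+ k)) = N%:R * z ^+ m.

Let unimod N k : (zeta R N ^+ k) * conjc (zeta R N ^+ k) = 1.
Proof. by rewrite mul_conj ncX nc_zeta !expr1n. Qed.

Lemma reproduces_dir N s L : (L <= N)%N -> reproduces N s (s + L) (fun u => u ^+ s * dir L u).
Proof.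
move=> LN m z /andP[h1 h2]; have iL : (m - s < L)%N by rewrite ltn_subLR.
have mE : m = (s + (m - s))%N by rewrite subnKC.
move: (m - s)%N iL mE => i iL ->.
rewrite (eq_bigr (fun k : 'I_N => \sum_(j < L) z ^+ (s + j) *
  ((zeta R N ^+ k) ^+ i * conjc ((zeta R N ^+ k) ^+ j)))); last first.
 move=> k _; have := unimod N k; set ze := zeta R N ^+ k => hz; clearbody ze.
 rewrite /dir !mulr_sumr; apply: eq_bigr => j _.
 transitivity (z ^+ (s + j) * (ze ^+ i * conjc (ze ^+ j)) * (ze * conjc ze) ^+ s); last by rewrite hz expr1n mulr1.
 by rewrite conjX !exprD !exprMn; ring.
rewrite exchange_big/= (bigD1 (Ordinal iL))//= -mulr_sumr sum_zeta ?(leq_trans iL)// eqxx.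
rewrite big1 ?addr0 1?mulrC// => j ji; rewrite -mulr_sumr sum_zeta ?(leq_trans iL)//; last first.
 exact: leq_trans LN.
case: eqP => [E|_]; last by rewrite mulr0.
by move: ji; rewrite -val_eqE/= E eqxx.
Qed.

(** Multiplying G by u^j shifts its range of frequencies by j, so the average over j < l still
    reproduces every m with m - j >= lo for all these j. *)
Lemma reproduces_step N lo hi G l : (0 < l)%N -> reproduces N lo hi G ->
 reproduces N (lo + l) hi (fun u => G u * (dir l u / l%:R)).
Proof.
move=> l0 hG m z /andP[h1 h2].
rewrite (eq_bigr (fun k : 'I_N => \sum_(j < l) l%:R^-1 * z ^+ j *
  ((zeta R N ^+ k) ^+ (m - j) * G (z * conjc (zeta R N ^+ k))))); last first.
 move=> k _; rewrite /dir mulr_suml !mulr_sumr; apply: eq_bigr => j _.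
 have jm : (j <= m)%N by apply: leq_trans h1; rewrite (leq_trans (ltnW (ltn_ord j)))// leq_addl.
 have := unimod N k; set ze := zeta R N ^+ k => hz; clearbody ze.
 move: (G _) => g.
 transitivity (l%:R^-1 * z ^+ j * (ze ^+ (m - j) * g) * (ze * conjc ze) ^+ j); last by rewrite hz expr1n mulr1.
 by rewrite -{1}(subnK jm) exprD !exprMn; ring.
rewrite exchange_big/= (eq_bigr (fun=> l%:R^-1 * (N%:R * z ^+ m))); last first.
 move=> j _; rewrite -mulr_sumr hG.
  have jm : (j <= m)%N by apply: leq_trans h1; rewrite (leq_trans (ltnW (ltn_ord j)))// leq_addl.
  by rewrite -[in RHS](subnKC jm) exprD; ring.
 rewrite (leq_ltn_trans (leq_subr _ _) h2) andbT leq_subRL.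
  by apply: leq_trans h1; rewrite addnC leq_add2l ltnW.
 by apply: leq_trans h1; rewrite (leq_trans (ltnW (ltn_ord j)))// leq_addl.
by rewrite sumr_const card_ord -[LHS]mulr_natl mulrA mulfV ?mul1r// pnatr_eq0 -lt0n.
Qed.

Lemma reproduces_iter N lo hi G l A : (0 < l)%N -> reproduces N lo hi G ->
 reproduces N (lo + A * l) hi (fun u => G u * (dir l u / l%:R) ^+ A).
Proof.
move=> l0 hG; elim: A => [|A IH].
 by rewrite mul0n addn0 => m z h; under eq_bigr do rewrite expr0 mulr1; exact: hG.
rewrite mulSn addnA addnAC => m z h.
rewrite -(reproduces_step l0 IH z h); apply: eq_bigr => k _.
by rewrite exprSr [G _ * (_ * _)]mulrA.
Qed.

(** Kernel of de la Vallee-Poussin type: a Dirichlet kernel whose range is widened below by A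
    2^(n-q), times A averaged Dirichlet kernels of length 2^(n-q). The widening pays for the
    products, and each factor brings one power of [xk]. *)
Definition psi A q n (u : C) : C := u ^+ (2 ^ n - A * 2 ^ (n - q)) * dir (2 ^ n + A * 2 ^ (n - q)) u *
 (dir (2 ^ (n - q)) u / (2 ^ (n - q))%:R) ^+ A.

Let Al A q n : (A * 2 <= 2 ^ q)%N -> (q <= n)%N -> (A * 2 ^ (n - q) * 2 <= 2 ^ n)%N.
Proof.
by move=> h qn; rewrite mulnAC -[X in (_ <= 2 ^ X)%N](subnKC qn) expnD leq_mul2r h orbT.
Qed.

Lemma psi_reproduces A q n : (A * 2 <= 2 ^ q)%N -> (q <= n)%N ->
 reproduces (2 ^ n.+1) (2 ^ n) (2 ^ n.+1) (psi A q n).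
Proof.
move=> Aq qn; have := Al Aq qn; set b := (A * 2 ^ (n - q))%N => hb.
have b1 : (b <= 2 ^ n)%N by rewrite (leq_trans _ hb)// leq_pmulr.
have e1 : (2 ^ n = 2 ^ n - b + b)%N by rewrite subnK.
have e2 : (2 ^ n.+1 = 2 ^ n - b + (2 ^ n + b))%N by rewrite expnS mul2n -addnn addnCA subnK.
have := @reproduces_dir (2 ^ n.+1) (2 ^ n - b) (2 ^ n + b); rewrite -e2.
have bn : (2 ^ n + b <= 2 ^ n.+1)%N by rewrite expnS mul2n -addnn leq_add2l.
move=> /(_ bn) /(@reproduces_iter _ _ _ _ (2 ^ (n - q)) A); rewrite expn_gt0 => /(_ isT).
by rewrite -e1.
Qed.

Lemma dir_kernel q n (u : C) : (q <= n)%N -> normc u <= 1 ->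
 normc (dir (2 ^ (n - q)) u / (2 ^ (n - q))%:R) <= (1 + 2 ^+ q.+1) * xk n u.
Proof.
move=> qn u1; have l0 : 0 < (2 ^ (n - q))%:R :> R by rewrite ltr0n expn_gt0.
rewrite normcM normcV nc_nat /xk ler_pdivlMr; last first.
 by rewrite ltr_wpDr ?mulr_ge0 ?exprn_ge0 ?nc_ge0.
have h1 := nc_dir_le (2 ^ (n - q)) u1.
have h2 : normc (dir (2 ^ (n - q)) u) * normc (1 - u) <= 2.
 rewrite -normcM (_ : _ * _ = 1 - u ^+ (2 ^ (n - q))).
  by rewrite (le_trans (ncB _ _))// normc1 ncX; have : normc u ^+ (2 ^ (n - q)) <= 1 by [rewrite exprn_ile1 ?nc_ge0]; lra.
 rewrite /dir; elim: (2 ^ (n - q))%N => [|l IH]; first by rewrite big_ord0 mul0r expr0 subrr.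
 by rewrite big_ord_recr/= mulrDl IH exprS; ring.
have e : 2 ^+ n = 2 ^+ q * (2 ^ (n - q))%:R :> R by rewrite natrX -exprD subnKC.
rewrite e; move: (normc (dir _ _)) (normc (1 - u)) h1 h2 (nc_ge0 (1 - u)) => y t h1 h2 t0.
move: ((2 ^ (n - q))%:R) l0 h1 => l l0 h1.
rewrite (_ : y / l * _ = y / l + 2 ^+ q * (y * t)); last by field; rewrite gt_eqF.
apply: lerD; first by rewrite ler_pdivrMr// mul1r.
by rewrite exprSr ler_wpM2l ?exprn_ge0.
Qed.

(** As A 2^(n-q) <= 2^(n-1), the lowest frequency is still at least 2^(n-1). *)
Lemma nc_psi A q n (u : C) : (A * 2 <= 2 ^ q)%N -> (q <= n)%N -> (0 < n)%N -> normc u <= 1 ->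
 normc (psi A q n u) <= normc u ^+ (2 ^ n.-1) * (2 ^ n.+1)%:R * ((1 + 2 ^+ q.+1) * xk n u) ^+ A.
Proof.
move=> Aq qn n0 u1; have := Al Aq qn; rewrite /psi; set b := (A * 2 ^ (n - q))%N => hb.
have e : (2 ^ n = 2 ^ n.-1 + 2 ^ n.-1)%N by rewrite -[in LHS](prednK n0) expnS mul2n addnn.
have b1 : (b <= 2 ^ n.-1)%N by rewrite -(leq_pmul2r (isT : (0 < 2)%N)) (leq_trans hb)// e addnn -muln2.
rewrite normcM [normc (_ ^+ _ * _)]normcM; apply: ler_pM.
- by rewrite mulr_ge0 ?nc_ge0.
- exact: nc_ge0.
- apply: ler_pM; rewrite ?nc_ge0// ?ncX.
  rewrite ler_wiXn2l ?nc_ge0//; clear -e b1; move: e b1; move: (2 ^ n)%N (2 ^ n.-1)%N b => x y b; lia.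
 apply: (le_trans (nc_dir_le _ u1)); rewrite ler_nat expnS mul2n -addnn leq_add2l.
 by rewrite (leq_trans b1)// e leq_addr.
- rewrite ncX; apply: lerXn2r; rewrite ?nnegrE; [exact: nc_ge0| |exact: dir_kernel].
 by apply: mulr_ge0; [rewrite addr_ge0 ?exprn_ge0|exact: ltW (xk_gt0 _ _)].
Qed.
End DiscreteReproduction.

Section BandAtoms.
Variables (R : realType) (w : R[i] -> R).
Hypothesis hw : class_Dhat w.
Local Notation C := R[i].
Local Notation sg := (sg w).

(** On levels below q the widened band has no room; their frequencies are left to the Taylor
    polynomial [psum a (2 ^ q)]. *)
Definition gat A q i (z : C) : C := if (i.1 < q)%N then 0 else
 psi A q i.1 (z * conjc (@nd R i)) / ((2 ^ i.1.+1)%:R * (sg i.1)%:C).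

(** Value at the node of the dyadic block of the series, with frequencies from 2^n up to 2^(n+1) for
    n = i.1, scaled by [sg]. *)
Definition cco (a : nat -> C) i : C :=
 (sg i.1)%:C * \sum_(m < 2 ^ i.1) a (2 ^ i.1 + m)%N * @nd R i ^+ (2 ^ i.1 + m).

Lemma gat_level A q a n z : (A * 2 <= 2 ^ q)%N -> (q <= n)%N ->
 \sum_(k < 2 ^ n.+1) cco a (n, nat_of_ord k) * gat A q (n, nat_of_ord k) z =
 \sum_(m < 2 ^ n) a (2 ^ n + m)%N * z ^+ (2 ^ n + m).
Proof.
move=> Aq qn; have s0 : (sg n)%:C != 0 :> C by rewrite eqCR0 gt_eqF// sg_gt0.
have N0 : (2 ^ n.+1)%:R != 0 :> C by rewrite pnatr_eq0 expn_eq0.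
rewrite (eq_bigr (fun k : 'I_(2 ^ n.+1) => \sum_(m < 2 ^ n) (a (2 ^ n + m)%N / (2 ^ n.+1)%:R) *
  ((zeta R (2 ^ n.+1) ^+ k) ^+ (2 ^ n + m) * psi A q n (z * conjc (zeta R (2 ^ n.+1) ^+ k))))); last first.
 move=> k _; rewrite /gat /= ltnNge qn/= /cco /nd/= mulr_sumr mulr_suml; apply: eq_bigr => m _.
 by move: (psi _ _ _ _) => P; field; rewrite s0 N0.
rewrite exchange_big/=; apply: eq_bigr => m _; rewrite -mulr_sumr psi_reproduces//.
 by rewrite mulrA divfK.
by rewrite leq_addr/= expnS mul2n -addnn ltn_add2l.
Qed.

Lemma band_sum1 (V : nmodType) (F : nat -> V) L :
 \sum_(m < 2 ^ L) F m = F 0%N + \sum_(n < L) \sum_(m < 2 ^ n) F (2 ^ n + m)%N.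
Proof.
elim: L => [|L IH]; first by rewrite big_ord_recl !big_ord0.
by rewrite [in LHS]expnS mul2n -addnn big_split_ord/= IH big_ord_recr/= addrA.
Qed.

Lemma gat_synth A q a L z : (A * 2 <= 2 ^ q)%N -> (q <= L)%N ->
 psum a (2 ^ L) z = psum a (2 ^ q) z + \sum_(i <- il L) cco a i * gat A q i z.
Proof.
move=> Aq qL; rewrite /il dl_sum -(subnKC qL); elim: (L - q)%N => [|r IH].
 rewrite addn0 big1 ?addr0// => n _; rewrite big1// => k _.
 by rewrite /gat/= ltn_ord mulr0.
rewrite addnS big_ord_recr/= addrA -IH gat_level ?leq_addr//.
by rewrite {1}/psum [in LHS]expnS mul2n -addnn big_split_ord.
Qed.

Lemma cco_sum : exists2 B : R, 0 < B & forall a L,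
 \sum_(i <- il L) normc (cco a i) ^+ 2 <= B * \sum_(m < 2 ^ L) normc (a m) ^+ 2 * Wm w m.
Proof.
have [c c0 hc] := Wm_lb hw; exists (2 / c) => [|a L]; first by rewrite divr_gt0.
have ci : 0 <= 2 / c by rewrite divr_ge0 ?ltW.
have t0 m : 0 <= normc (a m) ^+ 2 * Wm w m by rewrite mulr_ge0 ?exprn_ge0 ?nc_ge0// ltW// Wm_gt0.
rewrite (band_sum1 (fun m => normc (a m) ^+ 2 * Wm w m)) /il dl_sum mulrDr -[leLHS]add0r.
apply: lerD; first exact: mulr_ge0.
rewrite mulr_sumr; apply: ler_sum => n _; move: (nat_of_ord n) => {}n.
have E (k : 'I_(2 ^ n.+1)) : normc (cco a (n, nat_of_ord k)) ^+ 2 = sg n ^+ 2 *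
  normc (\sum_(m < 2 ^ n) a (2 ^ n + m)%N * (zeta R (2 ^ n.+1) ^+ k) ^+ m) ^+ 2.
 rewrite /cco /nd/= normcM exprMn nc_real ger0_norm ?(ltW (sg_gt0 hw n))//; congr (_ * _ ^+ 2).
 rewrite (eq_bigr (fun m : 'I_(2 ^ n) => (zeta R (2 ^ n.+1) ^+ k) ^+ (2 ^ n) * (a (2 ^ n + m)%N * (zeta R (2 ^ n.+1) ^+ k) ^+ m))).
  by rewrite -mulr_sumr normcM !ncX nc_zeta !expr1n mul1r.
 by move=> m _; rewrite exprD mulrCA.
under eq_bigr do rewrite E.
rewrite -mulr_sumr (parseval_le (fun m => a (2 ^ n + m)%N)) ?leq_exp2l// sg_sqr//.
have nd1 := @dy_nat R n.
have mn m : (m < 2 ^ n)%N -> c * Hn w n <= Wm w (2 ^ n + m) by move=> h; rewrite hc// expnS mul2n -addnn ltn_add2l.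
have -> : dy n * Hn w n * ((2 ^ n.+1)%:R * \sum_(m < 2 ^ n) normc (a (2 ^ n + m)%N) ^+ 2) =
  2 * (dy n * (2 ^ n)%:R) * (Hn w n * \sum_(m < 2 ^ n) normc (a (2 ^ n + m)%N) ^+ 2).
 by rewrite expnS natrM; ring.
rewrite nd1 mulr1 -[leRHS]mulrA ler_wpM2l// [leRHS]mulrC ler_pdivlMr// mulr_sumr mulr_suml.
apply: ler_sum => m _; rewrite (_ : _ * c = normc (a (2 ^ n + m)%N) ^+ 2 * (c * Hn w n)); last by ring.
by rewrite ler_wpM2l ?exprn_ge0 ?nc_ge0// mn.
Qed.

Lemma gat_bound A q : (A * 2 <= 2 ^ q)%N -> (0 < q)%N -> exists2 B : R, 0 < B & forall i j z, annulus j.1 z ->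
 normc (z - yj R j) <= 10 * dy j.1 -> sg j.1 * normc (gat A q i z) <= B * Mx A i j.
Proof.
move=> Aq q0; have [B B0 hB] := sg_decay hw; have [K K1 HK] := sg_gt hw.
have K0 : 0 < K by exact: lt_le_trans K1.
have r0 := @rho_gt0 R; pose c : R := (1 + 2 ^+ q.+1) * 21.
have c0 : 0 < c by rewrite mulr_gt0// ltr_wpDr ?exprn_ge0.
exists (B * K * rho^-1 * c ^+ A) => [|i j z an hz].
 by apply: mulr_gt0; [rewrite divr_gt0// mulr_gt0|rewrite exprn_gt0].
have BK0 : 0 <= B * K * rho^-1 by apply: mulr_ge0; [apply: mulr_ge0; exact: ltW|rewrite invr_ge0 ltW].
have M0 := @Mx_gt0 R A i j.
rewrite /gat; case: ifPn => [_|].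
 rewrite normc0 mulr0; apply: mulr_ge0; last exact: ltW.
 by rewrite mulr_ge0// exprn_ge0// ltW.
rewrite -leqNgt => qn; set n := i.1; have n0 : (0 < n)%N by exact: leq_trans qn.
have s0 := sg_gt0 hw n; have s0' := sg_gt0 hw j.1; have N0 : 0 < (2 ^ n.+1)%:R :> R by rewrite ltr0n expn_gt0.
have /andP[zl zu] := an.
have z1 : normc z <= 1 by apply: (le_trans (ltW zu)); rewrite gerBl dy_ge0.
set u := z * _; have un : normc u = normc z by rewrite /u normcM nc_conj nc_nd mulr1.
have hp := nc_psi Aq qn n0 (eq_ind_r (fun x => x <= 1) z1 un); rewrite un in hp.
(* On the annulus of j, |1 - u| is at least dy / 2, so moving from z to the reference point, a
   distance of at most 10 dy, costs a factor 1 + 20. *)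
have hx : xk n u <= 21 * xk n (yj R j * conjc (nd R i)).
 have p1 : 0 < 1 + 2 ^+ n * normc (1 - yj R j * conjc (nd R i)).
  by rewrite ltr_wpDr ?mulr_ge0 ?exprn_ge0 ?nc_ge0.
 have p2 : 0 < 1 + 2 ^+ n * normc (1 - u) by rewrite ltr_wpDr ?mulr_ge0 ?exprn_ge0 ?nc_ge0.
 rewrite /xk ler_pdivlMr// mulrC ler_pdivrMr//.
 have h1 : normc (1 - yj R j * conjc (nd R i)) <= normc (1 - u) + 10 * dy j.1.
  rewrite (_ : 1 - _ = (1 - u) + (z - yj R j) * conjc (nd R i)); last by rewrite /u; ring.
  by rewrite (le_trans (ncD _ _))// lerD2l normcM nc_conj nc_nd mulr1.
 have h2 : dy j.1 / 2 <= normc (1 - u).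
  have := ncB_ge 1 u; rewrite normc1 un; move: zu; rewrite dyS; lra.
 have h3 : normc (1 - yj R j * conjc (nd R i)) <= 21 * normc (1 - u) by lra.
 have h4 : 0 <= 2 ^+ n :> R by rewrite exprn_ge0.
 by have := ler_wpM2l h4 h3; lra.
have x0 : 0 <= xk n u by rewrite ltW// xk_gt0.
have hk : ((1 + 2 ^+ q.+1) * xk n u) ^+ A <= c ^+ A * xk n (yj R j * conjc (nd R i)) ^+ A.
 have q1 : 0 <= 1 + 2 ^+ q.+1 :> R by rewrite addr_ge0 ?exprn_ge0.
 have y0 := ltW (@xk_gt0 R n (yj R j * conjc (nd R i))).
 rewrite -exprMn; apply: lerXn2r; rewrite ?nnegrE; [exact: mulr_ge0|by rewrite mulr_ge0// ltW|].
 by rewrite /c -mulrA ler_wpM2l.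
(* [nc_psi] supplies |z| to the power 2^(n-1) only; the shift by one level costs K and 1 / rho. *)
have hd : sg j.1 * normc z ^+ (2 ^ n.-1) <= B * K * rho^-1 * (rho ^+ ((n - j.1) + (j.1 - n)) * sg n).
 apply: (le_trans (hB n.-1 j.1 z an)).
 have hs : sg n.-1 <= K * sg n by have := HK n.-1 1%N; rewrite expr1 addn1 prednK.
 have hr : rho ^+ ((n.-1 - j.1) + (j.1 - n.-1)) <= rho^-1 * rho ^+ ((n - j.1) + (j.1 - n)) :> R.
  rewrite mulrC ler_pdivlMr// -exprSr ler_wiXn2l ?(ltW r0) ?(ltW (@rho_lt1 R))//.
  by move: (n.-1) (prednK n0) => m <-; move: (j.1) => jj; clear; lia.
 rewrite (_ : B * K * _ * _ = B * (rho^-1 * rho ^+ ((n - j.1) + (j.1 - n)) * (K * sg n))); last by ring.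
 rewrite ler_wpM2l ?(ltW B0)//; apply: ler_pM => //; last exact: ltW (sg_gt0 hw _).
 by rewrite exprn_ge0// ltW.
rewrite [normc (_ / _)]normcM normcV [normc (_%:R * _)]normcM nc_nat nc_real ger0_norm ?(ltW s0)// mulrA ler_pdivrMr ?mulr_gt0//.
apply: (@le_trans _ _ (sg j.1 * (normc z ^+ (2 ^ n.-1) * (2 ^ n.+1)%:R * (c ^+ A * xk n (yj R j * conjc (nd R i)) ^+ A)))).
 rewrite ler_wpM2l ?(ltW s0')//; apply: (le_trans hp); rewrite ler_wpM2l//.
 by rewrite mulr_ge0 ?exprn_ge0 ?nc_ge0.
rewrite /Mx -/n; have y0 : 0 <= xk n (yj R j * conjc (nd R i)) ^+ A by rewrite exprn_ge0 ?(ltW (xk_gt0 _ _)).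
move: (xk n (yj R j * _) ^+ A) y0 => y y0.
have cA : 0 <= c ^+ A by rewrite exprn_ge0 ?ltW.
have hf : 0 <= (2 ^ n.+1)%:R * (c ^+ A * y) by rewrite mulr_ge0// mulr_ge0.
have := ler_wpM2r hf hd; move: (rho^-1) (rho ^+ _) (c ^+ A) => r1 r2 cc; congr (is_true (_ <= _)); by ring.
Qed.
End BandAtoms.

Section RealCauchySchwarz.
Variable R : realType.

Lemma real_CS (I : Type) (r : seq I) (P : pred I) (x y m : I -> R) :
 (forall i, 0 <= x i) -> (forall i, 0 <= y i) -> (forall i, 0 < m i) ->
 (\sum_(i <- r | P i) x i * y i) ^+ 2 <=
 (\sum_(i <- r | P i) x i ^+ 2 * m i) * (\sum_(i <- r | P i) y i ^+ 2 / m i).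
Proof.
move=> x0 y0 m0.
have key (s X Y a b c : R) : 0 <= s -> 0 <= X -> 0 <= Y -> 0 <= a -> 0 <= b -> 0 < c ->
  s ^+ 2 <= X * Y -> (a * b + s) ^+ 2 <= (a ^+ 2 * c + X) * (b ^+ 2 / c + Y).
 move=> s0 X0 Y0 a0 b0 c0 h.
 pose al := X * (b ^+ 2 / c); pose be := Y * (a ^+ 2 * c).
 have al0 : 0 <= al by rewrite /al mulr_ge0// divr_ge0 ?exprn_ge0 ?(ltW c0).
 have be0 : 0 <= be by rewrite /be mulr_ge0// mulr_ge0 ?exprn_ge0 ?(ltW c0).
 have abE : al * be = (a * b) ^+ 2 * (X * Y) by rewrite /al /be; field; rewrite gt_eqF.
 have e : (a ^+ 2 * c + X) * (b ^+ 2 / c + Y) = (a * b) ^+ 2 + (al + be) + X * Y.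
  by rewrite /al /be; field; rewrite gt_eqF.
 clearbody al be.
 have h2 : 2 * (a * b * s) <= al + be.
  rewrite -(@ler_pXn2r _ 2)// ?nnegrE ?addr_ge0 ?mulr_ge0//.
  apply: (@le_trans _ _ (4 * (al * be))); last by have := sqr_ge0 (al - be); nra.
  rewrite abE (_ : (2 * _) ^+ 2 = 4 * ((a * b) ^+ 2 * s ^+ 2)); last by ring.
  by rewrite ler_wpM2l// ler_wpM2l// exprn_ge0// mulr_ge0.
 rewrite e (_ : (a * b + s) ^+ 2 = (a * b) ^+ 2 + 2 * (a * b * s) + s ^+ 2); last by ring.
 by apply: lerD => //; apply: lerD.
elim: r => [|i r IH]; first by rewrite !big_nil expr0n mul0r.
rewrite !big_cons; case: ifP => _ //; apply: key => //.
- by apply: sumr_ge0 => j _; rewrite mulr_ge0.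
- by apply: sumr_ge0 => j _; rewrite mulr_ge0 ?exprn_ge0 ?(ltW (m0 j)).
- by apply: sumr_ge0 => j _; rewrite divr_ge0 ?exprn_ge0 ?(ltW (m0 j)).
Qed.
End RealCauchySchwarz.

Section DyadicLists.
Variable R : realType.

Lemma dl_uniq f P : uniq (dl f P).
Proof.
apply: allpairs_uniq_dep; [exact: iota_uniq|by move=> x _; exact: iota_uniq|].
by move=> [x y] [x' y'] _ _ /= [<- <-].
Qed.

Lemma dl_stable (V : nmodType) f (E : pred (nat * nat)) (F : nat * nat -> V) L0 L :
 (forall i, E i -> i \in dl f L0) -> (L0 <= L)%N ->
 \sum_(i <- dl f L | E i) F i = \sum_(i <- dl f L0 | E i) F i.
Proof.
move=> hE LL; rewrite big_mkcond [RHS]big_mkcond !dl_sum -(subnKC LL) big_split_ord/=.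
rewrite [X in _ + X]big1 ?addr0// => n _; rewrite big1// => k _.
by case: ifP => // /hE; rewrite mem_dl ltnNge leq_addr.
Qed.
End DyadicLists.

Section PolynomialFunctions.
Variables (R : realType) (w : R[i] -> R).
Hypothesis hw : class_Dhat w.
Local Notation C := R[i].

Definition ispoly (f : C -> C) := exists P : {poly C}, forall z, f z = P.[z].

Lemma ispoly_gat A q i : ispoly (gat w A q i).
Proof.
case: (boolP (i.1 < q)%N) => iq; first by exists 0 => z; rewrite /gat iq horner0.
pose d l : {poly C} := \sum_(m < l) 'X^m.
have dE l u : (d l).[u] = dir l u by rewrite horner_sum; apply: eq_bigr => m _; rewrite hornerXn.
pose n := i.1; pose l := (2 ^ (n - q))%N.
pose P : {poly C} := 'X^(2 ^ n - A * l) * d (2 ^ n + A * l)%N * (d l * ((l%:R)^-1)%:P) ^+ A.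
have PE u : P.[u] = psi A q n u.
 rewrite /psi -/l -(dE l) -(dE (2 ^ n + A * l)%N) -hornerXn /P.
 move: ('X^_ : {poly C}) (d _) (d _) => p1 p2 p3.
 rewrite hornerM; congr (_ * _); first exact: hornerM.
 by rewrite horner_exp; congr (_ ^+ _); rewrite hornerM hornerC.
exists ((P \Po ((conjc (nd R i)) *: 'X)) * (((2 ^ n.+1)%:R * (sg w n)%:C)^-1)%:P) => z.
by rewrite /gat (negbTE iq) hornerM hornerC horner_comp hornerZ hornerX PE [_ * z]mulrC.
Qed.

Lemma ispoly_psum f : ispoly f -> exists b M, (forall m, (M <= m)%N -> b m = 0) /\ forall z, f z = psum b M z.
Proof.
move=> [P hP]; exists (fun m => P`_m), (size P); split; first by move=> m; exact: nth_default.
by move=> z; rewrite hP horner_coef.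
Qed.

Lemma mcf_ispoly f : ispoly f -> mcf f.
Proof. by move=> /ispoly_psum[b [M [_ h]]]; rewrite (_ : f = psum b M); [exact: mcf_psum|apply/funext => z; exact: h]. Qed.

Lemma mcf_sum (I : Type) (r : seq I) (P : pred I) (c : I -> C) (F : I -> C -> C) : (forall i, mcf (F i)) ->
 mcf (fun z => \sum_(i <- r | P i) c i * F i z).
Proof.
move=> hF; elim: r => [|i r IH].
 by rewrite (_ : (fun z => _) = (fun=> 0)); [exact: mcf_cst|apply/funext => z; rewrite big_nil].
rewrite (_ : (fun z => _) = (fun z => (if P i then c i else 0) * F i z + \sum_(j <- r | P j) c j * F j z)).
 exact: mcfZD.
by apply/funext => z; rewrite big_cons; case: ifP => // _; rewrite mul0r add0r.
Qed.
End PolynomialFunctions.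

(** * Integrals against mu estimated cell by cell *)

Section CellFatou.
Variables (R : realType) (mu : {measure set R[i] -> \bar R}).
Local Notation C := R[i].
Local Notation D := (@unit_disc R).
Local Notation cell := (@dyadic_rectangle R).
Let mD : measurable D := @measurable_unit_disc R.
Hypothesis mc : forall j, (j.2 < 2 ^ j.1)%N -> mu (cell j.1 j.2) \is a fin_num.

(** Restricting U n to |z| < 1 - 2^-n leaves finitely many cells, so each integral is bounded by a
    finite sum while mu is not yet known to be finite on the disc; Fatou's lemma handles the
    limit. *)
Lemma fatou_cells (u : C -> R) (U : nat -> C -> R) (c : nat -> nat * nat -> R) B :
 measurable_fun D u -> (forall n, measurable_fun D (U n)) ->
 (forall z, D z -> 0 <= u z) -> (forall n z, D z -> 0 <= U n z) -> (forall n j, 0 <= c n j) ->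
 (forall z e, D z -> 0 < e -> exists N, forall n, (N <= n)%N -> u z - e <= U n z) ->
 (forall n j z, (j.2 < 2 ^ j.1)%N -> cell j.1 j.2 z -> U n z <= c n j) ->
 (forall n, \sum_(j <- jl n) c n j * fine (mu (cell j.1 j.2)) <= B) ->
 (\int[mu]_(z in D) (u z)%:E <= B%:E)%E.
Proof.
move=> mu' mU u0 U0 c0 lim ub sb.
pose V n : set C := [set z | normc z < 1 - dy n].
have mV n : measurable (V n) by exact: measurable_disc.
pose F n z := (\1_(V n) z * U n z)%:E.
have mF n : measurable_fun D (F n).
 by apply/measurable_EFinP; apply: measurable_funM => //; exact: measurable_indic.
have F0 n z : D z -> (0 <= F n z)%E by move=> Dz; rewrite lee_fin indicE mulr_ge0 ?ler0n ?U0.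
apply: (@le_trans _ _ (\int[mu]_(z in D) limn_einf (F^~ z))%E).
 apply: ge0_le_integral => //.
 - exact/measurable_EFinP.
 - by apply: measurable_limn_einf.
 - move=> z Dz; apply: le_einf => e e0; have [N HN] := lim z e Dz e0.
  have z1 : normc z < 1 by [].
  have q0 : 0 < (1 - normc z) / 2 by lra.
  have [N' hN'] := @dy_small R _ q0.
  exists (maxn N N') => n; rewrite geq_max => /andP[nN nN'].
  rewrite lee_fin indicE mem_set ?mul1r ?HN//.
  by have := @dy_le R _ _ nN'; rewrite /V/=; lra.
apply: (le_trans (@fatou _ _ _ mu D mD F mF F0)).
apply: einf_le => n.
pose Cj (j : nat * nat) : set C := if (j.2 < 2 ^ j.1)%N then cell j.1 j.2 else set0.
have mCj j : measurable (Cj j) by rewrite /Cj; case: ifP => // h; exact: measurable_cell.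
have mI j : measurable_fun D (fun z => (\1_(Cj j) z : R)%:E) by apply/measurable_EFinP; exact: measurable_indic.
have i0 j z : (0 <= (\1_(Cj j) z : R)%:E)%E by rewrite lee_fin indicE ler0n.
have mG j : measurable_fun D (fun z => ((c n j)%:E * (\1_(Cj j) z : R)%:E)%E).
 by apply: measurable_funeM.
have G0 j z : D z -> (0 <= (c n j)%:E * (\1_(Cj j) z : R)%:E)%E by move=> _; rewrite mule_ge0// lee_fin.
apply: (@le_trans _ _ (\int[mu]_(z in D) (\sum_(j <- jl n) (c n j)%:E * (\1_(Cj j) z : R)%:E))%E).
 apply: ge0_le_integral => //.
 - exact: F0.
 - exact: emeasurable_sum.
 move=> z Dz; rewrite /F; have [zV|zV] := pselect (V n z); last first.
  rewrite indicE memNset// mul0r sume_ge0// => j _; exact: G0.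
 have [n0 [k [kv cz]]] := cell_cover Dz.
 have n0n : (n0 < n)%N.
  rewrite ltnNge; apply/negP => /(@dy_le R) h; have /andP[h1 _] := cell_norm cz.
  by move: zV; rewrite /V/=; lra.
 have hin : (n0, k) \in jl n by rewrite mem_dl n0n.
 rewrite (big_rem _ hin)/= indicE mem_set// mul1r {1}/Cj/= kv indicE mem_set// mule1.
 apply: (@le_trans _ _ (c n (n0, k))%:E); first by rewrite lee_fin; exact: (ub n (n0, k)).
 by apply: leeDl; apply: sume_ge0 => j _; exact: G0.
rewrite ge0_integral_sum//.
apply: (@le_trans _ _ (\sum_(j <- jl n) (c n j * fine (mu (cell j.1 j.2)))%:E)%E); last first.
 by rewrite sumEFin lee_fin.
rewrite big_seq [leRHS]big_seq; apply: lee_sum => -[a k]; rewrite mem_dl => /andP[_ kv].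
rewrite ge0_integralZl//; last by rewrite lee_fin.
rewrite integral_indic// setIidl; last by rewrite /Cj/= kv; exact: cell_disc.
by rewrite EFinM fineK ?mc// /Cj/= kv.
Qed.
End CellFatou.

Section LevelSums.
Variables (R : realType) (w : R[i] -> R) (mu : {measure set R[i] -> \bar R}) (p : R).
Hypotheses (hw : class_Dhat w) (p0 : 0 < p).
Local Notation C := R[i].
Local Notation D := (@unit_disc R).
Local Notation sg := (sg w).
Local Notation cell := (@dyadic_rectangle R).
Local Notation star := (weight_star w).

Definition mcell (j : nat * nat) : R := fine (mu (cell j.1 j.2)) / sg j.1 ^+ 2.

Lemma mcell_ge0 j : 0 <= mcell j.
Proof. by rewrite divr_ge0 ?fine_ge0// exprn_ge0// ltW// sg_gt0. Qed.

Lemma level_sums : (\esum_(j in dyadic_indices)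
  poweR (mu (cell j.1 j.2) * ((star (dyadic_point j.1 j.2))^-1)%:E) p < +oo)%E ->
 (forall j, (j.2 < 2 ^ j.1)%N -> mu (cell j.1 j.2) \is a fin_num) /\
 exists B, forall P, \sum_(j <- jl P) mcell j `^ p <= B.
Proof.
move=> hS0; pose a (j : nat * nat) : \bar R := poweR (mu (cell j.1 j.2) * ((star (dyadic_point j.1 j.2))^-1)%:E)%E p.
have hS : (\esum_(j in dyadic_indices) a j < +oo)%E by exact: hS0.
have a0 j : (0 <= a j)%E by exact: poweR_ge0.
have st0 j : 0 < star (@dyadic_point R j.1 j.2) by exact: star_dyadic_gt0.
have mc j : (j.2 < 2 ^ j.1)%N -> mu (cell j.1 j.2) \is a fin_num.
 move=> jv; rewrite ge0_fin_numE// ltNge leye_eq; apply/negP => /eqP E.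
 have : (a j < +oo)%E.
  apply: le_lt_trans hS; have := @esum_seq_le _ _ dyadic_indices a [:: j] a0; rewrite big_seq1.
  by apply => // i; rewrite inE => /eqP ->.
 by rewrite /a E gt0_mulye ?lte_fin ?invr_gt0// poweRyr ?gt_eqF// ltxx.
split => //; have [c [C1 [c0 C10 hst]]] := star_dyadic hw.
exists (C1 `^ p * fine (\esum_(j in dyadic_indices) a j)) => P.
have e0 : (0 <= \esum_(j in dyadic_indices) a j)%E by exact: esum_ge0.
apply: (@le_trans _ _ (\sum_(j <- jl P) C1 `^ p * ratio w mu j `^ p)).
 apply: ler_sum => j _; rewrite -powRM ?ratio_ge0 ?(ltW C10)//.
 have s0 : 0 < sg j.1 ^+ 2 by rewrite exprn_gt0// sg_gt0.
 have r0 : 0 <= C1 * ratio w mu j by apply: mulr_ge0; [exact: ltW|exact: ratio_ge0].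
 apply: ge0_ler_powR; rewrite ?nnegrE ?mcell_ge0 ?(ltW p0)//.
 rewrite /mcell /ratio mulrCA ler_wpM2l ?fine_ge0//.
 have /andP[_ h] := hst j.1 j.2; rewrite -sg_sqr// in h.
 by rewrite -[leLHS]mul1r ler_pdivrMr// mulrAC ler_pdivlMr// mul1r.
rewrite -mulr_sumr ler_wpM2l ?powR_ge0// -lee_fin fineK ?ge0_fin_numE// -sumEFin.
apply: le_trans (@esum_seq_le _ _ dyadic_indices a (jl P) a0 (dl_uniq _ _) _); last first.
 by move=> [n k]; rewrite mem_dl => /andP[].
rewrite big_seq [leRHS]big_seq; apply: lee_sum => -[n k]; rewrite mem_dl => /andP[_ kv].
by rewrite /a -(@fineK _ (mu (cell _ _))) ?(mc (n, k))// -EFinM poweR_EFin.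
Qed.
End LevelSums.

Section Embedding.
Variables (R : realType) (w : R[i] -> R) (mu : {measure set R[i] -> \bar R}) (p : R).
Hypotheses (hw : class_Dhat w) (p0 : 0 < p).
Local Notation C := R[i].
Local Notation D := (@unit_disc R).
Local Notation sg := (sg w).
Local Notation one := (fun=> 1 : R).
Local Notation cell := (@dyadic_rectangle R).
Local Notation mc := (mcell w mu).
Hypothesis mfin : forall j, (j.2 < 2 ^ j.1)%N -> mu (cell j.1 j.2) \is a fin_num.
Let mD : measurable D := @measurable_unit_disc R.
Let m0 j : 0 <= mc j. Proof. exact: mcell_ge0. Qed.

Lemma Yp_ge0 A b P i : 0 <= Yp A b mc P i.
Proof. by apply: sumr_ge0 => j _; rewrite mulr_ge0 ?powR_ge0. Qed.

Lemma Yp_le A b P P' i : (P <= P')%N -> Yp A b mc P i <= Yp A b mc P' i.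
Proof.
move=> PP; apply: sum_uniq_sub; first exact: dl_uniq.
 by move=> [n k]; rewrite !mem_dl => /andP[/leq_trans -> //= ->].
by move=> j; rewrite mulr_ge0 ?powR_ge0.
Qed.

(** Supremum over the truncation level P, finite under the bound assumed in [Ysup_facts]; pairs out
    of range get 0. *)
Definition Ysup A b (i : nat * nat) : R :=
 if (i.2 < 2 ^ i.1.+1)%N then sup [set Yp A b mc P i | P in setT] else 0.

Lemma Ysup_facts A b K : (forall L P, \sum_(i <- il L) Yp A b mc P i `^ p <= K) ->
 [/\ forall i, 0 <= Ysup A b i, forall L i P, i \in il L -> Yp A b mc P i <= Ysup A b i &
  forall L, \sum_(i <- il L) Ysup A b i `^ p <= 2 `^ p * K].
Proof.
move=> hK.
have hs i : (i.2 < 2 ^ i.1.+1)%N -> has_sup [set Yp A b mc P i | P in setT].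
 move=> iv; split; first by exists (Yp A b mc 0 i), 0%N.
 exists (K `^ p^-1) => _ [P _ <-].
 have h : Yp A b mc P i `^ p <= K.
  apply: le_trans (hK i.1.+1 P); have hin : i \in il i.1.+1 by case: (i) iv => n k kv; rewrite mem_dl ltnSn.
  by rewrite (big_rem _ hin)/= lerDl sumr_ge0// => j _; exact: powR_ge0.
 have -> : Yp A b mc P i = (Yp A b mc P i `^ p) `^ p^-1.
  by rewrite -powRrM divff ?gt_eqF// powRr1// Yp_ge0.
 apply: ge0_ler_powR; rewrite ?nnegrE ?powR_ge0 ?invr_ge0 ?(ltW p0)//.
 exact: le_trans (powR_ge0 _ _) h.
have h2 i P : (i.2 < 2 ^ i.1.+1)%N -> Yp A b mc P i <= Ysup A b i.
 by move=> iv; rewrite /Ysup iv; apply: (ub_le_sup (hs i iv).2); exists P.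
have h1 i : 0 <= Ysup A b i.
 have [iv|/negbTE iv] := boolP (i.2 < 2 ^ i.1.+1)%N; last by rewrite /Ysup iv.
 exact: le_trans (Yp_ge0 A b 0 i) (h2 i 0%N iv).
(* Half of each supremum is reached at some level, and finitely many indices share one level P; this
   is the source of the factor 2 to the power p. *)
have h3 i : exists P, Ysup A b i <= 2 * Yp A b mc P i.
 have [iv|/negbTE iv] := boolP (i.2 < 2 ^ i.1.+1)%N; last first.
  by exists 0%N; rewrite /Ysup iv mulr_ge0 ?Yp_ge0.
 have := h1 i; rewrite le_eqVlt => /predU1P[<-|Y0]; first by exists 0%N; rewrite mulr_ge0 ?Yp_ge0.
 have q0 : 0 < Ysup A b i / 2 by rewrite divr_gt0.
 have [_ [P _ <-] hx] := sup_adherent q0 (hs i iv); exists P.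
 by move: hx; rewrite (_ : sup _ = Ysup A b i); [lra|rewrite /Ysup iv].
split => // [L [n k] P|L]; first by rewrite mem_dl => /andP[_ kv]; exact: h2.
have [P hP] : exists P, forall i, i \in il L -> Ysup A b i <= 2 * Yp A b mc P i.
 elim: (il L) => [|i r [P IH]]; first by exists 0%N.
 have [P' hP'] := h3 i; exists (maxn P P') => i'; rewrite inE => /predU1P[->|/IH h].
  by apply: (le_trans hP'); rewrite ler_wpM2l// Yp_le// leq_maxr.
 by apply: (le_trans h); rewrite ler_wpM2l// Yp_le// leq_maxl.
apply: (@le_trans _ _ (\sum_(i <- il L) 2 `^ p * Yp A b mc P i `^ p)).
 rewrite big_seq [leRHS]big_seq; apply: ler_sum => i iL.
 rewrite -powRM ?Yp_ge0//; apply: ge0_ler_powR; rewrite ?nnegrE ?(ltW p0) ?h1 ?mulr_ge0 ?Yp_ge0//.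
 exact: hP.
by rewrite -mulr_sumr ler_wpM2l ?powR_ge0.
Qed.

(** The single index (0, 0) sees every cell: [Mx] there is at least rho^n 3^-A on level n, and sg^2
    <= Hn 0 rho^(2n) <= Hn 0 rho^(bn) because b < 2. Hence the measure of a cell is at most c times
    its term in [Yp]. *)
Lemma finite_of_level_sums A b B : 0 < b < 2 -> (forall P, Yp A b mc P (0, 0)%N <= B) -> (mu D < +oo)%E.
Proof.
move=> /andP[b0 b2] hB; pose c := Hn w 0 / (3^-1 ^+ A) `^ b.
have t0 : 0 < (3^-1 ^+ A : R) `^ b by rewrite powR_gt0// exprn_gt0// invr_gt0.
have H0 := Hn_gt0 hw 0.
have c0 : 0 <= c by rewrite divr_ge0 ?ltW.
have : (\int[mu]_(z in D) ((fun=> 1 : R) z)%:E <= (c * B)%:E)%E.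
 apply: (@fatou_cells R mu mfin _ (fun n z => 1) (fun n j => 1)) => //.
 - by move=> z e _ e0; exists 0%N => n _; rewrite lerBlDr lerDl ltW.
 - move=> n; apply: (@le_trans _ _ (c * Yp A b mc n (0, 0)%N)); last by rewrite ler_wpM2l.
  rewrite mulr_sumr; apply: ler_sum => j _; rewrite mul1r.
  have s0 : 0 < sg j.1 ^+ 2 by rewrite exprn_gt0// sg_gt0.
  have -> : fine (mu (cell j.1 j.2)) = mc j * sg j.1 ^+ 2 by rewrite divfK// gt_eqF.
  rewrite [leRHS]mulrCA ler_wpM2l// sg_sqr//.
  have d0 := @dy_gt0 R j.1; have r0 := @rho_gt0 R; have r1 := @rho_lt1 R.
  have hr : dy j.1 <= (rho ^+ j.1) `^ b :> R.
   have -> : dy j.1 = (rho ^+ j.1) `^ 2 :> R.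
    by rewrite powR_mulrn ?exprn_ge0 ?(ltW r0)// -exprM mulnC exprM rho_sqr.
   have x0 : 0 < rho ^+ j.1 :> R by rewrite exprn_gt0.
   have x1 : rho ^+ j.1 <= 1 :> R by rewrite exprn_ile1 ?ltW.
   rewrite /powR gt_eqF// ler_expR; have := ln_le0 x1; nra.
  have hx : 3^-1 <= xk 0 (yj R j * conjc (nd R (0, 0)%N)).
   rewrite /xk expr0 mul1r lef_pV2 ?posrE//; last by rewrite ltr_wpDr ?nc_ge0.
   have := ncB 1 (yj R j * conjc (nd R (0, 0)%N)); rewrite normc1 normcM nc_conj nc_nd.
   by have := @nc_yj R j; lra.
  apply: (@le_trans _ _ (c * ((rho ^+ j.1) `^ b * (3^-1 ^+ A) `^ b))).
   have -> : c * ((rho ^+ j.1) `^ b * (3^-1 ^+ A) `^ b) = Hn w 0 * (rho ^+ j.1) `^ b.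
    by rewrite /c; field; rewrite gt_eqF.
   rewrite mulrC; apply: ler_pM; rewrite ?(ltW d0) ?(ltW (Hn_gt0 hw _))//.
   exact: Hn_noninc.
  rewrite ler_wpM2l// -powRM ?exprn_ge0 ?(ltW r0) ?invr_ge0//.
  have M0 := ltW (@Mx_gt0 R A (0, 0)%N j).
  apply: ge0_ler_powR; rewrite ?nnegrE ?(ltW b0)//.
   by apply: mulr_ge0; apply: exprn_ge0; rewrite ?invr_ge0// ltW.
  rewrite /Mx [X in rho ^+ X]/= sub0n subn0 add0n ler_wpM2l ?exprn_ge0 ?(ltW r0)//.
  have : 3^-1 <= xk (0, 0)%N.1 (yj R j * conjc (nd R (0, 0)%N)) by exact: hx.
  move: (xk _ _) => x hx2; have x0 : 0 <= x by apply: le_trans hx2; rewrite invr_ge0.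
  by apply: lerXn2r; rewrite ?nnegrE ?invr_ge0.
by rewrite integral_cst// mul1e => h; apply: le_lt_trans h _; exact: ltry.
Qed.

Definition approx A q (E : pred (nat * nat)) L a (z : C) : C :=
 psum a (2 ^ q) z + \sum_(i <- il L | E i) cco w a i * gat w A q i z.

Lemma mcf_remainder A q E L a : ell2 w a -> @mcf R (fun z => mkf a z - approx A q E L a z).
Proof.
move=> ea; have mg i : mcf (gat w A q i) by apply: mcf_ispoly; exact: ispoly_gat.
have mh : @mcf R (approx A q E L a).
 by have := @mcfZD R 1 _ _ (mcf_psum a (2 ^ q)) (mcf_sum (il L) E (cco w a) mg);
  congr mcf; apply/funext => z; rewrite mul1r.
have := @mcfZD R (-1) _ _ mh (mcf_hsum (ell2_hsum hw ea)).
by congr mcf; apply/funext => z; rewrite mulN1r addrC.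
Qed.

Lemma cell_yj j z : cell j.1 j.2 z -> normc (z - yj R j) <= 10 * dy j.1.
Proof.
move=> cz; have h := cell_node cz; set ze := zeta R (2 ^ j.1) ^+ j.2 in h.
have z1 : normc ze = 1 by rewrite /ze ncX nc_zeta expr1n.
have d0 := @dy_ge0 R j.1.
rewrite (_ : z - yj R j = (z * conjc ze - 1 + (dy j.1)%:C) * ze); last first.
 rewrite /yj -/ze RCB; have hz : ze * conjc ze = 1 by rewrite mul_conj z1 expr1n.
 by rewrite !mulrDl -!mulrA [conjc ze * ze]mulrC hz; ring.
rewrite normcM z1 mulr1 (le_trans (ncD _ _))// nc_real ger0_norm// ncBC; lra.
Qed.

(** Cauchy-Schwarz is applied with weights M^b on the coefficients and M^-b on the atoms: the atoms
    leave M^(2 - b), summable over i, while the coefficients summed against m_j give Y_i, at most t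
    off E. *)
Lemma embedding_bound A q b t (E : pred (nat * nat)) L0 B K1 Bc a : (A * 2 <= 2 ^ q)%N -> 0 < b < 2 ->
 0 <= t -> 0 <= K1 ->
 (forall i j z, annulus j.1 z -> normc (z - yj R j) <= 10 * dy j.1 ->
   sg j.1 * normc (gat w A q i z) <= B * Mx A i j) ->
 (forall j L, \sum_(i <- il L) Mx A i j `^ (2 - b) <= K1) ->
 (forall a L, \sum_(i <- il L) normc (cco w a i) ^+ 2 <= Bc * \sum_(m < 2 ^ L) normc (a m) ^+ 2 * Wm w m) ->
 (forall i, E i -> i \in il L0) ->
 (forall i L P, i \in il L -> ~~ E i -> Yp A b mc P i <= t) -> ell2 w a ->
 (\int[mu]_(z in D) (normc (mkf a z - approx A q E L0 a z) ^+ 2)%:E <= (B ^+ 2 * K1 * (t * (Bc * Qn area w (mkf a))))%:E)%E.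
Proof.
move=> Aq /andP[b0 b2] t0 K10 hg hK hBc hE hY ea; pose S z := mkf a z - approx A q E L0 a z.
pose Sn n z := \sum_(i <- il n | ~~ E i) cco w a i * gat w A q i z.
have mg i : mcf (gat w A q i) by apply: mcf_ispoly; exact: ispoly_gat.
have mS : mcf S by exact: mcf_remainder.
have mSn n : mcf (Sn n) by exact: mcf_sum.
have SnE n z : (maxn q L0 <= n)%N -> psum a (2 ^ n) z - approx A q E L0 a z = Sn n z.
 rewrite geq_max => /andP[qn Ln]; rewrite (gat_synth hw a z Aq qn) (bigID E)/= /approx.
 by rewrite /il (dl_stable _ hE Ln) addrA [X in X - _]addrC addrK.
pose Q := B ^+ 2 * K1.
have Q0 : 0 <= Q by rewrite mulr_ge0// sqr_ge0.
pose G n j := \sum_(i <- il n | ~~ E i) normc (cco w a i) ^+ 2 * Mx A i j `^ b.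
have G0 n j : 0 <= G n j by apply: sumr_ge0 => i _; rewrite mulr_ge0 ?powR_ge0 ?exprn_ge0 ?nc_ge0.
have s0 n : 0 < sg n := sg_gt0 hw n.
apply: (@fatou_cells R mu mfin (fun z => normc (S z) ^+ 2) (fun n z => normc (Sn n z) ^+ 2) (fun n j => Q / sg j.1 ^+ 2 * G n j)).
- by apply: measurable_funX; exact: mcf_normc.
- by move=> n; apply: measurable_funX; exact: mcf_normc.
- by move=> z _; rewrite exprn_ge0 ?nc_ge0.
- by move=> n z _; rewrite exprn_ge0 ?nc_ge0.
- by move=> n j; rewrite mulr_ge0// divr_ge0// exprn_ge0// ltW.
- move=> z e Dz e0; have x0 := nc_ge0 (S z).
 have d0 : 0 < e / (2 * (normc (S z) + 1)) by rewrite divr_gt0// mulr_gt0// ltr_wpDl.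
 have [N HN] := ell2_hsum hw ea Dz d0.
 exists (maxn N (maxn q L0)) => n; rewrite geq_max => /andP[Nn nn].
 have N2 : (N <= 2 ^ n)%N by rewrite (leq_trans Nn)// ltnW// ltn_expl.
 have h := HN _ N2; have := SnE n z nn; have := nc_ge0 (Sn n z).
 have := nc_triangle (psum a (2 ^ n) z - approx A q E L0 a z) (S z) 0; rewrite !subr0.
 rewrite (_ : S z - (_ - _) = mkf a z - psum a (2 ^ n) z); last by rewrite /S; ring.
 move=> h2 y0 E2; rewrite E2 in h2.
 have : e / (2 * (normc (S z) + 1)) * (2 * (normc (S z) + 1)) = e by rewrite divfK// gt_eqF// mulr_gt0// ltr_wpDl.
 move: (e / _) d0 h => d d0 h; move: (normc (S z)) (normc (Sn n z)) (normc (mkf a z - psum a (2 ^ n) z)) x0 y0 h h2 => x y v x0 y0 h h2 dE.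
 have [xd|xd] := leP x d; nra.
- move=> n j z jv cz; have /andP[an1 an2] := cell_norm cz.
 have an : annulus j.1 z by apply/andP.
 have hgz i := hg i j z an (cell_yj cz).
 have M0 i := @Mx_gt0 R A i j.
 apply: (@le_trans _ _ ((\sum_(i <- il n | ~~ E i) normc (cco w a i) * normc (gat w A q i z)) ^+ 2)).
  apply: lerXn2r; rewrite ?nnegrE ?nc_ge0//; first by apply: sumr_ge0 => i _; rewrite mulr_ge0 ?nc_ge0.
  by rewrite (le_trans (nc_sum _ _ _))//; apply: ler_sum => i _; rewrite normcM.
 have Mb i : 0 < Mx A i j `^ b by exact: powR_gt0.
 apply: (le_trans (real_CS (il n) (fun i => ~~ E i) (fun i => nc_ge0 (cco w a i)) (fun i => nc_ge0 (gat w A q i z)) Mb)).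
 rewrite -/(G n j) [leLHS]mulrC ler_wpM2r//.
 apply: (@le_trans _ _ (\sum_(i <- il n) normc (gat w A q i z) ^+ 2 / Mx A i j `^ b)).
  by rewrite [leRHS](bigID E)/= lerDr sumr_ge0// => i _; rewrite divr_ge0 ?exprn_ge0 ?nc_ge0 ?ltW.
 apply: (@le_trans _ _ (\sum_(i <- il n) B ^+ 2 / sg j.1 ^+ 2 * Mx A i j `^ (2 - b))).
  apply: ler_sum => i _; rewrite ler_pdivrMr// -[leRHS]mulrA -powRD; last first.
   by apply/implyP => _; rewrite gt_eqF.
  rewrite (_ : 2 - b + b = 2%:R); last by rewrite subrK.
  rewrite powR_mulrn ?(ltW (M0 i))// -expr_div_n -exprMn.
  apply: lerXn2r; rewrite ?nnegrE ?nc_ge0//; last first.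
   by rewrite mulrAC ler_pdivlMr// mulrC.
  rewrite mulrAC divr_ge0 ?(ltW (s0 _))//.
  by apply: le_trans (hgz i); rewrite mulr_ge0 ?nc_ge0 ?(ltW (s0 _)).
 rewrite -mulr_sumr (_ : Q / _ = B ^+ 2 / sg j.1 ^+ 2 * K1) ?ler_wpM2l//; last by rewrite /Q mulrAC.
 by rewrite divr_ge0 ?sqr_ge0.
- move=> n.
 have -> : \sum_(j <- jl n) Q / sg j.1 ^+ 2 * G n j * fine (mu (cell j.1 j.2)) =
   Q * \sum_(i <- il n | ~~ E i) normc (cco w a i) ^+ 2 * Yp A b mc n i.
  transitivity (\sum_(j <- jl n) \sum_(i <- il n | ~~ E i) Q * (normc (cco w a i) ^+ 2 * (mc j * Mx A i j `^ b))).
   apply: eq_bigr => j _; rewrite -mulr_sumr /mcell.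
   transitivity (Q * (fine (mu (cell j.1 j.2)) / sg j.1 ^+ 2 * G n j)); first by ring.
   congr (_ * _); rewrite /G mulr_sumr; apply: eq_bigr => i _; ring.
  rewrite exchange_big/= mulr_sumr; apply: eq_bigr => i _.
  by rewrite -mulr_sumr -mulr_sumr.
 rewrite /Q ler_wpM2l//.
 apply: (@le_trans _ _ (\sum_(i <- il n) t * normc (cco w a i) ^+ 2)).
  rewrite [leRHS](bigID E)/= -[leLHS]add0r; apply: lerD.
   by apply: sumr_ge0 => i _; rewrite mulr_ge0 ?exprn_ge0 ?nc_ge0.
  rewrite big_seq_cond [leRHS]big_seq_cond; apply: ler_sum => i /andP[iL nE].
  by rewrite mulrC ler_wpM2r ?exprn_ge0 ?nc_ge0// (hY i n).
 rewrite -mulr_sumr ler_wpM2l//; apply: (le_trans (hBc a n)).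
 (* For the constant sequence 1 and L = 0 the left side of [hBc] is empty, which gives the sign of
    Bc. *)
 have Bc0 : 0 <= Bc.
  have il0 : il 0 = [::] by [].
  have := hBc (fun=> 1) 0%N; rewrite il0 big_nil big_ord1 normc1 expr1n mul1r.
  by rewrite pmulr_lge0// Wm_gt0.
 by rewrite ler_wpM2l// Qn_mkf_lb.
Qed.
End Embedding.

(** * Finite rank approximation of the Toeplitz operator *)

Section FiniteRankApproximation.
Variables (R : realType) (w : R[i] -> R) (mu : {measure set R[i] -> \bar R}) (Cm : R).
Local Notation C := R[i].
Local Notation D := (@unit_disc R).
Local Notation one := (fun=> 1 : R).
Local Notation H := (bergman_space w).
Local Notation T := (toeplitz_operator w mu).
Local Notation nrm := (bergman_norm w).
Local Notation Q := (Qn area w).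
Local Notation Qm := (Qn mu one).
Local Notation ipa := (ip area w).
Local Notation ipm := (ip mu one).
Hypotheses (hw : class_Dhat w) (muD : (mu D < +oo)%E) (Cm0 : 0 <= Cm).
Hypothesis emb : forall f : C -> C^o, H f -> L2 mu one f /\ Qm f <= Cm * Q f.
Let mw := Dhat_meas hw.
Let w0 := Dhat_ge0 hw.
Let m1 : measurable_fun D one. Proof. exact: measurable_cst. Qed.
Let o0 z : D z -> 0 <= (1 : R). Proof. by []. Qed.

Let Q0 f : 0 <= Q f. Proof. exact: Qn_ge0. Qed.
Let Qm0 f : 0 <= Qm f. Proof. exact: Qn_ge0. Qed.

Lemma nrm_le (f g : C -> C^o) k : 0 <= k -> Q f <= k ^+ 2 * Q g -> nrm f <= k * nrm g.
Proof.
move=> k0 h; rewrite -(@ler_pXn2r _ 2)// ?nnegrE ?mulr_ge0 ?sqrtr_ge0//.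
by rewrite exprMn !nrm_sqr.
Qed.

Let le_of_sqr (x k q : R) : 0 <= x -> 0 <= k -> 0 <= q -> x ^+ 2 <= k * (q * x) -> x <= k * q.
Proof.
move=> x0 k0 q0; have [->|xn] := eqVneq x 0; first by rewrite mulr_ge0.
have xp : 0 < x by rewrite lt_neqAle eq_sym xn.
by rewrite mulrA expr2 ler_pM2r.
Qed.

(** Let P be the truncation of T_mu f. Its squared norm X is also the pairing of f with P in
    L^2(mu), so Cauchy-Schwarz and the embedding give X^2 <= Cm^2 Q(f) X, uniformly in the
    truncation. *)
Lemma toeplitz_space f : H f -> H (T f) /\ Q (T f) <= Cm ^+ 2 * Q f.
Proof.
move=> Hf; have [lf qf] := emb Hf; have [rt TE] := toeplitz_mkf hw muD lf.
have bd M : \sum_(m < M) normc (tc w mu f m) ^+ 2 * Wm w m <= Cm ^+ 2 * Q f.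
 pose b m := if (m < M)%N then tc w mu f m else 0.
 have hb m : (M <= m)%N -> b m = 0 by rewrite /b ltnNge => ->.
 have HP : H (mkf b) by apply: ell2_space => //; exact: (ell2_fin hw hb).
 have [lP qP] := emb HP; set X := \sum_(m < M) _.
 have QP : Q (mkf b) = X.
  by rewrite (Qn_fin hw hb); apply: eq_bigr => m _; rewrite /b ltn_ord.
 have iP : ipm f (mkf b) = X%:C.
  rewrite (ip_eqD mu one (fun z _ => erefl (f z)) (mkf_psum hb)) /psum ip_sum_r//; last first.
   by move=> i; exact: L2mu_X.
  rewrite /X RC_sum; apply: eq_bigr => m _; rewrite /b ltn_ord.
  have -> : ipm f (fun z => z ^+ m) = tc w mu f m * (Wm w m)%:C.
   by rewrite /tc divfK// eqCR0 gt_eqF// Wm_gt0.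
  by rewrite RCM -mul_conj; ring.
 have X0 : 0 <= X by apply: sumr_ge0 => m _; rewrite mulr_ge0 ?exprn_ge0 ?nc_ge0// ltW// Wm_gt0.
 have := ip_CS m1 o0 lf lP; rewrite iP nc_real ger0_norm// => h.
 apply: le_of_sqr => //; first exact: exprn_ge0.
 apply: (le_trans h); rewrite -QP expr2 (_ : Cm * Cm * _ = (Cm * Q f) * (Cm * Q (mkf b))); last by ring.
 exact: ler_pM.
have et : ell2 w (tc w mu f) by exists (Cm ^+ 2 * Q f).
by rewrite TE; split; [exact: ell2_space|exact: Qn_mkf_ub].
Qed.

Lemma space_sub (f g : C -> C^o) : H f -> H g -> H (fun z => f z - g z).
Proof.
move=> Hf Hg; have := space_lin hw (-1) Hg Hf; congr H.
by apply/funext => z; rewrite /= fctE scaleN1r addrC.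
Qed.

Let lin1 (m : {measure set C -> \bar R}) (v : C -> R) (mv : measurable_fun D v) (v0 : forall z, D z -> 0 <= v z)
 f g h : L2 m v f -> L2 m v g -> L2 m v h -> ip m v (fun z => f z - g z) h = ip m v f h - ip m v g h.
Proof.
move=> lf lg lh; rewrite (_ : (fun z => f z - g z) = (fun z => (-1) * g z + f z)).
 by rewrite ip_linear// mulN1r addrC.
by apply/funext => z; rewrite mulN1r addrC.
Qed.

Let lin2 (m : {measure set C -> \bar R}) (v : C -> R) (mv : measurable_fun D v) (v0 : forall z, D z -> 0 <= v z)
 f g h : L2 m v f -> L2 m v g -> L2 m v h -> ip m v h (fun z => f z - g z) = ip m v h f - ip m v h g.
Proof.
move=> lf lg lh; rewrite (_ : (fun z => f z - g z) = (fun z => (-1) * g z + f z)).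
 rewrite ip_linear_r// (_ : conjc (-1) = -1) ?mulN1r 1?addrC//.
 by apply: eqc; rewrite /= ?oppr0.
by apply/funext => z; rewrite mulN1r addrC.
Qed.

(** Extends [toeplitz_form] from polynomials to g: the embedding makes the partial sums of g
    converge in both norms at once. *)
Lemma toeplitz_ipE f g : H f -> H g -> ipa (T f) g = ipm f g.
Proof.
move=> Hf Hg; have [HT QT] := toeplitz_space Hf; have [lf qf] := emb Hf; have [lg _] := emb Hg.
have lT := L2_space hw HT; have [a ea gE] := space_ell2 hw Hg.
apply/eqP; rewrite -subr_eq0 -sqrf_eq0; apply/eqP.
apply: (@small_eq0 _ (2 * (Q (T f) + Cm * (Cm * Q f)))) => e e0.
have [M0 HM] := Qn_tail hw ea e0; have {HM} := HM M0 (leqnn _).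
pose b m := if (m < M0)%N then a m else 0.
have hb m : (M0 <= m)%N -> b m = 0 by rewrite /b ltnNge => ->.
have HP : H (mkf b) by apply: ell2_space => //; exact: (ell2_fin hw hb).
have Hd := space_sub Hg HP; have [lP _] := emb HP; have [ld qd] := emb Hd.
have -> : Q (fun z => mkf a z - psum a M0 z) = Q (fun z => g z - mkf b z).
 apply: Qn_eqD => z Dz; rewrite gE (mkf_psum hb)//; congr (_ - _).
 by apply: eq_bigr => m _; rewrite /b ltn_ord.
move=> qe; have TF := toeplitz_form hw muD hb lf HT.
have -> : ipa (T f) g - ipm f g = ipa (T f) (fun z => g z - mkf b z) - ipm f (fun z => g z - mkf b z).
 rewrite (lin2 mw w0) ?(lin2 m1 o0)//; try exact: L2_space.
 by rewrite TF; ring.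
rewrite ncX; set x := ipa _ _; set y := ipm _ _.
have hx := ip_CS mw w0 lT (L2_space hw Hd); rewrite -/x in hx.
have hy := ip_CS m1 o0 lf ld; rewrite -/y in hy.
have := nc_sqrD_le x (- y); rewrite ncN => hxy; apply: (le_trans hxy).
rewrite -mulrA ler_wpM2l// mulrDl; apply: lerD.
 by apply: (le_trans hx); rewrite ler_wpM2l.
apply: (le_trans hy); rewrite (_ : Cm * _ * e = (Cm * Q f) * (Cm * e)); last by ring.
apply: ler_pM => //; apply: (le_trans qd); exact: ler_wpM2l.
Qed.

Lemma toeplitz_linear (c : C) (f g : C -> C^o) : H f -> H g -> T (c *: f + g) = c *: T f + T g.
Proof.
move=> Hf Hg; have [lf _] := emb Hf; have [lg _] := emb Hg; apply/funext => z.
have [Dz|Dz] := pselect (D z); last first.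
 rewrite -[LHS]/(T (c *: f + g) z) -[RHS]/(c * T f z + T g z) /toeplitz_operator memNset//.
 by rewrite mulr0 addr0.
rewrite -[RHS]/(c * T f z + T g z) !toeplitz_ip// -(ip_linear m1 o0)//.
by have [] := emb (ell2_space hw (kc_ell2 hw Dz)).
Qed.

Lemma toeplitz_bounded : is_bounded_linear H nrm T.
Proof.
split => [f Hf|c f g Hf Hg|]; first by have [] := toeplitz_space Hf.
 exact: toeplitz_linear.
by exists Cm => f Hf; apply: nrm_le => //; have [] := toeplitz_space Hf.
Qed.

Section FiniteRank.
Variables (r : nat) (e v : 'I_r -> C -> C^o) (t : R).
Hypotheses (He : forall l, H (e l)) (Hv : forall l, H (v l)) (t0 : 0 <= t).
Local Notation phi f l := (ipa f (v l)).
Let K f : C -> C^o := fun z => \sum_(l < r) phi f l * e l z.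
Let S (f : C -> C^o) : C -> C^o := fun z => f z - K f z.
Hypothesis hS : forall f, H f -> Qm (fun z => f z - \sum_(l < r) phi f l * e l z) <= t * Q f.

Let sumE (c : 'I_r -> C) (g : 'I_r -> C -> C^o) : (fun z => \sum_(l < r) c l * g l z) = \sum_(l < r) c l *: g l.
Proof. by apply/funext => z; rewrite fct_sumE. Qed.

Let HK f : H f -> H (K f).
Proof. by move=> _; rewrite /K sumE; exact: space_sum. Qed.
Let HS f : H f -> H (S f).
Proof. by move=> Hf; exact: space_sub (HK Hf). Qed.

(** With S = 1 - K, the form <f, g>_mu - <S f, S g>_mu equals <K f, g>_mu + <S f, K g>_mu, of rank
    at most 2 r. Correcting both arguments leaves the error form <S f, S g>_mu, bounded by t;
    correcting only one would leave a bound of order sqrt(t). *)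
Let Ff (f : C -> C^o) : C -> C^o :=
 \sum_(l < r) phi f l *: T (e l) + \sum_(l < r) ipm (S f) (e l) *: v l.

Let L2v l := L2_space hw (Hv l).

Let phi_lin c (f g : C -> C^o) l : H f -> H g -> phi (c *: f + g) l = c * phi f l + phi g l.
Proof. by move=> Hf Hg; rewrite -(ip_linear mw w0)//; exact: L2_space. Qed.

Let S_lin c (f g : C -> C^o) : H f -> H g -> S (c *: f + g) = (fun z => c * S f z + S g z).
Proof.
move=> Hf Hg; apply/funext => z; rewrite /S /K.
rewrite (eq_bigr (fun l => c * (phi f l * e l z) + phi g l * e l z)).
 rewrite big_split/= -mulr_sumr (_ : (c *: f + g) z = c * f z + g z)//.
 by move: (\sum_(l < r) _) (\sum_(l < r) _) => x y; ring.
by move=> l _; rewrite phi_lin//; ring.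
Qed.

Let HF f : H f -> H (Ff f).
Proof.
move=> Hf; rewrite /Ff -[X in X + _]scale1r; apply: space_lin => //; apply: space_sum => //.
by move=> l; have [] := toeplitz_space (He l).
Qed.

Let F_lin c (f g : C -> C^o) : H f -> H g -> Ff (c *: f + g) = c *: Ff f + Ff g.
Proof.
move=> Hf Hg; rewrite /Ff scalerDr !scaler_sumr [RHS]addrACA.
congr (_ + _); rewrite -big_split/=; apply: eq_bigr => l _; rewrite scalerA -scalerDl; congr (_ *: _).
 exact: phi_lin.
have [l1 _] := emb (HS Hf); have [l2 _] := emb (HS Hg); have [l3 _] := emb (He l).
by rewrite S_lin//; exact: (ip_linear m1 o0 c l1 l2 l3).
Qed.

Let form f g : H f -> H g -> ipa (fun z => T f z - Ff f z) g = ipm (S f) (S g).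
Proof.
move=> Hf Hg; have [lf _] := emb Hf; have [lg _] := emb Hg.
have [lKf _] := emb (HK Hf); have [lKg _] := emb (HK Hg); have [lSf _] := emb (HS Hf).
have le l : L2 mu one (e l) by have [] := emb (He l).
have [HTf _] := toeplitz_space Hf; have lag := L2_space hw Hg.
have lTe l : L2 area w (T (e l)).
 by have [HTe _] := toeplitz_space (He l); exact: (L2_space hw HTe).
rewrite (lin1 mw w0) ?toeplitz_ipE//; try by apply: L2_space => //; exact: HF.
have -> : ipa (Ff f) g = ipm (K f) g + ipm (S f) (K g).
 rewrite /Ff -!sumE (_ : _ + _ = (fun z => 1 * (\sum_(l < r) phi f l * T (e l) z) + \sum_(l < r) ipm (S f) (e l) * v l z)); last first.
  by apply/funext => z; rewrite mul1r.
 rewrite (ip_linear mw w0)//; try by apply: L2_sum => // l; apply: L2Z.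
 rewrite mul1r !(ip_sum mw w0)//; congr (_ + _).
  by rewrite /K (ip_sum m1 o0)//; apply: eq_bigr => l _; rewrite toeplitz_ipE.
 by rewrite /K (ip_sum_r m1 o0)//; apply: eq_bigr => l _; rewrite mulrC -(ip_conj mw w0).
have e1 : ipm (S f) g = ipm f g - ipm (K f) g := lin1 m1 o0 lf lKf lg.
have e2 : ipm (S f) (S g) = ipm (S f) g - ipm (S f) (K g) := lin2 m1 o0 lg lKg lSf.
by rewrite e2 e1 opprD addrA.
Qed.

Let err f : H f -> Q (fun z => T f z - Ff f z) <= t ^+ 2 * Q f.
Proof.
move=> Hf; have [HTf _] := toeplitz_space Hf; have Hd := space_sub HTf (HF Hf).
set d := fun z => T f z - Ff f z in Hd *.
apply: le_of_sqr => //; first exact: exprn_ge0.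
have := form Hf Hd; rewrite ip_self => E.
have [lSf _] := emb (HS Hf); have [lSd _] := emb (HS Hd).
have := ip_CS m1 o0 lSf lSd; rewrite -E nc_real ger0_norm// => h; apply: (le_trans h).
rewrite expr2 (_ : t * t * _ = (t * Q f) * (t * Q d)); last by ring.
by apply: ler_pM => //; exact: hS.
Qed.

Lemma singular_value_le n : (2 * r <= n)%N -> singular_value H nrm T n <= t.
Proof.
move=> rn; have [k ->] : exists k, n = (r + (r + k))%N.
 by exists (n - 2 * r)%N; rewrite addnA addnn -mul2n subnKC.
have lb0 (S' : set R) : (forall x, S' x -> 0 <= x) -> has_lbound S' by move=> h; exists 0 => x /h.
have op0 (G : (C -> C^o) -> C -> C^o) : 0 <= op_norm H nrm G by apply: inf_ge0 => x [].
apply: (@le_trans _ _ (op_norm H nrm (fun f => T f - Ff f))).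
 apply: ge_inf; first by apply: lb0 => _ [G _ <-]; exact: op0.
 exists Ff => //; split.
  split => [f Hf|c f g Hf Hg|]; [exact: HF|exact: F_lin|].
  exists (2 * (Cm + t)) => f Hf; apply: nrm_le; first by rewrite mulr_ge0 ?addr_ge0.
  have [HTf qT] := toeplitz_space Hf; have Hd := space_sub HTf (HF Hf).
  have -> : Q (Ff f) = Q (fun z => T f z - (T f z - Ff f z)).
   by apply: Qn_eqD => z _; rewrite opprB addrCA subrr addr0.
  apply: (le_trans (Qn_sub mw w0 (L2_space hw HTf) (L2_space hw Hd))).
  have := err Hf; move: (Q (T f)) (Q (fun z => _ - _)) (Q f) (Q0 f) qT => a b c c0 ha hb.
  have h1 := mulr_ge0 (mulr_ge0 Cm0 t0) c0.
  have h2 := mulr_ge0 (exprn_ge0 2 Cm0) c0; have h3 := mulr_ge0 (exprn_ge0 2 t0) c0.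
  by rewrite (_ : (2 * (Cm + t)) ^+ 2 * c = 4 * (Cm ^+ 2 * c) + 8 * (Cm * t * c) + 4 * (t ^+ 2 * c)); [lra|ring].
 (* The k directions beyond the 2 r needed ones are filled with 0. *)
 pose g (i : 'I_(r + (r + k))) : C -> C^o := match fintype.split i with
  inl l => T (e l) | inr i' => match fintype.split i' with inl l => v l | inr _ => 0 end end.
 exists g; split.
  move=> i; rewrite /g; case: (fintype.split i) => [l|i']; first by have [] := toeplitz_space (He l).
  by case: (fintype.split i') => [l|_]; [exact: Hv|exact: space0].
 move=> f Hf; exists (fun i => match fintype.split i with
  inl l => phi f l | inr i' => match fintype.split i' with inl l => ipm (S f) (e l) | inr _ => 0 end end).
 have E1 a b (j : 'I_a) : fintype.split (lshift b j) = inl j by exact: (unsplitK (inl j)).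
 have E2 a b (j : 'I_b) : fintype.split (rshift a j) = inr j by exact: (unsplitK (inr j)).
 rewrite big_split_ord/= big_split_ord/= [X in _ + (_ + X)]big1 ?addr0; last first.
  by move=> i _; rewrite /g !E2 scale0r.
 by rewrite /Ff; congr (_ + _); apply: eq_bigr => l _; rewrite /g ?E2 E1.
apply: ge_inf; first by apply: lb0 => x [].
split => // f Hf; apply: nrm_le => //; exact: err.
Qed.
End FiniteRank.
End FiniteRankApproximation.

Section FiniteRankData.
Variables (R : realType) (w : R[i] -> R) (mu : {measure set R[i] -> \bar R}).
Local Notation C := R[i].
Local Notation D := (@unit_disc R).
Local Notation one := (fun=> 1 : R).
Local Notation H := (bergman_space w).

Definition finite_coefs (b : nat -> C) := exists N, forall m, (N <= m)%N -> b m = 0.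

(** Both families consist of polynomials, so the functionals read finitely many coefficients of f;
    the compactness argument relies on this. *)
Definition fr_approx (t : R) (r : nat) := exists (e v : 'I_r -> nat -> C),
 [/\ forall l, finite_coefs (e l), forall l, finite_coefs (v l) &
  forall f : C -> C^o, H f -> Qn mu one (fun z => f z - \sum_(l < r) ip area w f (mkf (v l)) * mkf (e l) z)
   <= t * Qn area w f].

Hypothesis hw : class_Dhat w.

Lemma ip_mkf_fin (f : C -> C^o) b N : H f -> (forall m, (N <= m)%N -> b m = 0) ->
 ip area w f (mkf b) = \sum_(m < N) conjc (b m) * ip area w f (fun z => z ^+ m).
Proof.
move=> Hf hb; rewrite (ip_eqD area w (fun z _ => erefl (f z)) (mkf_psum hb)).
rewrite /psum (ip_sum_r (Dhat_meas hw) (Dhat_ge0 hw))//; last exact: L2_space.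
by move=> i; exact: L2_X.
Qed.
End FiniteRankData.

(** * Compactness of the Toeplitz operator *)

Section Compactness.
Variables (R : realType) (w : R[i] -> R) (mu : {measure set R[i] -> \bar R}) (Cm : R).
Local Notation C := R[i].
Local Notation D := (@unit_disc R).
Local Notation one := (fun=> 1 : R).
Local Notation H := (bergman_space w).
Local Notation T := (toeplitz_operator w mu).
Local Notation nrm := (bergman_norm w).
Local Notation Q := (Qn area w).
Local Notation Qm := (Qn mu one).
Hypotheses (hw : class_Dhat w) (muD : (mu D < +oo)%E) (Cm0 : 0 <= Cm).
Hypothesis emb : forall f : C -> C^o, H f -> L2 mu one f /\ Qm f <= Cm * Q f.
Hypothesis fr : forall t, 0 < t -> exists r, fr_approx w mu t r.
Let mw := Dhat_meas hw.
Let w0 := Dhat_ge0 hw.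
Let m1 : measurable_fun D one. Proof. exact: measurable_cst. Qed.
Let o0 z : D z -> 0 <= (1 : R). Proof. by []. Qed.
Let W0 := Wm_gt0 hw.

(** Tychonoff's theorem on a product of segments gives a cluster point for coordinatewise
    convergence; the subsequence is extracted in [toeplitz_compact]. *)
Lemma cluster_coordinates (f : nat -> nat -> R) (B : nat -> R) : (forall n i, `|f n i| <= B i) ->
 exists a : nat -> R, forall N K (e : R), 0 < e -> exists2 n, (N <= n)%N &
  forall i, (i < K)%N -> `|f n i - a i| < e.
Proof.
move=> hf.
pose P := prod_topology (fun _ : nat => (R : topologicalType)).
pose F : set_system P := (fun n => f n : P) @ \oo.
have PF : ProperFilter F by exact: fmap_proper_filter.
have cK (i : nat) : compact (`[- B i, B i]%classic : set R) by exact: segment_compact.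
have [|a [_ ca]] := @tychonoff nat (fun=> R) (fun i => `[- B i, B i]%classic) cK F PF.
 by exists 0%N => // n _ i; rewrite /= in_itv/= -ler_norml.
exists a => N K e e0.
have nb : nbhs (a : P) [set g : P | forall i, (i < K)%N -> `|g i - a i| < e].
 elim: K => [|K IH]; first by apply: filterS filterT => g _ i.
 have pc := @proj_continuous nat (fun=> R) K (a : P).
 have h : nbhs (a : P) [set g : P | `|g K - a K| < e].
  have := pc [set x : R | `|x - a K| < e]; apply.
  by apply/nbhs_ballP; exists e => //= x; rewrite /ball/= distrC.
 apply: filterS (filterI IH h) => g [h1 h2] i; rewrite ltnS leq_eqVlt => /predU1P[->//|].
 exact: h1.
have FN : F [set g : P | exists2 n, (N <= n)%N & g = f n].
 by exists N => // n /= Nn; exists n.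
by have [g [[n Nn ->] hg]] := ca _ _ FN nb; exists n.
Qed.

Lemma Q_toeplitz_le f : H f -> Q (T f) <= Cm * Qm f.
Proof.
move=> Hf; have [HT _] := toeplitz_space hw muD Cm0 emb Hf.
have [lf _] := emb Hf; have [lT qT] := emb HT.
have E : ip area w (T f) (T f) = ip mu one f (T f) by exact: (toeplitz_ipE hw muD Cm0 emb).
have := ip_CS m1 o0 lf lT; rewrite -E ip_self nc_real ger0_norm ?Qn_ge0// => h.
have Q0 : 0 <= Q (T f) by exact: Qn_ge0.
have Qm0 : 0 <= Qm f by exact: Qn_ge0.
have [->|xn] := eqVneq (Q (T f)) 0; first by rewrite mulr_ge0.
have xp : 0 < Q (T f) by rewrite lt_neqAle eq_sym xn.
rewrite -(ler_pM2r xp) -expr2; apply: (le_trans h); rewrite mulrAC [Cm * _ * _]mulrC.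
by rewrite ler_wpM2l.
Qed.

(** The finite rank part of d is controlled by finitely many coefficients, and the rest by the
    approximation. *)
Lemma weakly_small t r : fr_approx w mu t r -> exists N (EB : R), 0 <= EB /\ forall (d : C -> C^o) (eta : R), H d -> 0 <= eta ->
 (forall m, (m < N)%N -> normc (ip area w d (fun z => z ^+ m)) <= eta * Wm w m) ->
 Qm d <= 2 * (t * Q d + (eta * EB) ^+ 2).
Proof.
move=> [e [v [/choice[Ne hNe] /choice[Nv hNv] hS]]].
exists (\max_(l < r) Nv l)%N.
pose V l := \sum_(m < Nv l) normc (v l m) * Wm w m; pose B l := \sum_(m < Ne l) normc (e l m).
have V0 l : 0 <= V l by apply: sumr_ge0 => m _; rewrite mulr_ge0 ?nc_ge0// ltW.
have B0 l : 0 <= B l by apply: sumr_ge0 => m _; rewrite nc_ge0.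
pose s := Num.sqrt (fine (mu D)); have s2 : s ^+ 2 = fine (mu D) by rewrite sqr_sqrtr// fine_ge0.
have S0 : 0 <= \sum_(l < r) V l * B l by apply: sumr_ge0 => l _; exact: mulr_ge0.
exists ((\sum_(l < r) V l * B l) * s); split; first by rewrite mulr_ge0 ?sqrtr_ge0.
move=> d eta Hd eta0 hd.
have He l : H (mkf (e l)) by apply: ell2_space => //; exact: (ell2_fin hw (hNe l)).
pose K : C -> C^o := fun z => \sum_(l < r) ip area w d (mkf (v l)) * mkf (e l) z.
have HK : H K.
 have -> : K = \sum_(l < r) ip area w d (mkf (v l)) *: (mkf (e l) : C -> C^o).
  by apply/funext => z; rewrite fct_sumE.
 exact: space_sum.
have [ld _] := emb Hd; have [lK _] := emb HK; have lS := L2B m1 o0 ld lK.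
have cb l : normc (ip area w d (mkf (v l))) <= eta * V l.
 rewrite (ip_mkf_fin hw Hd (hNv l)) (le_trans (nc_sum _ _ _))// mulr_sumr; apply: ler_sum => m _.
 rewrite normcM nc_conj mulrCA ler_wpM2l ?nc_ge0// hd//.
 exact: leq_trans (ltn_ord m) (leq_bigmax l).
have Kb z : D z -> normc (K z) <= eta * \sum_(l < r) V l * B l.
 move=> Dz; rewrite (le_trans (nc_sum _ _ _))// mulr_sumr; apply: ler_sum => l _.
 rewrite normcM mulrA; apply: ler_pM; rewrite ?nc_ge0//.
 rewrite (mkf_psum (hNe l))// (le_trans (nc_sum _ _ _))//; apply: ler_sum => m _.
 by rewrite normcM ncX ler_piMr ?nc_ge0// exprn_ile1 ?nc_ge0// ltW.
have qK : Qm K <= (eta * ((\sum_(l < r) V l * B l) * s)) ^+ 2.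
 rewrite mulrA exprMn s2; apply: (Qmu_le muD) => //; exact: (mcf_space hw).
have -> : Qm d = Qm (fun z => d z - K z + K z) by apply: Qn_eqD => z _; rewrite subrK.
have -> : Qm (fun z => d z - K z + K z) = Qm (fun z => (d z - K z) - (- K z)).
 by apply: Qn_eqD => z _; rewrite opprK.
have lN : L2 mu one (fun z => - K z) by have := L2Z m1 o0 (-1) lK; congr L2; apply/funext => z; rewrite mulN1r.
apply: (le_trans (Qn_sub m1 o0 lS lN)); rewrite ler_wpM2l//; apply: lerD; first exact: hS.
have -> : Qm (fun z => - K z) = Qm K by rewrite /Qn; congr fine; apply: eq_integral => z _; rewrite ncN.
exact: qK.
Qed.

(** A bounded sequence has a subsequence whose coefficients converge, and the limits are again
    square summable. The differences have bounded norm and small initial coefficients, so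
    [weakly_small] makes them small in L^2(mu), and [Q_toeplitz_le] makes their images small. *)
Lemma toeplitz_compact : is_compact_operator H nrm T.
Proof.
move=> u Hu [M hM].
pose cf n m := ip area w (u n) (fun z => z ^+ m) / (Wm w m)%:C.
have QM n : Q (u n) <= M ^+ 2.
 have h0 : 0 <= nrm (u n) by exact: sqrtr_ge0.
 have h1 := hM n; have M0 := le_trans h0 h1.
 have E := nrm_sqr hw (u n); rewrite -E; move: (nrm (u n)) h0 h1 => x x0 xM.
 by rewrite expr2 [leRHS]expr2; exact: ler_pM.
have ipu n m : ip area w (u n) (fun z => z ^+ m) = cf n m * (Wm w m)%:C.
 by rewrite divfK// eqCR0 gt_eqF.
have hcf n N : \sum_(m < N) normc (cf n m) ^+ 2 * Wm w m <= M ^+ 2.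
 apply: le_trans (QM n); have [a ea uE] := space_ell2 hw (Hu n).
 rewrite (eq_bigr (fun m : 'I_N => normc (a m) ^+ 2 * Wm w m)).
  by rewrite uE; exact: Qn_mkf_lb.
 by move=> m _; rewrite /cf uE ip_mkf_X// mulfK// eqCR0 gt_eqF.
have cb n m : normc (cf n m) <= M ^+ 2 / Wm w m + 1.
 have h : normc (cf n m) ^+ 2 <= M ^+ 2 / Wm w m.
  rewrite ler_pdivlMr//; apply: le_trans (hcf n m.+1); rewrite big_ord_recr/= lerDr.
  by apply: sumr_ge0 => i _; rewrite mulr_ge0 ?exprn_ge0 ?nc_ge0// ltW.
 have := nc_ge0 (cf n m); move: (normc _) h => x; nra.
clearbody cf.
(* Real and imaginary parts are interleaved into one real sequence: coefficient m occupies the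
   coordinates 2 m and 2 m + 1. *)
pose f n i := if odd i then cIm (cf n i./2) else cRe (cf n i./2).
have fB n i : `|f n i| <= M ^+ 2 / Wm w i./2 + 1.
 by apply: le_trans (cb n i./2); rewrite /f; case: ifP => _; [exact: nc_Im|exact: nc_Re].
have [a ha] := cluster_coordinates fB.
pose al m : C := a m.*2 +i* a m.*2.+1.
have close n m (e : R) K : (m < K)%N -> (forall i, (i < K.*2)%N -> `|f n i - a i| < e) ->
  normc (cf n m - al m) <= 2 * e.
 move=> mK h; rewrite (le_trans (nc_ReIm _))// mulr2n mulrDl mul1r ReD ImD ReN ImN/=.
 have e1 : (m.*2 < K.*2)%N by rewrite ltn_double.
 have e2 : (m.*2.+1 < K.*2)%N by rewrite ltn_Sdouble.
 by apply: lerD; [have := h _ e1|have := h _ e2]; rewrite /f/= ?odd_double ?uphalf_double ?doubleK//= => /ltW.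
clearbody al.
have ea : ell2 w al.
 exists (2 * M ^+ 2 + 2) => N; pose SW := \sum_(m < N) Wm w m.
 have SW0 : 0 <= SW by apply: sumr_ge0 => m _; exact: ltW.
 (* Chosen so that 4 d times the sum of the first N moments is at most 1. *)
 have d0 : 0 < (4 * (SW + 1))^-1 by rewrite invr_gt0 mulr_gt0// ltr_wpDl.
 have d1 : (4 * (SW + 1))^-1 <= 1 by rewrite invf_le1; lra.
 have dE : (4 * (SW + 1))^-1 * (4 * (SW + 1)) = 1 by rewrite mulVf// gt_eqF//; lra.
 move: (_^-1) d0 d1 dE => d d0 d1 dE.
 have [n _ hn] := ha 0%N N.*2 d d0.
 apply: (@le_trans _ _ (2 * \sum_(m < N) normc (cf n m) ^+ 2 * Wm w m + 2 * \sum_(m < N) 4 * d * Wm w m)).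
  rewrite !mulr_sumr -big_split; apply: ler_sum => m _.
  have h := close n m d N (ltn_ord m) hn.
  have h2 := nc_sqrD_le (cf n m) (al m - cf n m); rewrite addrCA subrr addr0 in h2.
  rewrite -ncBC in h2; have W1 := ltW (W0 m); have y0 := nc_ge0 (cf n m - al m).
  rewrite -[leRHS]mulrDr -mulrDl mulrA.
  apply: ler_wpM2r => //; apply: (le_trans h2); rewrite ler_wpM2l// lerD2l.
  move: (normc (cf n m - al m)) y0 h => x x0 h; nra.
 rewrite -mulr_sumr -/SW; have := hcf n N; nra.
have He : H (mkf al) by exact: ell2_space.
have /choice[pk hpk] : forall Nj : nat * nat, exists n, (Nj.1 <= n)%N /\
  forall i, (i < Nj.2.*2)%N -> `|f n i - a i| < (Nj.2.+1%:R)^-1.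
 move=> [N j]; have [|n Nn hn] := ha N j.*2 (j.+1%:R^-1); first by rewrite invr_gt0.
 by exists n.
(* Index j is chosen past the previous one and matches the first 2 j real coordinates within 1 / (j
   + 1). *)
pose k := fix k j := if j is j'.+1 then pk ((k j').+1, j) else pk (0%N, 0%N).
have kc j i : (i < j.*2)%N -> `|f (k j) i - a i| < j.+1%:R^-1.
 by case: j => [|j]; [exact: (hpk (0%N, 0%N)).2|exact: (hpk ((k j).+1, j.+1)).2].
exists k, (T (mkf al)); split.
- by apply: homo_ltn => [? ? ?|j]; [exact: ltn_trans|exact: (hpk ((k j).+1, j.+1)).1].
- by have [] := toeplitz_space hw muD Cm0 emb He.
pose Bq := 2 * (M ^+ 2 + Q (mkf al)).
have Bq0 : 0 <= Bq by rewrite mulr_ge0// addr_ge0 ?sqr_ge0 ?Qn_ge0.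
apply/cvgrPdist_le => e e0.
pose t := e ^+ 2 / (4 * (Cm + 1) * (Bq + 1)).
have den0 : 0 < 4 * (Cm + 1) * (Bq + 1) by rewrite !mulr_gt0// ltr_wpDl.
have t0 : 0 < t by rewrite divr_gt0// exprn_gt0.
have tE : t * (4 * (Cm + 1) * (Bq + 1)) = e ^+ 2 by rewrite divfK// gt_eqF.
have [r /weakly_small[N [EB [EB0 hK]]]] := fr t0.
pose X := Cm * 2 * EB ^+ 2; have X0 : 0 <= X by rewrite !mulr_ge0// sqr_ge0.
pose eta := Num.min 1 (e ^+ 2 / (2 * (X + 1))).
have X10 : 0 < 2 * (X + 1) by rewrite mulr_gt0// ltr_wpDl.
have eta0 : 0 < eta by rewrite lt_min ltr01 divr_gt0// exprn_gt0.
have eta1 : eta <= 1 by rewrite ge_min lexx.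
have eta2 : eta * (2 * (X + 1)) <= e ^+ 2 by rewrite -ler_pdivlMr// ge_min lexx orbT.
have [J hJ] : exists J : nat, 2 / eta <= J%:R by exists (Num.truncn (2 / eta)).+1; exact: ltW (truncnS_gt _).
exists (maxn N J) => // j /=; rewrite geq_max => /andP[Nj Jj].
rewrite sub0r normrN ger0_norm ?sqrtr_ge0//.
pose d : C -> C^o := fun z => u (k j) z - mkf al z.
have Hd : H d by exact: space_sub.
have -> : T (u (k j)) - T (mkf al) = T d.
 have -> : d = (-1) *: (mkf al : C -> C^o) + u (k j).
  by apply/funext => z; rewrite /d -[RHS]/(-1 * mkf al z + u (k j) z) mulN1r addrC.
 by rewrite (toeplitz_linear hw emb)// scaleN1r addrC.
rewrite -(@ler_pXn2r _ 2)// ?nnegrE ?sqrtr_ge0 ?(ltW e0)// nrm_sqr//.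
apply: (le_trans (Q_toeplitz_le Hd)).
have Qd : Q d <= Bq.
 apply: (le_trans (Qn_sub mw w0 (L2_space hw (Hu _)) (L2_space hw He))).
 by rewrite /Bq ler_wpM2l// lerD2r.
have je : 2 * j.+1%:R^-1 <= eta.
 rewrite ler_pdivrMr// mulrC -ler_pdivrMr//; apply: (le_trans hJ); rewrite ler_nat.
 exact: leq_trans Jj (leqnSn j).
have h : Qm d <= 2 * (t * Q d + (eta * EB) ^+ 2).
 apply: hK => // [|m mN]; first exact: ltW.
 have -> : ip area w d (fun z => z ^+ m) = (cf (k j) m - al m) * (Wm w m)%:C.
  have -> : ip area w d (fun z => z ^+ m) = ip area w (u (k j)) (fun z => z ^+ m) - ip area w (mkf al) (fun z => z ^+ m).
   have E3 := ip_linear mw w0 (-1) (L2_space hw He) (L2_space hw (Hu (k j))) (L2_X hw m).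
   rewrite mulN1r addrC in E3; rewrite -E3; apply: ip_eqD => // z _.
   by rewrite mulN1r addrC.
  by rewrite ipu ip_mkf_X// mulrBl.
 rewrite normcM nc_real ger0_norm ?(ltW (W0 m))//; apply: ler_wpM2r; first exact: ltW.
 apply: le_trans je; apply: (close _ _ _ j) => //; [exact: leq_trans mN Nj|exact: kc].
apply: (@le_trans _ _ (Cm * (2 * (t * Bq + (eta * EB) ^+ 2)))).
 rewrite ler_wpM2l//; apply: (le_trans h); rewrite ler_wpM2l// lerD2r ler_wpM2l//; exact: ltW.
have p1 : Cm * (2 * (t * Bq)) <= e ^+ 2 / 2.
 have a1 := mulr_ge0 (ltW t0) (mulr_ge0 Cm0 Bq0); have a2 := mulr_ge0 (ltW t0) Cm0.
 by have a3 := mulr_ge0 (ltW t0) Bq0; nra.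
have p2 : Cm * (2 * (eta * EB) ^+ 2) <= e ^+ 2 / 2.
 rewrite (_ : Cm * _ = eta ^+ 2 * X); last by rewrite /X; ring.
 have : eta ^+ 2 * X <= eta * X by rewrite ler_wpM2r// expr2 ler_piMl// ltW.
 by lra.
lra.
Qed.
End Compactness.

Lemma sum_pairs (V : nmodType) (F : nat -> V) N :
 \sum_(i < 2 * N) F i = \sum_(k < N) F (2 * k)%N + \sum_(k < N) F (2 * k).+1.
Proof.
elim: N => [|N IH]; first by rewrite muln0 !big_ord0 addr0.
by rewrite mulnS !big_ord_recr/= IH addrACA addrA.
Qed.

(** * Summation of the singular values *)

Section GreedySum.
Variables (R : realType) (T : eqType).

Lemma greedy_sum (P : pred T) (Y : T -> R) (x : nat -> R) (p B : R) : 0 < p ->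
 (forall k, 0 <= x k) -> (forall i, 0 <= Y i) ->
 (forall k, 0 < x k -> exists G : seq T, [/\ uniq G, (k < size G)%N & forall i, i \in G -> P i /\ x k <= Y i]) ->
 (forall G : seq T, uniq G -> (forall i, i \in G -> P i) -> \sum_(i <- G) Y i `^ p <= B) ->
 forall N, \sum_(k < N) x k `^ p <= B.
Proof.
move=> p0 x0 Y0 hG hB N.
suff [G [uG sG PG hs]] : exists G : seq T, [/\ uniq G, (size G <= N)%N, forall i, i \in G -> P i &
  \sum_(k < N) x k `^ p <= \sum_(i <- G) Y i `^ p] by exact: le_trans hs (hB G uG PG).
elim: N => [|N [G [uG sG PG hs]]]; first by exists [::]; rewrite big_ord0 big_nil.
have [xz|xn] := eqVneq (x N) 0.
 exists G; split => //; first exact: leqW.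
 by rewrite big_ord_recr/= xz powR0 ?gt_eqF// addr0.
have xp : 0 < x N by rewrite lt_neqAle eq_sym xn x0.
have [G' [uG' sG' hG']] := hG N xp.
have /hasP[i iG' iG] : has (fun i => i \notin G) G'.
 apply: contraTT (leq_ltn_trans sG sG') => /hasPn h; rewrite -leqNgt uniq_leq_size// => i /h.
 by rewrite negbK.
have [Pi xi] := hG' i iG'.
exists (i :: G); split => //=; first by rewrite iG.
 by move=> i'; rewrite inE => /predU1P[->|/PG].
rewrite big_ord_recr big_cons/= addrC lerD//.
by apply: ge0_ler_powR; rewrite ?nnegrE ?(ltW p0).
Qed.
End GreedySum.

Section SumToSchatten.
Variables (R : realType) (w : R[i] -> R) (mu : {measure set R[i] -> \bar R}) (p : R).
Hypotheses (hw : class_Dhat w) (p0 : 0 < p).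
Local Notation C := R[i].
Local Notation D := (@unit_disc R).
Local Notation one := (fun=> 1 : R).
Local Notation H := (bergman_space w).
Local Notation T := (toeplitz_operator w mu).
Local Notation nrm := (bergman_norm w).
Local Notation Q := (Qn area w).
Local Notation Qm := (Qn mu one).
Let m1 : measurable_fun D one. Proof. exact: measurable_cst. Qed.
Let o0 z : D z -> 0 <= (1 : R). Proof. by []. Qed.
Let W0 := Wm_gt0 hw.

Let cj0 : conjc (0 : C) = 0.
Proof. by apply: eqc; rewrite /= ?oppr0. Qed.

Lemma psum_embedding N : (mu D < +oo)%E -> exists2 K : R, 0 <= K & forall a, ell2 w a ->
 L2 mu one (psum a N) /\ Qm (psum a N) <= K * Q (mkf a).
Proof.
move=> muD; pose V := \sum_(m < N) (1 : R) ^+ 2 / Wm w m.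
have V0 : 0 <= V by apply: sumr_ge0 => m _; rewrite divr_ge0 ?expr1n// ltW.
exists (V * fine (mu D)) => [|a ea]; first by rewrite mulr_ge0 ?fine_ge0.
split; first exact: L2mu_psum.
have Q0 : 0 <= Q (mkf a) by apply: Qn_ge0; exact: Dhat_ge0.
have hb z : D z -> normc (psum a N z) <= Num.sqrt (Q (mkf a) * V).
 move=> Dz; rewrite -(@ler_pXn2r _ 2)// ?nnegrE ?nc_ge0 ?sqrtr_ge0// sqr_sqrtr ?mulr_ge0//.
 apply: (@le_trans _ _ ((\sum_(m < N) normc (a m) * 1) ^+ 2)).
  apply: lerXn2r; rewrite ?nnegrE ?nc_ge0//; first by apply: sumr_ge0 => m _; rewrite mulr1 nc_ge0.
  rewrite (le_trans (nc_sum _ _ _))//; apply: ler_sum => m _.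
  by rewrite mulr1 normcM ncX ler_piMr ?nc_ge0// exprn_ile1 ?nc_ge0// ltW.
 have := real_CS (index_enum 'I_N) xpredT (fun m : 'I_N => nc_ge0 (a m)) (fun=> ler01) (fun m : 'I_N => W0 m).
 move=> /le_trans; apply; rewrite -/V ler_wpM2r//.
 exact: Qn_mkf_lb.
apply: le_trans (Qmu_le muD (mcf_psum a N) hb) _.
by rewrite sqr_sqrtr ?mulr_ge0// [Q _ * V]mulrC mulrAC.
Qed.

Lemma psum_ip m : finite_coefs (fun m' => (m' == m)%:R / (Wm w m)%:C : C).
Proof. by exists m.+1 => m' h; rewrite gtn_eqF// mul0r. Qed.

(** Coefficients of the function that represents [cco] in the inner product of the Bergman space. *)
Definition cco_vec (i : nat * nat) (m : nat) : C :=
 if (2 ^ i.1 <= m < 2 ^ i.1.+1)%N then conjc ((sg w i.1)%:C * nd R i ^+ m) / (Wm w m)%:C else 0.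

Lemma cco_vec_fin i m : (2 ^ i.1.+1 <= m)%N -> cco_vec i m = 0.
Proof. by rewrite /cco_vec ltnNge => ->; rewrite andbF. Qed.

Lemma cco_vec_low i m : (m < 2 ^ i.1)%N -> cco_vec i m = 0.
Proof. by move=> h; rewrite /cco_vec leqNgt h. Qed.

Lemma cco_ip a i : ell2 w a -> ip area w (mkf a) (mkf (cco_vec i)) = cco w a i.
Proof.
move=> ea; rewrite (ip_mkf_fin hw (ell2_space hw ea) (cco_vec_fin (i := i))).
rewrite expnS mul2n -addnn big_split_ord/= [X in X + _]big1 ?add0r; last first.
 by move=> m _; rewrite cco_vec_low// cj0 mul0r.
rewrite /cco mulr_sumr; apply: eq_bigr => m _; rewrite ip_mkf_X//.
rewrite /cco_vec leq_addr/= expnS mul2n -addnn ltn_add2l ltn_ord.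
have E : conjc (conjc ((sg w i.1)%:C * nd R i ^+ (2 ^ i.1 + m)) / (Wm w (2 ^ i.1 + m))%:C) =
  ((sg w i.1)%:C * nd R i ^+ (2 ^ i.1 + m)) / (Wm w (2 ^ i.1 + m))%:C.
 rewrite conjM conjK; congr (_ * _); rewrite -[(_%:C)^-1]fmorphV.
 by apply: eqc; rewrite /= ?oppr0.
rewrite E; have : (Wm w (2 ^ i.1 + m))%:C != 0 :> C by rewrite eqCR0 gt_eqF.
by move=> h; field.
Qed.

Lemma cco_approx A q E L0 t : (forall a, ell2 w a ->
  Qm (fun z => mkf a z - approx w A q E L0 a z) <= t * Q (mkf a)) ->
 fr_approx w mu t (2 ^ q + size [seq i <- il L0 | E i]).
Proof.
move=> hS; set s := [seq i <- _ | _].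
have /choice[b hb] : forall i, exists b, finite_coefs b /\ forall z, gat w A q i z = mkf b z \/ ~ D z.
 move=> i; have [b [M [h1 h2]]] := ispoly_psum (ispoly_gat w A q i).
 exists b; split; first by exists M.
 by move=> z; have [Dz|] := pselect (D z); [left; rewrite h2 (mkf_psum h1)|right].
pose i_ (l : 'I_(size s)) := nth (0, 0)%N s l.
pose e (l : 'I_(2 ^ q + size s)) : nat -> C := match fintype.split l with
 inl m => fun m' => (m' == nat_of_ord m)%:R | inr l => b (i_ l) end.
pose v (l : 'I_(2 ^ q + size s)) : nat -> C := match fintype.split l with
 inl m => fun m' => (m' == nat_of_ord m)%:R / (Wm w m)%:C | inr l => cco_vec (i_ l) end.
exists e, v; split.
- move=> l; rewrite /e; case: (fintype.split l) => [m|l']; last by have [] := hb (i_ l').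
 by exists m.+1 => m' h; rewrite gtn_eqF.
- move=> l; rewrite /v; case: (fintype.split l) => [m|l']; first exact: psum_ip.
 by exists (2 ^ (i_ l').1.+1)%N => m'; exact: cco_vec_fin.
move=> f Hf; have [a ea ->] := space_ell2 hw Hf; apply: le_trans (hS a ea).
apply: le_of_eq; apply: Qn_eqD => z Dz; congr (_ - _).
have E1 a' b' (j : 'I_a') : fintype.split (lshift b' j) = inl j by exact: (unsplitK (inl j)).
have E2 a' b' (j : 'I_b') : fintype.split (rshift a' j) = inr j by exact: (unsplitK (inr j)).
rewrite /approx big_split_ord/=; congr (_ + _).
 apply: eq_bigr => m _; rewrite /e /v E1.
 have hX m' : (m.+1 <= m')%N -> (m' == nat_of_ord m)%:R = 0 :> C by move=> h; rewrite gtn_eqF.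
 have hV m' : (m.+1 <= m')%N -> (m' == nat_of_ord m)%:R / (Wm w m)%:C = 0 :> C by move=> h; rewrite gtn_eqF// mul0r.
 have last1 (F : nat -> C) : \sum_(m' < m.+1) (nat_of_ord m' == m)%:R * F m' = F m.
  rewrite big_ord_recr/= eqxx mul1r big1 ?add0r// => m' _.
  by rewrite ltn_eqF ?mul0r.
 rewrite (ip_mkf_fin hw (ell2_space hw ea) hV) (mkf_psum hX)// /psum last1; congr (_ * _).
 rewrite (eq_bigr (fun m' : 'I_m.+1 => (nat_of_ord m' == m)%:R * a m)).
  by rewrite (last1 (fun=> a m)).
 move=> m' _; rewrite ip_mkf_X//; case: eqP => [->|_]; last first.
  by rewrite !mul0r cj0 mul0r.
 have h : (Wm w m)%:C != 0 :> C by rewrite eqCR0 gt_eqF.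
 rewrite !mul1r (_ : conjc ((Wm w m)%:C)^-1 = ((Wm w m)%:C)^-1); first by field.
 by rewrite -[(_%:C)^-1]fmorphV; apply: eqc; rewrite /= ?oppr0.
rewrite -[RHS]big_filter -/s (big_nth (0, 0)%N) big_mkord; apply: eq_bigr => l _.
rewrite /e /v E2 cco_ip//; congr (_ * _).
by have [_ /(_ z)[]] := hb (i_ l).
Qed.

Lemma sum_to_schatten : (\esum_(j in dyadic_indices)
  poweR (mu (dyadic_rectangle j.1 j.2) * ((weight_star w (dyadic_point j.1 j.2))^-1)%:E) p < +oo)%E ->
 toeplitz_in_schatten p w mu.
Proof.
move=> /(level_sums hw p0)[mfin [B hB]].
have [A0 [b [K [b02 Ab K0 hK]]]] := @sum_Yp R p p0.
have /andP[b0 b2] := b02; have b20 : 0 < 2 - b by lra.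
have m0 := mcell_ge0 mu hw.
pose A := A0; pose q := A.+1.
have Aq : (A * 2 <= 2 ^ q)%N by rewrite /q expnS mulnC leq_mul2l/= ltnW// ltn_expl.
have [Bg Bg0 hg] := @gat_bound R w hw A q Aq isT.
have [K1 K10 hK1] := @Mx_sum_i R A _ b20 Ab.
have [Bc Bc0 hBc] := cco_sum hw.
have hKB L P : \sum_(i <- il L) Yp A b (mcell w mu) P i `^ p <= K * B.
 by apply: (le_trans (hK _ m0 L P)); rewrite ler_wpM2l ?(ltW K0).
have [Y0 hY hYs] := Ysup_facts hw p0 hKB.
set Y := Ysup w mu A b in Y0 hY hYs; set BY := 2 `^ p * (K * B) in hYs.
have iL0 : (0, 0)%N \in il 1 by [].
have muD : (mu D < +oo)%E.
 by apply: (finite_of_level_sums hw mfin b02 (B := Y (0, 0)%N)) => P; exact: hY iL0.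
have hK1' j L : \sum_(i <- il L) Mx A i j `^ (2 - b) <= K1 by rewrite /il dl_sum hK1.
pose C0 := Bg ^+ 2 * K1 * Bc; have C00 : 0 < C0 by rewrite !mulr_gt0 ?exprn_gt0.
have valid i L : i \in il L -> (i.2 < 2 ^ i.1.+1)%N by case: i => n k; rewrite mem_dl => /andP[].
have BY0 : 0 <= BY by have := hYs 0%N; rewrite (_ : il 0 = [::])// big_nil.
have mono L L' : (L <= L')%N -> {subset il L <= il L'}.
 by move=> LL [n k]; rewrite !mem_dl => /andP[/leq_trans -> //= ->].
(* the tail of a convergent sum has small terms *)
have finE t : 0 < t -> exists L0, forall i, (i.2 < 2 ^ i.1.+1)%N -> t < Y i -> i \in il L0.
 move=> t0; pose S := [set \sum_(i <- il L) Y i `^ p | L in setT].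
 have hS : has_sup S by split; [exists (\sum_(i <- il 0) Y i `^ p), 0%N|exists BY => _ [L _ <-]].
 have tp : 0 < t `^ p by exact: powR_gt0.
 have [_ [L0 _ <-] hL0] := sup_adherent tp hS; exists L0 => i iv ti.
 apply/negPn/negP => iL; pose L := maxn L0 i.1.+1.
 have iLL : i \in il L.
  have := mem_dl (fun n => 2 ^ n.+1)%N L i.1 i.2; rewrite -surjective_pairing /il => ->.
  by rewrite iv andbT /L leq_max ltnSn orbT.
 have hsup : \sum_(i <- il L) Y i `^ p <= sup S by apply: (ub_le_sup hS.2); exists L.
 have : \sum_(j <- i :: il L0) Y j `^ p <= \sum_(j <- il L) Y j `^ p.
  apply: sum_uniq_sub => [||j]; [by rewrite /= iL dl_uniq| |exact: powR_ge0].
  by move=> j; rewrite inE => /predU1P[->//|]; apply: mono; exact: leq_maxl.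
 have : t `^ p <= Y i `^ p by apply: ge0_ler_powR; rewrite ?nnegrE ?(ltW p0) ?(ltW t0)// ltW.
 by rewrite big_cons; lra.
(* Off a finite set E that contains the large values of Y, the remainder embeds in L^2(mu) with
   constant C0 t. The empty set and t = T0 give the embedding itself; E = {Y > t} gives the finite
   rank approximation. *)
have main t (E : pred (nat * nat)) L0 a : 0 <= t -> (forall i, E i -> i \in il L0) ->
  (forall i, (i.2 < 2 ^ i.1.+1)%N -> ~~ E i -> Y i <= t) -> ell2 w a ->
  L2 mu one (fun z => mkf a z - approx w A q E L0 a z) /\
  Qm (fun z => mkf a z - approx w A q E L0 a z) <= C0 * t * Q (mkf a).
 move=> t0 hE hYE ea.
 have := @embedding_bound R w mu hw mfin A q b t E L0 Bg K1 Bc a Aq b02 t0 (ltW K10) hg hK1' hBc hE _ ea.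
 have hYE' i L P : i \in il L -> ~~ E i -> Yp A b (mcell w mu) P i <= t.
  by move=> iL nE; apply: le_trans (hY L i P iL) _; apply: hYE => //; exact: valid iL.
 move=> /(_ hYE'); set S := fun z => _ - _; rewrite -/(Qn area w (mkf a)) => h.
 have mS : mcf S by exact: mcf_remainder.
 have E1 : (\int[mu]_(z in D) (normc (S z) ^+ 2 * 1)%:E = \int[mu]_(z in D) (normc (S z) ^+ 2)%:E)%E.
  by apply: eq_integral => z _; rewrite mulr1.
 have lS : L2 mu one S by split => //; rewrite E1; apply: le_lt_trans h _; exact: ltry.
 split => //; rewrite -lee_fin QnE// E1; apply: (le_trans h); rewrite lee_fin /C0.
 by apply: le_of_eq; ring.
pose T0 := BY `^ p^-1.
have YT0 i : (i.2 < 2 ^ i.1.+1)%N -> Y i <= T0.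
 move=> iv; have -> : Y i = (Y i `^ p) `^ p^-1 by rewrite -powRrM divff ?gt_eqF// powRr1.
 apply: ge0_ler_powR; rewrite ?nnegrE ?powR_ge0 ?invr_ge0 ?(ltW p0)//.
 apply: le_trans (hYs i.1.+1); have hin : i \in il i.1.+1 by case: (i) iv => n k kv; rewrite mem_dl ltnSn.
 by rewrite (big_rem _ hin)/= lerDl sumr_ge0// => j _; exact: powR_ge0.
have T00 : 0 <= T0 by exact: powR_ge0.
have [KV KV0 hKV] := psum_embedding (2 ^ q) muD.
pose Cm := 2 * (C0 * T0 + KV); have Cm0 : 0 <= Cm.
 by rewrite /Cm mulr_ge0// addr_ge0// mulr_ge0// ltW.
have emb (f : C -> C^o) : H f -> L2 mu one f /\ Qm f <= Cm * Q f.
 move=> Hf; have [a ea ->] := space_ell2 hw Hf.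
 have [lP qP] := hKV a ea.
 have [||lS qS] := @main T0 pred0 0%N a T00 _ _ ea; first by [].
  by move=> i iv _; exact: YT0.
 have SE z : approx w A q pred0 0 a z = psum a (2 ^ q) z by rewrite /approx big_pred0// addr0.
 have fE : mkf a = (fun z => (mkf a z - approx w A q pred0 0 a z) + psum a (2 ^ q) z) :> (C -> C).
  by apply/funext => z; rewrite SE subrK.
 have lN : L2 mu one (fun z => - psum a (2 ^ q) z).
  by have := L2Z m1 o0 (-1) lP; congr L2; apply/funext => z; rewrite mulN1r.
 split; first by rewrite fE; exact: L2D.
 have -> : Qm (mkf a) = Qm (fun z => (mkf a z - approx w A q pred0 0 a z) - (- psum a (2 ^ q) z)).
  by apply: Qn_eqD => z _; rewrite opprK SE subrK.
 apply: (le_trans (Qn_sub m1 o0 lS lN)); rewrite /Cm -mulrA ler_wpM2l// mulrDl; apply: lerD => //.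
 have -> : Qm (fun z => - psum a (2 ^ q) z) = Qm (psum a (2 ^ q)).
  by rewrite /Qn; congr fine; apply: eq_integral => z _; rewrite ncN.
 exact: qP.
pose G t L0 := [seq i <- il L0 | t < Y i].
have frt t L0 : 0 < t -> (forall i, (i.2 < 2 ^ i.1.+1)%N -> t < Y i -> i \in il L0) ->
  fr_approx w mu (C0 * t) (2 ^ q + size (G t L0)).
 move=> t0 hL0.
 have -> : G t L0 = [seq i <- il L0 | [pred i | (i \in il L0) && (t < Y i)] i].
  by apply: eq_in_filter => i /= ->.
 apply: (@cco_approx A q) => a ea.
 have [||//] := @main t [pred i | (i \in il L0) && (t < Y i)] L0 a (ltW t0) _ _ ea.
  by move=> i /= /andP[].
 move=> i iv /=; rewrite negb_and -leNgt => /orP[|//] h; rewrite leNgt; apply: contra h.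
 exact: hL0.
split; first by apply: (toeplitz_definedP hw muD) => f /emb[].
split; first exact: (toeplitz_bounded hw muD Cm0 emb).
 apply: (toeplitz_compact hw muD Cm0 emb) => t t0.
 have tc : 0 < t / C0 by rewrite divr_gt0.
 have [L0 hL0] := finE _ tc; exists (2 ^ q + size (G (t / C0) L0))%N.
 by have := frt _ _ tc hL0; rewrite mulrC divfK// gt_eqF.
pose s n := singular_value H nrm T n.
have s0 n : 0 <= s n by exact: singular_value_ge0.
have sv t L0 n : 0 < t -> (forall i, (i.2 < 2 ^ i.1.+1)%N -> t < Y i -> i \in il L0) ->
  (2 * (2 ^ q + size (G t L0)) <= n)%N -> s n <= C0 * t.
 move=> t0 hL0 hn; have [e [v [he hv hS]]] := frt t L0 t0 hL0.
 apply: (singular_value_le hw muD Cm0 emb (e := fun l => mkf (e l)) (v := fun l => mkf (v l))) hn => //.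
 - by move=> l; have [N h] := he l; apply: ell2_space => //; exact: (ell2_fin hw h).
 - by move=> l; have [N h] := hv l; apply: ell2_space => //; exact: (ell2_fin hw h).
 - by rewrite mulr_ge0// ltW.
(* Twice the rank of the Taylor polynomial; beyond it every large Y costs rank 2. *)
pose n0 := (2 * 2 ^ q)%N.
(* As the rank grows by two per index, even and odd singular values are summed separately, each
   against all of Y. If s (g k) / (2 C0) is positive, more than k of the Y_i exceed it: otherwise s
   (g k) would be at most half of itself. *)
have half (g : nat -> nat) : (forall k, (n0 + 2 * k <= g k)%N) -> forall N,
  \sum_(k < N) (s (g k) / (2 * C0)) `^ p <= BY.
 move=> hgk; have c2 : 0 < 2 * C0 by rewrite mulr_gt0.
 apply: (@greedy_sum R _ (fun i => (i.2 < 2 ^ i.1.+1)%N) Y (fun k => s (g k) / (2 * C0)) p BY p0) => //.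
 - by move=> k; rewrite divr_ge0// ltW.
 - move=> k xk0; set x := s (g k) / (2 * C0) in xk0 *.
  have [L0 hL0] := finE x xk0; exists (G x L0); split.
  + by rewrite filter_uniq// dl_uniq.
  + rewrite ltnNge; apply/negP => hk.
   have : s (g k) <= C0 * x.
    apply: sv hL0 _ => //; apply: leq_trans (hgk k); rewrite /n0 mulnDr leq_add2l leq_mul2l.
    exact: hk.
   have sE : s (g k) = 2 * (C0 * x) by rewrite /x; field; rewrite gt_eqF.
   by rewrite sE; have := mulr_gt0 C00 xk0; lra.
  + by move=> i; rewrite mem_filter => /andP[/ltW h /valid].
 - move=> F uF vF.
  pose L := (\max_(i <- F) i.1.+1)%N.
  apply: le_trans (hYs L); apply: sum_uniq_sub => // [[n k] nF|i]; last exact: powR_ge0.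
  rewrite mem_dl (vF _ nF) andbT /L.
  by rewrite (big_rem _ nF)/= leq_maxl.
have total N : \sum_(n < N) s n `^ p <= \sum_(n < n0) s n `^ p + 2 * ((2 * C0) `^ p * BY).
 apply: (@le_trans _ _ (\sum_(n < n0 + (N + N)) s n `^ p)).
  have NN : (N <= n0 + (N + N))%N by rewrite addnA leq_addl.
  rewrite (big_ord_widen _ (fun n => s n `^ p) NN) [leRHS](bigID (fun n : 'I__ => (n < N)%N))/=.
  by rewrite lerDl sumr_ge0// => n _; exact: powR_ge0.
 rewrite big_split_ord/= lerD2l addnn -mul2n.
 have c2 : 0 <= 2 * C0 by rewrite mulr_ge0// ltW.
 have each (g : nat -> nat) : (forall k, (n0 + 2 * k <= g k)%N) ->
   \sum_(k < N) s (g k) `^ p <= (2 * C0) `^ p * BY.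
  move=> /half/(_ N) h; apply: le_trans (ler_wpM2l (powR_ge0 (2 * C0) p) h).
  rewrite mulr_sumr; apply: ler_sum => k _; rewrite -powRM ?divr_ge0//.
  by rewrite mulrC divfK// gt_eqF// mulr_gt0.
 rewrite (sum_pairs (fun i => s (n0 + i)%N `^ p)) mulr2n mulrDl mul1r; apply: lerD; first by apply: (each (fun k => n0 + 2 * k)%N).
 by apply: (each (fun k => n0 + (2 * k).+1)%N) => k; rewrite leq_add2l.
apply: (@le_lt_trans _ _ (\sum_(n < n0) s n `^ p + 2 * ((2 * C0) `^ p * BY))%:E); last exact: ltry.
apply: lime_le; first by apply: is_cvg_nneseries => n _ _; rewrite lee_fin powR_ge0.
apply: nearW => N; rewrite big_mkord sumEFin lee_fin; exact: total.
Qed.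
End SumToSchatten.

(** * Cell sums and hyperbolic discs *)

Section NonMeasurableIntegrands.
Variables (R : realType) (m : {measure set R[i] -> \bar R}).
Local Notation C := R[i].
Local Notation D := (@unit_disc R).
Let mD : measurable D := @measurable_unit_disc R.

(** The integral is a supremum over simple functions below the integrand, so arbitrary nonnegative
    functions can be compared; z -> mu (phdisc z r) is treated this way. *)
Lemma ge0_integral_mono (f g : C -> \bar R) : (forall z, D z -> (0 <= f z)%E) ->
 (forall z, D z -> (f z <= g z)%E) -> (\int[m]_(z in D) f z <= \int[m]_(z in D) g z)%E.
Proof.
move=> f0 fg; have g0 z : D z -> (0 <= g z)%E by move=> Dz; exact: le_trans (f0 z Dz) (fg z Dz).
rewrite !ge0_integralE//; apply: ereal_sup_le => _ [h hf <-]; exists h => // z; apply: (le_trans (hf z)); rewrite !patchE; case: ifPn => // /[!inE] Dz.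
exact: fg.
Qed.

(** The predicate P expresses that some index in [s] has the point in its set, without an equality
    on T. *)
Lemma measure_cover (T : Type) (s : seq T) (B : T -> set C) (A : set C) : measurable A ->
 (forall j, measurable (B j)) -> (forall z, A z -> exists2 P : pred T, has P s & forall j, P j -> B j z) ->
 (m A <= \sum_(j <- s) m (B j))%E.
Proof.
move=> mA mB; elim: s A mA => [|j s IH] A mA hA.
 by rewrite big_nil (_ : A = set0) ?measure0//; apply/seteqP; split => // z /hA[].
rewrite big_cons (measureDI m mA (mB j)) addeC; apply: leeD.
 by apply: le_measure; rewrite ?inE//; first [exact: measurableI|exact: subIsetr].
apply: IH; first exact: measurableD.
move=> z [Az nB]; have [P /= /orP[Pj|hs] PB] := hA z Az; last by exists P.
by have := nB (PB j Pj).
Qed.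
End NonMeasurableIntegrands.

Section AreaBounds.
Variable R : realType.
Local Notation C := R[i].
Local Notation D := (@unit_disc R).
Local Notation lam := (@lebesgue_measure R).
Local Notation cell := (@dyadic_rectangle R).
Let mD : measurable D := @measurable_unit_disc R.

Definition box (a b s : R) : set C :=
 [set z | a <= cRe z <= a + s /\ b <= cIm z <= b + s].

Let boxE a b s : @complex_of_pair R @^-1` box a b s = `[a, a + s]%classic `*` `[b, b + s]%classic.
Proof. by apply/seteqP; split => -[x y]; rewrite /box/= !in_itv. Qed.

Lemma measurable_box a b s : measurable (box a b s).
Proof.
rewrite /measurable/= /complex_measurable/= boxE; apply: measurableX; exact: measurable_itv.
Qed.

Lemma area_box a b s : 0 <= s -> area (box a b s) = (s ^+ 2 / pi)%:E.
Proof.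
move=> s0; have L x : lam `[x, x + s]%classic = s%:E.
 have := lebesgue_measure_itv `[x, x + s]; rewrite /= lte_fin => ->.
 have [_|h] := ltP x (x + s); first by rewrite -EFinB addrAC subrr add0r.
 by congr EFin; lra.
have P : (lam \x lam)%E (`[a, a + s]%classic `*` `[b, b + s]%classic) = (s%:E * s%:E)%E.
 pose I1 : set R := `[a, a + s]%classic; pose I2 : set R := `[b, b + s]%classic.
 transitivity (lam I1 * lam I2)%E; last by rewrite !L.
 by apply: product_measure1E.
by rewrite /area boxE P -!EFinM -expr2 mulrC.
Qed.

Lemma near_yj j z (c : R) : normc (z - yj R j) <= c ->
 box (cRe (yj R j) - c) (cIm (yj R j) - c) (2 * c) z.
Proof.
move=> h; have := le_trans (nc_Re _) h; have := le_trans (nc_Im _) h.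
rewrite ReD ImD ReN ImN !ler_norml => /andP[h1 h2] /andP[h3 h4].
by split; apply/andP; split; lra.
Qed.

Lemma area_cell_le : exists2 K : R, 0 < K & forall j, (j.2 < 2 ^ j.1)%N ->
 (area (cell j.1 j.2) <= (K * dy j.1 ^+ 2)%:E)%E.
Proof.
have h20 : 0 < 20 :> R by rewrite ltr0n.
exists (20 ^+ 2 / pi) => [|j jv]; first exact: divr_gt0 (exprn_gt0 2 h20) (pi_gt0 R).
have d0 := @dy_ge0 R j.1.
apply: (@le_trans _ _ (area (box (cRe (yj R j) - 10 * dy j.1) (cIm (yj R j) - 10 * dy j.1) (2 * (10 * dy j.1))))).
 apply: le_measure; rewrite ?inE; [exact: measurable_cell|exact: measurable_box|].
 by move=> z /cell_yj; exact: near_yj.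
rewrite area_box ?mulr_ge0// lee_fin; apply: le_of_eq; ring.
Qed.

Lemma measurable_phdisc a r : D a -> measurable (phdisc a r : set C).
Proof.
move=> Da; pose f z := a - z; pose g z : C := 1 - conjc a * z.
have mf : @mcf R f by have := mcfZD (-1) (@mcf_X R 1) (mcf_cst a); congr mcf; apply/funext => z; rewrite expr1 mulN1r addrC.
have mg : @mcf R g.
 by have := mcfZD (- conjc a) (@mcf_X R 1) (mcf_cst 1); congr mcf; apply/funext => z; rewrite /g expr1 mulNr addrC.
have mq : measurable_fun D (fun z => normc (f z) - r * normc (g z)).
 apply: measurable_funB; first exact: mcf_normc.
 by apply: measurable_funM; [exact: measurable_cst|exact: mcf_normc].
have g0 z : D z -> 0 < normc (g z).
 move=> Dz; have a1 : normc a < 1 by []. have z1 : normc z < 1 by [].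
 apply: nc_sub1_gt0; rewrite normcM nc_conj; apply: le_lt_trans z1.
 by rewrite ler_piMl ?nc_ge0// ltW.
have -> : phdisc a r = D `&` (fun z => normc (f z) - r * normc (g z)) @^-1` `]-oo, 0[.
 have E z : D z -> (normc ((a - z) / (1 - conjc a * z)) < r) = (normc (f z) - r * normc (g z) < 0).
  by move=> Dz; rewrite normcM normcV ltr_pdivrMr ?(g0 z Dz)// subr_lt0.
 apply/seteqP; split => z [Dz] h; split => //.
  by rewrite /= in_itv/= -E.
 by move: h; rewrite /= in_itv/= -E.
by apply: mq => //; exact: measurable_itv.
Qed.
End AreaBounds.

(** * From cell sums to hyperbolic discs *)

Section SumToIntegral.
Variables (R : realType) (w : R[i] -> R) (mu : {measure set R[i] -> \bar R}) (p : R).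
Hypotheses (hw : class_Dhat w) (p0 : 0 < p).
Local Notation C := R[i].
Local Notation D := (@unit_disc R).
Local Notation sg := (sg w).
Local Notation cell := (@dyadic_rectangle R).
Local Notation star := (weight_star w).
Let mD : measurable D := @measurable_unit_disc R.

(** The even nodes of level j.1 sit at the left ends of the arcs of that level, which are the angles
    of [yj]. *)
Definition bnode (j : nat * nat) : nat * nat := (j.1, 2 * j.2)%N.

Lemma nd_bnode j : nd R (bnode j) = zeta R (2 ^ j.1) ^+ j.2.
Proof.
rewrite /nd /bnode/= zeta_ang zeta_ang -(ang_double R j.1 j.2) mul2n.
by [].
Qed.

Lemma Mx_near A b c (j j' : nat * nat) : 0 <= c -> 0 < b -> (j.1 <= j'.1.+2)%N -> (j'.1 <= j.1.+2)%N ->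
 normc (yj R j' - yj R j) <= c * dy j.1 ->
 ((rho ^+ 4 * (2 + c)^-1 ^+ A : R) `^ b <= Mx A (bnode j) j' `^ b).
Proof.
move=> c0 b0 h1 h2 h; have c20 : 0 < 2 + c by lra.
have r0 := @rho_gt0 R.
have M0 := ltW (@Mx_gt0 R A (bnode j) j').
apply: ge0_ler_powR; rewrite ?nnegrE ?(ltW b0)//.
 by apply: mulr_ge0; apply: exprn_ge0; rewrite ?invr_ge0 ltW.
rewrite /Mx; apply: ler_pM; rewrite ?exprn_ge0 ?invr_ge0 ?(ltW c20) ?(ltW r0)//.
 rewrite ler_wiXn2l ?(ltW r0) ?(ltW (@rho_lt1 R))// /bnode/=.
 by move: h1 h2; clear; move: (j.1) (j'.1) => x y; lia.
have X0 := ltW (xk_gt0 (bnode j).1 (yj R j' * conjc (nd R (bnode j)))).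
have p1 : 0 < 1 + 2 ^+ (bnode j).1 * normc (1 - yj R j' * conjc (nd R (bnode j))).
 by rewrite ltr_wpDr ?mulr_ge0 ?exprn_ge0 ?nc_ge0.
apply: lerXn2r; rewrite ?nnegrE//; first by rewrite invr_ge0 ltW.
rewrite /xk lef_pV2 ?posrE//.
rewrite nd_bnode /bnode/=; set ze := zeta R (2 ^ j.1) ^+ j.2.
have z1 : normc ze = 1 by rewrite /ze ncX nc_zeta expr1n.
have hz : ze * conjc ze = 1 by rewrite mul_conj z1 expr1n.
have e : normc (1 - yj R j' * conjc ze) <= dy j.1 + c * dy j.1.
 have -> : 1 - yj R j' * conjc ze = (dy j.1)%:C - (yj R j' - yj R j) * conjc ze.
  have yE : yj R j = (1 - (dy j.1)%:C) * ze by rewrite /yj -/ze RCB.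
  transitivity ((dy j.1)%:C - yj R j' * conjc ze + (1 - (dy j.1)%:C) * (ze * conjc ze)); first by rewrite hz; ring.
  by rewrite yE; ring.
 rewrite (le_trans (ncB _ _))// nc_real ger0_norm ?dy_ge0// lerD2l.
 by rewrite normcM nc_conj z1 mulr1.
have q0 : 0 <= 2 ^+ j.1 :> R by rewrite exprn_ge0.
have qd : 2 ^+ j.1 * dy j.1 = 1 :> R by rewrite dyV mulfV// expf_neq0.
have := ler_wpM2l q0 e; rewrite mulrDr mulrCA qd; lra.
Qed.

(** From |z - x| < |1 - conj z x| / 5 and |1 - conj z x| <= 2 (1 - |z|) + |z - x| follows |z - x| <=
    (1 - |z|) / 2, so the levels differ by at most one; 31 covers 10 + 1/2 + 20. *)
Lemma phdisc_near j j' z x : cell j.1 j.2 z -> cell j'.1 j'.2 x -> phdisc z (5^-1) x ->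
 [/\ (j.1 <= j'.1.+1)%N, (j'.1 <= j.1.+1)%N & normc (yj R j' - yj R j) <= 31 * dy j.1].
Proof.
move=> cz cx [Dx hx]; have Dz := cell_disc cz.
have z1 : normc z < 1 by []. have x1 : normc x < 1 by [].
have g0 : 0 < normc (1 - conjc z * x).
 apply: nc_sub1_gt0; rewrite normcM nc_conj; apply: le_lt_trans x1.
 by rewrite ler_piMl ?nc_ge0// ltW.
rewrite normcM normcV ltr_pdivrMr// in hx.
have h1 : normc (1 - conjc z * x) <= 2 * (1 - normc z) + normc (z - x).
 have -> : 1 - conjc z * x = (1 - normc z ^+ 2)%:C + conjc z * (z - x).
  by rewrite RCB -mul_conj; ring.
 rewrite (le_trans (ncD _ _))//; apply: lerD.
  by rewrite nc_real ger0_norm; have := nc_ge0 z; nra.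
 by rewrite normcM nc_conj ler_piMl ?nc_ge0// ltW.
have h2 : normc (z - x) <= (1 - normc z) / 2 by lra.
have h3 := ncB_ge z x; have h4 := ncB_ge x z; rewrite ncBC in h4.
have /andP[a1 a2] := cell_norm cz; have /andP[b1 b2] := cell_norm cx.
rewrite !dyS in a2 b2; have d0 := @dy_gt0 R j.1; have d0' := @dy_gt0 R j'.1.
have n1 : (j.1 <= j'.1.+1)%N.
 rewrite leqNgt; apply/negP => h; have := @dy_le R _ _ h; rewrite !dyS; lra.
have n2 : (j'.1 <= j.1.+1)%N.
 rewrite leqNgt; apply/negP => h; have := @dy_le R _ _ h; rewrite !dyS; lra.
split => //; have y1 := cell_yj cz; have y2 := cell_yj cx.
have d2 : dy j'.1 <= 2 * dy j.1 :> R by have := @dy_le R _ _ n1; rewrite !dyS; lra.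
have := nc_triangle x (yj R j') (yj R j); have := nc_triangle z x (yj R j).
rewrite (ncBC (yj R j') x) (ncBC x z); lra.
Qed.

Lemma sum_to_integral : (\esum_(j in dyadic_indices)
  poweR (mu (cell j.1 j.2) * ((star (dyadic_point j.1 j.2))^-1)%:E) p < +oo)%E ->
 exists2 r : R, 0 < r < 1 & (\int[area]_(z in D)
  (poweR (mu (phdisc z r) * ((star z)^-1)%:E) p * (((1 - normc z) ^+ 2)^-1)%:E) < +oo)%E.
Proof.
move=> /(level_sums hw p0)[mfin [B hB]].
have [A [b [K [b02 Ab K0 hK]]]] := @sum_Yp R p p0.
have /andP[b0 b2] := b02.
have m0 := mcell_ge0 mu hw.
have hKB L P : \sum_(i <- il L) Yp A b (mcell w mu) P i `^ p <= K * B.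
 by apply: (le_trans (hK _ m0 L P)); rewrite ler_wpM2l ?(ltW K0).
have [Y0 hY hYs] := Ysup_facts hw p0 hKB.
set Y := Ysup w mu A b in Y0 hY hYs; set BY := 2 `^ p * (K * B) in hYs.
have [Ka Ka0 hKa] := area_cell_le R.
exists (5^-1); first by rewrite invr_gt0 ltr0n invf_lt1 ?ltr1n// ltr0n.
have [c c0 hc] := star_cell hw; have [K2 K21 HK2] := sg_gt hw; have K20 : 0 < K2 by exact: lt_le_trans K21.
pose e0 : R := (rho ^+ 4 * (2 + 31)^-1 ^+ A) `^ b.
have e00 : 0 < e0 by rewrite powR_gt0// mulr_gt0 ?exprn_gt0 ?rho_gt0// invr_gt0.
pose C1 := K2 ^+ 2 / e0 / c; have C10 : 0 < C1 by rewrite !divr_gt0 ?exprn_gt0.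
have C1E : C1 * c = K2 ^+ 2 / e0 by rewrite /C1 divfK// gt_eqF.
clearbody C1.
(* Constant bound for the integrand on the cell j; the factor (1 - |z|)^-2 is at most 4 / dy^2
   there. *)
pose cc (j : nat * nat) : R := (C1 * Y (bnode j)) `^ p * (4 / dy j.1 ^+ 2).
have valid j : (j.2 < 2 ^ j.1)%N -> bnode j \in il j.1.+1.
 by case: j => n k kv; rewrite /il /bnode/= mem_dl ltnSn/= expnS ltn_mul2l.
(* By the conventions for inverse and logarithm at 0 the integrand vanishes at z = 0, where
   [star_cell] does not apply. *)
have star0 : star 0 = 0.
 by rewrite /weight_star /Rintegral (eq_integral (cst 0%E)) ?integral0// => s _; rewrite normc0 invr0 mulr0 ln0// mulr0 mul0r.
pose u z := (poweR (mu (phdisc z 5^-1) * ((star z)^-1)%:E) p * (((1 - normc z) ^+ 2)^-1)%:E)%E.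
have u0 z : (0 <= u z)%E.
 by rewrite mule_ge0 ?poweR_ge0// lee_fin invr_ge0 sqr_ge0.
have cc0 j : 0 <= cc j by rewrite mulr_ge0 ?powR_ge0// divr_ge0// exprn_ge0// dy_ge0.
have ub j z : (j.2 < 2 ^ j.1)%N -> cell j.1 j.2 z -> (u z <= (cc j)%:E)%E.
 move=> jv cz; have [z0|zn] := eqVneq (normc z) 0.
  have -> : u z = 0%E.
   have z00 : z = 0 by apply/eqP; rewrite -nc_eq0 z0.
   by rewrite /u z00 star0 invr0 mule0 poweR0r ?gt_eqF// mul0e.
  by rewrite lee_fin.
 have zp : 0 < normc z by rewrite lt_neqAle eq_sym zn nc_ge0.
 have an := cell_norm cz; have hs := hc j.1 z zp an; rewrite -sg_sqr// in hs.
 have s20 : 0 < sg j.1 ^+ 2 by rewrite exprn_gt0// sg_gt0.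
 have st0 : 0 < star z by apply: lt_le_trans hs; rewrite mulr_gt0.
 pose S := [seq j' <- jl j.1.+2 | [&& (j.1 <= j'.1.+1)%N, (j'.1 <= j.1.+1)%N & normc (yj R j' - yj R j) <= 31 * dy j.1]].
 pose Cj (j' : nat * nat) : set C := if (j'.2 < 2 ^ j'.1)%N then cell j'.1 j'.2 else set0.
 have mCj j' : measurable (Cj j') by rewrite /Cj; case: ifP => // h; exact: measurable_cell.
 have h1 : (mu (phdisc z 5^-1) <= \sum_(j' <- S) mu (Cj j'))%E.
  apply: measure_cover => //; first by apply: measurable_phdisc; exact: cell_disc cz.
  move=> x hx; have [n' [k' [kv' cx]]] := cell_cover hx.1.
  have [a1 a2 a3] := @phdisc_near j (n', k') z x cz cx hx.
  exists (pred1 (n', k')); last by move=> j' /eqP ->; rewrite /Cj/= kv'.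
  by rewrite has_pred1 mem_filter/= a1 a2 a3/= mem_dl ltnS a2.
 have h2 : (\sum_(j' <- S) mu (Cj j') <= (C1 * c * sg j.1 ^+ 2 * Y (bnode j))%:E)%E.
  apply: (@le_trans _ _ (\sum_(j' <- S) (K2 ^+ 2 / e0 * sg j.1 ^+ 2 * (mcell w mu j' * Mx A (bnode j) j' `^ b))%:E)%E).
   rewrite big_seq [leRHS]big_seq; apply: lee_sum => -[n' k'] /=.
   rewrite mem_filter mem_dl => /andP[/= /and3P[a1 a2 a3] /andP[_ kv']].
   rewrite /Cj/= kv' -(fineK (mfin (n', k') kv')) lee_fin/=.
   have s0' : 0 < sg n' ^+ 2 by rewrite exprn_gt0// sg_gt0.
   have hM : e0 <= Mx A (bnode j) (n', k') `^ b.
    by apply: Mx_near => //; [exact: leq_trans a1 _|exact: leq_trans a2 _].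
   have hsg : sg n' ^+ 2 <= K2 ^+ 2 * sg j.1 ^+ 2.
    rewrite -exprMn; apply: lerXn2r; rewrite ?nnegrE ?mulr_ge0 ?(ltW (sg_gt0 hw _)) ?(ltW K20)//.
    have [le|lt] := leqP n' j.1.
     apply: le_trans (HK2 n' (j.1 - n')%N) _; rewrite subnKC//.
     rewrite ler_wpM2r ?(ltW (sg_gt0 hw _))//.
     have : (j.1 - n' <= 1)%N by rewrite leq_subLR addn1.
     by case: (_ - _)%N => [|[|//]] _; rewrite ?expr0 ?expr1.
    apply: le_trans (sg_lt hw (ltnW lt)) _; rewrite -/rho.
    rewrite ler_wpM2r ?(ltW (sg_gt0 hw _))//; apply: le_trans K21.
    by rewrite exprn_ile1 ?(ltW (@rho_gt0 R)) ?(ltW (@rho_lt1 R)).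
   have fE : fine (mu (cell n' k')) = mcell w mu (n', k') * sg n' ^+ 2 by rewrite /mcell/= divfK// gt_eqF.
   rewrite fE [leRHS]mulrCA; apply: ler_wpM2l => //; apply: (le_trans hsg).
   rewrite (_ : K2 ^+ 2 / e0 * _ * _ = K2 ^+ 2 * sg j.1 ^+ 2 * (Mx A (bnode j) (n', k') `^ b / e0)); last by ring.
   by rewrite ler_peMr ?mulr_ge0 ?exprn_ge0 ?(ltW K20) ?(ltW (sg_gt0 hw _))// ler_pdivlMr// mul1r.
  rewrite sumEFin lee_fin -mulr_sumr.
  rewrite C1E.
  apply: ler_wpM2l; first by rewrite mulr_ge0 ?divr_ge0 ?exprn_ge0 ?(ltW K20) ?(ltW e00) ?(ltW (sg_gt0 hw _)).
  apply: le_trans (hY j.1.+1 (bnode j) j.1.+2 (valid j jv)).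
  rewrite /S big_filter /Yp [leRHS](bigID [pred j' : nat * nat | [&& (j.1 <= j'.1.+1)%N, (j'.1 <= j.1.+1)%N & normc (yj R j' - yj R j) <= 31 * dy j.1]])/=.
  by rewrite lerDl sumr_ge0// => j' _; rewrite mulr_ge0 ?powR_ge0.
 rewrite /u /cc EFinM; apply: lee_pmul; rewrite ?poweR_ge0 ?lee_fin ?invr_ge0 ?sqr_ge0//.
  rewrite -poweR_EFin; apply: gt0_ler_poweR; rewrite ?(ltW p0) ?in_itv/= ?leey ?andbT//.
  - by rewrite mule_ge0// lee_fin invr_ge0 ltW.
  - by rewrite lee_fin mulr_ge0 ?(ltW C10).
  apply: (@le_trans _ _ ((C1 * c * sg j.1 ^+ 2 * Y (bnode j))%:E * ((star z)^-1)%:E)%E).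
   by apply: lee_wpmul2r; [rewrite lee_fin invr_ge0 ltW|exact: le_trans h2].
  rewrite -EFinM lee_fin ler_pdivrMr// (_ : C1 * c * _ * _ = C1 * Y (bnode j) * (c * sg j.1 ^+ 2)); last by ring.
  by rewrite ler_wpM2l// mulr_ge0// ltW.
 have d0 := @dy_gt0 R j.1; have /andP[_ a2] := an; rewrite dyS in a2.
 have x0 : 0 < 1 - normc z by lra.
 rewrite ler_pdivlMr ?exprn_gt0// mulrC ler_pdivrMr ?exprn_gt0//; nra.
pose G n z : \bar R := (\sum_(j <- jl n) (cc j)%:E * (\1_(if (j.2 < 2 ^ j.1)%N then cell j.1 j.2 else set0) z : R)%:E)%E.
have mC (j : nat * nat) : measurable (if (j.2 < 2 ^ j.1)%N then cell j.1 j.2 else set0).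
 by case: ifP => // h; exact: measurable_cell.
have G0 n z : (0 <= G n z)%E by apply: sume_ge0 => j _; rewrite mule_ge0// lee_fin.
have mG1 (j : nat * nat) : measurable_fun D (fun z => ((cc j)%:E * (\1_(if (j.2 < 2 ^ j.1)%N then cell j.1 j.2 else set0) z : R)%:E)%E).
 by apply: measurable_funeM; apply/measurable_EFinP; exact: measurable_indic.
have mG n : measurable_fun D (G n) by exact: emeasurable_sum.
pose Bf := 4 * Ka * (C1 `^ p * BY).
have IG n : (\int[area]_(z in D) G n z <= Bf%:E)%E.
 rewrite /G ge0_integral_sum//; last by move=> j z _; rewrite mule_ge0// lee_fin.
 apply: (@le_trans _ _ (\sum_(j <- jl n) (4 * Ka * (C1 `^ p * Y (bnode j) `^ p))%:E)%E).
  rewrite big_seq [leRHS]big_seq; apply: lee_sum => -[n' k]; rewrite mem_dl => /andP[_ kv].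
  rewrite ge0_integralZl//; last 2 first.
  - by apply/measurable_EFinP; exact: measurable_indic.
  - by rewrite lee_fin.
  rewrite integral_indic// kv setIidl; last exact: cell_disc.
  apply: le_trans (lee_wpmul2l _ (hKa (n', k) kv)) _; first by rewrite lee_fin.
  rewrite -EFinM lee_fin /cc/= powRM ?(ltW C10)//; have d0 := @dy_gt0 R n'.
  apply: le_of_eq; field.
  by rewrite !gt_eqF.
 rewrite sumEFin lee_fin -!mulr_sumr /Bf; have k0 : 0 <= 4 * Ka by rewrite mulr_ge0// ltW.
 rewrite ler_wpM2l// ler_wpM2l ?powR_ge0//.
 apply: le_trans (hYs n); rewrite -(big_map bnode xpredT (fun i => Y i `^ p)).
 apply: sum_uniq_sub => [||j]; last exact: powR_ge0.
  rewrite map_inj_uniq ?dl_uniq// => -[a k] [a' k']; rewrite /bnode/= => -[-> /eqP].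
  by rewrite eqn_pmul2l// => /eqP ->.
 move=> i /mapP[[a k]]; rewrite mem_dl => /andP[an kv] ->.
 by rewrite /il /bnode/= mem_dl an/= expnS ltn_mul2l.
apply: (@le_lt_trans _ _ Bf%:E); last exact: ltry.
(* The integrand is dominated by the lower limit of the measurable step functions [G n], and Fatou's
   lemma is applied to these. *)
apply: (@le_trans _ _ (\int[area]_(z in D) limn_einf (G^~ z))%E).
 apply: (@ge0_integral_mono R area u) => [z _|z Dz]; first exact: u0.
 have [n [k [kv cz]]] := cell_cover Dz.
 apply: (le_trans (ub (n, k) z kv cz)); apply: le_einf => e e1; exists n.+1 => N nN.
 apply: (@le_trans _ _ (cc (n, k))%:E); first by rewrite lee_fin lerBlDr lerDl ltW.
 have hin : (n, k) \in jl N by rewrite mem_dl nN.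
 rewrite /G (big_rem _ hin)/= kv indicE mem_set// mule1; apply: leeDl.
 by apply: sume_ge0 => j _; rewrite mule_ge0// lee_fin.
apply: (le_trans (@fatou _ _ _ area D mD G mG (fun n z _ => G0 n z))).
exact: einf_le.
Qed.
End SumToIntegral.

Section PowerSums.
Variable R : realType.

(** The sum is at most the number of terms times the largest one. *)
Lemma powR_sum_le_size (I : Type) (s : seq I) (x : I -> R) (p : R) : 0 < p -> (forall i, 0 <= x i) ->
 (\sum_(i <- s) x i) `^ p <= (size s)%:R `^ p * \sum_(i <- s) x i `^ p.
Proof.
move=> p0 x0; have [m [m0 h1 h2]] : exists m, [/\ 0 <= m, \sum_(i <- s) x i <= (size s)%:R * m &
  m `^ p <= \sum_(i <- s) x i `^ p].
 elim: s => [|i s [m [m0 h1 h2]]]; first by exists 0; rewrite !big_nil mulr0 powR0 ?gt_eqF.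
 exists (Num.max (x i) m); rewrite !big_cons le_max x0; split => //.
  rewrite /= -natr1 mulrDl mul1r addrC; apply: lerD; last by rewrite le_max lexx.
  by apply: (le_trans h1); rewrite ler_wpM2l// le_max lexx orbT.
 have S0 : 0 <= \sum_(j <- s) x j `^ p by apply: sumr_ge0 => j _; exact: powR_ge0.
 have [le|lt] := leP (x i) m; first by rewrite (le_trans h2)// lerDr powR_ge0.
 by rewrite lerDl.
have S0 : 0 <= \sum_(i <- s) x i by exact: sumr_ge0.
apply: (@le_trans _ _ (((size s)%:R * m) `^ p)).
 by apply: ge0_ler_powR; rewrite ?nnegrE ?(ltW p0) ?mulr_ge0.
by rewrite powRM// ler_wpM2l ?powR_ge0.
Qed.

Lemma grid_point (x0 s y L : R) : 0 < s -> x0 <= y <= x0 + L * s ->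
 exists2 a, (a < (Num.truncn L).+1)%N & x0 + a%:R * s <= y <= x0 + a%:R * s + s.
Proof.
move=> s0 /andP[h1 h2]; pose t := (y - x0) / s.
have t0 : 0 <= t by rewrite divr_ge0 ?subr_ge0 ?(ltW s0).
have tE : t * s = y - x0 by rewrite divfK// gt_eqF.
have tL : t <= L by rewrite ler_pdivrMr//; lra.
exists (Num.truncn t); first by rewrite ltnS le_truncn.
have g0 : (Num.truncn t)%:R <= t by rewrite truncn_le.
have g1 := ler_wpM2r (ltW s0) g0; have g2 := ler_wpM2r (ltW s0) (ltW (truncnS_gt t)).
rewrite -natr1 mulrDl mul1r tE in g2; rewrite tE in g1.
by apply/andP; split; lra.
Qed.
End PowerSums.

(** * From hyperbolic discs to cell sums *)

Section IntegralToSum.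
Variables (R : realType) (w : R[i] -> R) (mu : {measure set R[i] -> \bar R}) (p r : R).
Hypotheses (hw : class_Dhat w) (p0 : 0 < p) (r01 : 0 < r < 1).
Local Notation C := R[i].
Local Notation D := (@unit_disc R).
Local Notation sg := (sg w).
Local Notation cell := (@dyadic_rectangle R).
Local Notation star := (weight_star w).
Let mD : measurable D := @measurable_unit_disc R.
(** Mesh of the boxes relative to the cell: two points x, y of one box are at distance at most 2 ka
    dy, while |1 - conj x y| >= dy / 2 when y is in the cell, so 4 ka < r puts y in the disc about
    x. *)
Let ka : R := r / 8.
Let ka0 : 0 < ka. Proof. by case/andP: r01 => r0 _; rewrite divr_gt0. Qed.
Let ka1 : ka <= 8^-1. Proof. by case/andP: r01 => _ r1; rewrite /ka; lra. Qed.
Let kar : 4 * ka < r. Proof. by case/andP: r01 => r0 _; rewrite /ka; lra. Qed.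

(** Grid on the square of side 20 dy around the reference point, which contains the cell by
    [cell_yj]. The boxes carry the area; the pieces [A], their intersections with the cell, carry
    the mass of mu. *)
Let Qb (j l : nat * nat) : set C :=
 box (cRe (yj R j) - 10 * dy j.1 + l.1%:R * (ka * dy j.1))
   (cIm (yj R j) - 10 * dy j.1 + l.2%:R * (ka * dy j.1)) (ka * dy j.1).
Let nq := (Num.truncn (20 / ka)).+1.
Let pieces : seq (nat * nat) := [seq (a, b) | a <- iota 0 nq, b <- iota 0 nq].
Let A j l := Qb j l `&` cell j.1 j.2.

Let mQ j l : measurable (Qb j l). Proof. exact: measurable_box. Qed.
Let mA j l : (j.2 < 2 ^ j.1)%N -> measurable (A j l).
Proof. by move=> jv; apply: measurableI => //; exact: measurable_cell. Qed.

Let cover j y : cell j.1 j.2 y -> exists2 l, l \in pieces & A j l y.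
Proof.
move=> cy; have s0 : 0 < ka * dy j.1 by rewrite mulr_gt0// dy_gt0.
have [/andP[h1 h2] /andP[h3 h4]] := near_yj (cell_yj cy).
have E : 20 / ka * (ka * dy j.1) = 20 * dy j.1 by rewrite mulrA divfK// gt_eqF.
have [|a a1 a2] := @grid_point R (cRe (yj R j) - 10 * dy j.1) _ (cRe y) (20 / ka) s0.
 by rewrite E h1/=; move: h2; lra.
have [|b b1 b2] := @grid_point R (cIm (yj R j) - 10 * dy j.1) _ (cIm y) (20 / ka) s0.
 by rewrite E h3/=; move: h4; lra.
by exists (a, b) => //; apply: allpairs_f; rewrite mem_iota.
Qed.

Let near j l x y : Qb j l x -> A j l y ->
 [/\ D x, phdisc x r y, 1 - 5 / 4 * dy j.1 <= normc x <= 1 - dy j.1 / 4 & normc (x - yj R j) <= 11 * dy j.1].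
Proof.
move=> [/andP[x1 x2] /andP[x3 x4]] [[/andP[y1 y2] /andP[y3 y4]] cy].
have d0 := @dy_gt0 R j.1; have /andP[n1 n2] := cell_norm cy; rewrite dyS in n2.
have hd : normc (x - y) <= 2 * (ka * dy j.1).
 rewrite (le_trans (nc_ReIm _))// ReD ImD ReN ImN mulr2n mulrDl mul1r.
 by apply: lerD; rewrite ler_norml; apply/andP; split; lra.
have hk : ka * dy j.1 <= dy j.1 / 8 by rewrite mulrC ler_wpM2l// ltW.
have t1 := ncB_ge x y; have t2 := ncB_ge y x; rewrite ncBC in t2.
have Dx : normc x < 1 by lra.
split => //; last 2 first.
- by apply/andP; split; lra.
- by have := nc_triangle y x (yj R j); have := cell_yj cy; lra.
split; first exact: cell_disc cy.
have g0 : dy j.1 / 2 <= normc (1 - conjc x * y).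
 have := ncB_ge 1 (conjc x * y); rewrite normc1 normcM nc_conj.
 have : normc x * normc y <= normc y by rewrite ler_piMl ?nc_ge0// ltW.
 by lra.
have gp : 0 < normc (1 - conjc x * y) by lra.
rewrite normcM normcV ltr_pdivrMr//; apply: (le_lt_trans hd).
have h5 : 4 * ka * (dy j.1 / 2) < r * (dy j.1 / 2) by rewrite ltr_pM2r// divr_gt0.
have r0 : 0 <= r by case/andP: r01 => /ltW.
have := ler_wpM2l r0 g0; lra.
Qed.

Let muA j l x : (j.2 < 2 ^ j.1)%N -> Qb j l x -> A j l !=set0 -> (mu (A j l) <= mu (phdisc x r))%E.
Proof.
move=> jv Qx [y Ay]; have [Dx _ _ _] := near Qx Ay.
apply: le_measure; rewrite ?inE; [exact: mA|exact: measurable_phdisc|].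
by move=> y' Ay'; have [] := near Qx Ay'.
Qed.

Let areaQ j l : area (Qb j l) = ((ka * dy j.1) ^+ 2 / pi)%:E.
Proof. by rewrite area_box// mulr_ge0 ?dy_ge0// ltW. Qed.

Let u z : \bar R := (poweR (mu (phdisc z r) * ((star z)^-1)%:E) p * (((1 - normc z) ^+ 2)^-1)%:E)%E.
Let u0 z : (0 <= u z)%E.
Proof.
by rewrite mule_ge0 ?poweR_ge0// lee_fin invr_ge0 sqr_ge0.
Qed.

Let star_gt0 x : D x -> x != 0 -> 0 < star x.
Proof.
move=> Dx xn; have [c c0 hc] := star_cell hw; have [n [k [_ /cell_norm cx]]] := cell_cover Dx.
have xp : 0 < normc x by rewrite nc_gt0.
by apply: lt_le_trans (hc n x xp cx); rewrite !mulr_gt0 ?dy_gt0 ?(Hn_gt0 hw).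
Qed.

Hypothesis Iu : (\int[area]_(z in D) u z < +oo)%E.
Let I := fine (\int[area]_(z in D) u z)%E.
Let IE : (\int[area]_(z in D) u z)%E = I%:E.
Proof. by rewrite /I fineK// ge0_fin_numE//; apply: integral_ge0 => z _; exact: u0. Qed.

Let pi0 : 0 < pi :> R. Proof. exact: pi_gt0. Qed.

(** If the piece had infinite mass, the integrand would be infinite on a box of positive area. *)
Lemma piece_fin j l : (j.2 < 2 ^ j.1)%N -> mu (A j l) \is a fin_num.
Proof.
move=> jv; rewrite ge0_fin_numE// ltNge leye_eq; apply/negP => /eqP muoo.
have An : A j l !=set0.
 by apply/set0P; apply/negP => /eqP A0; move: muoo; rewrite A0 measure0.
have [y Ay] := An.
have s0 : 0 < (ka * dy j.1) ^+ 2 / pi.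
 by apply: divr_gt0; [apply: exprn_gt0; apply: mulr_gt0 => //; exact: dy_gt0|exact: pi_gt0].
(* The degenerate box Z is the point 0, removed because the associated weight is 0 there by
   convention. *)
pose Z : set C := box 0 0 0; have mZ : measurable Z by exact: measurable_box.
have Z0 : area Z = 0%E by rewrite area_box// expr0n mul0r.
have mQZ : measurable (Qb j l `\` Z) by exact: measurableD.
have aQZ : area (Qb j l `\` Z) = ((ka * dy j.1) ^+ 2 / pi)%:E.
 have z0 : area (Qb j l `&` Z) = 0%E.
  by apply/eqP; rewrite -measure_le0 -Z0; apply: le_measure; rewrite ?inE//; exact: measurableI.
 have E : area (Qb j l) = (area (Qb j l `\` Z) + area (Qb j l `&` Z))%E by exact: (measureDI area (mQ j l) mZ).
 by rewrite areaQ z0 adde0 in E; rewrite E.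
(* A constant whose integral over the box is I + 1, more than the integral allows. *)
pose T : R := (I + 1) / ((ka * dy j.1) ^+ 2 / pi).
have I0 : 0 <= I by rewrite fine_ge0// integral_ge0// => z _; exact: u0.
have T0 : 0 <= T by rewrite divr_ge0 ?(ltW s0)// addr_ge0.
have : (\int[area]_(z in D) (T%:E * (\1_(Qb j l `\` Z) z : R)%:E) <= \int[area]_(z in D) u z)%E.
 apply: ge0_integral_mono => z Dz; first by rewrite mule_ge0// lee_fin.
 rewrite indicE; case: (boolP (z \in _)) => [|_]; last by rewrite mule0.
 rewrite inE => -[Qz nZ].
 suff -> : u z = +oo%E by rewrite leey.
 have zn : z != 0 by apply: contra_notN nZ => /eqP ->; split; rewrite /= addr0 lexx.
 have st := star_gt0 Dz zn.
 have z1 : normc z < 1 by [].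
 have mo : mu (phdisc z r) = +oo%E by apply/eqP; rewrite -leye_eq -muoo; exact: muA.
 rewrite /u mo gt0_mulye ?lte_fin ?invr_gt0// poweRyr ?gt_eqF// gt0_mulye// lte_fin invr_gt0 exprn_gt0//.
 by rewrite subr_gt0.
rewrite ge0_integralZl//; last first.
 by apply/measurable_EFinP; exact: measurable_indic.
rewrite integral_indic// setIidl; last by move=> z [Qz _]; have [] := near Qz Ay.
have aQZ' : (area : {measure set C -> \bar R}) (Qb j l `\` Z) = ((ka * dy j.1) ^+ 2 / pi)%:E := aQZ.
rewrite aQZ' IE -EFinM lee_fin /T divfK ?gt_eqF//; lra.
Qed.

Let cell_le j : (j.2 < 2 ^ j.1)%N -> mu (cell j.1 j.2) \is a fin_num /\
 fine (mu (cell j.1 j.2)) <= \sum_(l <- pieces) fine (mu (A j l)).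
Proof.
move=> jv; have h : (mu (cell j.1 j.2) <= (\sum_(l <- pieces) fine (mu (A j l)))%:E)%E.
 rewrite -sumEFin (eq_bigr (fun l => mu (A j l))); last by move=> l _; rewrite fineK// piece_fin.
 apply: measure_cover; [exact: measurable_cell|by move=> l; exact: mA|].
 move=> y /cover[l lp Al]; exists (pred1 l); last by move=> l' /eqP ->.
 by rewrite has_pred1.
have f : mu (cell j.1 j.2) \is a fin_num by rewrite ge0_fin_numE// (le_lt_trans h)// ltry.
by split => //; rewrite -lee_fin fineK.
Qed.

(** On the box of a piece the integrand is at least [v]. The bounded overlap of the boxes is
    expressed by the decay matrix: a box containing x belongs to a cell near that of x, where the
    third power of [Mx] is at least e0, and [Mx_sum_j] sums these powers. Levels from 2 on keep the
    boxes away from 0. *)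
Lemma piece_sums : exists2 K : R, 0 < K & forall l P,
 \sum_(j <- jl P | (2 <= j.1)%N) (fine (mu (A j l)) / sg j.1 ^+ 2) `^ p <= K.
Proof.
have [K2 K21 HK2] := sg_gt hw; have K20 : 0 < K2 by exact: lt_le_trans K21.
(* An exponent above 2 is summable over the cells; the value 3 also admits A = 1. *)
have [K K0 hK] := @Mx_sum_j R 1 3 (ltr_nat R 2 3) ltac:(by rewrite mul1r ler_nat).
(* 54 = 44 + 10: at most 11 dy n for the box, with dy n <= 4 dy n0, and 10 dy n0 for the cell of
   x. *)
pose e0 : R := (rho ^+ 4 * (2 + 54)^-1 ^+ 1) `^ 3.
have e00 : 0 < e0 by rewrite powR_gt0// mulr_gt0 ?exprn_gt0 ?rho_gt0// invr_gt0.
pose C2 := 2 * K2 ^+ 2; have C20 : 0 < C2 by rewrite mulr_gt0// exprn_gt0.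
pose v j l : R := (fine (mu (A j l)) / sg j.1 ^+ 2 / C2) `^ p / (4 * dy j.1 ^+ 2).
have s20 n : 0 < sg n ^+ 2 by rewrite exprn_gt0// sg_gt0.
have v0 j l : 0 <= v j l by rewrite divr_ge0 ?powR_ge0// mulr_ge0// exprn_ge0// dy_ge0.
have vu j l x : (2 <= j.1)%N -> (j.2 < 2 ^ j.1)%N -> A j l !=set0 -> Qb j l x -> ((v j l)%:E <= u x)%E.
 move=> j2 jv An Qx; have [y Ay] := An; have [Dx _ /andP[b1 b2] _] := near Qx Ay.
 have d0 := @dy_gt0 R j.1; have x1 : normc x < 1 by [].
 have jE : j.1 = (j.1.-1).+1 by rewrite prednK// ltnW.
 have d2 : dy j.1.-1 = 2 * dy j.1 :> R by rewrite [in RHS]jE dyS; lra.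
 have q2 : dy j.1 <= 4^-1 :> R by have := @dy_le R _ _ j2; rewrite !dyS /dy expr0; lra.
 have xn : x != 0 by rewrite -nc_gt0; lra.
 have st := star_gt0 Dx xn.
 have stu : star x <= C2 * sg j.1 ^+ 2.
  have p1 : (0 < j.1.-1)%N by rewrite -ltnS -jE.
  apply: le_trans (star_cell_ub hw p1 _) _; first by rewrite d2; apply/andP; split; lra.
  rewrite -sg_sqr// /C2 -mulrA ler_wpM2l// -exprMn; apply: lerXn2r; rewrite ?nnegrE ?mulr_ge0 ?(ltW (sg_gt0 hw _)) ?(ltW K20)//.
  by have := HK2 j.1.-1 1%N; rewrite expr1 addn1 -jE.
 rewrite /v EFinM; apply: lee_pmul; rewrite ?lee_fin ?powR_ge0 ?invr_ge0 ?mulr_ge0 ?exprn_ge0 ?(ltW d0)//.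
  have f0 : 0 <= fine (mu (A j l)) by exact: fine_ge0.
  rewrite -poweR_EFin; apply: gt0_ler_poweR; rewrite ?(ltW p0) ?in_itv/= ?leey ?andbT//.
  - by rewrite lee_fin !divr_ge0 ?(ltW C20) ?(ltW (s20 _)).
  - by rewrite mule_ge0// lee_fin invr_ge0 ltW.
  apply: (@le_trans _ _ (mu (A j l) * ((star x)^-1)%:E)%E); last first.
   by apply: lee_wpmul2r; [rewrite lee_fin invr_ge0 ltW|exact: muA].
  rewrite -{2}(fineK (piece_fin l jv)) -EFinM lee_fin -mulrA ler_wpM2l//.
  have q := mulr_gt0 (s20 j.1) C20; rewrite -invfM lef_pV2 ?posrE//.
  by rewrite mulrC.
 have y0 : 0 < 1 - normc x by lra.
 rewrite lef_pV2 ?posrE ?exprn_gt0 ?mulr_gt0 ?exprn_gt0//; nra.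
clearbody C2.
pose al := e0 / K; have al0 : 0 < al by rewrite divr_gt0.
have ptw l P x : D x -> ((\sum_(j <- jl P | (2 <= j.1)%N) al * v j l * \1_(Qb j l) x)%:E <= u x)%E.
 move=> Dx; have [ux|ux] := eqVneq (u x) +oo%E; first by rewrite ux leey.
 have uf : u x \is a fin_num by rewrite ge0_fin_numE// ltey.
 have U0 : 0 <= fine (u x) by exact: fine_ge0.
 rewrite -(fineK uf) lee_fin; have [n0 [k0 [kv0 cx]]] := cell_cover Dx.
 pose j0 := (n0, k0); have cx0 : cell j0.1 j0.2 x by [].
 apply: (@le_trans _ _ (\sum_(j <- jl P) K^-1 * fine (u x) * Mx 1 (bnode j0) j `^ 3)); last first.
  rewrite -mulr_sumr mulrAC ler_piMl// mulrC ler_pdivrMr// mul1r.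
  by rewrite /jl dl_sum hK.
 rewrite big_mkcond big_seq [leRHS]big_seq; apply: ler_sum => -[n k]; rewrite mem_dl => /andP[_ kv].
 have M0 : 0 <= K^-1 * fine (u x) * Mx 1 (bnode j0) (n, k) `^ 3.
  by rewrite mulr_ge0 ?powR_ge0// mulr_ge0// invr_ge0 ltW.
 case: ifP => // n2; rewrite indicE; case: (boolP (x \in _)) => [|_]; last by rewrite mulr0.
 rewrite inE => Qx; rewrite mulr1; have [A0|An] := eqVneq (A (n, k) l) set0.
  by rewrite /v A0 measure0 mul0r mul0r powR0 ?gt_eqF// mul0r mulr0.
 move/set0P in An; have [y Ay] := An; have [_ _ /andP[b1 b2] b3] := near Qx Ay.
 have hv := @vu (n, k) l x n2 kv An Qx; rewrite -(fineK uf) lee_fin in hv.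
 have /andP[a1 a2] := cell_norm cx; have d0 := @dy_gt0 R n; have d0' := @dy_gt0 R n0.
 rewrite /= in b1 b2 b3; rewrite dyS in a2.
 have m1 : (n0 <= n.+2)%N.
  rewrite leqNgt; apply/negP => h; have := @dy_le R _ _ h; rewrite !dyS; lra.
 have m2 : (n <= n0.+1)%N.
  rewrite leqNgt; apply/negP => h; have := @dy_le R _ _ h; rewrite !dyS; lra.
 have dd : dy n <= 4 * dy n0 :> R by have := @dy_le R _ _ m1; rewrite !dyS; lra.
 have hM : e0 <= Mx 1 (bnode j0) (n, k) `^ 3.
  apply: Mx_near => //=; first exact: leqW m2.
  have := nc_triangle x (yj R (n, k)) (yj R j0); have := cell_yj cx0; rewrite (ncBC (yj R (n, k)) x)/=; lra.
 rewrite /al (_ : e0 / K * _ = K^-1 * v (n, k) l * e0); last by ring.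
 apply: ler_pM => //; first by rewrite mulr_ge0// invr_ge0 ltW.
  exact: ltW.
 by rewrite ler_wpM2l// invr_ge0 ltW.
pose cf := al / C2 `^ p * (ka ^+ 2 / (4 * pi)).
have cf0 : 0 < cf.
 have p4 : 0 < 4 * pi :> R by apply: mulr_gt0; [rewrite ltr0n|exact: pi_gt0].
 exact: (mulr_gt0 (divr_gt0 al0 (powR_gt0 p C20)) (divr_gt0 (exprn_gt0 2 ka0) p4)).
have I0 : 0 <= I by rewrite fine_ge0// integral_ge0// => z _; exact: u0.
exists ((I + 1) / cf) => [|l P]; first by rewrite divr_gt0// ltr_wpDl.
suff h : cf * \sum_(j <- jl P | (2 <= j.1)%N) (fine (mu (A j l)) / sg j.1 ^+ 2) `^ p <= I.
 by rewrite ler_pdivlMr// mulrC; lra.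
rewrite -lee_fin -IE; apply: (@le_trans _ _ (\int[area]_(z in D) (\sum_(j <- jl P | (2 <= j.1)%N) (al * v j l)%:E * (\1_(Qb j l) z : R)%:E))%E); last first.
 apply: ge0_integral_mono => z Dz.
  by apply: sume_ge0 => j _; rewrite mule_ge0// lee_fin// mulr_ge0// ltW.
 by apply: le_trans (ptw l P z Dz); rewrite -sumEFin.
under eq_integral do rewrite -big_filter.
rewrite ge0_integral_sum//; last 2 first.
- by move=> j; apply: measurable_funeM; apply/measurable_EFinP; exact: measurable_indic.
- by move=> j z _; rewrite mule_ge0// lee_fin// mulr_ge0// ltW.
rewrite -big_filter mulr_sumr -sumEFin big_seq [leRHS]big_seq; apply: lee_sum => -[n k].
rewrite mem_filter mem_dl => /and3P[n2 _ kv].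
rewrite ge0_integralZl//; last 2 first.
- by apply/measurable_EFinP; exact: measurable_indic.
- by rewrite lee_fin mulr_ge0// ltW.
rewrite integral_indic//; have [A0|An] := eqVneq (A (n, k) l) set0.
 by rewrite A0 measure0 mul0r powR0 ?gt_eqF// mulr0 mule_ge0// lee_fin mulr_ge0// ltW.
move/set0P : An => [y Ay]; rewrite setIidl; last by move=> z Qz; have [] := near Qz Ay.
have areaQ' : (area : {measure set C -> \bar R}) (Qb (n, k) l) = ((ka * dy n) ^+ 2 / pi)%:E := areaQ (n, k) l.
rewrite areaQ' -EFinM lee_fin /v /cf/=; have d0 := @dy_gt0 R n.
have yy : 0 <= fine (mu (A (n, k) l)) / sg n ^+ 2 by rewrite divr_ge0 ?fine_ge0 ?(ltW (s20 _)).
move: (fine _ / _) yy => y1 yy; rewrite (powRM p yy); last by rewrite invr_ge0 ltW.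
have -> : (C2^-1) `^ p = (C2 `^ p)^-1 by rewrite -powR_inv1 ?(ltW C20)// -powRrM mulN1r powRN.
move: (y1 `^ p) => y'; have cp0 := powR_gt0 p C20; move: (C2 `^ p) cp0 => x x0.
have := pi_gt0 R; move: (pi : R) => pp pp0.
apply: le_of_eq; field.
by rewrite !gt_eqF.
Qed.

Lemma integral_to_sum : (\esum_(j in dyadic_indices)
  poweR (mu (cell j.1 j.2) * ((star (dyadic_point j.1 j.2))^-1)%:E) p < +oo)%E.
Proof.
have [K K0 hK] := piece_sums; have [c [C1 [c0 C10 hst]]] := star_dyadic hw.
have s20 n : 0 < sg n ^+ 2 by rewrite exprn_gt0// sg_gt0.
pose N : R := (size pieces)%:R `^ p; have N0 : 0 <= N by exact: powR_ge0.
have mp j : (j.2 < 2 ^ j.1)%N -> mcell w mu j `^ p <= N * \sum_(l <- pieces) (fine (mu (A j l)) / sg j.1 ^+ 2) `^ p.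
 move=> jv; have [_ h] := cell_le jv.
 apply: le_trans (powR_sum_le_size pieces p0 _); last by move=> l; rewrite divr_ge0 ?fine_ge0 ?(ltW (s20 _)).
 have f0 : 0 <= mcell w mu j by exact: mcell_ge0.
 apply: ge0_ler_powR; rewrite ?nnegrE ?(ltW p0)//.
  by apply: sumr_ge0 => l _; rewrite divr_ge0 ?fine_ge0 ?(ltW (s20 _)).
 by rewrite /mcell -mulr_suml ler_wpM2r// invr_ge0 ltW.
have high P : \sum_(j <- jl P | (2 <= j.1)%N) mcell w mu j `^ p <= N * ((size pieces)%:R * K).
 apply: (@le_trans _ _ (\sum_(j <- jl P | (2 <= j.1)%N) N * \sum_(l <- pieces) (fine (mu (A j l)) / sg j.1 ^+ 2) `^ p)).
  rewrite big_seq_cond [leRHS]big_seq_cond; apply: ler_sum => -[n k]; rewrite mem_dl => /andP[/andP[_ kv] _].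
  exact: mp.
 rewrite -mulr_sumr ler_wpM2l// exchange_big/=.
 apply: (@le_trans _ _ (\sum_(l <- pieces) K)); first by apply: ler_sum => l _; exact: hK.
 by rewrite big_const_seq count_predT iter_addr_0 mulr_natl.
(* Levels 0 and 1, left out of [piece_sums], contribute a finite sum. *)
pose B := c^-1 `^ p * (\sum_(j <- jl 2) mcell w mu j `^ p + N * ((size pieces)%:R * K)).
apply: (@le_lt_trans _ _ B%:E); last exact: ltry.
apply: esum_le_seq => F uF hF.
apply: (@le_trans _ _ (\sum_(j <- F) (c^-1 `^ p * mcell w mu j `^ p)%:E)%E).
 rewrite big_seq [leRHS]big_seq; apply: lee_sum => j /hF jv.
 have [f _] := cell_le jv; rewrite -(fineK f) -EFinM poweR_EFin lee_fin -powRM ?invr_ge0 ?(ltW c0) ?mcell_ge0//.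
 have st : 0 < star (@dyadic_point R j.1 j.2) by exact: star_dyadic_gt0.
 have g0 : 0 <= fine (mu (cell j.1 j.2)) by exact: fine_ge0.
 apply: ge0_ler_powR; rewrite ?nnegrE ?(ltW p0)//.
 - by rewrite divr_ge0// ltW.
 - by rewrite mulr_ge0 ?mcell_ge0// invr_ge0 ltW.
 have q := mulr_gt0 c0 (s20 j.1); rewrite /mcell mulrCA ler_wpM2l// -invfM lef_pV2 ?posrE//.
 by have /andP[h _] := hst j.1 j.2; rewrite -sg_sqr in h.
rewrite sumEFin lee_fin -mulr_sumr ler_wpM2l ?powR_ge0//.
pose P := (\max_(j <- F) j.1.+1)%N.
apply: (@le_trans _ _ (\sum_(j <- jl P) mcell w mu j `^ p)).
 apply: sum_uniq_sub => // [[n k] nF|j]; last exact: powR_ge0.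
 have kv := hF _ nF; rewrite mem_dl kv andbT /P.
 by rewrite (big_rem _ nF)/= leq_maxl.
rewrite (bigID (fun j : nat * nat => (2 <= j.1)%N))/= addrC; apply: lerD; last exact: high.
rewrite -big_filter; apply: sum_uniq_sub => [||j]; [by rewrite filter_uniq// dl_uniq| |exact: powR_ge0].
by move=> [n k]; rewrite mem_filter !mem_dl/= -ltnNge => /and3P[-> _ ->].
Qed.
End IntegralToSum.

Theorem theorem1 (R : realType) (p : R) (w : R[i] -> R)
    (mu : {measure set R[i] -> \bar R}) (p_gt0 : 0 < p) (w_Dhat : class_Dhat w) :
  [<-> toeplitz_in_schatten p w mu;
       (\esum_(j in dyadic_indices)
          poweR (mu (dyadic_rectangle j.1 j.2)
                 * ((weight_star w (dyadic_point j.1 j.2))^-1)%:E) p < +oo)%E;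
       exists2 r : R, 0 < r < 1 &
         (\int[area]_(z in unit_disc)
            (poweR (mu (phdisc z r) * ((weight_star w z)^-1)%:E) p
             * (((1 - normc z) ^+ 2)^-1)%:E) < +oo)%E].
Proof.
split; first exact: schatten_to_sum.
split; first exact: sum_to_integral.
(* The cycle is closed through the cell sums. *)
by move=> [r r01 h]; apply: (sum_to_schatten w_Dhat p_gt0); exact: (integral_to_sum w_Dhat p_gt0 r01 h).
Qed.
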